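(* For any $p\in[1,\infty)$, any $s\ge 0$, and any $R<\infty$, there exists $\tau>0$ for which the solution mapping $S$ of the Cauchy problem (NLS$^*$), initially defined on $C^\infty(\mathbb T)$, extends by continuity to a uniformly continuous mapping from the ball centered at $0$ of radius $R$ in $\mathcal H^{s,p}(\mathbb T)$ to $C^0([0,\tau],\mathcal H^{s,p}(\mathbb T))$.
   Context: $\mathbb T=\mathbb R/2\pi\mathbb Z$, $\widehat f(n)=(2\pi)^{-1}\int_{\mathbb T}e^{-inx}f(x)\,dx$ for $n\in\mathbb Z$ (extended to distributions), and $\langle n\rangle=(1+n^2)^{1/2}$. For $s\ge 0$, $p\in[1,\infty)$, $\mathcal H^{s,p}(\mathbb T)$ is the space of distributions $f$ on $\mathbb T$ with $\|f\|_{\mathcal H^{s,p}}=\big(\sum_{n\in\mathbb Z}\langle n\rangle^{ps}|\widehat f(n)|^p\big)^{1/p}<\infty$. $C^\infty(\mathbb T)$ is dense in $\mathcal H^{s,p}$ for $p<\infty$. The parameter $\omega\in\{1,-1\}$ is fixed, and $\mu(|f|^2)=(2\pi)^{-1}\int_{\mathbb T}|f(x)|^2\,dx$. The modified Cauchy problem (NLS$^*$), for $x\in\mathbb T$, $t\ge 0$, is $$iu_t+u_{xx}+\omega\big(|u|^2-2\mu(|u|^2)\big)u=0,\qquad u(0,x)=u_0(x),$$ where $\mu(|u|^2)$ means $\mu(|u(t,\cdot)|^2)$. The solution mapping $S$: there exists a unique mapping $u_0\mapsto Su_0(t,x)$, defined for $u_0\in C^\infty(\mathbb T)$, which for all sufficiently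 large $\sigma$ extends to a uniformly continuous mapping from the Sobolev space $H^\sigma(\mathbb T)$ to $C^0([0,\infty),H^\sigma(\mathbb T))\cap C^1([0,\infty),H^{\sigma-2}(\mathbb T))$, and such that $Su_0$ solves (NLS$^*$) with initial datum $u_0$ (that is, $Su_0$ is the usual smooth solution). *)

(* Defs.v *)
From HB Require Import structures.
From mathcomp Require Import all_boot all_order all_algebra.
From mathcomp Require Import complex ring.
From mathcomp Require Import all_classical all_reals all_analysis.
Import Order.TTheory GRing.Theory Num.Theory.
Import numFieldNormedType.Exports.
Import Normc.

Set Implicit Arguments.
Unset Strict Implicit.
Unset Printing Implicit Defensive.

Local Open Scope classical_set_scope.
Local Open Scope ring_scope.
Local Open Scope complex_scope.

Section SmoothReal.
Context {R : realType}.
Implicit Types f g : R -> R.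

Definition smooth f := forall (k : nat) (x : R), derivable (derive1n k f) x 1.

Lemma derive1nSr f k : derive1n k.+1 f = derive1n k (derive1 f).
Proof. by rewrite /derive1n iterSr. Qed.

Lemma smooth_lin (a b : R) f g : smooth f -> smooth g ->
  (forall k, derive1n k (fun x => a * f x + b * g x) =
             (fun x => a * (derive1n k f) x + b * (derive1n k g) x)) /\
  smooth (fun x => a * f x + b * g x).
Proof.
move=> sf sg.
have dk (k : nat) (x : R) : is_derive x 1 (fun x : R => a * (derive1n k f) x + b * (derive1n k g) x)
    (a * (derive1n k.+1 f) x + b * (derive1n k.+1 g) x).
  have H1 : is_derive x 1 (derive1n k f) ((derive1n k.+1 f) x).
    by rewrite derive1nS derive1E; apply: DeriveDef.
  have H2 : is_derive x 1 (derive1n k g) ((derive1n k.+1 g) x).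
    by rewrite derive1nS derive1E; apply: DeriveDef.
  have := is_deriveD (is_deriveZ a H1) (is_deriveZ b H2).
  exact.
have E k : derive1n k (fun x => a * f x + b * g x) =
             (fun x => a * (derive1n k f) x + b * (derive1n k g) x).
  elim: k => [//|k IH]; rewrite derive1nS IH; apply/funext => x.
  by rewrite derive1E derive_val.
split=> // k x; rewrite E; exact: ex_derive.
Qed.

Lemma smooth_trig (c a b : R) :
  smooth (fun x => a * cos (c * x) + b * sin (c * x)).
Proof.
have d1 (a' b' x : R) : is_derive x 1
    (fun x => a' * cos (c * x) + b' * sin (c * x))
    ((b' * c) * cos (c * x) + (- a' * c) * sin (c * x)).
  have Hc : is_derive x 1 (fun y : R => c * y) (c * 1).
    exact: (is_deriveZ c (is_derive_id x 1)).
  have H1 := is_derive1_comp (is_derive_cos (c * x)) Hc.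
  have H2 := is_derive1_comp (is_derive_sin (c * x)) Hc.
  apply: is_derive_eq (is_deriveD (is_deriveZ a' H1) (is_deriveZ b' H2)) _.
  by rewrite /GRing.scale /=; ring.
move=> k; elim: k a b => [|k IH] a b x; first exact: ex_derive.
rewrite derive1nSr.
rewrite (_ : derive1 _ = fun x => (b * c) * cos (c * x) + (- a * c) * sin (c * x)).
  exact: IH.
by apply/funext => y; rewrite derive1E derive_val.
Qed.

Lemma smooth_continuous f : smooth f -> continuous f.
Proof.
by move=> sf x; apply: differentiable_continuous; apply/derivable1_diffP;
  exact: (sf 0 x).
Qed.

End SmoothReal.

Section Circle.
Context {R : realType}.
Local Notation C := R[i].

Definition cderive1n (k : nat) (f : R -> C) (x : R) : C :=
  (derive1n k (fun y => complex.Re (f y)) x) +i* (derive1n k (fun y => complex.Im (f y)) x).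

Definition smooth_periodic : {pred R -> C^o} := fun f =>
  `[< (forall x, f (x + 2 * pi) = f x) /\
      smooth (fun x => complex.Re (f x)) /\ smooth (fun x => complex.Im (f x)) >].

Let ReL (a z w : C) : complex.Re (a * z + w) =
  complex.Re a * complex.Re z + (- complex.Im a) * complex.Im z + complex.Re w.
Proof. by case: a z w => [? ?] [? ?] [? ?] /=; rewrite mulNr. Qed.

Let ImL (a z w : C) : complex.Im (a * z + w) =
  complex.Re a * complex.Im z + complex.Im a * complex.Re z + complex.Im w.
Proof. by case: a z w => [? ?] [? ?] [? ?] /=. Qed.

Let derivs_lin (a : C) (f g : R -> C) :
  smooth (fun x => complex.Re (f x)) -> smooth (fun x => complex.Im (f x)) ->
  smooth (fun x => complex.Re (g x)) -> smooth (fun x => complex.Im (g x)) ->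
  let h := fun x => a * f x + g x in
  smooth (fun x => complex.Re (h x)) /\ smooth (fun x => complex.Im (h x)).
Proof.
move=> f1 f2 g1 g2 h.
have [_ A] := smooth_lin (complex.Re a) (- complex.Im a) f1 f2.
have [_ A'] := smooth_lin 1 1 A g1.
have [_ B] := smooth_lin (complex.Re a) (complex.Im a) f2 f1.
have [_ B'] := smooth_lin 1 1 B g2.
split.
- rewrite (_ : (fun x => complex.Re (h x)) = fun x => 1 * (complex.Re a * complex.Re (f x)
      + (- complex.Im a) * complex.Im (f x)) + 1 * complex.Re (g x)) //.
  by apply/funext => x; rewrite !mul1r /h ReL.
- rewrite (_ : (fun x => complex.Im (h x)) = fun x => 1 * (complex.Re a * complex.Im (f x)
      + complex.Im a * complex.Re (f x)) + 1 * complex.Im (g x)) //.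
  by apply/funext => x; rewrite !mul1r /h ImL.
Qed.

Lemma smooth_cst0 : smooth (fun _ : R => 0 : R).
Proof.
have := @smooth_trig R 0 0 0.
by under eq_fun do rewrite !mul0r addr0.
Qed.

Lemma smooth_periodic_submod_closed : submod_closed smooth_periodic.
Proof.
split.
  by apply/asboolP; split=> //; split; exact: smooth_cst0.
move=> a f g /asboolP[pf [f1 f2]] /asboolP[pg [g1 g2]]; apply/asboolP.
split; first by move=> x; rewrite !fctE pf pg.
exact: derivs_lin.
Qed.

HB.instance Definition _ := GRing.isSubmodClosed.Build _ _ smooth_periodic
  smooth_periodic_submod_closed.

End Circle.

(* C^oo(T), as smooth 2 pi-periodic functions on the line *)
Record Cinfty (R : realType) := MkCinfty {
  Cinfty_fun :> R -> R[i]^o;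
  Cinfty_subproof : Cinfty_fun \in smooth_periodic }.

HB.instance Definition _ (R : realType) := [isSub for @Cinfty_fun R].
HB.instance Definition _ (R : realType) := [Choice of Cinfty R by <:].
HB.instance Definition _ (R : realType) := [SubChoice_isSubLmodule of Cinfty R by <:].

Section Torus.
Context {R : realType}.
Local Notation C := R[i].

Definition torus_int (g : R -> R) : R :=
  \int[lebesgue_measure]_(x in `[0, 2 * pi]) g x.

Definition torus_mean (g : R -> R) : R := (2 * pi)^-1 * torus_int g.

Definition ctorus_int (f : R -> C) : C :=
  torus_int (fun x => complex.Re (f x)) +i* torus_int (fun x => complex.Im (f x)).

(* x |-> e^{-inx} *)
Definition expin_fun (n : int) (x : R) : C^o :=
  cos (n%:~R * x) -i* sin (n%:~R * x).

Lemma expin_subproof n : expin_fun n \in smooth_periodic.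
Proof.
apply/asboolP; split; last split.
- move=> x; rewrite /expin_fun mulrDr.
  rewrite (_ : n%:~R * (2 * pi) = (2 * pi : R) *~ n); last by rewrite mulrC mulrzr.
  have per (k : nat) (y : R) : cos (y + (2 * pi) *+ k) = cos y /\
                               sin (y + (2 * pi) *+ k) = sin y.
    elim: k y => [|k IH] y; first by rewrite mulr0n addr0.
    rewrite mulrSr addrA mulr_natl.
    by rewrite cosD2pi sinD2pi -mulr_natl; exact: IH.
  case: n => k /=.
    by rewrite -!pmulrn; case: (per k (k%:R * x)) => -> ->.
  rewrite NegzE mulrNz -pmulrn.
  set z := _ * x; case: (per k.+1 (z - (2 * pi) *+ k.+1)).
  by rewrite subrK => -> ->.
- have := @smooth_trig R n%:~R 1 0.
  by under eq_fun do rewrite mul1r mul0r addr0.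
- have := @smooth_trig R n%:~R 0 (-1).
  by under eq_fun do rewrite mul0r add0r mulN1r.
Qed.

Definition expin (n : int) : Cinfty R := MkCinfty (expin_subproof n).

(* Continuity of a linear form for the Frechet topology of C^oo(T): it is
   dominated by the maximum of the sup norms of finitely many derivatives. *)
Definition is_distribution : {pred Cinfty R -> C^o} := fun D =>
  `[< scalar D /\
      exists (K : R) (N : nat), 0 <= K /\ forall (phi : Cinfty R) (B : R),
        (forall (k : nat) (x : R), (k <= N)%N ->
           normc (cderive1n k phi x) <= B) ->
        normc (D phi) <= K * B >].

Let normc_ge0 (z : C) : 0 <= normc z.
Proof. by case: z => a b; exact: sqrtr_ge0. Qed.

Lemma is_distribution_submod_closed : submod_closed is_distribution.
Proof.
split.
  apply/asboolP; split; first by move=> a f g; rewrite -[LHS]/(0 : R[i]) -[X in _ = _ + X]/(0 : R[i]) -[X in _ * X]/(0 : R[i]) mulr0 addr0.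
  by exists 0, 0%N; split=> // phi B _; rewrite mul0r le_eqVlt; apply/orP; left; apply/eqP; exact: normc0.
move=> a D1 D2 /asboolP[l1 [K1 [N1 [K10 b1]]]] /asboolP[l2 [K2 [N2 [K20 b2]]]].
apply/asboolP; split.
  move=> b f g; rewrite !fctE l1 l2 /= /GRing.scale /=; ring.
exists (normc a * K1 + K2), (maxn N1 N2); split.
  by rewrite addr_ge0// mulr_ge0.
move=> phi B hB; rewrite !fctE.
apply: le_trans (le_normcD _ _) _; rewrite mulrDl lerD//.
  rewrite normcM -mulrA ler_wpM2l//; apply: b1 => k x kN; apply: hB.
  by rewrite leq_max kN.
by apply: b2 => k x kN; apply: hB; rewrite leq_max kN orbT.
Qed.

HB.instance Definition _ := GRing.isSubmodClosed.Build _ _ is_distribution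
  is_distribution_submod_closed.

End Torus.

Record torus_distribution (R : realType) := MkTorusDistribution {
  distribution_fun :> Cinfty R -> R[i]^o;
  distribution_subproof : distribution_fun \in is_distribution }.

HB.instance Definition _ (R : realType) := [isSub for @distribution_fun R].
HB.instance Definition _ (R : realType) := [Choice of torus_distribution R by <:].
HB.instance Definition _ (R : realType) :=
  [SubChoice_isSubLmodule of torus_distribution R by <:].

Section Embedding.
Context {R : realType}.
Local Notation C := R[i].
Local Notation Re := complex.Re.
Local Notation Im := complex.Im.

Let integr (g : R -> R) : continuous g ->
  lebesgue_measure.-integrable `[0, 2 * pi] (EFin \o g).
Proof.
move=> cg; apply: continuous_compact_integrable; first exact: segment_compact.
exact: continuous_subspaceT.
Qed.

Let contZD (a b : R) (f g : R -> R) : continuous f -> continuous g ->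
  continuous (fun x => a * f x + b * g x).
Proof.
move=> cf cg x.
by apply: (@continuousD _ _ _ (fun x => a * f x) (fun x => b * g x));
  (apply: continuousM; [exact: cvg_cst|]); [exact: cf|exact: cg].
Qed.

Let tiD (a b : R) (f g : R -> R) : continuous f -> continuous g ->
  torus_int (fun x => a * f x + b * g x) = a * torus_int f + b * torus_int g.
Proof.
move=> cf cg; rewrite /torus_int.
have m : measurable (`[0, 2 * pi] : set R) by [].
rewrite RintegralD//; last 2 first.
- by apply: integr => x; apply: continuousM; [exact: cvg_cst|exact: cf].
- by apply: integr => x; apply: continuousM; [exact: cvg_cst|exact: cg].
by rewrite !RintegralZl//; exact: integr.
Qed.

Let ReM (z w : C) : Re (z * w) = 1 * (Re z * Re w) + (-1) * (Im z * Im w).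
Proof. by case: z w => [? ?] [? ?] /=; rewrite mul1r mulN1r. Qed.
Let ImM (z w : C) : Im (z * w) = 1 * (Re z * Im w) + 1 * (Im z * Re w).
Proof. by case: z w => [? ?] [? ?] /=; rewrite !mul1r. Qed.

Let cont (u : Cinfty R) :
  continuous (fun x => Re (u x)) /\ continuous (fun x => Im (u x)).
Proof.
have /asboolP[_ [a b]] := Cinfty_subproof u.
by split; exact: smooth_continuous.
Qed.

Let contM (f g : R -> R) (a b : R) (h k : R -> R) :
  continuous f -> continuous g -> continuous h -> continuous k ->
  continuous (fun x => a * (f x * g x) + b * (h x * k x)).
Proof.
move=> cf cg ch ck; apply: contZD => x.
  by apply: continuousM; [exact: cf|exact: cg].
by apply: continuousM; [exact: ch|exact: ck].
Qed.

Definition to_distribution_fun (u : Cinfty R) (phi : Cinfty R) : C^o :=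
  ctorus_int (fun x => (u x : C) * phi x).

Let contuphi (u phi : Cinfty R) :
  continuous (fun x => Re ((u x : C) * phi x)) /\
  continuous (fun x => Im ((u x : C) * phi x)).
Proof.
have [a b] := cont u; have [c d] := cont phi.
split.
  by under eq_fun do rewrite ReM; exact: contM.
by under eq_fun do rewrite ImM; exact: contM.
Qed.

Lemma to_distribution_subproof u : to_distribution_fun u \in is_distribution.
Proof.
apply/asboolP; split.
  move=> a f g; rewrite /to_distribution_fun /ctorus_int.
  have [c1 c2] := contuphi u f; have [c3 c4] := contuphi u g.
  have E x : (u x : C) * ((a *: f + g) x : C) = a * ((u x : C) * f x) + (u x : C) * g x.
    by rewrite /= !fctE /GRing.scale /=; ring.
  under eq_fun do rewrite E.
  under [X in _ +i* torus_int X]eq_fun do rewrite E.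
  have X1 : torus_int (fun x => Re (a * ((u x : C) * f x) + (u x : C) * g x)) =
     Re a * torus_int (fun x => Re ((u x : C) * f x))
     + (- Im a) * torus_int (fun x => Im ((u x : C) * f x))
     + torus_int (fun x => Re ((u x : C) * g x)).
    rewrite -tiD// -[X in _ + X]mul1r -[X in X + _]mul1r -tiD//.
      by congr torus_int; apply/funext => x; rewrite raddfD /= ReM !mul1r; ring.
    exact: contZD.
  have X2 : torus_int (fun x => Im (a * ((u x : C) * f x) + (u x : C) * g x)) =
     Re a * torus_int (fun x => Im ((u x : C) * f x))
     + Im a * torus_int (fun x => Re ((u x : C) * f x))
     + torus_int (fun x => Im ((u x : C) * g x)).
    rewrite -tiD// -[X in _ + X]mul1r -[X in X + _]mul1r -tiD//.
      by congr torus_int; apply/funext => x; rewrite raddfD /= ImM !mul1r; ring.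
    exact: contZD.
  rewrite X1 X2; apply/eqP; rewrite eq_complex.
  case: a {E X1 X2} => a b /=.
  by rewrite mulNr !eqxx.
pose w x := `|Re (u x)| + `|Im (u x)|.
have [c1 c2] := cont u.
have cw : continuous w.
  move=> x; apply: (@continuousD _ _ _ (fun x => `|Re (u x)|) (fun x => `|Im (u x)|));
    (apply: continuous_comp; last exact: norm_continuous).
    exact: c1.
  exact: c2.
have w0 x : 0 <= w x by rewrite addr_ge0.
have m : measurable (`[0, 2 * pi] : set R) by [].
have iw0 : 0 <= torus_int w by apply: Rintegral_ge0 => x _.
exists (2 * torus_int w), 0%N; split; first by rewrite mulr_ge0.
move=> phi B hB.
have hp x : normc (phi x : C) <= B.
  have := hB 0%N x isT; rewrite /cderive1n /derive1n /=.
  by case: (phi x).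
have absle (z : C) : `|Re z| <= normc z /\ `|Im z| <= normc z.
  case: z => a b /=; rewrite -!sqrtr_sqr !ler_wsqrtr// ?lerDl ?lerDr ?sqr_ge0//.
have bnd x : `|Re ((u x : C) * phi x)| <= B * w x /\
             `|Im ((u x : C) * phi x)| <= B * w x.
  have [r1 r2] := absle (phi x); have h := hp x.
  have r1' := le_trans r1 h; have r2' := le_trans r2 h.
  rewrite ReM ImM !mul1r mulN1r; split.
    apply: le_trans (ler_normB _ _) _; rewrite !normrM /w mulrDr.
    by rewrite lerD// mulrC ler_wpM2r.
  apply: le_trans (ler_normD _ _) _; rewrite !normrM /w mulrDr.
  by rewrite lerD// mulrC ler_wpM2r.
have [d1 d2] := contuphi u phi.
have key (h : R -> R) : continuous h -> (forall x, `|h x| <= B * w x) ->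
    `|torus_int h| <= B * torus_int w.
  move=> ch hb; apply: le_trans (le_normr_Rintegral _ _) _ => //; first exact: integr.
  rewrite /torus_int -RintegralZl//; last exact: integr.
  apply: le_Rintegral => //; apply: integr => x.
    by apply: continuous_comp; [exact: ch|exact: norm_continuous].
  by apply: continuousM; [exact: cvg_cst|exact: cw].
have k1 := key _ d1 (fun x => (bnd x).1).
have k2 := key _ d2 (fun x => (bnd x).2).
have nle (a b : R) : normc (a +i* b) <= `|a| + `|b|.
  have -> : a +i* b = a%:C + (0 +i* b) by apply/eqP; rewrite eq_complex /= addr0 add0r !eqxx.
  apply: le_trans (le_normcD _ _) _.
  by rewrite /= expr0n /= addr0 add0r !sqrtr_sqr.
apply: le_trans (nle _ _) _.
by apply: le_trans (lerD k1 k2) _; rewrite -mulrA mulrDl !mul1r ![B * _]mulrC.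
Qed.

(* The function u identified with the distribution phi |-> \int_T u phi dx *)
Definition to_distribution (u : Cinfty R) : torus_distribution R :=
  MkTorusDistribution (to_distribution_subproof u).

End Embedding.

Section FourierLebesgue.
Context {R : realType}.
Implicit Types (f g : torus_distribution R) (u v : R -> torus_distribution R) (I : set R).

Definition fourier_coef f (n : int) : R[i] :=
  ((2 * pi)^-1)%:C * (f (expin n) : R[i]).

Definition japanese (n : int) : R := Num.sqrt (1 + n%:~R ^+ 2).

(* The norm of H^{s,p}, equal to +oo outside the space; for p = 2 it is the
   norm of the Sobolev space H^s(T). *)
Definition Hsp_norm (s p : R) f : \bar R :=
  ((\esum_(n in [set: int])
     (japanese n `^ (p * s) * normc (fourier_coef f n) `^ p)%:E) `^ p^-1)%E.

Definition Hsp (s p : R) : set (torus_distribution R) :=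
  [set f | (Hsp_norm s p f < +oo)%E].

Definition Hsp_ball (s p r : R) : set (torus_distribution R) :=
  [set f | (Hsp_norm s p f <= r%:E)%E].

Definition C0_Hsp I (s p : R) u : Prop :=
  (forall t, I t -> Hsp s p (u t)) /\
  (forall t, I t ->
    Hsp_norm s p (u t' - u t) @[t' --> within I (nbhs t)] --> 0%E).

Definition has_derivative_Hsp I (s p : R) u v : Prop :=
  forall t, I t ->
    Hsp_norm s p (((t' - t)^-1)%:C *: (u t' - u t) - v t)
      @[t' --> within I t^'] --> 0%E.

Definition C0_Hsp_norm I (s p : R) u : \bar R :=
  ereal_sup [set Hsp_norm s p (u t) | t in I].

(* Uniform continuity on D, for the H^{s,p} norm, of a map F with values in
   C^0(I, H^{s',p'}) with the supremum norm *)
Definition unif_continuous_C0_Hsp (D : set (torus_distribution R)) (s p : R)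
    I (s' p' : R) (F : torus_distribution R -> R -> torus_distribution R) : Prop :=
  forall eps : R, 0 < eps -> exists2 delta : R, 0 < delta &
    forall f g, D f -> D g -> (Hsp_norm s p (f - g)%R < delta%:E)%E ->
      (C0_Hsp_norm I s' p' (fun t => F f t - F g t)%R < eps%:E)%E.

End FourierLebesgue.

Section NLS.
Context {R : realType}.

(* The classical initial value problem for (NLS* ); the time derivative is
   one-sided at t = 0. *)
Definition NLS_star (omega : R) (u0 : Cinfty R) (u : R -> Cinfty R) : Prop :=
  (forall x, u 0 x = u0 x) /\
  forall t x : R, 0 <= t -> exists ut : R[i],
    normc (((t' - t)^-1)%:C * (u t' x - u t x : R[i]) - ut)
      @[t' --> within `[0, +oo[ t^'] --> (0 : R) /\
    'i * ut + cderive1n 2 (u t) x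
      + (omega * (normc (u t x) ^+ 2
                  - 2 * torus_mean (fun y => normc (u t y) ^+ 2)))%:C
        * (u t x : R[i]) = 0.

(* S is the solution map on C^oo(T). The C^1 part is expressed by the time
   derivative dSsigma. C^0([0, +oo[, H^sigma) carries the topology of uniform
   convergence on compact time intervals and uniform continuity on H^sigma is
   meant on bounded subsets: already for constant data a, where
   u(t) = exp(- i omega |a|^2 t) a, it fails on the whole space. *)
Definition is_solution_map (omega : R) (S : Cinfty R -> R -> Cinfty R) : Prop :=
  (forall u0, NLS_star omega u0 (S u0)) /\
  exists sigma0 : R, forall sigma : R, sigma0 <= sigma ->
    exists Ssigma dSsigma : torus_distribution R -> R -> torus_distribution R,
    [/\ forall u0 t, 0 <= t ->
          Ssigma (to_distribution u0) t = to_distribution (S u0 t),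
        forall f, Hsp sigma 2 f ->
          [/\ C0_Hsp `[0, +oo[ sigma 2 (Ssigma f),
              C0_Hsp `[0, +oo[ (sigma - 2) 2 (dSsigma f) &
              has_derivative_Hsp `[0, +oo[ (sigma - 2) 2 (Ssigma f) (dSsigma f)] &
        forall r T : R,
          unif_continuous_C0_Hsp (Hsp_ball sigma 2 r) sigma 2
            `[0, T] sigma 2 Ssigma /\
          unif_continuous_C0_Hsp (Hsp_ball sigma 2 r) sigma 2
            `[0, T] (sigma - 2) 2 dSsigma].

End NLS.

(* Main.v *)
Require Import Defs.
From HB Require Import structures.
From mathcomp Require Import all_boot all_order all_algebra.
From mathcomp Require Import finmap complex ring lra zify.
From mathcomp Require Import all_classical all_reals all_analysis.
Import Order.TTheory GRing.Theory Num.Theory.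
Import numFieldNormedType.Exports.
Import Normc.

(** The equation is renormalized so that its resonant part almost disappears. In
   terms of the profiles a_n(t) = exp(i n^2 t) u^(t, n) it reads

     a_n' = i omega sum_(j - k + l = n) resc exp(i phase t) a_j conj(a_k) a_l,

   where phase = 2 (n - j) (j - k) and resc vanishes if exactly one of j = n and
   j = k holds: subtracting twice the mass removes exactly these interactions, and
   leaves -1 at j = k = n ([renormalized_cubic]). A nonresonant interaction
   with a given phase is a factorization of half of that phase, and a nonzero
   integer mu has at most C <mu>^e factorizations ([divisor_bound]). Hence the sum
   over j and k is almost one-dimensional, which is why l^p norms of the
   coefficients suffice for every finite p.

   Working with space-time coefficients c(n, l), so that a_n(t) is the sum over l of
   c(n, l) exp(i l t), Hoelder's inequality and the divisor bound give a trilinear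
   estimate ([trilinear]) in the norm with weights <n>^s and <l>^b, b slightly
   above 1 - 1/p, for which the temporal part embeds into l^1. Time is localized to
   [0, 1/M] without cutting off: v = exp(- M t) a satisfies v' + M v = exp(2 M t) N(v),
   and both exponentials agree on [0, 1/M] with periodic windows of explicitly
   known coefficients ([exp_windows]). Inverting d/dt + M gains M^(-2/5)
   ([duhamel_trilinear]), while the windows only cost small powers of M. So for
   large M, depending on the radius of the ball only, the Picard map on coefficients
   contracts, and its iterates depend on the data in a Lipschitz way
   ([picard_bound], [picard_lip]).

   The iterates converge to the smooth solution whenever that exists. For smooth data
   a weight <n>^s (1 + kap <n>^2) with small kap satisfies the same estimates with the
   same constants, so the iterates decay like <n>^-2 and can be compared with the
   solution by the mean value inequality ([picard_cvg]). Thus smooth solutions from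
   data in the ball are Lipschitz in the norm of H^(s,p), uniformly on [0, 1/M]
   ([profile_stability], [smooth_stability]). That the profiles of the given
   solutions solve the system above is obtained from the pointwise equation by
   Fourier inversion for smooth periodic functions ([fourier_inversion],
   [coefficient_equation]).

   Finally, the flow of a general datum is the limit of the smooth solutions from its
   truncations in frequency ([flow_coefs_ex]). It inherits the Lipschitz bound and the
   continuity in time, and it is a distribution because its coefficients are bounded
   ([distribution_of_coefs]). *)

Set Implicit Arguments.
Unset Strict Implicit.
Unset Printing Implicit Defensive.

Local Open Scope classical_set_scope.
Local Open Scope ring_scope.
Local Open Scope complex_scope.

(** * Unordered sums of nonnegative, real and complex families *)

Section NonnegativeSums.
Context {R : realType}.
Local Open Scope ereal_scope.

Definition nsum {T : choiceType} (f : T -> \bar R) : \bar R :=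
  \esum_(i in [set: T]) f i.

Lemma nsum_ge0 {T : choiceType} (f : T -> \bar R) :
  (forall i, 0 <= f i) -> 0 <= nsum f.
Proof. by move=> f0; apply: esum_ge0. Qed.

Lemma le_nsum {T : choiceType} (f g : T -> \bar R) :
  (forall i, f i <= g i) -> nsum f <= nsum g.
Proof. by move=> fg; apply: le_esum. Qed.

Lemma eq_nsum {T : choiceType} (f g : T -> \bar R) :
  (forall i, f i = g i) -> nsum f = nsum g.
Proof. by move=> fg; apply: eq_esum. Qed.

Lemma nsumD {T : choiceType} (f g : T -> \bar R) :
  (forall i, 0 <= f i) -> (forall i, 0 <= g i) ->
  nsum (fun i => f i + g i) = nsum f + nsum g.
Proof. by move=> f0 g0; apply: esumD. Qed.

Lemma nsum_seq_le {T : choiceType} (f : T -> \bar R) (s : seq T) :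
  (forall i, 0 <= f i) -> uniq s -> \sum_(i <- s) f i <= nsum f.
Proof.
move=> f0 us; apply: esum_ge; exists [set` s].
  by split=> //; exact: finite_seq.
rewrite fsbig_finite/=; last exact: finite_seq.
have ps : perm_eq s (fset_set [set` s]).
  apply: uniq_perm => //= x; rewrite in_fset_set; last exact: finite_seq.
  by apply/idP/idP; rewrite inE.
by rewrite (perm_big _ ps).
Qed.

Lemma nsum_le_seq {T : choiceType} (f : T -> \bar R) (K : \bar R) :
  (forall s, uniq s -> \sum_(i <- s) f i <= K) -> nsum f <= K.
Proof.
move=> h; apply: ge_ereal_sup => _ [X [finX _] <-].
rewrite fsbig_finite//; apply: h; exact: finmap.fset_uniq.
Qed.

Lemma nsum_term {T : choiceType} (f : T -> \bar R) (i : T) :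
  (forall i, 0 <= f i) -> f i <= nsum f.
Proof.
by move=> f0; have := nsum_seq_le f0 (isT : uniq [:: i]); rewrite big_seq1.
Qed.

Lemma nsum0 {T : choiceType} : nsum (fun _ : T => 0) = 0.
Proof. exact: esum1. Qed.

Lemma nsumZ {T : choiceType} (c : R) (f : T -> \bar R) : (0 <= c)%R ->
  (forall i, 0 <= f i) -> nsum (fun i => c%:E * f i) = c%:E * nsum f.
Proof.
move=> c0 f0.
have le (d : R) (g : T -> \bar R) : (0 <= d)%R -> (forall i, 0 <= g i) ->
    nsum (fun i => d%:E * g i) <= d%:E * nsum g.
  move=> d0 g0; apply: nsum_le_seq => s us.
  rewrite -ge0_sume_distrr//; apply: lee_wpmul2l; rewrite ?lee_fin//.
  exact: nsum_seq_le.
move: c0; rewrite le_eqVlt => /predU1P[<-|c0].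
  by rewrite mul0e -[RHS](@nsum0 T); apply: eq_nsum => i; rewrite mul0e.
apply/eqP; rewrite eq_le le//=; last exact: ltW.
rewrite -lee_pdivlMl//; apply: le_trans (le _ _ _ _); last 2 first.
- by rewrite invr_ge0 ltW.
- by move=> i; rewrite mule_ge0// lee_fin ltW.
by apply: le_nsum => i; rewrite muleA -EFinM mulVf ?mul1e// gt_eqF.
Qed.

Lemma nsum_pair {T U : choiceType} (f : T -> U -> \bar R) :
  (forall i j, 0 <= f i j) ->
  nsum (fun i => nsum (fun j => f i j)) = nsum (fun k => f k.1 k.2).
Proof.
move=> f0; rewrite /nsum esum_esum//; congr esum.
by apply/seteqP; split.
Qed.

Lemma nsum_reindex {T U : choiceType} (e : T -> U) (f : U -> \bar R) :
  bijective e -> nsum (fun i => f (e i)) = nsum f.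
Proof.
move=> be; rewrite /nsum -(@reindex_esum _ _ _ [set: T] [set: U] e)//.
by rewrite setTT_bijective.
Qed.

Lemma nsum_swap {T U : choiceType} (f : T -> U -> \bar R) :
  (forall i j, 0 <= f i j) ->
  nsum (fun i => nsum (fun j => f i j)) = nsum (fun j => nsum (fun i => f i j)).
Proof.
move=> f0; rewrite !nsum_pair// -(@nsum_reindex _ _ (fun k : T * U => (k.2, k.1)))//.
by exists (fun k => (k.2, k.1)) => -[].
Qed.

Lemma nsum_delta {T : choiceType} (a : T) (f : T -> \bar R) :
  0 <= f a -> nsum (fun i => if i == a then f i else 0) = f a.
Proof.
move=> f0; rewrite /nsum -[RHS](@esum_set1 _ _ a f)// [RHS]esum_mkcond.
by apply: eq_esum => i _; rewrite (_ : (i \in [set a]) = (i == a))//; apply/idP/eqP; rewrite inE.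
Qed.

(** The complement of a finite set that almost exhausts the sum carries the rest. *)
Lemma nsum_tail {T : choiceType} (f : T -> \bar R) (eps : R) :
  (forall i, 0 <= f i) -> nsum f < +oo -> (0 < eps)%R ->
  exists2 s, uniq s & nsum (fun i => if i \in s then 0 else f i) < eps%:E.
Proof.
move=> f0 foo e0.
have ffin : nsum f \is a fin_num by rewrite ge0_fin_numE// nsum_ge0.
have : nsum f - eps%:E < nsum f by rewrite lteBlDr// lteDl// lte_fin.
move=> /ereal_sup_gt[_ [X [finX _] <-]] h; exists (fset_set X).
  exact: finmap.fset_uniq.
rewrite fsbig_finite// in h.
set s := (fset_set X : seq T) in h *.
have split1 : nsum f = nsum (fun i => if i \in s then f i else 0) +
                       nsum (fun i => if i \in s then 0 else f i).
  rewrite -nsumD//; try by move=> i; case: ifP.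
  by apply: eq_nsum => i; case: ifP; rewrite ?adde0 ?add0e.
have g0 i : 0 <= (if i \in s then f i else 0) by case: ifP.
have sle : \sum_(i <- s) f i <= nsum (fun i => if i \in s then f i else 0).
  have := nsum_seq_le g0 (finmap.fset_uniq _ : uniq s).
  by rewrite big_seq; under eq_bigr => i -> do []; rewrite -big_seq.
have s0 : 0 <= \sum_(i <- s) f i by rewrite sume_ge0.
have sfin : \sum_(i <- s) f i \is a fin_num.
  by rewrite ge0_fin_numE//; apply: le_lt_trans foo; apply: nsum_seq_le => //; exact: finmap.fset_uniq.
have g1 : nsum (fun i => if i \in s then f i else 0) \is a fin_num.
  rewrite ge0_fin_numE ?nsum_ge0//; apply: le_lt_trans foo; rewrite split1 leeDl// nsum_ge0//.
  by move=> i; case: ifP.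
have -> : nsum (fun i => if i \in s then 0 else f i) =
    nsum f - nsum (fun i => if i \in s then f i else 0).
  by rewrite split1 addeAC subee// add0e.
rewrite lteBlDr//; apply: lt_le_trans (leeD2l _ sle).
by rewrite addeC -lteBlDr.
Qed.

End NonnegativeSums.

Section RealSums.
Context {R : realType} {T : choiceType}.
Implicit Types f g : T -> R.

(** Only meaningful when the sum of the absolute values is finite. *)
Definition rsum f : R :=
  fine (nsum (fun i => (Num.max (f i) 0)%:E)) -
  fine (nsum (fun i => (Num.max (- f i) 0)%:E)).

Definition rsummable f : Prop := (nsum (fun i => `|f i|%:E) < +oo)%E.

Lemma nsum_fin f : (forall i, 0 <= f i) -> (nsum (fun i => (f i)%:E) < +oo)%E ->
  nsum (fun i => (f i)%:E) = (fine (nsum (fun i => (f i)%:E)))%:E.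
Proof.
by move=> f0 foo; rewrite fineK// ge0_fin_numE//; apply: nsum_ge0 => i; rewrite lee_fin.
Qed.

Lemma rsumE f g h : (forall i, 0 <= g i) -> (forall i, 0 <= h i) ->
  (nsum (fun i => (g i)%:E) < +oo)%E -> (nsum (fun i => (h i)%:E) < +oo)%E ->
  (forall i, f i = g i - h i) ->
  rsum f = fine (nsum (fun i => (g i)%:E)) - fine (nsum (fun i => (h i)%:E)).
Proof.
move=> g0 h0 goo hoo fE; rewrite /rsum.
set P := fun i => Num.max (f i) 0; set N := fun i => Num.max (- f i) 0.
have P0 i : 0 <= P i by rewrite le_max lexx orbT.
have N0 i : 0 <= N i by rewrite le_max lexx orbT.
have Poo : (nsum (fun i => (P i)%:E) < +oo)%E.
  apply: le_lt_trans goo; apply: le_nsum => i; rewrite lee_fin /P ge_max g0 andbT.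
  by rewrite fE gerBl.
have Noo : (nsum (fun i => (N i)%:E) < +oo)%E.
  apply: le_lt_trans hoo; apply: le_nsum => i; rewrite lee_fin /N ge_max h0 andbT.
  by rewrite fE opprB gerBl.
have : (nsum (fun i => (P i)%:E) + nsum (fun i => (h i)%:E) =
        nsum (fun i => (N i)%:E) + nsum (fun i => (g i)%:E))%E.
  rewrite -!nsumD; try by move=> i; rewrite lee_fin.
  apply: eq_nsum => i; rewrite -!EFinD; congr (_%:E).
  by rewrite /P /N fE; case: (lerP 0 (g i - h i)) => H1; case: (lerP 0 (- (g i - h i))) => H2; lra.
rewrite (nsum_fin P0)// (nsum_fin N0)// (nsum_fin g0)// (nsum_fin h0)//.
rewrite -!EFinD => -[]; lra.
Qed.

Lemma rsummable_parts f : rsummable f ->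
  (nsum (fun i => (Num.max (f i) 0)%:E) < +oo)%E /\
  (nsum (fun i => (Num.max (- f i) 0)%:E) < +oo)%E.
Proof.
move=> fs; split; apply: le_lt_trans fs; apply: le_nsum => i; rewrite lee_fin ge_max normr_ge0 andbT.
  exact: ler_norm.
by rewrite -normrN ler_norm.
Qed.

Lemma rsummableZ c f : rsummable f -> rsummable (fun i => c * f i).
Proof.
move=> fs; rewrite /rsummable; under eq_fun do rewrite normrM EFinM.
rewrite nsumZ//.
by rewrite lte_mul_pinfty// lee_fin.
Qed.

Let max0 (x : R) : 0 <= Num.max x 0. Proof. by rewrite le_max lexx orbT. Qed.
Hint Resolve max0 : core.
Let maxE (x : R) : x = Num.max x 0 - Num.max (- x) 0.
Proof. by case: (lerP 0 x) => H1; case: (lerP 0 (- x)) => H2; lra. Qed.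

Lemma rsumD f g : rsummable f -> rsummable g ->
  rsum (fun i => f i + g i) = rsum f + rsum g.
Proof.
move=> /rsummable_parts[f1 f2] /rsummable_parts[g1 g2].
rewrite (@rsumE _ (fun i => Num.max (f i) 0 + Num.max (g i) 0)
  (fun i => Num.max (- f i) 0 + Num.max (- g i) 0)).
- under eq_fun do rewrite EFinD; under [X in _ - fine (nsum X)]eq_fun do rewrite EFinD.
  rewrite !nsumD; try by move=> i; rewrite lee_fin.
  have fin (h : T -> R) : (nsum (fun i => (Num.max (h i) 0)%:E) < +oo)%E ->
      nsum (fun i => (Num.max (h i) 0)%:E) \is a fin_num.
    by move=> hoo; rewrite ge0_fin_numE// nsum_ge0// => i; rewrite lee_fin.
  by rewrite !fineD ?fin// /rsum; lra.
- by move=> i; rewrite addr_ge0.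
- by move=> i; rewrite addr_ge0.
- under eq_fun do rewrite EFinD; rewrite nsumD; try by move=> i; rewrite lee_fin.
  exact: lte_add_pinfty.
- under eq_fun do rewrite EFinD; rewrite nsumD; try by move=> i; rewrite lee_fin.
  exact: lte_add_pinfty.
- by move=> i; rewrite {1}(maxE (f i)) {1}(maxE (g i)); ring.
Qed.

Lemma rsumN f : rsum (fun i => - f i) = - rsum f.
Proof.
by rewrite /rsum opprB; congr (_ - fine (nsum _)); apply/funext => i; rewrite opprK.
Qed.

Lemma rsumZ c f : rsummable f -> rsum (fun i => c * f i) = c * rsum f.
Proof.
wlog c0 : c / 0 <= c => [H fs|/rsummable_parts[f1 f2]].
  have [/H->//|c0] := leP 0 c.
  rewrite -[LHS]opprK -rsumN; under eq_fun do rewrite -mulNr.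
  by rewrite H// ?oppr_ge0 ?ltW//; ring.
rewrite (@rsumE _ (fun i => c * Num.max (f i) 0) (fun i => c * Num.max (- f i) 0)).
- under eq_fun do rewrite EFinM; under [X in _ - fine (nsum X)]eq_fun do rewrite EFinM.
  rewrite !nsumZ//; try by move=> i; rewrite lee_fin.
  by rewrite !fineM// ?mulrBr// ge0_fin_numE// nsum_ge0// => i; rewrite lee_fin.
- by move=> i; rewrite mulr_ge0.
- by move=> i; rewrite mulr_ge0.
- under eq_fun do rewrite EFinM; rewrite nsumZ//; try by move=> i; rewrite lee_fin.
  by rewrite lte_mul_pinfty// lee_fin.
- under eq_fun do rewrite EFinM; rewrite nsumZ//; try by move=> i; rewrite lee_fin.
  by rewrite lte_mul_pinfty// lee_fin.
- by move=> i; rewrite {1}(maxE (f i)) mulrBr.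
Qed.

End RealSums.

Lemma rsum_reindex {R : realType} {T U : choiceType} (e : T -> U) (f : U -> R) :
  bijective e -> rsum (fun i => f (e i)) = rsum f.
Proof.
move=> be; rewrite /rsum (nsum_reindex (fun i => (Num.max (f i) 0)%:E) be).
by rewrite (nsum_reindex (fun i => (Num.max (- f i) 0)%:E) be).
Qed.

Lemma rsum_pair {R : realType} {T U : choiceType} (f : T -> U -> R) :
  rsummable (fun k : T * U => f k.1 k.2) ->
  rsum (fun i => rsum (f i)) = rsum (fun k : T * U => f k.1 k.2).
Proof.
move=> /rsummable_parts[f1 f2].
have max0 (x : R) : 0 <= Num.max x 0 by rewrite le_max lexx orbT.
have aux (g : T -> U -> R) : (forall i j, 0 <= g i j) ->
    (nsum (fun k : T * U => (g k.1 k.2)%:E) < +oo)%E ->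
    nsum (fun i => (fine (nsum (fun j => (g i j)%:E)))%:E) =
      nsum (fun k : T * U => (g k.1 k.2)%:E).
  move=> g0 goo; rewrite -(@nsum_pair _ _ _ (fun i j => (g i j)%:E)); last by move=> i j; rewrite lee_fin.
  apply: eq_nsum => i; rewrite -nsum_fin//; apply: le_lt_trans goo.
  rewrite -(@nsum_pair _ _ _ (fun i j => (g i j)%:E)); last by move=> ? j; rewrite lee_fin.
  by apply: (@nsum_term _ _ (fun i => nsum (fun j => (g i j)%:E))) => ?; apply: nsum_ge0 => j; rewrite lee_fin.
rewrite (@rsumE _ _ _ (fun i => fine (nsum (fun j => (Num.max (f i j) 0)%:E)))
  (fun i => fine (nsum (fun j => (Num.max (- f i j) 0)%:E)))).
- by rewrite !(aux (fun i j => Num.max (f i j) 0)) ?(aux (fun i j => Num.max (- f i j) 0)).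
- by move=> i; rewrite fine_ge0// nsum_ge0// => j; rewrite lee_fin.
- by move=> i; rewrite fine_ge0// nsum_ge0// => j; rewrite lee_fin.
- by rewrite (aux (fun i j => Num.max (f i j) 0)).
- by rewrite (aux (fun i j => Num.max (- f i j) 0)).
- by [].
Qed.

Section ComplexSums.
Context {R : realType}.
Local Notation C := R[i].
Local Notation Re := complex.Re.
Local Notation Im := complex.Im.

Lemma normc_ge0 (z : C) : 0 <= normc z.
Proof. by case: z => a b; exact: sqrtr_ge0. Qed.

Lemma normcE (z : C) : normc z = Num.sqrt (Re z ^+ 2 + Im z ^+ 2).
Proof. by case: z. Qed.

Lemma sqr_normc (z : C) : normc z ^+ 2 = Re z ^+ 2 + Im z ^+ 2.
Proof. by rewrite normcE sqr_sqrtr// addr_ge0// sqr_ge0. Qed.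

Lemma normcJ (z : C) : normc (conjc z) = normc z.
Proof. by case: z => a b /=; rewrite sqrrN. Qed.

Lemma normcR (x : R) : normc x%:C = `|x|.
Proof. by rewrite normcE /= expr0n addr0 sqrtr_sqr. Qed.

Lemma normc_Re (z : C) : `|Re z| <= normc z.
Proof. by rewrite normcE -sqrtr_sqr ler_wsqrtr// lerDl sqr_ge0. Qed.

Lemma normc_Im (z : C) : `|Im z| <= normc z.
Proof. by rewrite normcE -sqrtr_sqr ler_wsqrtr// lerDr sqr_ge0. Qed.

Lemma normc_le_ReIm (z : C) : normc z <= `|Re z| + `|Im z|.
Proof.
rewrite normcE -[leRHS]ger0_norm ?addr_ge0// -sqrtr_sqr ler_wsqrtr//.
rewrite sqrrD -(real_normK (num_real (Re z))) -(real_normK (num_real (Im z))) lerD2r lerDl.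
by rewrite mulrn_wge0// mulr_ge0.
Qed.

Lemma normc_eq0 (z : C) : (normc z == 0) = (z == 0).
Proof. by apply/eqP/eqP => [/eq0_normc//|->]; exact: normc0. Qed.

Lemma ReD (z w : C) : Re (z + w) = Re z + Re w. Proof. by case: z w => [? ?] []. Qed.
Lemma ImD (z w : C) : Im (z + w) = Im z + Im w. Proof. by case: z w => [? ?] []. Qed.
Lemma ReN (z : C) : Re (- z) = - Re z. Proof. by case: z. Qed.
Lemma ImN (z : C) : Im (- z) = - Im z. Proof. by case: z. Qed.
Lemma ReM (z w : C) : Re (z * w) = Re z * Re w - Im z * Im w.
Proof. by case: z w => [? ?] []. Qed.
Lemma ImM (z w : C) : Im (z * w) = Re z * Im w + Im z * Re w.
Proof. by case: z w => [? ?] []. Qed.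
Lemma complex_eq (z w : C) : Re z = Re w -> Im z = Im w -> z = w.
Proof. by case: z w => [? ?] [? ?] /= -> ->. Qed.

Definition csum {T : choiceType} (f : T -> C) : C :=
  rsum (fun i => Re (f i)) +i* rsum (fun i => Im (f i)).

Definition csummable {T : choiceType} (f : T -> C) : Prop :=
  (nsum (fun i => (normc (f i))%:E) < +oo)%E.

Lemma csummable_ReIm {T : choiceType} (f : T -> C) : csummable f ->
  rsummable (fun i => Re (f i)) /\ rsummable (fun i => Im (f i)).
Proof.
by move=> fs; split; apply: le_lt_trans fs; apply: le_nsum => i;
  rewrite lee_fin ?normc_Re ?normc_Im.
Qed.

Lemma csummable_le {T : choiceType} (f : T -> C) (g : T -> R) :
  (forall i, normc (f i) <= g i) -> (nsum (fun i => (g i)%:E) < +oo)%E -> csummable f.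
Proof. by move=> fg; apply: le_lt_trans; apply: le_nsum => i; rewrite lee_fin. Qed.

Lemma eq_csum {T : choiceType} (f g : T -> C) : f =1 g -> csum f = csum g.
Proof. by move=> /funext->. Qed.

Lemma csummableD {T : choiceType} (f g : T -> C) :
  csummable f -> csummable g -> csummable (fun i => f i + g i).
Proof.
move=> fs gs; apply: le_lt_trans (lte_add_pinfty fs gs).
rewrite -nsumD; try by move=> i; rewrite lee_fin normc_ge0.
by apply: le_nsum => i; rewrite -EFinD lee_fin le_normcD.
Qed.

Lemma csummableZ {T : choiceType} c (f : T -> C) : csummable f -> csummable (fun i => c * f i).
Proof.
move=> fs; rewrite /csummable; under eq_fun do rewrite normcM EFinM.
rewrite nsumZ ?normc_ge0//; last by move=> i; rewrite lee_fin normc_ge0.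
by rewrite lte_mul_pinfty// lee_fin normc_ge0.
Qed.

Lemma csumD {T : choiceType} (f g : T -> C) : csummable f -> csummable g ->
  csum (fun i => f i + g i) = csum f + csum g.
Proof.
move=> /csummable_ReIm[f1 f2] /csummable_ReIm[g1 g2]; apply: complex_eq => /=.
  by under eq_fun do rewrite ReD; rewrite rsumD.
by under eq_fun do rewrite ImD; rewrite rsumD.
Qed.

Lemma csumZ {T : choiceType} c (f : T -> C) : csummable f ->
  csum (fun i => c * f i) = c * csum f.
Proof.
move=> /csummable_ReIm[f1 f2]; apply: complex_eq; rewrite ?ReM ?ImM /=.
  under eq_fun do rewrite ReM -mulNr.
  rewrite rsumD ?rsumZ//; [lra|exact: rsummableZ|exact: rsummableZ].
under eq_fun do rewrite ImM.
by rewrite rsumD ?rsumZ//; exact: rsummableZ.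
Qed.

Lemma csumN {T : choiceType} (f : T -> C) : csum (fun i => - f i) = - csum f.
Proof.
apply: complex_eq; rewrite ?ReN ?ImN /= -rsumN; congr rsum; apply/funext => i.
  exact: ReN.
exact: ImN.
Qed.

Lemma csummableN {T : choiceType} (f : T -> C) : csummable f -> csummable (fun i => - f i).
Proof. by rewrite /csummable; under [X in _ -> (nsum X < _)%E]eq_fun do rewrite normcN. Qed.

Lemma csumB {T : choiceType} (f g : T -> C) : csummable f -> csummable g ->
  csum (fun i => f i - g i) = csum f - csum g.
Proof. by move=> fs gs; rewrite csumD// ?csumN//; exact: csummableN. Qed.

Lemma csumJ {T : choiceType} (f : T -> C) : csum (fun i => conjc (f i)) = conjc (csum f).
Proof.
apply: complex_eq; rewrite /= -?rsumN; congr rsum; apply/funext => i; by case: (f i).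
Qed.

Lemma csum_reindex {T U : choiceType} (e : T -> U) (f : U -> C) :
  bijective e -> csum (fun i => f (e i)) = csum f.
Proof.
by move=> be; rewrite /csum (rsum_reindex (fun i => Re (f i)) be) (rsum_reindex (fun i => Im (f i)) be).
Qed.

Lemma csum_pair {T U : choiceType} (f : T -> U -> C) :
  csummable (fun k : T * U => f k.1 k.2) ->
  csum (fun i => csum (f i)) = csum (fun k : T * U => f k.1 k.2).
Proof.
move=> /csummable_ReIm[f1 f2]; apply: complex_eq => /=.
  exact: (@rsum_pair _ _ _ (fun i j => Re (f i j))).
exact: (@rsum_pair _ _ _ (fun i j => Im (f i j))).
Qed.

Lemma csum_swap {T U : choiceType} (f : T -> U -> C) :
  csummable (fun k : T * U => f k.1 k.2) ->
  csum (fun i => csum (f i)) = csum (fun j => csum (fun i => f i j)).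
Proof.
move=> fs.
have b : bijective (fun k : U * T => (k.2, k.1)) by exists (fun k => (k.2, k.1)) => -[].
rewrite csum_pair// (@csum_pair _ _ (fun j i => f i j)).
  by rewrite -(csum_reindex _ b).
by move: fs; rewrite /csummable -(nsum_reindex _ b).
Qed.

Lemma normc_csum {T : choiceType} (f : T -> C) :
  ((normc (csum f))%:E <= nsum (fun i => (normc (f i))%:E))%E.
Proof.
have [fs|] := boolP (nsum (fun i => (normc (f i))%:E) < +oo)%E; last first.
  by rewrite -leNgt leye_eq => /eqP ->; rewrite leey.
set z := csum f.
have [->|z0] := eqVneq z 0.
  by rewrite [normc _]normc0 nsum_ge0// => i; rewrite lee_fin normc_ge0.
have nz0 : normc z != 0 by rewrite normc_eq0.
pose th : C := conjc z * ((normc z)^-1)%:C.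
have nth : normc th = 1.
  by rewrite normcM normcJ normcR ger0_norm ?invr_ge0 ?normc_ge0// mulfV.
have -> : normc z = Re (csum (fun i => th * f i)).
  rewrite csumZ// -/z /th mulrAC.
  have -> : conjc z * z = ((normc z) ^+ 2)%:C.
    by rewrite sqr_normc; apply: complex_eq; rewrite ?ReM ?ImM; case: (z) => a b /=; ring.
  by rewrite /= mulr0 subr0 expr2 mulfK.
have [gs _] := csummable_ReIm (csummableZ th fs).
have [g1 g2] := rsummable_parts gs.
rewrite /=; apply: (@le_trans _ _ (fine (nsum (fun i => (Num.max (Re (th * f i)) 0)%:E)))%:E).
  rewrite lee_fin /rsum gerBl fine_ge0// nsum_ge0// => i.
  by rewrite lee_fin le_max lexx orbT.
rewrite fineK; last first.
  by rewrite ge0_fin_numE// nsum_ge0// => i; rewrite lee_fin le_max lexx orbT.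
apply: le_nsum => i; rewrite lee_fin ge_max normc_ge0 andbT.
by apply: le_trans (ler_norm _) _; apply: le_trans (normc_Re _) _; rewrite normcM nth mul1r.
Qed.

Lemma normc_csum_le {T : choiceType} (f : T -> C) (g : T -> R) (K : R) :
  (forall i, normc (f i) <= g i) -> (nsum (fun i => (g i)%:E) <= K%:E)%E ->
  normc (csum f) <= K.
Proof.
move=> fg gK; rewrite -lee_fin; apply: le_trans (normc_csum f) _; apply: le_trans gK.
by apply: le_nsum => i; rewrite lee_fin.
Qed.

Lemma csum_delta {T : choiceType} (a : T) (f : T -> C) :
  csum (fun i => if i == a then f i else 0) = f a.
Proof.
have aux (g : T -> R) : rsum (fun i => if i == a then g i else 0) = g a.
  rewrite /rsum.
  have E (h : T -> R) : fine (nsum (fun i => (Num.max (if i == a then h i else 0) 0)%:E)) = Num.max (h a) 0.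
    rewrite (@eq_nsum _ _ _ (fun i => if i == a then (Num.max (h i) 0)%:E else 0%E)).
      by rewrite (@nsum_delta _ _ a (fun i => (Num.max (h i) 0)%:E))// lee_fin le_max lexx orbT.
    by move=> i; case: ifP; rewrite // maxxx.
  under [X in _ - fine (nsum X)]eq_fun do rewrite (fun_if -%R) oppr0.
  rewrite !E; by case: (lerP 0 (g a)) => H1; case: (lerP 0 (- g a)) => H2; lra.
rewrite /csum; apply: complex_eq => /=.
  rewrite -[RHS](aux (fun i => Re (f i))); congr rsum; apply/funext => i; by case: ifP.
rewrite -[RHS](aux (fun i => Im (f i))); congr rsum; apply/funext => i; by case: ifP.
Qed.

Lemma csum0 {T : choiceType} : csum (fun _ : T => 0) = 0.
Proof.
apply: eq0_normc; apply/eqP; rewrite eq_le normc_ge0 andbT.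
apply: (@normc_csum_le _ _ (fun=> 0)) => [i|]; first by rewrite [normc _]normc0.
by rewrite nsum0.
Qed.

Lemma csummable_fin {T : choiceType} (s : seq T) (f : T -> C) :
  csummable (fun i => if i \in s then f i else 0).
Proof.
elim: s => [|a s IH].
  by rewrite /csummable [X in nsum X](_ : _ = fun=> 0%E) ?nsum0//; apply/funext => i; rewrite in_nil normc0.
apply: (@csummable_le _ _ (fun i => (if i == a then normc (f i) else 0) +
   normc (if i \in s then f i else 0))) => [i|].
  rewrite inE; case: eqP => /= [_|_]; rewrite ?add0r// lerDl normc_ge0//.
under eq_fun do rewrite EFinD.
rewrite nsumD; try by move=> i; rewrite lee_fin ?normc_ge0//; case: ifP => // _; rewrite normc_ge0.
apply: lte_add_pinfty => //.
rewrite (@eq_nsum _ _ _ (fun i => if i == a then (normc (f i))%:E else 0%E)).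
  by rewrite (@nsum_delta _ _ a (fun i => (normc (f i))%:E)) ?ltry// lee_fin normc_ge0.
by move=> i; case: ifP.
Qed.

Lemma csum_fin {T : choiceType} (s : seq T) (f : T -> C) : uniq s ->
  csum (fun i => if i \in s then f i else 0) = \sum_(i <- s) f i.
Proof.
elim: s => [_|a s IH /= /andP[as_ us]]; first by rewrite big_nil csum0.
rewrite big_cons -IH// -[f a](csum_delta a f) -csumD.
- apply: eq_csum => i; rewrite inE; case: eqP => [->|] /=; last by rewrite add0r.
  by rewrite (negbTE as_) addr0.
- have := csummable_fin [:: a] f; congr csummable; apply/funext => i; by rewrite inE.
- exact: csummable_fin.
Qed.

Lemma csum_split {T : choiceType} (s : seq T) (f : T -> C) : csummable f -> uniq s ->
  csum f = \sum_(i <- s) f i + csum (fun i => if i \in s then 0 else f i).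
Proof.
move=> fs us; rewrite -csum_fin// -csumD.
- by apply: eq_csum => i; case: ifP; rewrite ?addr0 ?add0r.
- exact: csummable_fin.
- apply: csummable_le fs => i; case: ifP => // _; by rewrite [normc _]normc0 normc_ge0.
Qed.

(** One finite set of indices serves all families dominated by f; this
   uniformity lets sums be exchanged with integrals, derivatives and limits. *)
Lemma csum_approx {T : choiceType} (f : T -> C) (eps : R) : csummable f -> 0 < eps ->
  exists2 s, uniq s & forall g : T -> C, (forall i, normc (g i) <= normc (f i)) ->
    normc (csum g - \sum_(i <- s) g i) < eps.
Proof.
move=> fs e0.
have [s us h] := nsum_tail (fun i => (normc_ge0 (f i) : (0 <= (normc (f i))%:E)%E)) fs e0.
exists s => // g gf.
have gs : csummable g by exact: csummable_le fs.
rewrite (csum_split gs us) addrC addKr -lte_fin.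
apply: le_lt_trans (normc_csum _) _; apply: le_lt_trans h; apply: le_nsum => i.
by case: ifP => _; rewrite lee_fin ?[normc _]normc0.
Qed.

End ComplexSums.

(** * The weights <n> *)

Section Japanese.
Context {R : realType}.
Local Notation J n := (japanese n : R).

Lemma japaneseE (n : int) : J n ^+ 2 = 1 + n%:~R ^+ 2.
Proof. by rewrite sqr_sqrtr// addr_ge0// sqr_ge0. Qed.

Lemma japanese_ge1 (n : int) : 1 <= J n.
Proof. by rewrite -[leLHS]sqrtr1 ler_wsqrtr// lerDl sqr_ge0. Qed.

Lemma japanese_gt0 (n : int) : 0 < J n.
Proof. exact: lt_le_trans ltr01 (japanese_ge1 n). Qed.

Lemma japanese_ge0 (n : int) : 0 <= J n. Proof. exact: ltW (japanese_gt0 n). Qed.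

Lemma japaneseN (n : int) : J (- n) = J n.
Proof. by rewrite /japanese mulrNz sqrrN. Qed.

Lemma le_norm_japanese (n : int) : `|n%:~R| <= J n.
Proof. by rewrite -sqrtr_sqr ler_wsqrtr// lerDr. Qed.

Lemma japaneseD (m n : int) : J (m + n) <= J m + J n.
Proof.
rewrite -(@ler_pXn2r _ 2)// ?nnegrE ?addr_ge0 ?japanese_ge0//.
rewrite sqrrD !japaneseE rmorphD/= sqrrD.
have h1 := le_norm_japanese m; have h2 := le_norm_japanese n.
have := ler_pM (normr_ge0 _) (normr_ge0 _) h1 h2; rewrite -normrM => h.
have := ler_norm (m%:~R * n%:~R : R); lra.
Qed.

Lemma japaneseM (m n : int) : J (m + n) <= 2 * (J m * J n).
Proof.
apply: le_trans (japaneseD m n) _.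
have := japanese_ge1 m; have := japanese_ge1 n; nra.
Qed.

Lemma japanese_double (n : int) : J n <= J (2 * n).
Proof.
rewrite ler_wsqrtr// lerD2l rmorphM/= exprMn.
by rewrite ler_peMl ?sqr_ge0//; lra.
Qed.

Lemma powR_japanese_ge1 (n : int) a : 0 <= a -> 1 <= J n `^ a.
Proof. by move=> a0; rewrite -(powRr0 (J n)) ler_powR// japanese_ge1. Qed.

Lemma powR_japanese_gt0 (n : int) a : 0 < J n `^ a.
Proof. by rewrite powR_gt0// japanese_gt0. Qed.

Lemma powR_japaneseN_le1 (n : int) a : 0 <= a -> J n `^ (- a) <= 1.
Proof. by move=> a0; rewrite -(powRr0 (J n)) ler_powR ?japanese_ge1// oppr_le0. Qed.

Lemma powRN_le (a c x y : R) : 0 <= a -> 0 < c -> 0 < x -> 0 < y -> y <= c * x ->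
  x `^ (- a) <= c `^ a * y `^ (- a).
Proof.
move=> a0 c0 x0 y0 yx; rewrite !powRN ler_pdivlMr ?powR_gt0// mulrC.
rewrite ler_pdivrMr ?powR_gt0// -powRM ?(ltW c0) ?(ltW x0)//.
by apply: ge0_ler_powR; rewrite ?nnegrE ?(ltW y0) ?(ltW (mulr_gt0 c0 x0)).
Qed.

(** By telescoping, since a (k+1)^(-1-a) <= k^-a - (k+1)^-a. *)
Lemma sum_powR_bound (a : R) (n : nat) : 0 < a ->
  \sum_(i < n) (i.+1%:R : R) `^ (- (1 + a)) <= 1 + a^-1.
Proof.
move=> a0.
case: n => [|n]; first by rewrite big_ord0 addr_ge0// invr_ge0 ltW.
suff : \sum_(i < n.+1) (i.+1%:R : R) `^ (- (1 + a)) + a^-1 * n.+1%:R `^ (- a) <= 1 + a^-1.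
  by apply: le_trans; rewrite lerDl mulr_ge0 ?powR_ge0// invr_ge0 ltW.
elim: n => [|n IH]; first by rewrite big_ord1 powR1 mulr1.
apply: le_trans IH; rewrite big_ord_recr/= -addrA lerD2l.
have nR : 0 < n.+1%:R :> R by rewrite ltr0n.
have mR : 0 < n.+2%:R :> R by rewrite ltr0n.
set x : R := n.+2%:R in mR *; set y : R := n.+1%:R in nR *.
have xy : x = y + 1 by rewrite /x /y -natr1.
rewrite -(ler_pM2l a0) mulrDr !mulrA divff ?gt_eqF// !mul1r.
have -> : - (1 + a) = -1 + - a by rewrite opprD.
rewrite powRD; last by rewrite (gt_eqF mR) implybT.
rewrite powR_inv1 ?(ltW mR)//.
have -> : a * (x^-1 * x `^ (- a)) + x `^ (- a) = x `^ (- a) * (1 + a * x^-1) by ring.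
have -> : y `^ (- a) = x `^ (- a) * (y / x) `^ (- a).
  by rewrite -powRM ?(ltW mR) ?divr_ge0 ?(ltW mR) ?(ltW nR)// mulrC divfK// gt_eqF.
rewrite ler_wpM2l ?powR_ge0//.
rewrite /powR gt_eqF ?divr_gt0//.
apply: le_trans (expR_ge1Dx _); rewrite lerD2l mulNr -mulrN ler_wpM2l// ?(ltW a0)//.
have -> : y / x = 1 + (- x^-1) by apply: (@mulIf _ x); rewrite ?gt_eqF// mulrDl mulNr mulVf ?divfK ?gt_eqF// mul1r xy addrK.
rewrite lerNr; apply: le_ln1Dx.
by rewrite ltrN2 invf_lt1// /x ltr1n.
Qed.

Lemma nsum_nat_le (f : nat -> R) (K : R) : (forall i, 0 <= f i) ->
  (forall n, \sum_(i < n) f i <= K) -> (nsum (fun i => (f i)%:E) <= K%:E)%E.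
Proof.
move=> f0 fK; apply: nsum_le_seq => s us.
have [N hN] : exists N, forall i, i \in s -> (i < N)%N.
  exists (\max_(i <- s) i).+1 => i si; rewrite ltnS.
  exact: (@leq_bigmax_seq _ _ xpredT id).
apply: (@le_trans _ _ (\sum_(i < N) f i)%:E); last by rewrite lee_fin.
rewrite sumEFin lee_fin.
have -> : \sum_(i <- s) f i = \sum_(i <- [seq j <- iota 0 N | j \in s]) f i.
  apply: perm_big; apply: uniq_perm => //; first by rewrite filter_uniq// iota_uniq.
  move=> i; rewrite mem_filter mem_iota add0n leq0n/=.
  by apply/idP/andP => [si|[]//]; rewrite si hN.
rewrite big_filter big_mkcond -[in X in _ <= X](big_mkord xpredT f) /index_iota subn0.
by apply: ler_sum => i _; case: ifP.
Qed.

Lemma nsum_int_le (f : nat -> R) (K : R) : (forall i, 0 <= f i) ->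
  (forall n, \sum_(i < n) f i <= K) ->
  (nsum (fun n : int => (f `|n|%N)%:E) <= (2 * K)%:E)%E.
Proof.
move=> f0 fK.
have f0e k : (0 <= (f k)%:E)%E by rewrite lee_fin.
apply: (@le_trans _ _ (nsum (fun n : int => nsum (fun k : nat =>
    if k == `|n|%N then (f k)%:E else 0%E)))).
  by apply: le_nsum => n; rewrite (nsum_delta (f := fun k => (f k)%:E)).
rewrite nsum_swap; last by move=> n k; case: ifP.
apply: (@le_trans _ _ (nsum (fun k => 2%:E * (f k)%:E)%E)); last first.
  by rewrite nsumZ// EFinM lee_wpmul2l// nsum_nat_le.
apply: le_nsum => k.
apply: (@le_trans _ _ (nsum (fun n : int => (if n == k%:Z then (f k)%:E else 0%E) +
    (if n == (- k%:Z)%R then (f k)%:E else 0%E))%E)).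
  apply: le_nsum => n; case: eqP => [e|_]; last by apply: adde_ge0; case: ifP.
  case: eqP => [_|n1]; first by rewrite leeDl//; case: ifP.
  case: eqP => [_|n2]; first by rewrite add0e.
  by exfalso; lia.
rewrite nsumD; try by move=> i; case: ifP.
rewrite (nsum_delta (f := fun=> (f k)%:E))// (nsum_delta (f := fun=> (f k)%:E))//.
by rewrite -EFinD lee_fin; lra.
Qed.

Definition jsum (a : R) : R := fine (nsum (fun n : int => (J n `^ (- a))%:E)).

Lemma nsum_japanese_lty (a : R) : 1 < a ->
  (nsum (fun n : int => (J n `^ (- a))%:E) < +oo)%E.
Proof.
move=> a1; have d0 : 0 < a - 1 by rewrite subr_gt0.
have aE : a = 1 + (a - 1) by ring.
apply: (@le_lt_trans _ _ (nsum (fun n : int => (2 `^ a)%:E * ((`|n|%N.+1%:R : R) `^ (- a))%:E)%E)).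
  apply: le_nsum => n; rewrite -EFinM lee_fin.
  apply: powRN_le; rewrite ?japanese_gt0 ?ltr0n//; first lra.
  rewrite -natr1 natr_absz intr_norm.
  have := le_norm_japanese n; have := japanese_ge1 n; lra.
rewrite nsumZ ?powR_ge0//.
rewrite lte_mul_pinfty ?lee_fin ?powR_ge0//.
apply: (@le_lt_trans _ _ (2 * (1 + (a - 1)^-1))%:E); last exact: ltry.
apply: (@nsum_int_le (fun k => (k.+1%:R : R) `^ (- a))) => [i|n]; first exact: powR_ge0.
by rewrite {1}aE; exact: sum_powR_bound.
Qed.

Lemma nsum_japanese (a : R) : 1 < a ->
  nsum (fun n : int => (J n `^ (- a))%:E) = (jsum a)%:E.
Proof. by move=> a1; apply: nsum_fin (nsum_japanese_lty a1) => i; exact: powR_ge0. Qed.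

Lemma jsum_ge0 (a : R) : 0 <= jsum a.
Proof. by rewrite fine_ge0// nsum_ge0// => i; rewrite lee_fin powR_ge0. Qed.

Lemma bijective_addl (a : int) : bijective (fun x : int => a + x).
Proof. by exists (fun x => - a + x) => x; ring. Qed.

Lemma bijective_subl (a : int) : bijective (fun x : int => a - x).
Proof. by exists (fun x => a - x) => x; ring. Qed.

Lemma bijective_subr (a : int) : bijective (fun x : int => x - a).
Proof. by exists (fun x => x + a) => x; ring. Qed.

Lemma bijective_oppz : bijective (fun x : int => - x).
Proof. by exists (fun x => - x) => x; ring. Qed.

Lemma japanese_conv_pt (a : R) (x y : int) : 0 <= a ->
  J x `^ (- a) * J y `^ (- a) <=
    2 `^ a * J (x + y) `^ (- a) * (J x `^ (- a) + J y `^ (- a)).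
Proof.
move=> a0.
wlog xy : x y / J x <= J y => [H|].
  have [/H//|/ltW/H] := leP (J x) (J y).
  by rewrite mulrC addrC [J y `^ _ + _]addrC.
have h : J y `^ (- a) <= 2 `^ a * J (x + y) `^ (- a).
  apply: powRN_le; rewrite ?japanese_gt0//.
  have := japaneseD x y; lra.
apply: le_trans (ler_wpM2l (powR_ge0 _ _) h) _.
rewrite mulrC ler_wpM2l ?mulr_ge0 ?powR_ge0// lerDl powR_ge0//.
Qed.

(** One of y and x - y is at least of size x / 2, so one factor is already
   of the size of the right-hand side and the other one is summable. *)
Lemma japanese_conv (a : R) (x : int) : 1 < a ->
  (nsum (fun y : int => (J y `^ (- a) * J (x - y) `^ (- a))%:E) <=
    (2 `^ a * (2 * jsum a) * J x `^ (- a))%:E)%E.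
Proof.
move=> a1; have a0 : 0 <= a by lra.
have k0 (n : int) : (0 <= (J n `^ (- a))%:E)%E by rewrite lee_fin powR_ge0.
apply: (@le_trans _ _ (nsum (fun y : int => (2 `^ a * J x `^ (- a))%:E *
    ((J y `^ (- a))%:E + (J (x - y) `^ (- a))%:E))%E)).
  apply: le_nsum => y; rewrite -EFinD -EFinM lee_fin.
  by have := @japanese_conv_pt a y (x - y) a0; rewrite (_ : y + (x - y) = x)//; ring.
rewrite nsumZ ?mulr_ge0 ?powR_ge0//; last by move=> i; apply: adde_ge0.
rewrite nsumD// (nsum_reindex (fun y => (J y `^ (- a))%:E) (bijective_subl x)).
rewrite nsum_japanese// -EFinD -EFinM lee_fin.
by rewrite le_eqVlt; apply/orP; left; apply/eqP; ring.
Qed.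

End Japanese.

(** * The divisor bound *)

Section DivisorBound.
Local Open Scope nat_scope.

Lemma size_divisors n : 0 < n ->
  size (divisors n) = \prod_(f <- prime_decomp n) f.2.+1.
Proof.
move=> _; rewrite /divisors; elim: (prime_decomp n) => [|[p e] l IH].
  by rewrite big_nil.
rewrite big_cons /= -IH; set d := foldr _ _ _.
elim: e => [|e IHe] /=; first by rewrite mul1n.
by rewrite size_merge size_cat size_map IHe mulSn [in RHS]mulSn addnC.
Qed.

Context {R : realType}.
Local Open Scope ring_scope.

(** A prime power p^e with p >= 2^(1/a) satisfies e + 1 <= p^(a e), and a
   smaller prime costs at most the constant factor K. *)
Lemma prod_succ_exponents (a : R) : 0 < a ->
  exists2 K : R, 1 <= K & exists B : nat, forall l : seq (nat * nat),
    (forall f, f \in l -> (2 <= f.1)%N) ->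
    (\prod_(f <- l) f.2.+1)%N%:R <=
      K ^+ (count (fun f => (f.1 < B)%N) l) * ((\prod_(f <- l) f.1 ^ f.2)%N%:R : R) `^ a.
Proof.
move=> a0.
have ln2 : 0 < ln 2 :> R by rewrite ln_gt0// ltr1n.
pose K : R := Num.max 1 (a * ln 2)^-1.
have K1 : 1 <= K by rewrite le_max lexx.
have Kp (e : nat) (p : nat) : (2 <= p)%N -> e.+1%:R <= K * ((p ^ e)%N%:R : R) `^ a.
  move=> p2.
  apply: (@le_trans _ _ (K * (2 ^+ e : R) `^ a)); last first.
    rewrite ler_wpM2l ?(le_trans ler01 K1)//; apply: ge0_ler_powR; rewrite ?nnegrE ?ler0n ?exprn_ge0 ?(ltW a0)//.
    by rewrite natrX lerXn2r ?nnegrE ?ler0n// ler_nat.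
  rewrite -powR_mulrn// -powRrM /powR gt_eqF// mulrAC.
  apply: (@le_trans _ _ (K * (1 + e%:R * ln 2 * a))); last first.
    by rewrite ler_wpM2l ?(le_trans ler01 K1)// expR_ge1Dx.
  rewrite mulrDr mulr1 -natr1 addrC lerD//.
  have : 1 <= K * (a * ln 2).
    rewrite -ler_pdivrMr ?mulr_gt0// mul1r le_max lexx orbT//.
  move=> h; rewrite (_ : K * _ = e%:R * (K * (a * ln 2))); last ring.
  by rewrite ler_peMr.
have Kb (e p : nat) : (Num.bound (2 `^ a^-1 : R) <= p)%N -> e.+1%:R <= ((p ^ e)%N%:R : R) `^ a.
  move=> pB.
  have p2 : 2 <= (p%:R : R) `^ a.
    have -> : 2 = (2 `^ a^-1) `^ a :> R by rewrite -powRrM mulVf ?powRr1// gt_eqF.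
    apply: ge0_ler_powR; rewrite ?nnegrE ?powR_ge0 ?ler0n ?(ltW a0)//.
    apply: le_trans (ltW (archi_boundP (powR_ge0 _ _))) _.
    by rewrite ler_nat.
  apply: (@le_trans _ _ (2 ^+ e)); first by rewrite -natrX ler_nat ltn_expl.
  rewrite natrX -powR_mulrn// -powRrM mulrC powRrM powR_mulrn ?powR_ge0//.
  by rewrite lerXn2r ?nnegrE ?powR_ge0.
exists K => //; exists (Num.bound (2 `^ a^-1 : R)) => l.
elim: l => [_|[p e] l IH hl].
  by rewrite !big_nil /= powR1 mulr1.
have {}IH := IH (fun f fl => hl f (mem_behead (s := (p, e) :: l) fl)).
rewrite !big_cons !natrM powRM ?ler0n//=.
set P := (\prod_(f <- l) f.1 ^ f.2)%N in IH *.
set D := (\prod_(f <- l) f.2.+1)%N in IH *.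
rewrite exprD mulrACA ler_pM ?ler0n//.
have /= := hl (p, e) (mem_head _ _).
move=> p2; case: (ltnP p) => pB; first by rewrite expr1; exact: Kp.
by rewrite expr0 mul1r; exact: Kb.
Qed.

(** The number of divisors is the product of the e + 1 over the exponents e of
   the prime factorization; only boundedly many primes cost a constant. *)
Lemma divisor_bound (a : R) : 0 < a -> exists2 C : R, 0 <= C &
  forall n, (0 < n)%N -> (size (divisors n))%:R <= C * (n%:R : R) `^ a.
Proof.
move=> a0; have [K K1 [B h]] := prod_succ_exponents a0.
exists (K ^+ B) => [|n n0]; first by rewrite exprn_ge0// (le_trans ler01).
rewrite size_divisors//.
have h2 f : f \in prime_decomp n -> (2 <= f.1)%N.
  by case: f => p e /mem_prime_decomp[/prime_gt1].
apply: le_trans (h _ h2) _; rewrite -prod_prime_decomp//.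
rewrite ler_wpM2r ?powR_ge0// ler_weXn2l//.
have -> : count (fun f => (f.1 < B)%N) (prime_decomp n) = count (fun p => (p < B)%N) (primes n).
  by rewrite /primes /unzip1 count_map.
rewrite -size_filter -[leqRHS](size_iota 0 B).
apply: uniq_leq_size; first by rewrite filter_uniq// primes_uniq.
by move=> p; rewrite mem_filter mem_iota => /andP[-> _].
Qed.

End DivisorBound.

(** * The kernel of the trilinear operator *)

Section Kernel.
Context {R : realType}.
Local Notation J n := (japanese n : R).

(** A factor of mu determines the other one and is, up to
   sign, a divisor of the absolute value of mu. *)
Lemma card_factorizations (a : R) : 0 < a -> exists2 C : R, 0 <= C &
  forall mu : int, mu != 0 ->
  (nsum (fun m1 : int => nsum (fun m2 : int =>
     if (m1 * m2)%R == mu then 1%:E else 0%E)) <= (C * J mu `^ a)%:E)%E.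
Proof.
move=> a0; have [C C0 hC] := divisor_bound a0.
exists (2 * C) => [|mu mu0]; first by rewrite mulr_ge0.
have amu : (0 < `|mu|)%N by rewrite absz_gt0.
apply: (@le_trans _ _ (nsum (fun m1 : int => \sum_(d <- divisors `|mu|%N)
   ((if m1 == d%:Z then 1%:E else 0%E) + (if m1 == (- d%:Z)%R then 1%:E else 0%E))))%E).
  apply: le_nsum => m1.
  have g0 (d : nat) : (0 <= ((if m1 == d%:Z then 1%:E else 0%E) + (if m1 == (- d%:Z)%R then 1%:E else 0%E)) :> \bar R)%E.
    by apply: adde_ge0; case: ifP.
  have [/dvdnP[q qE]|nd] := boolP (`|m1| %| `|mu|)%N; last first.
    rewrite [leLHS](_ : _ = 0%E); first by apply: sume_ge0 => d _; exact: g0.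
    rewrite -[RHS](@nsum0 _ int); apply: eq_nsum => m2; case: eqP => // e.
    by exfalso; move/negP: nd; apply; rewrite -e abszM dvdn_mulr.
  have m10 : m1 != 0 by apply: contraNneq mu0 => m10; rewrite m10 /= muln0 in qE; rewrite -absz_eq0 qE.
  apply: (@le_trans _ _ 1%:E).
    pose m := (mu %/ m1)%Z.
    apply: (@le_trans _ _ (nsum (fun m2 => if m2 == m then 1%:E else 0%E))).
      apply: le_nsum => m2; case: eqP => [e|_]; last by case: ifP.
      by rewrite /m -e mulKz// eqxx.
    by rewrite (nsum_delta (f := fun=> 1%:E)).
  have din : `|m1|%N \in divisors `|mu|%N by rewrite -dvdn_divisors// qE dvdn_mull.
  rewrite (bigD1_seq `|m1|%N)//= ?divisors_uniq//.
  apply: (@le_trans _ _ ((if m1 == `|m1|%N then 1%:E else 0%E) + (if m1 == (- `|m1|%N%:Z)%R then 1%:E else 0%E))%E).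
    case: eqP => [_|n1]; first by rewrite leeDl//; case: ifP.
    case: eqP => [_|n2]; first by rewrite add0e.
    by exfalso; lia.
  by rewrite leeDl// sume_ge0.
rewrite /nsum esum_sum; last by move=> i j _ _; apply: adde_ge0; case: ifP.
apply: (@le_trans _ _ (\sum_(d <- divisors `|mu|%N) (2 : R))%:E).
  rewrite -sumEFin; apply: lee_sum => d _; rewrite -/(nsum _) nsumD; try by move=> i; case: ifP.
  by rewrite (nsum_delta (f := fun=> 1%:E))// (nsum_delta (f := fun=> 1%:E))// -EFinD lee_fin; lra.
rewrite lee_fin (_ : \sum_(d <- _) _ = 2 * (size (divisors `|mu|))%:R); last first.
  by rewrite big_const_seq count_predT iter_addr addr0 mulr_natr.
rewrite -mulrA ler_pM2l//.
apply: le_trans (hC _ amu) _; rewrite ler_wpM2l//.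
apply: ge0_ler_powR; rewrite ?nnegrE ?ler0n ?japanese_ge0 ?(ltW a0)//.
by rewrite natr_absz intr_norm le_norm_japanese.
Qed.

(** The phase n^2 - j^2 + k^2 - l^2 of the interaction j - k + l = n. *)
Definition phase (n j k : int) : int := 2 * ((n - j) * (j - k)).

(** The interactions with j = n or l = n cancel against the mean, except that
   j = k = l = n has been subtracted twice. *)
Definition resc (n j k : int) : R := 1 - (n == j)%:R - (j == k)%:R.

Lemma resc_le1 n j k : `|resc n j k| <= 1.
Proof.
rewrite /resc; case: (n == j); case: (j == k); rewrite ?subr0 ?subrr ?sub0r ?normr0 ?normrN ?normr1//=.
Qed.

(** For fixed frequency mu the nonresonant interactions with phase 2 mu are
   the factorizations of mu, so the sum over j, k is essentially one-dimensional. *)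
Lemma phase_sum (a e : R) : 1 < a -> 0 < e -> exists2 C : R, 0 <= C &
  forall n nu : int,
  (nsum (fun j : int => nsum (fun k : int =>
     (`|resc n j k| * J (nu - phase n j k) `^ (- a))%:E)) <= (C * J nu `^ e)%:E)%E.
Proof.
move=> a1 e0.
pose e' := Num.min e ((a - 1) / 2).
have e'0 : 0 < e' by rewrite lt_min e0 divr_gt0// subr_gt0.
have e'e : e' <= e by rewrite ge_min lexx.
have ae' : 1 < a - e'.
  have : e' <= (a - 1) / 2 by rewrite ge_min lexx orbT.
  lra.
have [C C0 hC] := card_factorizations e'0.
exists (1 + C * 2 `^ e' * jsum (a - e')) => [|n nu].
  by rewrite addr_ge0// !mulr_ge0 ?powR_ge0 ?jsum_ge0.
pose g (m : int) : R := J (nu - 2 * m) `^ (- a).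
have g0 m : (0 <= (g m)%:E)%E by rewrite lee_fin powR_ge0.
have g1 m : g m <= 1 by apply: powR_japaneseN_le1; lra.
apply: (@le_trans _ _ (nsum (fun j : int => nsum (fun k : int =>
   ((if j == n then (if k == n then 1%:E else 0%E) else 0%E) +
    (if ((n - j) * (j - k))%R == 0%R then 0%E else (g ((n - j) * (j - k)))%:E))%E)))).
  apply: le_nsum => j; apply: le_nsum => k; rewrite /resc.
  rewrite mulf_eq0 !subr_eq0 [j == n]eq_sym [k == n]eq_sym.
  case: (eqVneq n j) => [<-|nj]; case: (eqVneq n k) => [<-|nk] /=;
    rewrite ?subrr ?sub0r ?subr0 ?normrN ?normr0 ?normr1 ?mul0r ?mul1r ?adde0 ?add0e ?eqxx//.
  - by rewrite lee_fin; apply: powR_japaneseN_le1; lra.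
  - by rewrite eq_sym (negbTE nj) subr0 normr1 mul1r.
  - case: (eqVneq j k) => [_|_] //=; first by rewrite subrr normr0 mul0r.
    by rewrite subr0 normr1 mul1r.
have if0 (b : bool) (x : \bar R) : (0 <= x)%E -> (0 <= if b then x else 0%E)%E by case: b.
have if1 (b : bool) (x : \bar R) : (0 <= x)%E -> (0 <= if b then 0%E else x)%E by case: b.
rewrite (@eq_nsum _ _ _ (fun j => (if j == n then 1%:E else 0%E) + nsum (fun k : int =>
    if ((n - j) * (j - k))%R == 0%R then 0%E else (g ((n - j) * (j - k)))%:E))%E); last first.
  move=> j; rewrite nsumD; last 2 first.
  - by move=> k; apply/if0/if0; rewrite lee_fin.
  - by move=> k; apply: if1.
  congr (_ + _)%E; case: eqP => _; last exact: nsum0.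
  by rewrite (nsum_delta (f := fun=> 1%:E)).
rewrite nsumD; last 2 first.
- by move=> k; apply: if0; rewrite lee_fin.
- by move=> k; apply: nsum_ge0 => ?; apply: if1.
rewrite (nsum_delta (f := fun=> 1%:E))// mulrDl mul1r EFinD leeD//.
  by rewrite lee_fin powR_japanese_ge1// ltW.
rewrite -(nsum_reindex _ (bijective_subl n))/=.
rewrite (@eq_nsum _ _ _ (fun m1 : int => nsum (fun m2 : int => nsum (fun mu : int =>
    if mu == (m1 * m2)%R then (if mu == 0 then 0%E else (g mu)%:E) else 0%E)))); last first.
  move=> m1; rewrite -(nsum_reindex _ (bijective_subl (n - m1)))/=.
  apply: eq_nsum => m2.
  rewrite (nsum_delta (f := fun mu => if mu == 0 then 0%E else (g mu)%:E)); last exact: if1.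
  by rewrite (_ : (n - (n - m1)) * (n - m1 - (n - m1 - m2)) = m1 * m2)//; ring.
rewrite (@eq_nsum _ _ _ (fun m1 : int => nsum (fun mu : int => nsum (fun m2 : int =>
    if mu == (m1 * m2)%R then (if mu == 0 then 0%E else (g mu)%:E) else 0%E)))); last first.
  by move=> m1; apply: nsum_swap => m2 mu; apply/if0/if1.
rewrite nsum_swap; last by move=> m2 mu; apply: nsum_ge0 => m1; apply/if0/if1.
apply: (@le_trans _ _ (nsum (fun mu : int => (C * 2 `^ e' * J nu `^ e')%:E *
    (J (nu - 2 * mu) `^ (- (a - e')))%:E)%E)).
  apply: le_nsum => mu; case: (eqVneq mu 0) => [_|mu0].
    rewrite (@eq_nsum _ _ _ (fun=> 0%E)); last first.
      by move=> m1; rewrite -[RHS](@nsum0 _ int); apply: eq_nsum => m2; case: ifP.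
    by rewrite nsum0 mule_ge0// lee_fin ?mulr_ge0 ?powR_ge0.
  apply: (@le_trans _ _ ((g mu)%:E * nsum (fun m1 : int => nsum (fun m2 : int =>
      if (m1 * m2)%R == mu then 1%:E else 0%E)))%E).
    rewrite -nsumZ ?powR_ge0//; last by move=> m1; apply: nsum_ge0 => m2; apply: if0.
    apply: le_nsum => m1; rewrite -nsumZ ?powR_ge0//; last by move=> m2; apply: if0.
    by apply: le_nsum => m2; rewrite eq_sym; case: eqP => _; rewrite ?mule1 ?mule0.
  apply: le_trans (lee_wpmul2l (g0 mu) (hC mu mu0)) _.
  rewrite -!EFinM lee_fin /g opprB [e' - a]addrC powRD; last by rewrite (gt_eqF (japanese_gt0 _)) implybT.
  rewrite (_ : C * 2 `^ e' * J nu `^ e' * (_ * _) = J (nu - 2 * mu) `^ (- a) *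
     (C * (2 `^ e' * J nu `^ e' * J (nu - 2 * mu) `^ e'))); last by rewrite -!mulrA; ring.
  rewrite ler_wpM2l ?powR_ge0// ler_wpM2l// -!powRM ?mulr_ge0 ?japanese_ge0//.
  apply: ge0_ler_powR; rewrite ?nnegrE ?mulr_ge0 ?japanese_ge0 ?(ltW e'0)//.
  apply: le_trans (japanese_double mu) _.
  have := @japaneseM R nu (- (nu - 2 * mu)); rewrite japaneseN.
  by rewrite (_ : nu + - (nu - 2 * mu) = 2 * mu) ?mulrA//; ring.
rewrite nsumZ ?mulr_ge0 ?powR_ge0//; last by move=> ?; rewrite lee_fin powR_ge0.
apply: (@le_trans _ _ ((C * 2 `^ e' * J nu `^ e')%:E * (jsum (a - e'))%:E)%E).
  apply: lee_wpmul2l; first by rewrite lee_fin !mulr_ge0 ?powR_ge0.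
  rewrite -nsum_japanese//.
  apply: (@le_trans _ _ (nsum (fun m : int => (J m `^ (- (a - e')))%:E))) => //.
  rewrite -(nsum_reindex (fun m : int => (J m `^ (- (a - e')))%:E) (bijective_subl nu)) /=.
  apply: nsum_le_seq => s us.
  rewrite -(@big_map _ _ _ _ _ (fun m : int => 2 * m) s xpredT
     (fun m => (J (nu - m) `^ (- (a - e')))%:E)).
  apply: nsum_seq_le => [i|]; first by rewrite lee_fin powR_ge0.
  rewrite map_inj_uniq// => x y /eqP.
  by rewrite -subr_eq0 -mulrBr mulf_eq0 subr_eq0/= => /eqP.
rewrite -EFinM lee_fin mulrAC ler_wpM2l ?mulr_ge0 ?powR_ge0 ?jsum_ge0//.
by apply: ler_powR => //; exact: japanese_ge1.
Qed.

Lemma nsum5 {T1 T2 T3 T4 T5 : choiceType} (f : T1 -> T2 -> T3 -> T4 -> T5 -> \bar R) :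
  (forall a b c d e, (0 <= f a b c d e)%E) ->
  nsum (fun t : T1 * T2 * T3 * T4 * T5 => f t.1.1.1.1 t.1.1.1.2 t.1.1.2 t.1.2 t.2) =
  nsum (fun a => nsum (fun b => nsum (fun c => nsum (fun d => nsum (fun e => f a b c d e))))).
Proof.
move=> f0.
rewrite -(@nsum_pair _ _ _ (fun (t : T1 * T2 * T3 * T4) e => f t.1.1.1 t.1.1.2 t.1.2 t.2 e))//.
rewrite -(@nsum_pair _ _ _ (fun (t : T1 * T2 * T3) d => nsum (fun e => f t.1.1 t.1.2 t.2 d e))); last first.
  by move=> *; exact: nsum_ge0.
rewrite -(@nsum_pair _ _ _ (fun (t : T1 * T2) c => nsum (fun d => nsum (fun e => f t.1 t.2 c d e)))); last first.
  by move=> *; do 2!apply: nsum_ge0 => *.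
rewrite -(@nsum_pair _ _ _ (fun (a : T1) b => nsum (fun c => nsum (fun d => nsum (fun e => f a b c d e)))))//.
by move=> *; do 3!apply: nsum_ge0 => *.
Qed.

(** An interaction of five indices: two spatial frequencies j, k and three
   temporal frequencies; l = n - j + k and the temporal frequency of the
   window factor are determined by them and by the output (n, nu). *)
Definition idx : choiceType := (int * int * int * int * int)%type.

Definition fl (n : int) (t : idx) : int := n - t.1.1.1.1 + t.1.1.1.2.

Definition ft (n nu : int) (t : idx) : int :=
  nu - phase n t.1.1.1.1 t.1.1.1.2 - t.1.1.2 + t.1.2 - t.2.

Definition kap (n : int) (t : idx) : R := resc n t.1.1.1.1 t.1.1.1.2.

(** Convolving the temporal weights one variable at a time leaves a
   single weight centred at nu minus the phase, to which [phase_sum] applies. *)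
Lemma kernel_bound (a e : R) : 1 < a -> 0 < e -> exists2 C : R, 0 <= C &
  forall n nu : int,
  (nsum (fun t : idx => (`|kap n t| * (J t.1.1.2 `^ (- a) * J t.1.2 `^ (- a) *
     J t.2 `^ (- a) * J (ft n nu t) `^ (- a)))%:E) <= (C * J nu `^ e)%:E)%E.
Proof.
move=> a1 e0; have [C C0 hC] := phase_sum a1 e0.
pose w (x : int) : R := J x `^ (- a).
have w0 x : 0 <= w x by rewrite powR_ge0.
have [K K0 conv1] : exists2 K : R, 0 <= K &
    forall x : int, (nsum (fun y : int => (w y * w (x - y))%:E) <= (K * w x)%:E)%E.
  exists (2 `^ a * (2 * @jsum R a)); first by rewrite mulr_ge0 ?powR_ge0// mulr_ge0 ?jsum_ge0.
  by move=> x; exact: japanese_conv.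
exists (K * (K * (K * C))) => [|n nu]; first by rewrite !mulr_ge0.
rewrite (nsum5 (f := fun j k x y z => (`|resc n j k| * (w x * w y * w z *
    w (nu - phase n j k - x + y - z)))%:E)); last by move=> *; rewrite lee_fin !mulr_ge0.
have conv2 (x : int) : (nsum (fun y : int => (w y * w (x + y))%:E) <= (K * w x)%:E)%E.
  rewrite -(nsum_reindex (fun y : int => (w y * w (x + y))%:E) bijective_oppz) /=.
  by apply: le_trans (conv1 x); apply: le_nsum => y; rewrite /w japaneseN.
have step (c : R) (f : int -> R) (B : R) : 0 <= c -> (forall x, 0 <= f x) ->
    (nsum (fun x => (f x)%:E) <= B%:E)%E -> (nsum (fun x => (c * f x)%:E) <= (c * B)%:E)%E.
  move=> c0 f0 h; under eq_fun do rewrite EFinM.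
  by rewrite nsumZ// EFinM lee_wpmul2l.
apply: (@le_trans _ _ (nsum (fun j => nsum (fun k =>
    ((K * (K * K)) * (`|resc n j k| * w (nu - phase n j k)))%:E)))).
  apply: le_nsum => j; apply: le_nsum => k; have := normr_ge0 (resc n j k); move: `|resc n j k| => c c0; set b := nu - _.
  apply: (@le_trans _ _ (nsum (fun x => (c * (K * K) * (w x * w (b - x)))%:E))).
    apply: le_nsum => x.
    apply: (@le_trans _ _ (nsum (fun y => (c * w x * K * (w y * w (b - x + y)))%:E))).
      apply: le_nsum => y.
      rewrite (_ : c * w x * K * _ = c * w x * w y * (K * w (b - x + y))); last ring.
      rewrite (_ : (fun z => _) = fun z => (c * w x * w y * (w z * w (b - x + y - z)))%:E); last first.
        by apply/funext => z; congr (_%:E); ring.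
      by apply: step => //; [rewrite !mulr_ge0|move=> z; rewrite mulr_ge0].
    rewrite (_ : c * (K * K) * _ = c * w x * K * (K * w (b - x))); last ring.
    by apply: step => //; [rewrite !mulr_ge0|move=> z; rewrite mulr_ge0].
  rewrite (_ : K * (K * K) * _ = c * (K * K) * (K * w b)); last ring.
  by apply: step => //; [rewrite !mulr_ge0|move=> z; rewrite mulr_ge0].
under eq_fun do (under eq_fun do rewrite EFinM; rewrite nsumZ ?mulr_ge0//; last by move=> ?; rewrite lee_fin mulr_ge0).
rewrite nsumZ ?mulr_ge0//; last by move=> ?; apply: nsum_ge0 => ?; rewrite lee_fin mulr_ge0.
apply: (@le_trans _ _ ((K * (K * K))%:E * (C * J nu `^ e)%:E)%E).
  by rewrite lee_wpmul2l ?lee_fin ?mulr_ge0//; exact: hC.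
by rewrite -EFinM lee_fin le_eqVlt; apply/orP; left; apply/eqP; ring.
Qed.

End Kernel.

(** * The trilinear estimate *)

Section Hoelder.
Context {R : realType}.

Lemma nsum_scale {T : choiceType} (c B : R) (f : T -> R) : 0 <= c ->
  (forall x, 0 <= f x) -> (nsum (fun x => (f x)%:E) <= B%:E)%E ->
  (nsum (fun x => (c * f x)%:E) <= (c * B)%:E)%E.
Proof.
move=> c0 f0 h; under eq_fun do rewrite EFinM.
by rewrite nsumZ// EFinM lee_wpmul2l.
Qed.

Lemma nsum2_scale {T U : choiceType} (c B : R) (f : T -> U -> R) : 0 <= c ->
  (forall x y, 0 <= f x y) -> (nsum (fun x => nsum (fun y => (f x y)%:E)) <= B%:E)%E ->
  (nsum (fun x => nsum (fun y => (c * f x y)%:E)) <= (c * B)%:E)%E.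
Proof.
move=> c0 f0; rewrite (nsum_pair (f := fun x y => (f x y)%:E))//.
move=> /(nsum_scale c0 (fun k => f0 k.1 k.2)).
by rewrite -(nsum_pair (f := fun x y => (c * f x y)%:E))// => x y; rewrite lee_fin mulr_ge0.
Qed.

(** A bound by K of the norm of w in the dual of l^p; for p = 1 the dual
   norm is a supremum and needs its own clause. *)
Definition dual_bound {T : choiceType} (p : R) (w : T -> R) (K : R) : Prop :=
  if p == 1 then forall i, w i <= K
  else (nsum (fun i => (w i `^ (p / (p - 1)))%:E) <= (K `^ (p / (p - 1)))%:E)%E.

Lemma hoelder_nsum {T : choiceType} (p K B : R) (w z : T -> R) : 1 <= p -> 0 < K -> 0 <= B ->
  (forall i, 0 <= w i) -> (forall i, 0 <= z i) -> dual_bound p w K ->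
  (nsum (fun i => (z i `^ p)%:E) <= (B `^ p)%:E)%E ->
  (nsum (fun i => (w i * z i)%:E) <= (K * B)%:E)%E.
Proof.
move=> p1 K0 B0 w0 z0; rewrite /dual_bound; case: eqP => [-> wK zB|/eqP pn1 wK zB].
  apply: (@le_trans _ _ (nsum (fun i => (K * z i)%:E))).
    by apply: le_nsum => i; rewrite lee_fin ler_wpM2r.
  apply: nsum_scale => //; first exact: ltW.
  by move: zB; rewrite powRr1//; under eq_fun do rewrite powRr1//.
have {pn1} p1' : 1 < p by rewrite lt_neqAle eq_sym pn1.
have p0 : 0 < p by lra.
have pn0 : p != 0 by rewrite gt_eqF.
have pm : 0 < p - 1 by lra.
set p' := p / (p - 1) in wK *.
have p'0 : 0 < p' by rewrite divr_gt0.
have pp' : p'^-1 + p^-1 = 1 by rewrite /p'; field; rewrite pn0 gt_eqF.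
move: B0; rewrite le_eqVlt => /predU1P[B0|B0].
  rewrite -B0 mulr0; rewrite -B0 powR0// in zB.
  have z00 i : z i = 0.
    apply/eqP; have : ((z i `^ p)%:E <= 0)%E.
      by apply: le_trans zB; apply: (@nsum_term _ _ (fun i => (z i `^ p)%:E)) => j; rewrite lee_fin powR_ge0.
    rewrite lee_fin => h; have : z i `^ p == 0 by rewrite eq_le h powR_ge0.
    by rewrite powR_eq0 => /andP[].
  rewrite [leLHS](_ : _ = 0%E)//.
  by rewrite -[RHS](@nsum0 _ T); apply: eq_nsum => i; rewrite z00 mulr0.
have young i : w i * z i <= K * B * p'^-1 * (K `^ p')^-1 * w i `^ p' +
                           K * B * p^-1 * (B `^ p)^-1 * z i `^ p.
  have := @conjugate_powR R (w i / K) (z i / B) p' p.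
  rewrite !divr_ge0 ?(ltW K0) ?(ltW B0)// => /(_ isT isT p'0 p0 pp').
  rewrite !powRM ?invr_ge0 ?(ltW K0) ?(ltW B0)//.
  have inv (x r : R) : 0 <= x -> x^-1 `^ r = (x `^ r)^-1.
    by move=> x0; rewrite -powR_inv1// -powRrM mulN1r powRN.
  rewrite !inv ?(ltW K0) ?(ltW B0)//.
  have KB : 0 < K * B by rewrite mulr_gt0.
  rewrite -(ler_pM2l KB).
  rewrite (_ : K * B * (w i / K * (z i / B)) = w i * z i); last by field; rewrite !gt_eqF.
  by move=> h; apply: le_trans h _; rewrite le_eqVlt; apply/orP; left; apply/eqP; ring.
apply: (@le_trans _ _ (nsum (fun i => (K * B * p'^-1 * (K `^ p')^-1 * w i `^ p')%:E +
                           (K * B * p^-1 * (B `^ p)^-1 * z i `^ p)%:E)%E)).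
  by apply: le_nsum => i; rewrite -EFinD lee_fin.
have c1 : 0 <= K * B * p'^-1 * (K `^ p')^-1.
  by rewrite !mulr_ge0 ?invr_ge0 ?powR_ge0 ?(ltW K0) ?(ltW B0) ?(ltW p'0).
have c2 : 0 <= K * B * p^-1 * (B `^ p)^-1.
  by rewrite !mulr_ge0 ?invr_ge0 ?powR_ge0 ?(ltW K0) ?(ltW B0) ?(ltW p0).
rewrite nsumD; try by move=> i; rewrite lee_fin mulr_ge0 ?powR_ge0.
apply: le_trans (leeD (nsum_scale c1 (fun i => powR_ge0 (w i) p') wK)
                      (nsum_scale c2 (fun i => powR_ge0 (z i) p) zB)) _.
rewrite -EFinD lee_fin !mulfVK ?gt_eqF ?powR_gt0//.
by rewrite -mulrDr pp' mulr1.
Qed.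

End Hoelder.

Section Trilinear.
Context {R : realType}.
Local Notation J n := (japanese n : R).
Variables (p : R).
Hypothesis p1 : 1 <= p.

(** Exponents: l^p in the temporal frequency with the weight <l>^bexp embeds
   into l^1, barely; a primitive gains one power of the modulation, of which
   gexp is traded for smallness and 1 - gexp is kept. *)
Definition bexp : R := 1 - p^-1 + p^-1 / 40.
Definition gexp : R := p^-1 / 2.

Let p0 : 0 < p. Proof. exact: lt_le_trans ltr01 p1. Qed.
Let q0 : 0 < p^-1. Proof. by rewrite invr_gt0. Qed.
Let q1 : p^-1 <= 1. Proof. by rewrite invf_le1. Qed.

Lemma bexp_gt0 : 0 < bexp. Proof. rewrite /bexp; have := q0; have := q1; move: p^-1 => q; lra. Qed.

(** The temporal weight is summable after passing to the dual exponent. *)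
Lemma dual_bexp (pn1 : p != 1) : 1 < bexp * (p / (p - 1)).
Proof.
have pm : 0 < p - 1 by rewrite subr_gt0 lt_neqAle eq_sym pn1.
rewrite mulrA ltr_pdivlMr// mul1r /bexp.
have -> : (1 - p^-1 + p^-1 / 40) * p = p - 1 + 1 / 40 by field; rewrite gt_eqF.
lra.
Qed.

Lemma dual_bound_japanese : exists2 K : R, 0 < K &
  dual_bound p (fun l : int => J l `^ (- bexp)) K.
Proof.
rewrite /dual_bound; case: eqP => [pE|/eqP pn1].
  exists 1 => // l; apply: powR_japaneseN_le1; exact: ltW bexp_gt0.
have pm : 0 < p - 1 by rewrite subr_gt0 lt_neqAle eq_sym pn1.
have p'0 : 0 < p / (p - 1) by rewrite divr_gt0.
exists ((1 + jsum (bexp * (p / (p - 1)))) `^ (p / (p - 1))^-1).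
  by rewrite powR_gt0// ltr_pwDl// jsum_ge0.
rewrite -powRrM mulVf ?gt_eqF// powRr1 ?addr_ge0 ?jsum_ge0//.
under eq_fun do rewrite -powRrM mulNr.
by rewrite nsum_japanese ?dual_bexp// lee_fin lerDr.
Qed.

(** The p-th power of a norm of Fourier restriction type. As x is indexed by
   the frequencies of a profile, from which the free evolution has been removed,
   l measures the distance to the dispersion curve. *)
Definition xnorm (W : int -> R) (x : int -> int -> R) : \bar R :=
  nsum (fun n => nsum (fun l => ((W n * J l `^ bexp * x n l) `^ p)%:E)).

Definition tnorm (y : int -> R) : \bar R :=
  nsum (fun l => ((J l `^ bexp * y l) `^ p)%:E).

(** The cubic interaction with all cancellations discarded, except those that
   are built into [resc]. *)
Definition tsum (x1 x2 x3 : int -> int -> R) (y : int -> R) (n nu : int) : \bar R :=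
  nsum (fun t : idx => (`|@kap R n t| * (x1 t.1.1.1.1 t.1.1.2 * x2 t.1.1.1.2 t.1.2 *
    x3 (fl n t) t.2 * y (ft n nu t)))%:E).

(** For p > 1, raising to the dual power leaves the coefficients of modulus 0
   or 1 unchanged and makes the temporal weights summable, so that [kernel_bound]
   applies; its loss <nu>^e is absorbed because bexp - 1 + gexp < 0. *)
Lemma dual_bound_kernel : exists2 K : R, 0 < K & forall n nu : int,
  dual_bound p (fun t : idx => J nu `^ (bexp - 1 + gexp) * (`|@kap R n t| *
   (J t.1.1.2 `^ (- bexp) * J t.1.2 `^ (- bexp) * J t.2 `^ (- bexp) *
    J (ft n nu t) `^ (- bexp)))) K.
Proof.
have b0 := ltW bexp_gt0.
have e0 : bexp - 1 + gexp < 0 by rewrite /bexp /gexp; have := q0; have := q1; move: p^-1 => q; lra.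
rewrite /dual_bound; case: eqP => [pE|/eqP pn1].
  exists 1 => // n nu t.
  have k1 (x : int) : J x `^ (- bexp) <= 1 by exact: powR_japaneseN_le1.
  have k2 : J nu `^ (bexp - 1 + gexp) <= 1.
    by rewrite -[X in _ `^ X]opprK powR_japaneseN_le1// oppr_ge0 ltW.
  by do ![apply: mulr_ile1 => //; rewrite ?mulr_ge0 ?powR_ge0//]; exact: resc_le1.
have pm : 0 < p - 1 by rewrite subr_gt0 lt_neqAle eq_sym pn1.
set p' := p / (p - 1); have p'0 : 0 < p' by rewrite divr_gt0.
have p'1 : 1 <= p' by rewrite ler_pdivlMr// mul1r; lra.
have ep : 0 < - (bexp - 1 + gexp) * p' by rewrite mulr_gt0// oppr_gt0.
have [C C0 hC] := @kernel_bound R _ _ (dual_bexp pn1) ep.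
exists ((1 + C) `^ p'^-1) => [|n nu]; first by rewrite powR_gt0// ltr_pwDl.
rewrite -powRrM mulVf ?gt_eqF// powRr1 ?addr_ge0//.
apply: (@le_trans _ _ (nsum (fun t : idx => ((J nu `^ (- (bexp - 1 + gexp) * p'))^-1 *
   (`|@kap R n t| * (J t.1.1.2 `^ (- (bexp * p')) * J t.1.2 `^ (- (bexp * p')) *
     J t.2 `^ (- (bexp * p')) * J (ft n nu t) `^ (- (bexp * p')))))%:E))).
  have E x : (J x `^ (- bexp)) `^ p' = J x `^ (- (bexp * p')) by rewrite -powRrM mulNr.
  have E2 : (J nu `^ (bexp - 1 + gexp)) `^ p' = (J nu `^ (- (bexp - 1 + gexp) * p'))^-1.
    by rewrite -powRrM -powRN mulNr opprK.
  have E3 t : `|@kap R n t| `^ p' = `|@kap R n t|.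
    rewrite /kap /resc; case: (_ == _); case: (_ == _);
      rewrite ?subr0 ?subrr ?sub0r ?normrN ?normr1 ?normr0 ?powR1 ?powR0 ?gt_eqF//.
  apply: le_nsum => t; rewrite lee_fin.
  by rewrite !powRM ?mulr_ge0 ?powR_ge0// E2 E3 !E.
have h : 0 <= (J nu `^ (- (bexp - 1 + gexp) * p'))^-1 by rewrite invr_ge0 powR_ge0.
apply: le_trans (nsum_scale h _ (hC n nu)) _ => [t|].
  by rewrite !mulr_ge0 ?powR_ge0.
by rewrite lee_fin mulrCA mulVf ?gt_eqF ?powR_japanese_gt0// mulr1 lerDr.
Qed.

(** Summing z^p over the outputs and the interactions factorizes, since (n, nu)
   is determined by the fourfold product of arguments. *)
Lemma tsum_fubini (z1 z2 z3 : int -> int -> R) (y : int -> R) (B1 B2 B3 G : R) :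
  (forall n l, 0 <= z1 n l) -> (forall n l, 0 <= z2 n l) -> (forall n l, 0 <= z3 n l) ->
  (forall l, 0 <= y l) -> 0 <= B2 -> 0 <= B3 -> 0 <= G ->
  (nsum (fun n => nsum (fun l => (z1 n l)%:E)) <= B1%:E)%E ->
  (nsum (fun n => nsum (fun l => (z2 n l)%:E)) <= B2%:E)%E ->
  (nsum (fun n => nsum (fun l => (z3 n l)%:E)) <= B3%:E)%E ->
  (nsum (fun l => (y l)%:E) <= G%:E)%E ->
  (nsum (fun n => nsum (fun nu => nsum (fun t : idx =>
     (z1 t.1.1.1.1 t.1.1.2 * z2 t.1.1.1.2 t.1.2 * z3 (fl n t) t.2 * y (ft n nu t))%:E)))
   <= (B1 * (B2 * (B3 * G)))%:E)%E.
Proof.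
move=> z10 z20 z30 y0 B20 B30 G0 h1 h2 h3 hy.
have pos n nu (t : idx) : (0 <= (z1 t.1.1.1.1 t.1.1.2 * z2 t.1.1.1.2 t.1.2 * z3 (fl n t) t.2 * y (ft n nu t))%:E)%E.
  by rewrite lee_fin !mulr_ge0.
rewrite (@eq_nsum _ _ _ (fun n => nsum (fun t : idx => nsum (fun nu =>
     (z1 t.1.1.1.1 t.1.1.2 * z2 t.1.1.1.2 t.1.2 * z3 (fl n t) t.2 * y (ft n nu t))%:E)))); last first.
  by move=> n; apply: nsum_swap => nu t; exact: pos.
rewrite nsum_swap; last by move=> n t; apply: nsum_ge0 => nu; exact: pos.
apply: (@le_trans _ _ (nsum (fun t : idx => nsum (fun n =>
    (z1 t.1.1.1.1 t.1.1.2 * z2 t.1.1.1.2 t.1.2 * z3 (n - t.1.1.1.1 + t.1.1.1.2) t.2 * G)%:E)))).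
  apply: le_nsum => t; apply: le_nsum => n.
  apply: nsum_scale => //; first by rewrite !mulr_ge0.
  rewrite /ft (@eq_nsum _ _ _ (fun nu => (y (nu - (phase n t.1.1.1.1 t.1.1.1.2 + t.1.1.2 - t.1.2 + t.2)))%:E)).
    by rewrite (nsum_reindex (fun nu => (y nu)%:E) (bijective_subr _)).
  by move=> nu; congr ((y _)%:E); ring.
rewrite (nsum5 (f := fun j k a b c => nsum (fun n => (z1 j a * z2 k b * z3 (n - j + k) c * G)%:E))); last first.
  by move=> *; apply: nsum_ge0 => n; rewrite lee_fin !mulr_ge0.
apply: (@le_trans _ _ (nsum (fun j => nsum (fun k => nsum (fun a => nsum (fun b =>
    (z1 j a * (z2 k b * (B3 * G)))%:E)))))).
  apply: le_nsum => j; apply: le_nsum => k; apply: le_nsum => a; apply: le_nsum => b.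
  rewrite nsum_swap; last by move=> c n; rewrite lee_fin !mulr_ge0.
  rewrite (@eq_nsum _ _ _ (fun n => nsum (fun c => (z1 j a * z2 k b * G * z3 (n - (j - k)) c)%:E))); last first.
    move=> n; apply: eq_nsum => c; rewrite (_ : n - j + k = n - (j - k)); last ring.
    by congr (_%:E); ring.
  rewrite (nsum_reindex (fun n => nsum (fun c => (z1 j a * z2 k b * G * z3 n c)%:E)) (bijective_subr (j - k))).
  rewrite (_ : z1 j a * (z2 k b * (B3 * G)) = z1 j a * z2 k b * G * B3); last ring.
  by apply: nsum2_scale => //; rewrite !mulr_ge0.
apply: (@le_trans _ _ (nsum (fun j => nsum (fun a => (B2 * (B3 * G) * z1 j a)%:E)))).
  apply: le_nsum => j.
  rewrite nsum_swap; last by move=> k a; apply: nsum_ge0 => b; rewrite lee_fin !mulr_ge0.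
  apply: le_nsum => a.
  rewrite (@eq_nsum _ _ _ (fun k => nsum (fun b => (z1 j a * (B3 * G) * z2 k b)%:E))); last first.
    by move=> k; apply: eq_nsum => b; congr (_%:E); ring.
  rewrite (_ : B2 * (B3 * G) * z1 j a = z1 j a * (B3 * G) * B2); last ring.
  by apply: nsum2_scale => //; rewrite !mulr_ge0.
rewrite (_ : B1 * _ = B2 * (B3 * G) * B1); last ring.
by apply: nsum2_scale => //; rewrite !mulr_ge0.
Qed.

(** Hoelder's inequality with the dual bound of the kernel turns the sum
   over interactions into an l^p sum. The weight W is distributed over the three
   factors by submultiplicativity, and the remaining sum factorizes. *)
Lemma trilinear : exists2 C : R, 0 < C & forall (W : int -> R) (A : R),
  (forall n, 0 <= W n) -> 0 < A ->
  (forall j k l, W (j - k + l) <= A * (W j * W k * W l)) ->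
  forall (x1 x2 x3 : int -> int -> R) (y : int -> R) (B1 B2 B3 G : R),
  (forall n l, 0 <= x1 n l) -> (forall n l, 0 <= x2 n l) -> (forall n l, 0 <= x3 n l) ->
  (forall l, 0 <= y l) -> 0 <= B1 -> 0 <= B2 -> 0 <= B3 -> 0 <= G ->
  (xnorm W x1 <= B1%:E)%E -> (xnorm W x2 <= B2%:E)%E -> (xnorm W x3 <= B3%:E)%E ->
  (tnorm y <= G%:E)%E ->
  (nsum (fun n => nsum (fun nu => ((W n * J nu `^ (bexp - 1 + gexp))%:E * tsum x1 x2 x3 y n nu) `^ p))
    <= (C * A `^ p * (B1 * (B2 * (B3 * G))))%:E)%E.
Proof.
have [K K0 hK] := dual_bound_kernel.
exists (K `^ p) => [|W A W0 A0 hW x1 x2 x3 y B1 B2 B3 G x10 x20 x30 y0 B10 B20 B30 G0 h1 h2 h3 hy].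
  by rewrite powR_gt0.
pose w (l : int) := J l `^ bexp.
have w0 l : 0 <= w l by rewrite powR_ge0.
have wV l : J l `^ (- bexp) * w l = 1.
  by rewrite powRN mulVf// gt_eqF// powR_japanese_gt0.
pose z1 n l := W n * w l * x1 n l; pose z2 n l := W n * w l * x2 n l.
pose z3 n l := W n * w l * x3 n l; pose yy l := w l * y l.
have z10 n l : 0 <= z1 n l by apply: mulr_ge0; [apply: mulr_ge0|].
have z20 n l : 0 <= z2 n l by apply: mulr_ge0; [apply: mulr_ge0|].
have z30 n l : 0 <= z3 n l by apply: mulr_ge0; [apply: mulr_ge0|].
have yy0 l : 0 <= yy l by apply: mulr_ge0.
pose Z n nu (t : idx) := z1 t.1.1.1.1 t.1.1.2 * z2 t.1.1.1.2 t.1.2 * z3 (fl n t) t.2 * yy (ft n nu t).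
have Z0 n nu t : 0 <= Z n nu t.
  by apply: mulr_ge0 => //; apply: mulr_ge0 => //; apply: mulr_ge0.
have tot : (nsum (fun n => nsum (fun nu => nsum (fun t => (Z n nu t `^ p)%:E))) <= (B1 * (B2 * (B3 * G)))%:E)%E.
  have := @tsum_fubini (fun n l => z1 n l `^ p) (fun n l => z2 n l `^ p) (fun n l => z3 n l `^ p)
     (fun l => yy l `^ p) B1 B2 B3 G.
  move=> /(_ (fun n l => powR_ge0 _ _) (fun n l => powR_ge0 _ _) (fun n l => powR_ge0 _ _) (fun l => powR_ge0 _ _)).
  move=> /(_ B20 B30 G0 h1 h2 h3 hy) h; apply: le_trans h.
  apply: le_nsum => n; apply: le_nsum => nu; apply: le_nsum => t.
  by rewrite lee_fin /Z !powRM// ?mulr_ge0.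
have ptw n nu : (((W n * J nu `^ (bexp - 1 + gexp))%:E * tsum x1 x2 x3 y n nu) `^ p <=
    (K `^ p * A `^ p)%:E * nsum (fun t => (Z n nu t `^ p)%:E))%E.
  set S := nsum (fun t => (Z n nu t `^ p)%:E).
  have S0 : (0 <= S)%E by apply: nsum_ge0 => t; rewrite lee_fin powR_ge0.
  have KA : 0 < K `^ p * A `^ p by rewrite mulr_gt0 ?powR_gt0.
  have [Sfin|] := boolP (S \is a fin_num); last first.
    rewrite ge0_fin_numE// -leNgt leye_eq => /eqP ->.
    by rewrite gt0_muley ?lte_fin// leey.
  have Sf0 : 0 <= fine S by rewrite fine_ge0.
  pose B := fine S `^ p^-1.
  have Bp : B `^ p = fine S by rewrite -powRrM mulVf ?gt_eqF// powRr1.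
  have hB : (nsum (fun t => (Z n nu t `^ p)%:E) <= (B `^ p)%:E)%E by rewrite Bp fineK.
  have B0 : 0 <= B by rewrite powR_ge0.
  have pos t : 0 <= J nu `^ (bexp - 1 + gexp) * (`|@kap R n t| *
     (J t.1.1.2 `^ (- bexp) * J t.1.2 `^ (- bexp) * J t.2 `^ (- bexp) *
      J (ft n nu t) `^ (- bexp))) by rewrite !mulr_ge0 ?powR_ge0.
  have := hoelder_nsum p1 K0 B0 pos (Z0 n nu) (hK n nu) hB.
  move=> H.
  apply: (@le_trans _ _ ((A * (K * B))%:E `^ p)%E); last first.
    by rewrite poweR_EFin !powRM ?mulr_ge0 ?(ltW K0) ?(ltW A0)// Bp -{2}(fineK Sfin) -EFinM lee_fin mulrCA mulrA.
  apply: gt0_ler_poweR; rewrite ?(ltW p0)// ?in_itv/= ?andbT ?leey ?lee_fin.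
  - by rewrite mule_ge0// ?lee_fin ?mulr_ge0 ?powR_ge0// nsum_ge0// => t; rewrite lee_fin !mulr_ge0.
  - by rewrite !mulr_ge0 ?(ltW K0) ?(ltW A0).
  have A0e : (0 <= A%:E)%E by rewrite lee_fin ltW.
  rewrite EFinM; apply: (le_trans _ (lee_wpmul2l A0e H)).
  rewrite -!nsumZ ?mulr_ge0 ?powR_ge0 ?(ltW A0)//; try by move=> t; rewrite lee_fin !mulr_ge0 ?powR_ge0.
  apply: le_nsum => t; rewrite -!EFinM lee_fin.
  have hWn : W n <= A * (W t.1.1.1.1 * W t.1.1.1.2 * W (fl n t)).
    by apply: le_trans (hW _ _ _); rewrite /fl (_ : _ - _ + _ = n)//; ring.
  rewrite /Z /z1 /z2 /z3 /yy.
  set k := `|_|; set b := J nu `^ _; set X1 := x1 _ _; set X2 := x2 _ _; set X3 := x3 _ _; set Y := y _.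
  have k0 : 0 <= k by rewrite normr_ge0.
  have b0 : 0 <= b by rewrite powR_ge0.
  apply: (@le_trans _ _ (A * (W t.1.1.1.1 * W t.1.1.1.2 * W (fl n t)) * b * (k * (X1 * X2 * X3 * Y)))).
    rewrite ler_wpM2r ?mulr_ge0 ?x10 ?x20 ?x30 ?y0//; first by rewrite ler_wpM2r.
  have e1 := wV t.1.1.2; have e2 := wV t.1.2; have e3 := wV t.2; have e4 := wV (ft n nu t).
  move: e1 e2 e3 e4; move: (J t.1.1.2 `^ _) (J t.1.2 `^ _) (J t.2 `^ _) (J (ft n nu t) `^ _).
  move: (w t.1.1.2) (w t.1.2) (w t.2) (w (ft n nu t)) => w1 w2 w3 w4 v1 v2 v3 v4 e1 e2 e3 e4.
  rewrite le_eqVlt; apply/orP; left; apply/eqP.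
  transitivity (A * (W t.1.1.1.1 * W t.1.1.1.2 * W (fl n t)) * b * (k * (X1 * X2 * X3 * Y)) *
     ((v1 * w1) * (v2 * w2) * (v3 * w3) * (v4 * w4))); last by rewrite -!mulrA; ring.
  by rewrite e1 e2 e3 e4 !mulr1.
apply: (@le_trans _ _ ((K `^ p * A `^ p)%:E * nsum (fun n => nsum (fun nu => nsum (fun t => (Z n nu t `^ p)%:E))))%E).
  have KA : 0 <= K `^ p * A `^ p by rewrite mulr_ge0 ?powR_ge0.
  have S0 n nu : (0 <= nsum (fun t => (Z n nu t `^ p)%:E))%E by apply: nsum_ge0 => t; rewrite lee_fin powR_ge0.
  rewrite -nsumZ//; last by move=> n; apply: nsum_ge0.
  apply: le_nsum => n; rewrite -nsumZ//; exact: le_nsum.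
by rewrite [leRHS]EFinM lee_wpmul2l// lee_fin mulr_ge0 ?powR_ge0.
Qed.

(** * Estimates for the Picard map *)

Lemma powRD_le (x y : R) : 0 <= x -> 0 <= y -> (x + y) `^ p <= 2 `^ p * (x `^ p + y `^ p).
Proof.
move=> x0 y0.
wlog xy : x y x0 y0 / x <= y => [H|].
  by have [/H->//|/ltW/H] := leP x y; rewrite addrC [x `^ _ + _]addrC; apply.
apply: (@le_trans _ _ ((2 * y) `^ p)).
  apply: ge0_ler_powR; rewrite ?nnegrE ?addr_ge0 ?mulr_ge0 ?(ltW p0)//; lra.
by rewrite powRM// ler_wpM2l ?powR_ge0// lerDr powR_ge0.
Qed.

Definition xnc (W : int -> R) (c : int -> int -> R[i]) : \bar R :=
  xnorm W (fun n l => normc (c n l)).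

Lemma xnorm_ge0 W x : (0 <= xnorm W x)%E.
Proof. by do 2!(apply: nsum_ge0 => ?); rewrite lee_fin powR_ge0. Qed.

Lemma le_xnorm W x y : (forall n, 0 <= W n) -> (forall n l, 0 <= x n l) ->
  (forall n l, x n l <= y n l) -> (xnorm W x <= xnorm W y)%E.
Proof.
move=> W0 x0 xy; apply: le_nsum => n; apply: le_nsum => l; rewrite lee_fin.
have y0 : 0 <= y n l by exact: le_trans (xy n l).
have Wj : 0 <= W n * J l `^ bexp by rewrite mulr_ge0 ?powR_ge0.
by apply: ge0_ler_powR; rewrite ?nnegrE ?(ltW p0)// ?ler_wpM2l// mulr_ge0.
Qed.

Lemma xnormD W x y : (forall n, 0 <= W n) -> (forall n l, 0 <= x n l) ->
  (forall n l, 0 <= y n l) ->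
  (xnorm W (fun n l => x n l + y n l)%R <= (2 `^ p)%:E * (xnorm W x + xnorm W y))%E.
Proof.
move=> W0 x0 y0.
have pos (z : int -> int -> R) n l : (0 <= ((W n * J l `^ bexp * z n l) `^ p)%:E)%E by rewrite lee_fin powR_ge0.
rewrite /xnorm -nsumD; [|by move=> n; apply: nsum_ge0 => l; exact: pos|by move=> n; apply: nsum_ge0 => l; exact: pos].
rewrite -nsumZ ?powR_ge0//; last by move=> n; apply: adde_ge0; apply: nsum_ge0 => l; exact: pos.
apply: le_nsum => n; rewrite -nsumD; try by move=> l; exact: pos.
rewrite -nsumZ ?powR_ge0//; last by move=> l; apply: adde_ge0; exact: pos.
apply: le_nsum => l; rewrite -EFinD -EFinM lee_fin mulrDr.
have Wj : 0 <= W n * J l `^ bexp by rewrite mulr_ge0 ?powR_ge0.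
by apply: powRD_le; rewrite mulr_ge0.
Qed.

Lemma xncD W c d : (forall n, 0 <= W n) ->
  (xnc W (fun n l => c n l + d n l)%R <= (2 `^ p)%:E * (xnc W c + xnc W d))%E.
Proof.
move=> W0; apply: le_trans (xnormD W0 (fun n l => normc_ge0 (c n l)) (fun n l => normc_ge0 (d n l))).
apply: le_xnorm => // n l; [exact: normc_ge0|exact: le_normcD].
Qed.

Lemma xncZ W k c : (forall n, 0 <= W n) ->
  normc k = 1 -> xnc W (fun n l => k * c n l) = xnc W c.
Proof.
move=> W0 k1; rewrite /xnc; congr (xnorm W _); apply/funext => n; apply/funext => l.
by rewrite normcM k1 mul1r.
Qed.

(** Space-time Fourier coefficients of the window with coefficients eta times the
   nonlinearity evaluated at profiles with coefficients c1, conjugate c2, c3. *)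
Definition dcoef (eta : int -> R[i]) (c1 c2 c3 : int -> int -> R[i]) (n nu : int) : R[i] :=
  csum (fun t : idx => (@kap R n t)%:C * (c1 t.1.1.1.1 t.1.1.2 *
    conjc (c2 t.1.1.1.2 t.1.2) * c3 (fl n t) t.2 * eta (ft n nu t))).

Definition resolvent (M : R) (l : int) : R[i] := (M +i* l%:~R)^-1.

(** Fourier coefficients of the solution of v' + M v = d, v(0) = 0, where
   gamma are the coefficients of a periodic extension of exp(- M t). The damping M
   makes the symbol of d/dt + M invertible at zero temporal frequency. *)
Definition duhamel (M : R) (gamma : int -> R[i]) (d : int -> int -> R[i]) (n l : int) : R[i] :=
  d n l * resolvent M l - csum (fun m => d n m * resolvent M m) * gamma l.

Lemma normc_resolvent (M : R) (l : int) : 1 <= M ->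
  normc (resolvent M l) <= M `^ (- gexp) * J l `^ (gexp - 1).
Proof.
move=> M1; rewrite /resolvent normcV normcE /=.
have M0 : 0 < M by lra.
set S := Num.sqrt _.
have SM : M <= S by rewrite -[leLHS]ger0_norm ?(ltW M0)// -sqrtr_sqr ler_wsqrtr// lerDl sqr_ge0.
have SJ : J l <= S by rewrite ler_wsqrtr// lerD2r -[leLHS](expr1n _ 2) lerXn2r// ?nnegrE ?(ltW M0).
have S0 : 0 < S by lra.
have g0 : 0 <= gexp by rewrite /gexp; have := q0; move: p^-1 => q; lra.
have g1 : 0 <= 1 - gexp by rewrite /gexp; have := q1; move: p^-1 => q; lra.
rewrite -[gexp - 1]opprB !powRN -invfM lef_pV2 ?posrE ?mulr_gt0 ?powR_gt0 ?japanese_gt0//.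
have -> : S = S `^ gexp * S `^ (1 - gexp).
  by rewrite -powRD ?subrKC ?subrK ?addrC ?subrK ?powRr1 ?(ltW S0)// (gt_eqF S0) implybT.
by apply: ler_pM; rewrite ?powR_ge0//; apply: ge0_ler_powR; rewrite ?nnegrE ?japanese_ge0 ?(ltW S0) ?(ltW M0).
Qed.

Lemma tnorm_l1 : exists2 K : R, 0 < K & forall (u : int -> R) (B : R),
  (forall l, 0 <= u l) -> 0 <= B -> (tnorm u <= (B `^ p)%:E)%E ->
  (nsum (fun l => (u l)%:E) <= (K * B)%:E)%E.
Proof.
have [K K0 hK] := dual_bound_japanese.
exists K => // u B u0 B0 uB.
have := @hoelder_nsum _ _ p K B _ (fun l => J l `^ bexp * u l) p1 K0 B0
  (fun l => powR_ge0 _ _) _ hK uB.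
move=> /(_ (fun l => mulr_ge0 (powR_ge0 _ _) (u0 l))); apply: le_trans.
apply: le_nsum => l.
by rewrite powRN mulrA mulVf ?mul1r// gt_eqF ?powR_japanese_gt0.
Qed.

Lemma tnorm_ge0 u : (0 <= tnorm u)%E.
Proof. by apply: nsum_ge0 => ?; rewrite lee_fin powR_ge0. Qed.

Lemma xnorm_tnorm W x : xnorm W x = nsum (fun n => tnorm (fun l => W n * x n l)).
Proof.
by apply: eq_nsum => n; apply: eq_nsum => l; rewrite mulrCA mulrA.
Qed.

(** The norm for the forcing term: weaker than [xnorm] by 1 - gexp powers of the
   temporal weight, the part of the gain of a primitive that is not spent on
   smallness. *)
Definition dnorm (W : int -> R) (d : int -> int -> R[i]) : \bar R :=
  nsum (fun n => nsum (fun nu => ((W n * J nu `^ (bexp - 1 + gexp) * normc (d n nu)) `^ p)%:E)).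

Lemma xnorm_resolvent W d M (T : R) : 1 <= M -> (forall n, 0 <= W n) ->
  (dnorm W d <= T%:E)%E ->
  (xnc W (fun n l => d n l * resolvent M l)%R <= (M `^ (- 2^-1) * T)%:E)%E.
Proof.
move=> M1 W0 hT.
have M0 : 0 < M by lra.
have gp : gexp * p = 2^-1 by rewrite /gexp mulrAC mulVf ?mul1r// gt_eqF.
apply: (@le_trans _ _ (nsum (fun n => nsum (fun l => (M `^ (- 2^-1) *
   (W n * J l `^ (bexp - 1 + gexp) * normc (d n l)) `^ p)%:E)))).
  apply: le_nsum => n; apply: le_nsum => l; rewrite lee_fin.
  rewrite -gp -mulNr powRrM -powRM ?mulr_ge0 ?powR_ge0 ?normc_ge0//.
  apply: ge0_ler_powR; rewrite ?nnegrE ?(ltW p0) ?mulr_ge0 ?powR_ge0 ?normc_ge0//.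
  have Jn0 : J l != 0 by rewrite gt_eqF// japanese_gt0.
  have -> : J l `^ (bexp - 1 + gexp) = J l `^ bexp * J l `^ (gexp - 1).
    by rewrite -powRD ?Jn0 ?implybT//; congr (_ `^ _); ring.
  rewrite normcM [leRHS](_ : _ = W n * J l `^ bexp * (normc (d n l) * (M `^ (- gexp) * J l `^ (gexp - 1)))); last by ring.
  rewrite ler_wpM2l ?mulr_ge0 ?powR_ge0// ler_wpM2l ?normc_ge0//; exact: normc_resolvent.
by apply: nsum2_scale => // [|n l]; exact: powR_ge0.
Qed.

Lemma xnc_fin_csummable W c (B : R) n : (forall n, 0 < W n) -> (xnc W c <= B%:E)%E ->
  csummable (c n).
Proof.
move=> W0 cB; have [K K0 hK] := tnorm_l1.
have Wn0 k : 0 <= W k := ltW (W0 k).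
have B0 : 0 <= B by rewrite -lee_fin; apply: le_trans cB; exact: xnorm_ge0.
have h : (nsum (fun l => (W n * normc (c n l))%:E) <= (K * B `^ p^-1)%:E)%E.
  apply: hK; rewrite ?powR_ge0//; first by move=> l; rewrite mulr_ge0 ?normc_ge0.
  rewrite -powRrM mulVf ?gt_eqF// powRr1//; apply: le_trans cB; rewrite /xnc xnorm_tnorm.
  by apply: (@nsum_term _ _ (fun n => tnorm (fun l => W n * normc (c n l)))) => k; exact: tnorm_ge0.
apply: (@le_lt_trans _ _ (((W n)^-1 * (K * B `^ p^-1))%:E)); last exact: ltry.
apply: (@le_trans _ _ (nsum (fun l => ((W n)^-1 * (W n * normc (c n l)))%:E))).
  by apply: le_nsum => l; rewrite mulrA mulVf ?mul1r// gt_eqF.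
by apply: nsum_scale => // [|l]; rewrite ?invr_ge0 ?mulr_ge0 ?normc_ge0.
Qed.

(** The boundary term at t = 0 is a sum over temporal frequencies, controlled by
   the embedding of the temporal norm into l^1. *)
Lemma duhamel_bound : exists2 K : R, 0 < K & forall W d M gamma (T G : R),
  1 <= M -> (forall n, 0 < W n) -> 0 <= G -> (dnorm W d <= T%:E)%E ->
  (tnorm (fun l => normc (gamma l)) <= G%:E)%E ->
  (xnc W (duhamel M gamma d) <= (K * (1 + G) * M `^ (- 2^-1) * T)%:E)%E.
Proof.
have [K K0 hK] := tnorm_l1.
exists (2 `^ p * (1 + K `^ p)) => [|W d M gamma T G M1 Wpos G0 hT hG].
  by rewrite mulr_gt0 ?powR_gt0// addr_gt0 ?powR_gt0.
have W0 n := ltW (Wpos n); have K0' := ltW K0.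
set u := fun n l => d n l * resolvent M l.
have hu : (xnc W u <= (M `^ (- 2^-1) * T)%:E)%E by exact: xnorm_resolvent.
set v := fun n l => - (csum (u n) * gamma l).
have -> : duhamel M gamma d = fun n l => u n l + v n l by [].
apply: le_trans (xncD u v W0) _.
have B0 : (0 <= M `^ (- 2^-1) * T)%R by rewrite -lee_fin; apply: le_trans hu; exact: xnorm_ge0.
have hv : (xnc W v <= (K `^ p * G * (M `^ (- 2^-1) * T))%:E)%E.
  rewrite /xnc xnorm_tnorm.
  apply: (@le_trans _ _ (nsum (fun n => (K `^ p * G)%:E * tnorm (fun l => (W n * normc (u n l))%R))%E)); last first.
    rewrite nsumZ ?mulr_ge0 ?powR_ge0//; last by move=> n; exact: tnorm_ge0.
    by rewrite [leRHS]EFinM; apply: lee_wpmul2l; [rewrite lee_fin mulr_ge0 ?powR_ge0|rewrite -xnorm_tnorm].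
  apply: le_nsum => n.
  set S := tnorm (fun l => W n * normc (u n l)).
  have S0 : (0 <= S)%E by exact: tnorm_ge0.
  have SB : (S <= (M `^ (- 2^-1) * T)%:E)%E.
    apply: le_trans hu; rewrite /xnc xnorm_tnorm.
    by apply: (@nsum_term _ _ (fun n => tnorm (fun l => W n * normc (u n l)))) => k; exact: tnorm_ge0.
  have Sfin : S \is a fin_num by rewrite ge0_fin_numE//; apply: le_lt_trans SB (ltry _).
  have f0 : 0 <= fine S by rewrite fine_ge0.
  have Wu0 l : 0 <= W n * normc (u n l) by rewrite mulr_ge0 ?normc_ge0.
  have : (nsum (fun l => (W n * normc (u n l))%:E) <= (K * fine S `^ p^-1)%:E)%E.
    by apply: hK; rewrite ?powR_ge0// -powRrM mulVf ?gt_eqF// powRr1// fineK.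
  move=> hs.
  have hc : W n * normc (csum (u n)) <= K * fine S `^ p^-1.
    have := normc_csum (fun l => (W n)%:C * u n l).
    have us : csummable (u n).
      apply: (@le_lt_trans _ _ (((W n)^-1 * (K * fine S `^ p^-1))%:E)); last exact: ltry.
      apply: (@le_trans _ _ (nsum (fun l => ((W n)^-1 * (W n * normc (u n l)))%:E))).
        by apply: le_nsum => l; rewrite mulrA mulVf ?mul1r// gt_eqF.
      by apply: nsum_scale => //; rewrite ?invr_ge0.
    rewrite csumZ// normcM normcR ger0_norm//.
    rewrite (@eq_nsum _ _ _ (fun l => (W n * normc (u n l))%:E)).
      by move=> h; rewrite -lee_fin; exact: le_trans h hs.
    by move=> l; rewrite normcM normcR ger0_norm.
  apply: (@le_trans _ _ (nsum (fun l => ((K `^ p * fine S) * (J l `^ bexp * normc (gamma l)) `^ p)%:E))).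
    apply: le_nsum => l; rewrite lee_fin.
    rewrite (_ : K `^ p * fine S = (K * fine S `^ p^-1) `^ p); last first.
      by rewrite powRM ?powR_ge0 ?(ltW K0)// -powRrM mulVf ?gt_eqF// powRr1.
    have pos0 : 0 <= K * fine S `^ p^-1 by rewrite mulr_ge0 ?powR_ge0 ?(ltW K0).
    rewrite -powRM ?mulr_ge0 ?powR_ge0 ?normc_ge0//.
    apply: ge0_ler_powR; rewrite ?nnegrE ?(ltW p0) ?mulr_ge0 ?powR_ge0 ?normc_ge0//.
    rewrite normcN normcM [leLHS](_ : _ = W n * normc (csum (u n)) * (J l `^ bexp * normc (gamma l))); last by ring.
    by rewrite ler_wpM2r ?mulr_ge0 ?powR_ge0 ?normc_ge0.
  rewrite -[in leRHS](fineK Sfin) -EFinM (_ : K `^ p * G * fine S = K `^ p * fine S * G); last by ring.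
  by apply: nsum_scale => // [|l]; rewrite ?mulr_ge0 ?powR_ge0.
apply: (@le_trans _ _ ((2 `^ p)%:E * ((M `^ (- 2^-1) * T)%:E + (K `^ p * G * (M `^ (- 2^-1) * T))%:E))%E).
  by rewrite lee_wpmul2l ?lee_fin ?powR_ge0// leeD.
rewrite -EFinD -EFinM lee_fin -!mulrA ler_wpM2l ?powR_ge0// -[X in X + _ <= _]mul1r.
have := powR_ge0 K p; move: (K `^ p) (_ * T) B0 => k X X0 k0.
rewrite -subr_ge0 (_ : _ - _ = (k + G) * X); last by ring.
by rewrite mulr_ge0// addr_ge0.
Qed.

Lemma tsum_lty (W : int -> R) (A : R) (x1 x2 x3 : int -> int -> R) (y : int -> R) (B1 B2 B3 G : R) n nu :
  (forall n, 0 < W n) -> 0 < A ->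
  (forall j k l, W (j - k + l) <= A * (W j * W k * W l)) ->
  (forall n l, 0 <= x1 n l) -> (forall n l, 0 <= x2 n l) -> (forall n l, 0 <= x3 n l) ->
  (forall l, 0 <= y l) -> 0 <= B1 -> 0 <= B2 -> 0 <= B3 -> 0 <= G ->
  (xnorm W x1 <= B1%:E)%E -> (xnorm W x2 <= B2%:E)%E -> (xnorm W x3 <= B3%:E)%E ->
  (tnorm y <= G%:E)%E -> (tsum x1 x2 x3 y n nu < +oo)%E.
Proof.
move=> W0 A0 hW x10 x20 x30 y0 B10 B20 B30 G0 h1 h2 h3 hy.
have [C C0 hC] := trilinear.
have := hC W A (fun n => ltW (W0 n)) A0 hW x1 x2 x3 y B1 B2 B3 G x10 x20 x30 y0 B10 B20 B30 G0 h1 h2 h3 hy.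
move=> h.
have Wj : 0 < W n * J nu `^ (bexp - 1 + gexp) by rewrite mulr_gt0 ?powR_gt0 ?japanese_gt0.
have : (((W n * J nu `^ (bexp - 1 + gexp))%:E * tsum x1 x2 x3 y n nu) `^ p < +oo)%E.
  apply: le_lt_trans (ltry (C * A `^ p * (B1 * (B2 * (B3 * G))))); apply: le_trans h.
  apply: le_trans (@nsum_term _ _ (fun n => nsum (fun nu => ((W n * J nu `^ (bexp - 1 + gexp))%:E * tsum x1 x2 x3 y n nu) `^ p)%E) n _).
    by apply: (@nsum_term _ _ (fun nu => ((W n * J nu `^ (bexp - 1 + gexp))%:E * tsum x1 x2 x3 y n nu) `^ p)%E) => k; exact: poweR_ge0.
  by move=> k; apply: nsum_ge0 => l; exact: poweR_ge0.
move=> /(lty_poweRy (lt0r_neq0 p0)) {}h.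
rewrite ltey; apply/eqP => E; move: h; rewrite E gt0_muley ?lte_fin// ltxx//.
Qed.

Lemma normc_dcoef eta c1 c2 c3 n nu :
  ((normc (dcoef eta c1 c2 c3 n nu))%:E <=
   tsum (fun n l => normc (c1 n l)) (fun n l => normc (c2 n l))
        (fun n l => normc (c3 n l)) (fun l => normc (eta l)) n nu)%E.
Proof.
apply: le_trans (normc_csum _) _; apply: le_nsum => t; rewrite lee_fin.
by rewrite !normcM normcJ normcR.
Qed.

(** The gain of a negative power of M comes from inverting d/dt + M, and it beats
   the growth of the norms of the windows. *)
Lemma duhamel_trilinear (Cw : R) : 0 < Cw -> exists2 C : R, 0 < C &
  forall (W : int -> R) (A M : R) gamma eta c1 c2 c3 (B1 B2 B3 : R),
  (forall n, 0 < W n) -> 0 < A -> 1 <= M ->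
  (forall j k l, W (j - k + l) <= A * (W j * W k * W l)) ->
  (tnorm (fun l => normc (gamma l)) <= (Cw * M `^ (1 / 20))%:E)%E ->
  (tnorm (fun l => normc (eta l)) <= (Cw * M `^ (1 / 20))%:E)%E ->
  0 <= B1 -> 0 <= B2 -> 0 <= B3 ->
  (xnc W c1 <= B1%:E)%E -> (xnc W c2 <= B2%:E)%E -> (xnc W c3 <= B3%:E)%E ->
  (xnc W (duhamel M gamma (dcoef eta c1 c2 c3)) <=
    (C * A `^ p * M `^ (- (2 / 5)) * (B1 * (B2 * B3)))%:E)%E.
Proof.
move=> Cw0; have [K K0 hK] := duhamel_bound; have [C C0 hC] := trilinear.
exists (K * (1 + Cw) * (C * Cw)).
  by rewrite !mulr_gt0// addr_gt0.
move=> W A M gamma eta c1 c2 c3 B1 B2 B3 Wp A0 M1 hW hg he B10 B20 B30 h1 h2 h3.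
have W0 n := ltW (Wp n).
have M0 : 0 < M by lra.
set m := M `^ (1 / 20) in hg he *.
have m1 : 1 <= m by rewrite -(powRr0 M) ler_powR//; lra.
have m0 : 0 <= Cw * m by rewrite mulr_ge0 ?(ltW Cw0)//; lra.
have hd : (dnorm W (dcoef eta c1 c2 c3) <= (C * A `^ p * (B1 * (B2 * (B3 * (Cw * m)))))%:E)%E.
  have := hC W A W0 A0 hW _ _ _ _ B1 B2 B3 _ (fun n l => normc_ge0 (c1 n l))
    (fun n l => normc_ge0 (c2 n l)) (fun n l => normc_ge0 (c3 n l)) (fun l => normc_ge0 (eta l))
    B10 B20 B30 m0 h1 h2 h3 he.
  apply: le_trans; apply: le_nsum => n; apply: le_nsum => nu.
  rewrite -poweR_EFin; apply: gt0_ler_poweR; rewrite ?(ltW p0)// ?in_itv/= ?andbT ?leey ?lee_fin.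
  - by rewrite !mulr_ge0 ?powR_ge0 ?normc_ge0.
  - rewrite mule_ge0// ?lee_fin ?mulr_ge0 ?powR_ge0//.
    by apply: nsum_ge0 => t; rewrite lee_fin !mulr_ge0 ?normc_ge0.
  - rewrite EFinM lee_wpmul2l ?lee_fin ?mulr_ge0 ?powR_ge0//; exact: normc_dcoef.
apply: le_trans (hK W _ M gamma _ _ M1 Wp m0 hd hg) _; rewrite lee_fin.
set T := A `^ p; have T0 : 0 <= T by rewrite powR_ge0.
have -> : M `^ (- (2 / 5)) = M `^ (- 2^-1) * (m * m).
  rewrite /m -!powRD ?(gt_eqF M0) ?implybT//; congr (_ `^ _); lra.
have g0 : 0 <= M `^ (- 2^-1) by rewrite powR_ge0.
rewrite [leLHS](_ : _ = (1 + Cw * m) * (K * M `^ (- 2^-1) * (C * T * (B1 * (B2 * (B3 * (Cw * m)))))));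
  last by ring.
rewrite [leRHS](_ : _ = ((1 + Cw) * m) * (K * M `^ (- 2^-1) * (C * T * (B1 * (B2 * (B3 * (Cw * m)))))));
  last by ring.
rewrite ler_wpM2r//; first by do ![apply: mulr_ge0 => //]; apply: ltW.
by rewrite mulrDl mul1r lerD2r.
Qed.

End Trilinear.

(** * Picard iteration on space-time Fourier coefficients *)

Section Picard.
Context {R : realType}.
Local Notation J n := (japanese n : R).
Local Notation C := R[i].
Variables (p : R) (p1 : 1 <= p) (M : R) (gamma eta : int -> C) (kw : C).

(** Coefficients, up to the factor exp(- M t), of the integral equation for a
   profile with initial datum a. The windows make the time variable periodic. *)
Definition picard_map (a : int -> C) (c : int -> int -> C) (n l : int) : C :=
  a n * gamma l + kw * duhamel M gamma (dcoef eta c c c) n l.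

Definition picard (a : int -> C) (m : nat) : int -> int -> C :=
  iter m (picard_map a) (fun _ _ => 0).

Definition anorm (W : int -> R) (a : int -> C) : \bar R :=
  nsum (fun n => ((W n * normc (a n)) `^ p)%:E).

Lemma anorm_ge0 W a : (0 <= anorm W a)%E.
Proof. by apply: nsum_ge0 => n; rewrite lee_fin powR_ge0. Qed.

Local Notation xnc := (xnc p).
Variables (W : int -> R) (A G T : R).
Hypotheses (W0 : forall n, 0 < W n) (A0 : 0 < A) (M1 : 1 <= M) (G0 : 0 <= G) (T0 : 0 <= T).
Hypothesis hW : forall j k l, W (j - k + l) <= A * (W j * W k * W l).
Hypothesis hgamma : (tnorm p (fun l => normc (gamma l)) <= G%:E)%E.
Hypothesis heta : (tnorm p (fun l => normc (eta l)) <= G%:E)%E.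
Hypothesis hkw : normc kw = 1.
Hypothesis hT : forall c1 c2 c3 (B1 B2 B3 : R), 0 <= B1 -> 0 <= B2 -> 0 <= B3 ->
  (xnc W c1 <= B1%:E)%E -> (xnc W c2 <= B2%:E)%E -> (xnc W c3 <= B3%:E)%E ->
  (xnc W (duhamel M gamma (dcoef eta c1 c2 c3)) <= (T * (B1 * (B2 * B3)))%:E)%E.

Let W0' n : 0 <= W n. Proof. exact: ltW. Qed.
Let p0 : 0 < p. Proof. exact: lt_le_trans ltr01 p1. Qed.

Lemma xnc_data a (rho : R) : (anorm W a <= rho%:E)%E ->
  (xnc W (fun n l => a n * gamma l)%R <= (G * rho)%:E)%E.
Proof.
move=> ha; rewrite /xnc /xnorm.
apply: (@le_trans _ _ (nsum (fun n => (G * (W n * normc (a n)) `^ p)%:E))); last first.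
  by apply: nsum_scale => // n; exact: powR_ge0.
apply: le_nsum => n; rewrite mulrC.
apply: (@le_trans _ _ (nsum (fun l => ((W n * normc (a n)) `^ p * (J l `^ (bexp p) * normc (gamma l)) `^ p)%:E))).
  apply: le_nsum => l; rewrite lee_fin -powRM ?mulr_ge0 ?normc_ge0 ?powR_ge0// normcM.
  rewrite le_eqVlt; apply/orP; left; apply/eqP; congr (_ `^ _); ring.
by apply: nsum_scale => // [|l]; exact: powR_ge0.
Qed.

Lemma xnc0 : xnc W (fun _ _ => 0) = 0%E.
Proof.
rewrite /xnc /xnorm -[RHS](@nsum0 _ int); apply: eq_nsum => n.
by rewrite -[RHS](@nsum0 _ int); apply: eq_nsum => l; rewrite normc0 mulr0 powR0// gt_eqF.
Qed.

(** The condition on Y says that the ball of radius Y is mapped to itself. *)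
Lemma picard_bound a (rho Y : R) : 0 <= Y -> (anorm W a <= rho%:E)%E ->
  2 `^ p * (G * rho + T * (Y * (Y * Y))) <= Y ->
  forall m, (xnc W (picard a m) <= Y%:E)%E.
Proof.
move=> Y0 ha hY; elim=> [|m IH]; first by rewrite xnc0 lee_fin.
rewrite /picard iterS -/(picard a m) /picard_map.
apply: le_trans (xncD p1 _ _ W0') _; rewrite xncZ//.
apply: (@le_trans _ _ ((2 `^ p)%:E * ((G * rho)%:E + (T * (Y * (Y * Y)))%:E))%E); last first.
  by rewrite -EFinD -EFinM lee_fin.
by apply: lee_wpmul2l; [rewrite lee_fin powR_ge0|apply: leeD; [exact: xnc_data|exact: hT]].
Qed.

Lemma dcoef_csummable c1 c2 c3 (B1 B2 B3 : R) n nu :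
  (xnc W c1 <= B1%:E)%E -> (xnc W c2 <= B2%:E)%E -> (xnc W c3 <= B3%:E)%E ->
  csummable (fun t : idx => (@kap R n t)%:C * (c1 t.1.1.1.1 t.1.1.2 *
    conjc (c2 t.1.1.1.2 t.1.2) * c3 (fl n t) t.2 * eta (ft n nu t))).
Proof.
move=> h1 h2 h3.
have pos c (B : R) : (xnc W c <= B%:E)%E -> 0 <= B.
  by move=> h; rewrite -lee_fin; apply: le_trans h; exact: xnorm_ge0.
have := @tsum_lty _ p p1 W A _ _ _ _ B1 B2 B3 G n nu W0 A0 hW
  (fun n l => normc_ge0 (c1 n l)) (fun n l => normc_ge0 (c2 n l)) (fun n l => normc_ge0 (c3 n l))
  (fun l => normc_ge0 (eta l)) (pos _ _ h1) (pos _ _ h2) (pos _ _ h3) G0 h1 h2 h3 heta.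
apply: le_lt_trans; apply: le_nsum => t.
by rewrite lee_fin !normcM normcJ normcR.
Qed.

Lemma xnc_dominated c d (B : R) : (forall n l, normc (c n l) <= normc (d n l)) ->
  (xnc W d <= B%:E)%E -> (xnc W c <= B%:E)%E.
Proof. by move=> cd; apply: le_trans; apply: le_xnorm => // n l; exact: normc_ge0. Qed.

Lemma csumB3 {S : choiceType} (f g x y z : S -> C) :
  csummable f -> csummable g -> csummable x -> csummable y -> csummable z ->
  (forall t, f t - g t = x t + (y t + z t)) ->
  csum f - csum g = csum x + (csum y + csum z).
Proof.
move=> sf sg sx sy sz E; rewrite -csumB// -(csumD sy sz) -csumD//; last exact: csummableD.
exact: eq_csum.
Qed.

(** Trilinearity, changing one argument at a time. *)
Lemma dcoefB c e (B : R) n nu : (xnc W c <= B%:E)%E -> (xnc W e <= B%:E)%E ->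
  let d := fun n l => c n l - e n l in
  dcoef eta c c c n nu - dcoef eta e e e n nu =
  dcoef eta d c c n nu + (dcoef eta e d c n nu + dcoef eta e e d n nu).
Proof.
move=> hc he d.
have hd : (xnc W d <= (2 `^ p * (B + B))%:E)%E.
  apply: le_trans (xncD p1 c (fun n l => - e n l) W0') _.
  rewrite EFinM EFinD; apply: lee_wpmul2l; first by rewrite lee_fin powR_ge0.
  by apply: leeD hc _; apply: xnc_dominated he => k l; rewrite normcN.
have S := dcoef_csummable.
rewrite /dcoef; apply: csumB3.
- exact: (S c c c B B B n nu hc hc hc).
- exact: (S e e e B B B n nu he he he).
- exact: (S d c c _ B B n nu hd hc hc).
- exact: (S e d c B _ B n nu he hd hc).
- exact: (S e e d B B _ n nu he he hd).
by move=> t; rewrite /d rmorphB /=; ring.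
Qed.

Lemma duhamel_csummable c1 c2 c3 (B1 B2 B3 : R) n :
  (xnc W c1 <= B1%:E)%E -> (xnc W c2 <= B2%:E)%E -> (xnc W c3 <= B3%:E)%E ->
  csummable (fun l => dcoef eta c1 c2 c3 n l * resolvent M l).
Proof.
move=> h1 h2 h3.
have pos c (B : R) : (xnc W c <= B%:E)%E -> 0 <= B.
  by move=> h; rewrite -lee_fin; apply: le_trans h; exact: xnorm_ge0.
have [C0 C00 hC] := trilinear p1.
have := hC W A W0' A0 hW _ _ _ _ B1 B2 B3 G (fun n l => normc_ge0 (c1 n l))
  (fun n l => normc_ge0 (c2 n l)) (fun n l => normc_ge0 (c3 n l)) (fun l => normc_ge0 (eta l))
  (pos _ _ h1) (pos _ _ h2) (pos _ _ h3) G0 h1 h2 h3 heta.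
move=> h.
have hd : (dnorm p W (dcoef eta c1 c2 c3) <= (C0 * A `^ p * (B1 * (B2 * (B3 * G))))%:E)%E.
  apply: le_trans h; apply: le_nsum => k; apply: le_nsum => nu.
  rewrite -poweR_EFin; apply: gt0_ler_poweR; rewrite ?(ltW p0)// ?in_itv/= ?andbT ?leey ?lee_fin.
  - by rewrite !mulr_ge0 ?powR_ge0 ?normc_ge0.
  - rewrite mule_ge0// ?lee_fin ?mulr_ge0 ?powR_ge0//.
    by apply: nsum_ge0 => t; rewrite lee_fin !mulr_ge0 ?normc_ge0.
  - rewrite EFinM lee_wpmul2l ?lee_fin ?mulr_ge0 ?powR_ge0//; exact: normc_dcoef.
exact: xnc_fin_csummable (xnorm_resolvent p1 M1 W0' hd).
Qed.

Lemma duhamelD d1 d2 n l :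
  csummable (fun l => d1 n l * resolvent M l) ->
  csummable (fun l => d2 n l * resolvent M l) ->
  duhamel M gamma (fun n l => d1 n l + d2 n l) n l = duhamel M gamma d1 n l + duhamel M gamma d2 n l.
Proof.
move=> s1 s2; rewrite /duhamel (_ : (fun m => _) = fun m => d1 n m * resolvent M m + d2 n m * resolvent M m).
  by rewrite csumD//; ring.
by apply/funext => m; rewrite mulrDl.
Qed.

(** The second smallness condition makes the map a contraction of ratio 1/2 in
   its iterate, so the difference stays within twice the contribution of the data. *)
Lemma picard_lip a b (rho delta Y : R) : 0 <= Y ->
  (anorm W a <= rho%:E)%E -> (anorm W b <= rho%:E)%E ->
  2 `^ p * (G * rho + T * (Y * (Y * Y))) <= Y ->
  2 `^ p * 2 `^ p * 2 `^ p * (3 * (T * (Y * Y))) <= 2^-1 -> 0 <= delta ->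
  (anorm W (fun n => a n - b n)%R <= delta%:E)%E ->
  forall m, (xnc W (fun n l => picard a m n l - picard b m n l)%R <=
    (2 * (2 `^ p * (G * delta)))%:E)%E.
Proof.
move=> Y0 ha hb hY hT2 d0 hab.
have hma := picard_bound Y0 ha hY; have hmb := picard_bound Y0 hb hY.
elim=> [|m IH].
  rewrite (_ : (fun n l => _) = fun _ _ => 0) ?xnc0 ?lee_fin ?mulr_ge0 ?powR_ge0//.
  by apply/funext => n; apply/funext => l /=; rewrite subrr.
have {}hma := hma m; have {}hmb := hmb m.
set c := picard a m in hma IH *; set e := picard b m in hmb IH *.
pose d n l := c n l - e n l.
set D := 2 * _ in IH *.
have D0 : 0 <= D by rewrite !mulr_ge0 ?powR_ge0.
pose d1 := dcoef eta d c c; pose d2 := dcoef eta e d c; pose d3 := dcoef eta e e d.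
have E : (fun n l => picard a m.+1 n l - picard b m.+1 n l) = (fun n l =>
    (a n - b n) * gamma l + kw * (duhamel M gamma d1 n l +
       (duhamel M gamma d2 n l + duhamel M gamma d3 n l))).
  apply/funext => n; apply/funext => l; rewrite /picard !iterS -!/(picard _ _) -/c -/e /picard_map.
  have s1 : csummable (fun l => d1 n l * resolvent M l) by apply: (duhamel_csummable _ IH hma hma).
  have s2 : csummable (fun l => d2 n l * resolvent M l) by apply: (duhamel_csummable _ hmb IH hma).
  have s3 : csummable (fun l => d3 n l * resolvent M l) by apply: (duhamel_csummable _ hmb hmb IH).
  have s23 : csummable (fun l => (d2 n l + d3 n l) * resolvent M l).
    by under eq_fun do rewrite mulrDl; exact: csummableD.
  rewrite -(@duhamelD d2 d3)// -(@duhamelD d1 (fun n l => d2 n l + d3 n l))//.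
  have se : csummable (fun l => dcoef eta e e e n l * resolvent M l) by apply: (duhamel_csummable _ hmb hmb hmb).
  have -> : duhamel M gamma (dcoef eta c c c) n l = duhamel M gamma (fun n l => (d1 n l + (d2 n l + d3 n l)) + dcoef eta e e e n l) n l.
    congr (duhamel _ _ _ n l); apply/funext => k; apply/funext => nu.
    by rewrite -(dcoefB _ _ hma hmb) subrK.
  rewrite (@duhamelD (fun n l => d1 n l + (d2 n l + d3 n l)) (dcoef eta e e e))//; first by ring.
  by under eq_fun do rewrite mulrDl; exact: csummableD.
rewrite E; apply: le_trans (xncD p1 _ _ W0') _; rewrite xncZ//.
pose t := 2 `^ p; have t1 : 1 <= t by rewrite -(powRr0 2) ler_powR// ?(ltW p0)//; lra.
have t0 : 0 <= t by lra.
apply: (@le_trans _ _ (t%:E * ((G * delta)%:E + t%:E * ((T * (D * (Y * Y)))%:E +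
    t%:E * ((T * (Y * (D * Y)))%:E + (T * (Y * (Y * D)))%:E))))%E).
  have te : (0 <= t%:E)%E by rewrite lee_fin.
  apply: lee_wpmul2l => //; apply: leeD; first exact: xnc_data.
  apply: le_trans (xncD p1 _ _ W0') _; apply: lee_wpmul2l => //; apply: leeD; first exact: hT.
  by apply: le_trans (xncD p1 _ _ W0') _; apply: lee_wpmul2l => //; apply: leeD; exact: hT.
rewrite -!(EFinD, EFinM) lee_fin.
set Z := T * (Y * Y) in hT2.
have Z0 : 0 <= Z by rewrite !mulr_ge0.
rewrite (_ : T * (D * (Y * Y)) = Z * D) /Z; last by ring.
rewrite (_ : T * (Y * (D * Y)) = Z * D) /Z; last by ring.
rewrite (_ : T * (Y * (Y * D)) = Z * D) /Z; last by ring.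
rewrite -/Z.
have ZD : 0 <= Z * D by rewrite mulr_ge0.
have h1 : t * t * t * (3 * (Z * D)) <= 2^-1 * D.
  by rewrite (_ : t * t * t * (3 * (Z * D)) = t * t * t * (3 * Z) * D) ?ler_wpM2r//; ring.
have DE : D = 2 * (t * (G * delta)) by [].
have tt : t <= t * t by rewrite ler_peMl.
have ttt : t * t <= t * t * t by rewrite ler_peMr// mulr_ge0.
have h2 : t * (G * delta + t * (Z * D + t * (Z * D + Z * D))) <=
   t * (G * delta) + t * t * t * (3 * (Z * D)).
  rewrite -subr_ge0 (_ : _ - _ = (t * t * t - t * t) * (Z * D)); last by ring.
  by rewrite mulr_ge0// subr_ge0.
lra.
Qed.

(** At a fixed time the coefficients are dominated by a sum over temporal
   frequencies, which the embedding of the temporal norm into l^1 controls. *)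
Lemma anorm_l1 : exists2 K : R, 0 < K & forall c (B : R) (a : int -> C),
  (xnc W c <= B%:E)%E ->
  (forall n, ((normc (a n))%:E <= nsum (fun l => (normc (c n l))%:E))%E) ->
  (anorm W a <= (K * B)%:E)%E.
Proof.
have [K K0 hK] := tnorm_l1 p1.
exists (K `^ p) => [|c B a hc ha]; first by rewrite powR_gt0.
have K0' := ltW K0.
apply: (@le_trans _ _ (nsum (fun n => (K `^ p)%:E * tnorm p (fun l => W n * normc (c n l))%R)%E)).
  apply: le_nsum => n.
  have Wc l : 0 <= W n * normc (c n l) by rewrite mulr_ge0 ?normc_ge0.
  set S := tnorm _ _; have S0 : (0 <= S)%E by exact: tnorm_ge0.
  have SB : (S <= B%:E)%E.
    apply: le_trans hc; rewrite /xnc xnorm_tnorm.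
    by apply: (@nsum_term _ _ (fun n => tnorm p (fun l => W n * normc (c n l)))) => k; exact: tnorm_ge0.
  have Sfin : S \is a fin_num by rewrite ge0_fin_numE//; apply: le_lt_trans SB (ltry _).
  have f0 : 0 <= fine S by rewrite fine_ge0.
  have h : (nsum (fun l => (W n * normc (c n l))%:E) <= (K * fine S `^ p^-1)%:E)%E.
    by apply: hK; rewrite ?powR_ge0// -powRrM mulVf ?gt_eqF// powRr1// fineK.
  have h2 : W n * normc (a n) <= K * fine S `^ p^-1.
    rewrite -lee_fin; apply: le_trans h; under [leRHS]eq_nsum do rewrite EFinM.
    rewrite nsumZ//; last by move=> l; rewrite lee_fin normc_ge0.
    by rewrite EFinM lee_wpmul2l ?lee_fin.
  rewrite -(fineK Sfin) -EFinM lee_fin.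
  rewrite (_ : K `^ p * fine S = (K * fine S `^ p^-1) `^ p); last first.
    by rewrite powRM ?powR_ge0// -powRrM mulVf ?gt_eqF// powRr1.
  by apply: ge0_ler_powR; rewrite ?nnegrE ?(ltW p0) ?mulr_ge0 ?powR_ge0 ?normc_ge0.
rewrite nsumZ ?powR_ge0//; last by move=> n; exact: tnorm_ge0.
by rewrite EFinM; apply: lee_wpmul2l; [rewrite lee_fin powR_ge0|rewrite -xnorm_tnorm].
Qed.

(** For weights growing like <n>^2 this makes all iterates decay like <n>^-2, fast
   enough to work with the equation pointwise in time. *)
Lemma row_bound : exists2 K : R, 0 < K & forall c (Y : R) n, 0 <= Y ->
  (xnc W c <= Y%:E)%E -> (nsum (fun l => (normc (c n l))%:E) <= (K * Y `^ p^-1 / W n)%:E)%E.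
Proof.
have [K K0 hK] := tnorm_l1 p1.
exists K => // c Y n Y0 hc.
have h : (nsum (fun l => (W n * normc (c n l))%:E) <= (K * Y `^ p^-1)%:E)%E.
  apply: hK; [by move=> l; rewrite mulr_ge0 ?normc_ge0|exact: powR_ge0|].
  rewrite -powRrM mulVf ?gt_eqF// powRr1//.
  apply: le_trans hc; rewrite /xnc xnorm_tnorm.
  by apply: (@nsum_term _ _ (fun n => tnorm p (fun l => W n * normc (c n l)))) => k; exact: tnorm_ge0.
rewrite mulrC; apply: le_trans (nsum_scale _ _ h); rewrite ?invr_ge0//.
  by apply: le_nsum => l; rewrite mulrA mulVf ?mul1r// gt_eqF.
by move=> l; rewrite mulr_ge0 ?normc_ge0.
Qed.

End Picard.

(** * Complex-valued functions of a real variable *)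

Section ComplexCalculus.
Context {R : realType}.
Local Notation C := R[i].
Local Notation Re := complex.Re.
Local Notation Im := complex.Im.

Definition cis (x : R) : C := cos x +i* sin x.

Lemma cisD x y : cis (x + y) = cis x * cis y.
Proof. by apply: complex_eq; rewrite ?ReM ?ImM /= ?cosD ?sinD//; ring. Qed.

Lemma cis0 : cis 0 = 1.
Proof. by rewrite /cis cos0 sin0. Qed.

Lemma normc_cis x : normc (cis x) = 1.
Proof. by rewrite normcE /= cos2Dsin2 sqrtr1. Qed.

Lemma cisJ x : conjc (cis x) = cis (- x).
Proof. by rewrite /cis cosN sinN. Qed.

Definition is_cderive (x : R) (f : R -> C) (d : C) : Prop :=
  is_derive x 1 (fun t => Re (f t)) (Re d) /\ is_derive x 1 (fun t => Im (f t)) (Im d).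

Lemma is_cderiveD x f g df dg : is_cderive x f df -> is_cderive x g dg ->
  is_cderive x (fun t => f t + g t) (df + dg).
Proof.
move=> [f1 f2] [g1 g2]; split.
  rewrite ReD (_ : (fun t => _) = (fun t => Re (f t)) \+ (fun t => Re (g t))); first exact: is_deriveD.
  by apply/funext => t; rewrite ReD.
rewrite ImD (_ : (fun t => _) = (fun t => Im (f t)) \+ (fun t => Im (g t))); first exact: is_deriveD.
by apply/funext => t; rewrite ImD.
Qed.

Lemma is_cderiveM x f g df dg : is_cderive x f df -> is_cderive x g dg ->
  is_cderive x (fun t => f t * g t) (df * g x + f x * dg).
Proof.
move=> [f1 f2] [g1 g2]; split.
  rewrite (_ : (fun t => _) = (fun t => Re (f t)) * (fun t => Re (g t)) - (fun t => Im (f t)) * (fun t => Im (g t))); last first.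
    by apply/funext => t; rewrite ReM.
  apply: is_derive_eq; rewrite !ReD !ReM /GRing.scale /=; ring.
rewrite (_ : (fun t => _) = (fun t => Re (f t)) * (fun t => Im (g t)) + (fun t => Im (f t)) * (fun t => Re (g t))); last first.
  by apply/funext => t; rewrite ImM.
apply: is_derive_eq; rewrite !ImD !ImM /GRing.scale /=; ring.
Qed.

Lemma is_cderive_cst x (c : C) : is_cderive x (fun _ => c) 0.
Proof. by split; exact: is_derive_cst. Qed.

Lemma is_cderiveZ x f df (c : C) : is_cderive x f df ->
  is_cderive x (fun t => c * f t) (c * df).
Proof.
move=> hf; have := is_cderiveM (is_cderive_cst x c) hf.
by rewrite mul0r add0r.
Qed.

Lemma is_cderiveB x f g df dg : is_cderive x f df -> is_cderive x g dg ->
  is_cderive x (fun t => f t - g t) (df - dg).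
Proof.
move=> hf hg; have := is_cderiveD hf (is_cderiveZ (-1) hg).
by under eq_fun do rewrite mulN1r; rewrite mulN1r.
Qed.

Lemma is_cderive_sum x (I : Type) (s : seq I) (f : I -> R -> C) (d : I -> C) :
  (forall i, is_cderive x (f i) (d i)) ->
  is_cderive x (fun t => \sum_(i <- s) f i t) (\sum_(i <- s) d i).
Proof.
move=> h; elim: s => [|i s IH].
  by under eq_fun do rewrite big_nil; rewrite big_nil; exact: is_cderive_cst.
by under eq_fun do rewrite big_cons; rewrite big_cons; exact: is_cderiveD.
Qed.

Lemma is_cderive_cis x (a : R) : is_cderive x (fun t => cis (a * t)) ((0 +i* a) * cis (a * x)).
Proof.
have Hc : is_derive x 1 (fun y : R => a * y) (a * 1).
  exact: (is_deriveZ a (is_derive_id x 1)).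
split.
  have := is_derive1_comp (is_derive_cos (a * x)) Hc.
  by move=> h; apply: (is_derive_eq h); rewrite ReM /=; ring.
have := is_derive1_comp (is_derive_sin (a * x)) Hc.
by move=> h; apply: (is_derive_eq h); rewrite ImM /=; ring.
Qed.

Lemma is_cderive_expR x (a : R) : is_cderive x (fun t => (expR (a * t))%:C) ((a * expR (a * x))%:C).
Proof.
have Hc : is_derive x 1 (fun y : R => a * y) (a * 1).
  exact: (is_deriveZ a (is_derive_id x 1)).
split; last exact: is_derive_cst.
have := is_derive1_comp (is_derive_expR (a * x)) Hc.
by move=> h; apply: (is_derive_eq h) => /=; ring.
Qed.

Lemma is_cderive_cvg x f d : is_cderive x f d ->
  {for x, continuous (fun t => Re (f t))} /\ {for x, continuous (fun t => Im (f t))}.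
Proof.
by move=> [f1 f2]; split; apply: differentiable_continuous; apply/derivable1_diffP; exact: ex_derive.
Qed.

(** By testing against the direction of f t - f 0. *)
Lemma cmvt (T : R) (f df : R -> C) (g dg : R -> R) :
  (forall t, 0 < t < T -> is_cderive t f (df t)) ->
  (forall t : R, is_derive t 1 g (dg t)) ->
  {within `[0, T], continuous (fun t => Re (f t))} ->
  {within `[0, T], continuous (fun t => Im (f t))} ->
  (forall t, 0 < t < T -> normc (df t) <= dg t) ->
  forall t, 0 <= t <= T -> normc (f t - f 0) <= g t - g 0.
Proof.
move=> hf hg cr ci hle t /andP[t0 tT].
have cg : continuous g.
  by move=> x; apply: differentiable_continuous; apply/derivable1_diffP; apply: ex_derive.
set z := f t - f 0.
have key (th : C) : normc th <= 1 -> Re (th * z) <= g t - g 0.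
  move=> hth.
  pose y s := Re th * Re (f s) - Im th * Im (f s) - g s.
  pose dy s := Re th * Re (df s) - Im th * Im (df s) - dg s.
  have hy s : s \in `]0, T[%R -> is_derive s 1 y (dy s).
    rewrite in_itv/= => sT; have [h1 h2] := hf _ sT.
    have := is_deriveB (is_deriveB (is_deriveZ (Re th) h1) (is_deriveZ (Im th) h2)) (hg s).
    exact.
  have cy : {within `[0, T], continuous y}.
    have c1 : {within `[0, T], continuous (fun s => Re th * Re (f s))}.
      by move=> s; apply: cvgM; [exact: cvg_cst|exact: cr].
    have c2 : {within `[0, T], continuous (fun s => Im th * Im (f s))}.
      by move=> s; apply: cvgM; [exact: cvg_cst|exact: ci].
    have c3 : {within `[0, T], continuous g} by exact: continuous_subspaceT.
    by move=> s; apply: cvgB; [apply: cvgB; [exact: c1|exact: c2]|exact: c3].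
  have h := @ler0_derive1_le_cc R y 0 T _ _ cy.
  have : y t <= y 0.
    apply: h; rewrite ?in_itv/= ?lexx ?t0 ?tT ?(le_trans t0 tT)//.
      by move=> s sT; have := hy s sT => hh; exact: ex_derive.
    move=> s sT; rewrite derive1E (@derive_val _ _ _ _ _ _ _ (hy s sT)) /dy.
    rewrite subr_le0; move: sT; rewrite in_itv/= => sT.
    apply: le_trans (hle s sT); rewrite -ReM; apply: le_trans (ler_norm _) _.
    apply: le_trans (normc_Re _) _; rewrite normcM ler_piMl ?normc_ge0//.
  rewrite /y /z ReM ReD ImD ReN ImN; lra.
have [z0|z0] := eqVneq z 0.
  rewrite z0 [normc _]normc0; have := key 0; rewrite mul0r /=; apply.
  by rewrite expr0n /= addr0 sqrtr0 ler01.
have nz0 : normc z != 0 by rewrite normc_eq0.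
pose th : C := conjc z * ((normc z)^-1)%:C.
have nth : normc th = 1.
  by rewrite normcM normcJ normcR ger0_norm ?invr_ge0 ?normc_ge0// mulfV.
have := key th; rewrite nth lexx => /(_ isT).
rewrite /th mulrAC.
have -> : conjc z * z = ((normc z) ^+ 2)%:C.
  by rewrite sqr_normc; apply: complex_eq; rewrite ?ReM ?ImM; case: (z) => a b /=; ring.
by rewrite /= mulr0 subr0 expr2 mulfK.
Qed.

End ComplexCalculus.

(** * The nonlinearity on rapidly decreasing sequences *)

Section Nonlinearity.
Context {R : realType}.
Local Notation J n := (japanese n : R).
Local Notation C := R[i].

(** The cubic nonlinearity seen by the profiles, with the resonant interactions
   removed by the mean. *)
Definition nl (a : int -> C) (t : R) (n : int) : C :=
  csum (fun jk : int * int => (@resc R n jk.1 jk.2)%:C * cis ((phase n jk.1 jk.2)%:~R * t) *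
    (a jk.1 * conjc (a jk.2) * a (n - jk.1 + jk.2))).

Let w (n : int) : R := J n `^ (- 2).

(** Two applications of [japanese_conv]. *)
Lemma japanese_conv3 : exists2 K : R, 0 < K & forall n : int,
  (nsum (fun jk : int * int => (w jk.1 * w jk.2 * w (n - jk.1 + jk.2))%:E) <= (K * w n)%:E)%E.
Proof.
have w0 x : 0 <= w x by rewrite powR_ge0.
pose K : R := 2 `^ 2 * (2 * jsum 2) + 1.
have K0 : 0 <= 2 `^ 2 * (2 * @jsum R 2) by rewrite mulr_ge0 ?powR_ge0// mulr_ge0 ?jsum_ge0.
have conv1 (x : int) : (nsum (fun y : int => (w y * w (x - y))%:E) <= (K * w x)%:E)%E.
  have l2 : 1 < 2 :> R by lra.
  apply: le_trans (japanese_conv x l2) _; rewrite lee_fin ler_wpM2r ?powR_ge0//.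
  by rewrite /K lerDl.
have Kp : 0 < K by rewrite /K; lra.
clearbody K.
have conv2 (x : int) : (nsum (fun y : int => (w y * w (x + y))%:E) <= (K * w x)%:E)%E.
  rewrite -(nsum_reindex (fun y : int => (w y * w (x + y))%:E) bijective_oppz) /=.
  by apply: le_trans (conv1 x); apply: le_nsum => y; rewrite /w japaneseN.
exists (K * K) => [|n]; first by rewrite mulr_gt0.
rewrite -(nsum_pair (f := fun j k => (w j * w k * w (n - j + k))%:E)); last first.
  by move=> j k; rewrite lee_fin !mulr_ge0.
apply: (@le_trans _ _ (nsum (fun j => (K * (w j * w (n - j)))%:E))).
  apply: le_nsum => j.
  rewrite (@eq_nsum _ _ _ (fun k => (w j * (w k * w (n - j + k)))%:E)); last by move=> k; rewrite mulrA.
  rewrite mulrCA; apply: nsum_scale => // k; exact: mulr_ge0.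
rewrite -mulrA; apply: nsum_scale => //; [exact: ltW|move=> j; exact: mulr_ge0].
Qed.

Lemma nl_term_csummable (a1 a2 a3 : int -> C) (B1 B2 B3 : R) t n :
  (forall n, normc (a1 n) <= B1 * w n) -> (forall n, normc (a2 n) <= B2 * w n) ->
  (forall n, normc (a3 n) <= B3 * w n) ->
  csummable (fun jk : int * int => (@resc R n jk.1 jk.2)%:C * cis ((phase n jk.1 jk.2)%:~R * t) *
    (a1 jk.1 * conjc (a2 jk.2) * a3 (n - jk.1 + jk.2))) /\
  forall K, (forall n : int,
  (nsum (fun jk : int * int => (w jk.1 * w jk.2 * w (n - jk.1 + jk.2))%:E) <= (K * w n)%:E)%E) ->
  normc (csum (fun jk : int * int => (@resc R n jk.1 jk.2)%:C * cis ((phase n jk.1 jk.2)%:~R * t) *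
    (a1 jk.1 * conjc (a2 jk.2) * a3 (n - jk.1 + jk.2)))) <= B1 * B2 * B3 * K * w n.
Proof.
move=> h1 h2 h3.
have w0 x : 0 < w x by rewrite powR_japanese_gt0.
have pos (a : int -> C) (B : R) : (forall n, normc (a n) <= B * w n) -> 0 <= B.
  by move=> h; rewrite -(pmulr_lge0 _ (w0 0)); apply: le_trans (h 0); exact: normc_ge0.
have B10 := pos _ _ h1; have B20 := pos _ _ h2; have B30 := pos _ _ h3.
have B0 : 0 <= B1 * B2 * B3 by rewrite !mulr_ge0.
have pt (jk : int * int) : normc ((@resc R n jk.1 jk.2)%:C * cis ((phase n jk.1 jk.2)%:~R * t) *
    (a1 jk.1 * conjc (a2 jk.2) * a3 (n - jk.1 + jk.2))) <=
    (B1 * B2 * B3) * (w jk.1 * w jk.2 * w (n - jk.1 + jk.2)).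
  rewrite !normcM normcR normc_cis mulr1 normcJ.
  apply: (@le_trans _ _ (1 * (normc (a1 jk.1) * normc (a2 jk.2) * normc (a3 (n - jk.1 + jk.2))))).
    by rewrite ler_wpM2r ?mulr_ge0 ?normc_ge0// resc_le1.
  rewrite mul1r (_ : B1 * B2 * B3 * _ = (B1 * w jk.1) * (B2 * w jk.2) * (B3 * w (n - jk.1 + jk.2))); last by ring.
  by do 2?[apply: ler_pM => //]; rewrite ?mulr_ge0 ?normc_ge0.
have ww (jk : int * int) : 0 <= w jk.1 * w jk.2 * w (n - jk.1 + jk.2) by rewrite !mulr_ge0 ?(ltW (w0 _)).
split.
  have [K K0 hK] := japanese_conv3.
  apply: csummable_le pt _.
  by apply: le_lt_trans (nsum_scale B0 ww (hK n)) (ltry _).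
move=> K hK; apply: normc_csum_le pt _.
by apply: le_trans (nsum_scale B0 ww (hK n)) _; rewrite mulrA.
Qed.

(** Trilinearity reduces it to the convolution bound for <n>^-2. *)
Lemma nl_lip : exists2 K : R, 0 < K & forall (a b : int -> C) (B D : R) t n,
  (forall n, normc (a n) <= B * w n) -> (forall n, normc (b n) <= B * w n) ->
  (forall n, normc (a n - b n) <= D * w n) ->
  normc (nl a t n - nl b t n) <= K * B ^+ 2 * D * w n.
Proof.
have [K K0 hK] := japanese_conv3.
exists (3 * K) => [|a b B D t n ha hb hd]; first by rewrite mulr_gt0.
pose d n := a n - b n.
have [sa _] := nl_term_csummable t n ha ha ha.
have [sb _] := nl_term_csummable t n hb hb hb.
have [s1 /(_ K hK) n1] := nl_term_csummable t n (hd : forall n, normc (d n) <= D * w n) ha ha.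
have [s2 /(_ K hK) n2] := nl_term_csummable t n hb (hd : forall n, normc (d n) <= D * w n) ha.
have [s3 /(_ K hK) n3] := nl_term_csummable t n hb hb (hd : forall n, normc (d n) <= D * w n).
rewrite /nl (csumB3 sa sb s1 s2 s3); last first.
  by move=> jk; rewrite /d rmorphB /=; ring.
apply: le_trans (le_normcD _ _) _.
have := le_normcD (csum (fun jk : int * int => (@resc R n jk.1 jk.2)%:C * cis ((phase n jk.1 jk.2)%:~R * t) *
    (b jk.1 * conjc (d jk.2) * a (n - jk.1 + jk.2)))) (csum (fun jk : int * int => (@resc R n jk.1 jk.2)%:C * cis ((phase n jk.1 jk.2)%:~R * t) *
    (b jk.1 * conjc (b jk.2) * d (n - jk.1 + jk.2)))).
have -> : 3 * K * B ^+ 2 * D * w n = D * B * B * K * w n + (B * D * B * K * w n + B * B * D * K * w n) by ring.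
move=> h; rewrite lerD//; apply: le_trans h _; exact: lerD.
Qed.

Lemma nl_scale (a : int -> C) (r : R) (B : R) t n : (forall n, normc (a n) <= B * w n) ->
  nl (fun n => r%:C * a n) t n = (r ^+ 3)%:C * nl a t n.
Proof.
move=> ha; rewrite /nl -csumZ; last by have [] := nl_term_csummable t n ha ha ha.
apply: eq_csum => jk.
have cj x : conjc (r%:C * x) = r%:C * conjc x.
  by rewrite rmorphM; congr (_ * _); exact: conjc_real.
rewrite cj.
have -> : (r ^+ 3)%:C = r%:C * r%:C * r%:C :> C by rewrite -!rmorphM /= !exprS expr0 mulr1 mulrA.
ring.
Qed.

Definition ev (c : int -> int -> C) (t : R) (n : int) : C :=
  csum (fun l : int => c n l * cis (l%:~R * t)).

Lemma normc_ev c t n : ((normc (ev c t n))%:E <= nsum (fun l => (normc (c n l))%:E))%E.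
Proof.
apply: le_trans (normc_csum _) _; apply: le_nsum => l.
by rewrite lee_fin normcM normc_cis mulr1.
Qed.

Lemma nsum_mul_le {T U : choiceType} (f : T -> R) (g : U -> R) (a b : R) :
  (forall i, 0 <= f i) -> (forall i, 0 <= g i) ->
  (nsum (fun i => (f i)%:E) <= a%:E)%E -> (nsum (fun i => (g i)%:E) <= b%:E)%E ->
  (nsum (fun k : T * U => (f k.1 * g k.2)%:E) <= (a * b)%:E)%E.
Proof.
move=> f0 g0 fa gb.
have b0 : 0 <= b by rewrite -lee_fin; apply: le_trans gb; apply: nsum_ge0 => i; rewrite lee_fin.
rewrite -(nsum_pair (f := fun i j => (f i * g j)%:E)); last by move=> i j; rewrite lee_fin mulr_ge0.
apply: (@le_trans _ _ (nsum (fun i => (b * f i)%:E))).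
  by apply: le_nsum => i; rewrite [b * _]mulrC; exact: nsum_scale.
by rewrite mulrC; exact: nsum_scale.
Qed.

Lemma csummable_bound {T : choiceType} (f : T -> C) : csummable f ->
  exists B : R, (nsum (fun i => (normc (f i))%:E) <= B%:E)%E.
Proof.
move=> fs; exists (fine (nsum (fun i => (normc (f i))%:E))).
rewrite fineK// ge0_fin_numE//; apply: nsum_ge0 => i; rewrite lee_fin; exact: normc_ge0.
Qed.

Lemma csummable_mul {T U : choiceType} (f : T -> C) (g : U -> C) :
  csummable f -> csummable g -> csummable (fun k : T * U => f k.1 * g k.2).
Proof.
move=> /csummable_bound[a fa] /csummable_bound[b gb].
apply: (@csummable_le _ _ _ (fun k => normc (f k.1) * normc (g k.2))).
  by move=> k; rewrite normcM.
apply: le_lt_trans (nsum_mul_le (fun i => normc_ge0 (f i)) (fun i => normc_ge0 (g i)) fa gb) (ltry _).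
Qed.

Lemma csum_mul {T U : choiceType} (f : T -> C) (g : U -> C) :
  csummable f -> csummable g -> csum f * csum g = csum (fun k : T * U => f k.1 * g k.2).
Proof.
move=> fs gs; rewrite -(@csum_pair _ _ _ (fun i j => f i * g j)); last exact: csummable_mul.
rewrite mulrC -csumZ//; apply: eq_csum => i; by rewrite csumZ// mulrC.
Qed.

Definition idx_split (k : (int * int) * (int * int * int)) : idx :=
  (k.1.1, k.1.2, k.2.1.1, k.2.1.2, k.2.2).

Lemma bijective_idx_split : bijective idx_split.
Proof.
exists (fun t : idx => ((t.1.1.1.1, t.1.1.1.2), (t.1.1.2, t.1.2, t.2))).
  by move=> [[j k] [[a b] c]].
by move=> [[[[j k] a] b] c].
Qed.

(** The Fourier coefficients of a product are convolutions; the exponentials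
   exp(i phase t) shift the temporal frequency. *)
Lemma ev_dcoef (c : int -> int -> C) (eta : int -> C) (B : R) t n :
  (forall n, (nsum (fun l => (normc (c n l))%:E) <= (B * w n)%:E)%E) -> csummable eta ->
  csummable (dcoef eta c c c n) /\
  ev (dcoef eta c c c) t n = csum (fun l => eta l * cis (l%:~R * t)) * nl (ev c t) t n.
Proof.
move=> hc etas.
have [E hE] := csummable_bound etas.
have cs m : csummable (c m) by apply: le_lt_trans (hc m) (ltry _).
have B0 : 0 <= B.
  rewrite -(pmulr_lge0 _ (powR_japanese_gt0 0 (-2) : 0 < w 0)) -lee_fin; apply: le_trans (hc 0).
  by apply: nsum_ge0 => i; rewrite lee_fin; exact: normc_ge0.
have w0 x : 0 <= w x by rewrite powR_ge0.
have E0 : 0 <= E.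
  by rewrite -lee_fin; apply: le_trans hE; apply: nsum_ge0 => i; rewrite lee_fin; exact: normc_ge0.
pose q (t : idx) := normc (c t.1.1.1.1 t.1.1.2) * normc (c t.1.1.1.2 t.1.2) * normc (c (fl n t) t.2).
have q0 tt : 0 <= q tt by rewrite !mulr_ge0 ?normc_ge0.
have [K K0 hK] := japanese_conv3.
have hq : (nsum (fun t => (q t)%:E) <= (B * B * B * (K * w n))%:E)%E.
  rewrite -(nsum_reindex _ bijective_idx_split) /q /idx_split /=.
  rewrite -(nsum_pair (f := fun (jk : int * int) (a : int * int * int) => (normc (c jk.1 a.1.1) * normc (c jk.2 a.1.2) *
      normc (c (fl n (idx_split (jk, a))) a.2))%:E)); last by move=> *; rewrite lee_fin !mulr_ge0 ?normc_ge0.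
  apply: (@le_trans _ _ (nsum (fun jk : int * int => (B * B * B * (w jk.1 * w jk.2 * w (n - jk.1 + jk.2)))%:E))).
    apply: le_nsum => jk.
    rewrite (_ : B * B * B * _ = (B * w jk.1) * (B * w jk.2) * (B * w (n - jk.1 + jk.2))); last by ring.
    have h12 := nsum_mul_le (fun i => normc_ge0 (c jk.1 i)) (fun i => normc_ge0 (c jk.2 i)) (hc jk.1) (hc jk.2).
    apply: (nsum_mul_le _ (fun i => normc_ge0 (c (n - jk.1 + jk.2) i)) h12 (hc (n - jk.1 + jk.2))).
    by move=> k; rewrite mulr_ge0 ?normc_ge0.
  by apply: nsum_scale => // [|jk]; rewrite !mulr_ge0.
pose X (t : idx) := (@kap R n t)%:C * (c t.1.1.1.1 t.1.1.2 * conjc (c t.1.1.1.2 t.1.2) * c (fl n t) t.2).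
have hX tt : normc (X tt) <= q tt.
  by rewrite !normcM normcJ normcR -[leRHS]mul1r ler_wpM2r ?resc_le1//; exact: q0.
have Xs : csummable X by apply: csummable_le hX _; apply: le_lt_trans hq (ltry _).
have tot : csummable (fun k : int * idx => X k.2 * eta (ft n k.1 k.2)).
  rewrite /csummable -(nsum_pair (f := fun nu tt => (normc (X tt * eta (ft n nu tt)))%:E)); last first.
    by move=> *; rewrite lee_fin normc_ge0.
  rewrite nsum_swap; last by move=> *; rewrite lee_fin normc_ge0.
  apply: (@le_lt_trans _ _ (nsum (fun tt => (E * q tt)%:E))).
    apply: le_nsum => tt; rewrite mulrC.
    apply: (@le_trans _ _ (nsum (fun nu => (q tt * normc (eta (ft n nu tt)))%:E))).
      by apply: le_nsum => nu; rewrite lee_fin normcM ler_wpM2r ?normc_ge0.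
    apply: nsum_scale => // [nu|]; first exact: normc_ge0.
    rewrite /ft (@eq_nsum _ _ _ (fun nu => (normc (eta (nu - (phase n tt.1.1.1.1 tt.1.1.1.2 + tt.1.1.2 - tt.1.2 + tt.2))))%:E)).
      by rewrite (nsum_reindex (fun nu => (normc (eta nu))%:E) (bijective_subr _)).
    by move=> nu; congr ((normc (eta _))%:E); ring.
  by apply: le_lt_trans (nsum_scale E0 q0 hq) (ltry _).
have dE nu : dcoef eta c c c n nu = csum (fun tt => X tt * eta (ft n nu tt)).
  by apply: eq_csum => tt; rewrite /X; ring.
have rows nu : csummable (fun tt => X tt * eta (ft n nu tt)).
  apply: le_lt_trans tot.
  rewrite -(nsum_pair (f := fun nu tt => (normc (X tt * eta (ft n nu tt)))%:E)); last first.
    by move=> *; rewrite lee_fin normc_ge0.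
  apply: (@nsum_term _ _ (fun nu => nsum (fun tt => (normc (X tt * eta (ft n nu tt)))%:E))) => k.
  by apply: nsum_ge0 => *; rewrite lee_fin normc_ge0.
split.
  rewrite /csummable; apply: le_lt_trans tot.
  rewrite -(nsum_pair (f := fun nu tt => (normc (X tt * eta (ft n nu tt)))%:E)); last first.
    by move=> *; rewrite lee_fin normc_ge0.
  by apply: le_nsum => nu; rewrite dE; exact: normc_csum.
have tot2 : csummable (fun k : int * idx => X k.2 * eta (ft n k.1 k.2) * cis (k.1%:~R * t)).
  by apply: csummable_le tot => k; rewrite normcM normc_cis mulr1.
rewrite /ev (@eq_csum _ _ _ (fun nu => csum (fun tt => X tt * eta (ft n nu tt) * cis (nu%:~R * t)))); last first.
  by move=> nu; rewrite dE mulrC -csumZ//; apply: eq_csum => tt; rewrite mulrC.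
rewrite (csum_swap (f := fun nu tt => X tt * eta (ft n nu tt) * cis (nu%:~R * t)))//.
set H := csum (fun l => eta l * _).
have es : csummable (fun l => eta l * cis (l%:~R * t)).
  by apply: csummable_le etas => l; rewrite normcM normc_cis mulr1.
pose sg (tt : idx) : int := phase n tt.1.1.1.1 tt.1.1.1.2 + tt.1.1.2 - tt.1.2 + tt.2.
rewrite (@eq_csum _ _ _ (fun tt => H * (X tt * cis ((sg tt)%:~R * t)))); last first.
  move=> tt; rewrite -(csum_reindex _ (bijective_addl (sg tt))).
  rewrite (@eq_csum _ _ _ (fun mu => (X tt * cis ((sg tt)%:~R * t)) * (eta mu * cis (mu%:~R * t)))); last first.
    move=> mu; rewrite rmorphD /= mulrDl cisD (_ : ft n (sg tt + mu) tt = mu); first by ring.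
    by rewrite /ft /sg; ring.
  by rewrite csumZ// mulrC.
have Xcs : csummable (fun tt => X tt * cis ((sg tt)%:~R * t)).
  by apply: csummable_le Xs => tt; rewrite normcM normc_cis mulr1.
rewrite csumZ//; congr (_ * _).
rewrite -(csum_reindex _ bijective_idx_split).
rewrite -(csum_pair (f := fun jk a => X (idx_split (jk, a)) * cis ((sg (idx_split (jk, a)))%:~R * t))); last first.
  rewrite /csummable; move: Xcs; rewrite /csummable -(nsum_reindex _ bijective_idx_split).
  by apply: le_lt_trans; apply: le_nsum => -[].
apply: eq_csum => jk.
have s1 m : csummable (fun l => c m l * cis (l%:~R * t)).
  by apply: csummable_le (cs m) => l; rewrite normcM normc_cis mulr1.
have s2 m : csummable (fun l => conjc (c m l * cis (l%:~R * t))).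
  by apply: csummable_le (cs m) => l; rewrite normcJ normcM normc_cis mulr1.
set f1 := fun l => c jk.1 l * _; set f2 := fun l => c jk.2 l * _; set f3 := fun l => c _ l * _.
rewrite -(csumJ f2) (csum_mul (s1 jk.1) (s2 jk.2)) (csum_mul (csummable_mul (s1 jk.1) (s2 jk.2)) (s1 (n - jk.1 + jk.2))).
rewrite -csumZ; last exact: (csummable_mul (csummable_mul (s1 jk.1) (s2 jk.2)) (s1 (n - jk.1 + jk.2))).
rewrite /f1 /f2 /f3 /=.
apply: eq_csum => a.
have cj (x : C) (y : R) : conjc (x * cis y) = conjc x * cis (- y) by rewrite rmorphM; congr (_ * _); exact: cisJ.
rewrite cj /X /sg /kap /fl /= !(rmorphD, rmorphB, rmorphN) /= !(mulrDl, mulNr) !cisD; ring.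
Qed.

End Nonlinearity.

(** * Comparison of the iterates with a smooth solution *)

Section Comparison.
Context {R : realType}.
Local Notation J n := (japanese n : R).
Local Notation C := R[i].
Local Notation Re := complex.Re.
Local Notation Im := complex.Im.
Local Notation w n := (J n `^ (- 2)).

(** A solution of the equation for the profiles exp(i n^2 t) u^(t, n), decaying
   fast enough for the nonlinearity to converge absolutely. *)
Definition profile_solution (T : R) (kw : C) (u : R -> int -> C) : Prop :=
  [/\ exists B : R, forall t n, 0 <= t <= T -> normc (u t n) <= B * w n,
      forall n, {within `[0, T], continuous (fun t => Re (u t n))},
      forall n, {within `[0, T], continuous (fun t => Im (u t n))} &
      forall n t, 0 < t < T -> is_cderive t (fun t => u t n) (kw * nl (u t) t n)].

Variables (M : R) (gamma eta : int -> C) (kw : C).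
Hypotheses (M1 : 1 <= M) (hkw : normc kw = 1).
Hypotheses (gs : csummable gamma) (es : csummable eta).
Let T := M^-1.
Hypothesis hg : forall t, 0 <= t <= T -> csum (fun l => gamma l * cis (l%:~R * t)) = (expR (- (M * t)))%:C.
Hypothesis he : forall t, 0 <= t <= T -> csum (fun l => eta l * cis (l%:~R * t)) = (expR (2 * (M * t)))%:C.

Let M0 : 0 < M. Proof. exact: lt_le_trans ltr01 M1. Qed.

Let x (a : int -> C) m t n : C := (expR (M * t))%:C * ev (picard M gamma eta kw a m) t n.

Let normr_res l : normc (resolvent M l) <= 1.
Proof.
have h : M <= normc (M +i* l%:~R).
  by apply: le_trans (normc_Re _); rewrite /= ger0_norm// ltW.
by rewrite /resolvent normcV invf_le1 ?(lt_le_trans M0 h)// (le_trans M1 h).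
Qed.

Let expM t : 0 <= t <= T -> expR (M * t) <= expR 1.
Proof. by move=> /andP[_ tT]; rewrite ler_expR mulrC -ler_pdivlMr// div1r. Qed.

Let F t l : C := (expR (M * t))%:C * cis (l%:~R * t).

(** On the interval where the windows agree with exponentials the iterate
   solves an integral equation, written here with the primitives of exp((M + i l) t). *)
Lemma picard_time a m (B : R) t n : 0 <= t <= T ->
  (forall n, (nsum (fun l => (normc (picard M gamma eta kw a m n l))%:E) <= (B * w n)%:E)%E) ->
  let d := dcoef eta (picard M gamma eta kw a m) (picard M gamma eta kw a m) (picard M gamma eta kw a m) n in
  x a m.+1 t n = a n + kw * csum (fun l => d l * resolvent M l * (F t l - 1)).
Proof.
move=> tT hB; set c := picard M gamma eta kw a m; move=> d.
have [ds _] := ev_dcoef t n hB es.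
have drs : csummable (fun l => d l * resolvent M l).
  by apply: csummable_le ds => l; rewrite normcM ler_piMr ?normc_ge0 ?normr_res.
have drc : csummable (fun l => d l * resolvent M l * cis (l%:~R * t)).
  by apply: csummable_le drs => l; rewrite normcM normc_cis mulr1.
have gc : csummable (fun l => gamma l * cis (l%:~R * t)).
  by apply: csummable_le gs => l; rewrite normcM normc_cis mulr1.
have H := hg tT.
set S := csum (fun l => d l * resolvent M l).
have H2 : ev (picard M gamma eta kw a m.+1) t n =
    a n * (expR (- (M * t)))%:C + kw * (csum (fun l => d l * resolvent M l * cis (l%:~R * t)) - S * (expR (- (M * t)))%:C).
  rewrite -H -!csumZ// -csumB//; last exact: csummableZ.
  rewrite -csumZ; last by apply: csummableD => //; apply: csummableN; exact: csummableZ.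
  rewrite -csumD; last 2 first.
  - exact: csummableZ.
  - by apply: csummableZ; apply: csummableD => //; apply: csummableN; exact: csummableZ.
  apply: eq_csum => l; rewrite /picard iterS -/(picard _ _ _ _ _ _) -/c /picard_map /duhamel -/d -/S; ring.
have EE : (expR (M * t))%:C * (expR (- (M * t)))%:C = 1 :> C.
  by rewrite -rmorphM /= -expRD subrr expR0.
have Fs : csummable (fun l => (expR (M * t))%:C * (d l * resolvent M l * cis (l%:~R * t))).
  exact: csummableZ.
have -> : csum (fun l => d l * resolvent M l * (F t l - 1)) =
    (expR (M * t))%:C * csum (fun l => d l * resolvent M l * cis (l%:~R * t)) - S.
  by rewrite -csumZ// -csumB//; apply: eq_csum => l; rewrite /F; ring.
rewrite /x H2; transitivity ((expR (M * t))%:C * (expR (- (M * t)))%:C * (a n - kw * S) +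
   kw * ((expR (M * t))%:C * csum (fun l => d l * resolvent M l * cis (l%:~R * t)))); first by ring.
by rewrite EE; ring.
Qed.

Lemma is_cderive_F t l : is_cderive t (fun s => F s l) ((M +i* l%:~R) * F t l).
Proof.
have := is_cderiveM (is_cderive_expR t M) (is_cderive_cis t l%:~R).
rewrite -/(F t l); set z := _ + _; suff -> : z = (M +i* l%:~R) * F t l by [].
rewrite /z /F (_ : (M * expR (M * t))%:C = M%:C * (expR (M * t))%:C); last by rewrite -rmorphM.
have -> : (M +i* l%:~R) = M%:C + (0 +i* l%:~R) :> C by apply: complex_eq; rewrite /= ?addr0 ?add0r.
ring.
Qed.

Lemma continuous_cderive (f : R -> C) : (forall t, exists d, is_cderive t f d) ->
  continuous (fun t => Re (f t)) /\ continuous (fun t => Im (f t)).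
Proof. by move=> h; split=> t; have [d /is_cderive_cvg[]] := h t. Qed.

(** The difference of the iterate of rank m and the solution is at most
   2^-m exp(L t) <n>^-2: the exponential weight turns the Lipschitz bound of the
   nonlinearity into a contraction of ratio 1/2. *)
Lemma picard_cvg (a : int -> C) (u : R -> int -> C) (B : R) :
  0 < B -> profile_solution T kw u -> (forall n, u 0 n = a n) ->
  (forall t n, 0 <= t <= T -> normc (u t n) <= B * w n) ->
  (forall m n, (nsum (fun l => (normc (picard M gamma eta kw a m n l))%:E) <= (B * w n)%:E)%E) ->
  exists L : R, forall m t n, 0 <= t <= T ->
    normc (x a m t n - u t n) <= expR 1 * B * 2 ^- m * w n * expR (L * t).
Proof.
move=> B0 [_ ucr uci ud] ua uB pB.
have [K K0 hK] := @nl_lip R.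
have T0 : 0 <= T by rewrite invr_ge0 ltW.
pose B' := expR 1 * B.
have e1 : 1 <= expR 1 :> R by rewrite -expR0 ler_expR.
have B'0 : 0 < B' by rewrite mulr_gt0 ?expR_gt0.
have uB' t n : 0 <= t <= T -> normc (u t n) <= B' * w n.
  move=> tT; apply: le_trans (uB t n tT) _.
  by rewrite ler_wpM2r ?powR_ge0// ler_peMl// ltW.
have xB' m t n : 0 <= t <= T -> normc (x a m t n) <= B' * w n.
  move=> tT; rewrite normcM normcR ger0_norm ?expR_ge0// -mulrA.
  apply: ler_pM; rewrite ?expR_ge0 ?normc_ge0//; first exact: expM.
  by rewrite -lee_fin; apply: le_trans (normc_ev _ _ _) (pB m n).
pose L := 2 * (K * B' ^+ 2).
have L0 : 0 < L by rewrite !mulr_gt0 ?exprn_gt0.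
exists L; elim=> [|m IH] t n tT.
  rewrite {1}/x (_ : ev _ t n = 0) ?mulr0 ?sub0r ?normcN ?expr0 ?invr1 ?mulr1; last first.
    by rewrite /ev -[RHS](@csum0 _ int); apply: eq_csum => l; rewrite mul0r.
  apply: le_trans (uB' t n tT) _; rewrite ler_peMr//; first by apply: mulr_ge0; [exact: ltW|exact: powR_ge0].
  by case/andP: tT => t0 _; rewrite -expR0 ler_expR mulr_ge0 ?(ltW L0).
have hB := pB m.
set c := picard M gamma eta kw a m in hB.
pose d := dcoef eta c c c n.
have [ds _] := ev_dcoef t n hB es; rewrite -/d in ds.
have evd s : 0 <= s <= T -> csum (fun l => d l * F s l) = nl (x a m s) s n.
  move=> sT.
  have [_ H] := ev_dcoef s n hB es.
  have cb k : normc (ev c s k) <= B * w k.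
    by rewrite -lee_fin; apply: le_trans (normc_ev _ _ _) (hB k).
  rewrite /x (nl_scale _ s n cb) -/c.
  rewrite (@eq_csum _ _ _ (fun l => (expR (M * s))%:C * (d l * cis (l%:~R * s)))); last first.
    by move=> l; rewrite /F mulrCA.
  rewrite csumZ; last by apply: csummable_le ds => l; rewrite normcM normc_cis mulr1.
  rewrite -/(ev (dcoef eta c c c) s n) H he// mulrA; congr (_ * _).
  by rewrite -rmorphM /= -expRD !exprS expr0 mulr1 -!expRD; congr ((expR _)%:C); ring.
have wn0 : 0 <= w n by rewrite powR_ge0.
apply/ler_addgt0Pl => eps eps0.
pose e2 : R := expR 1 + 1.
have e20 : 0 < e2 by rewrite addr_gt0 ?expR_gt0.
have ne2 : normc (e2%:C : C) = e2 by rewrite normcR ger0_norm// ltW.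
pose ep := eps / (1 + T).
have T1 : 0 < 1 + T by rewrite ltr_pwDl.
have ep0 : 0 < ep by rewrite divr_gt0.
have ds2 : csummable (fun l => e2%:C * d l) by exact: csummableZ.
have [s us hs] := csum_approx ds2 ep0.
pose f t := kw * (\sum_(l <- s) d l * resolvent M l * (F t l - 1)) - u t n.
pose df t := kw * (\sum_(l <- s) d l * F t l) - kw * nl (u t) t n.
have hf r : 0 < r < T -> is_cderive r f (df r).
  move=> rT; apply: is_cderiveB; last exact: ud.
  apply: is_cderiveZ; apply: is_cderive_sum => l.
  have := is_cderiveZ (d l * resolvent M l) (is_cderiveB (is_cderive_F r l) (is_cderive_cst r 1)).
  rewrite subr0 mulrA -[_ * _ * (M +i* _)]mulrA /resolvent mulVf ?mulr1//.
  by rewrite eq_complex /= (gt_eqF M0).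
have cf : continuous (fun t => Re (kw * (\sum_(l <- s) d l * resolvent M l * (F t l - 1)))) /\
   continuous (fun t => Im (kw * (\sum_(l <- s) d l * resolvent M l * (F t l - 1)))).
  apply: continuous_cderive => r; eexists; apply: is_cderiveZ; apply: is_cderive_sum => l.
  exact: (is_cderiveZ (d l * resolvent M l) (is_cderiveB (is_cderive_F r l) (is_cderive_cst r 1))).
have cfr : {within `[0, T], continuous (fun t => Re (f t))}.
  rewrite (_ : (fun t => Re (f t)) = fun t => Re (kw * (\sum_(l <- s) d l * resolvent M l * (F t l - 1))) - Re (u t n)).
    by move=> r; apply: cvgB; [exact: (continuous_subspaceT cf.1)|exact: ucr].
  by apply/funext => r; rewrite /f ReD ReN.
have cfi : {within `[0, T], continuous (fun t => Im (f t))}.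
  rewrite (_ : (fun t => Im (f t)) = fun t => Im (kw * (\sum_(l <- s) d l * resolvent M l * (F t l - 1))) - Im (u t n)).
    by move=> r; apply: cvgB; [exact: (continuous_subspaceT cf.2)|exact: uci].
  by apply/funext => r; rewrite /f ImD ImN.
pose D := B' * 2 ^- m.
pose g t := ep * t + D / 2 * w n * expR (L * t).
pose dg t := ep + D / 2 * w n * (L * expR (L * t)).
have hg' (r : R) : is_derive r 1 g (dg r).
  have Hc : is_derive r 1 (fun y : R => L * y) (L * 1) by exact: (is_deriveZ L (is_derive_id r 1)).
  have h1 := is_derive1_comp (is_derive_expR (L * r)) Hc.
  have h2 : is_derive r 1 (fun y : R => ep * y) (ep * 1) by exact: (is_deriveZ ep (is_derive_id r 1)).
  apply: is_derive_eq (is_deriveD h2 (is_deriveZ (D / 2 * w n) h1)) _.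
  by rewrite /dg /GRing.scale /=; ring.
have Fb r l : 0 <= r <= T -> normc (F r l) <= expR 1.
  by move=> rT; rewrite normcM normc_cis mulr1 normcR ger0_norm ?expR_ge0//; exact: expM.
have hdf r : 0 < r < T -> normc (df r) <= dg r.
  move=> /andP[r0 rT]; have rT' : 0 <= r <= T by rewrite !ltW.
  rewrite /df -mulrBr normcM hkw mul1r.
  rewrite (_ : _ - _ = - (csum (fun l => d l * F r l) - \sum_(l <- s) d l * F r l) +
    (csum (fun l => d l * F r l) - nl (u r) r n)); last by ring.
  apply: le_trans (le_normcD _ _) _; apply: lerD.
    rewrite normcN ltW//; apply: hs => l.
    rewrite (normcM (d l)) (normcM e2%:C) ne2 mulrC ler_wpM2r ?normc_ge0//.
    by apply: le_trans (Fb r l rT') _; rewrite lerDl.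
  rewrite evd//.
  have := hK (x a m r) (u r) B' (D * expR (L * r)) r n (fun k => xB' m r k rT') (fun k => uB' r k rT') _.
  have -> : D / 2 * w n * (L * expR (L * r)) = K * B' ^+ 2 * (D * expR (L * r)) * w n by rewrite /L; field.
  by apply=> k; apply: le_trans (IH r k rT') _; rewrite /D mulrAC.
have := cmvt hf hg' cfr cfi hdf tT.
have -> : f 0 = - u 0 n.
  rewrite /f big1 ?mulr0 ?sub0r// => l _.
  by rewrite /F !mulr0 expR0 cis0 mulr1 subrr mulr0.
have -> : g 0 = D / 2 * w n by rewrite /g !mulr0 expR0 mulr1 add0r.
move=> hmain.
rewrite (picard_time n tT hB) -/c -/d -ua.
set S1 := csum _.
rewrite (_ : u 0 n + kw * S1 - u t n = kw * (S1 - \sum_(l <- s) d l * resolvent M l * (F t l - 1)) + (f t - - u 0 n)); last first.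
  by rewrite /f; ring.
apply: le_trans (le_normcD _ _) _.
have h1 : normc (kw * (S1 - \sum_(l <- s) d l * resolvent M l * (F t l - 1))) <= ep.
  rewrite normcM hkw mul1r ltW//; apply: hs => l.
  rewrite (normcM (d l * _)) (normcM (d l)) (normcM e2%:C) ne2 mulrC.
  apply: ler_pM; rewrite ?mulr_ge0 ?normc_ge0//; last by rewrite ler_piMr ?normc_ge0 ?normr_res.
  apply: le_trans (le_normcD _ _) _; rewrite normcN; apply: lerD; first exact: Fb.
  by rewrite [normc 1]normc1.
apply: le_trans (lerD h1 hmain) _.
rewrite /g.
have -> : expR 1 * B * 2 ^- m.+1 * w n * expR (L * t) = D / 2 * w n * expR (L * t).
  by rewrite /D /B' exprS invfM; ring.
have D0 : 0 <= D by apply: mulr_ge0; [exact: ltW|rewrite invr_ge0 exprn_ge0].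
have Dw : 0 <= D / 2 * w n by rewrite mulr_ge0// divr_ge0.
case/andP: tT => t0 tT.
have : ep + ep * t <= eps.
  have : ep * (1 + T) = eps by rewrite /ep divfK ?gt_eqF.
  by rewrite mulrDr mulr1 => <-; rewrite lerD2l ler_pM2l.
lra.
Qed.

End Comparison.

(** * Integration over the period *)

Section TorusIntegral.
Context {R : realType}.
Local Notation CI f := ({within `[0, 2 * pi], continuous f}).

Lemma twopi_gt0 : 0 < 2 * pi :> R.
Proof. by rewrite mulr_gt0// pi_gt0. Qed.

Lemma ci_cont (f : R -> R) : continuous f -> CI f.
Proof. exact: continuous_subspaceT. Qed.

Lemma ciD (f g : R -> R) : CI f -> CI g -> CI (fun x => f x + g x).
Proof. by move=> cf cg x; apply: cvgD; [exact: cf|exact: cg]. Qed.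

Lemma ciM (f g : R -> R) : CI f -> CI g -> CI (fun x => f x * g x).
Proof. by move=> cf cg x; apply: cvgM; [exact: cf|exact: cg]. Qed.

Lemma ci_cst (c : R) : CI (fun _ : R => c).
Proof. by apply: ci_cont => x; exact: cvg_cst. Qed.

Lemma ciZ (c : R) (f : R -> R) : CI f -> CI (fun x => c * f x).
Proof. by move=> cf; apply: ciM => //; exact: ci_cst. Qed.

Lemma is_derive_continuous (f df : R -> R) : (forall x : R, is_derive x 1 f (df x)) -> continuous f.
Proof.
by move=> h x; apply: differentiable_continuous; apply/derivable1_diffP; apply: ex_derive.
Qed.

Lemma is_derive_affine (a b x : R) : is_derive x 1 (fun y : R => a * y + b) a.
Proof.
have := is_deriveD (is_deriveZ a (is_derive_id x 1)) (is_derive_cst b x 1).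
by move=> h; apply: (is_derive_eq h); rewrite /GRing.scale /= mulr1 addr0.
Qed.

Lemma is_derive_cosL (a b x : R) : is_derive x 1 (fun y : R => cos (a * y + b)) (- sin (a * x + b) * a).
Proof.
have h := @is_derive1_comp _ (@cos R) (fun y => a * y + b) x _ _ (is_derive_cos (a * x + b)) (is_derive_affine a b x).
exact: (is_derive_eq h).
Qed.

Lemma is_derive_sinL (a b x : R) : is_derive x 1 (fun y : R => sin (a * y + b)) (cos (a * x + b) * a).
Proof.
have h := @is_derive1_comp _ (@sin R) (fun y => a * y + b) x _ _ (is_derive_sin (a * x + b)) (is_derive_affine a b x).
exact: (is_derive_eq h).
Qed.

Lemma ci_cosL (a b : R) : CI (fun y => cos (a * y + b)).
Proof. exact: ci_cont (is_derive_continuous (is_derive_cosL a b)). Qed.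

Lemma ci_sinL (a b : R) : CI (fun y => sin (a * y + b)).
Proof. exact: ci_cont (is_derive_continuous (is_derive_sinL a b)). Qed.

Lemma ci_integrable (f : R -> R) : CI f -> lebesgue_measure.-integrable `[0, 2 * pi] (EFin \o f).
Proof. by move=> cf; apply: continuous_compact_integrable => //; exact: segment_compact. Qed.

Lemma torus_intD (a b : R) (f g : R -> R) : CI f -> CI g ->
  torus_int (fun x => a * f x + b * g x) = a * torus_int f + b * torus_int g.
Proof.
move=> cf cg; rewrite /torus_int RintegralD//; last 2 first.
- by apply: (@ci_integrable (fun x => a * f x)); exact: ciZ.
- by apply: (@ci_integrable (fun x => b * g x)); exact: ciZ.
by rewrite !RintegralZl//; exact: ci_integrable.
Qed.

Lemma torus_intZ (a : R) (f : R -> R) : CI f ->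
  torus_int (fun x => a * f x) = a * torus_int f.
Proof. by move=> cf; rewrite /torus_int RintegralZl//; exact: ci_integrable. Qed.

Lemma torus_int_ge0 (f : R -> R) : (forall x, 0 <= f x) -> 0 <= torus_int f.
Proof. by move=> f0; apply: Rintegral_ge0 => x _. Qed.

Lemma torus_int_le (f g : R -> R) : CI f -> CI g -> (forall x, 0 <= x <= 2 * pi -> f x <= g x) ->
  torus_int f <= torus_int g.
Proof.
move=> cf cg h; apply: le_Rintegral; [by []|exact: ci_integrable|exact: ci_integrable|].
by move=> x /=; rewrite in_itv /=; exact: h.
Qed.

Lemma torus_int_cst (c : R) : torus_int (fun=> c) = 2 * pi * c.
Proof.
rewrite /torus_int Rintegral_cst//= lebesgue_measure_itv/= lte_fin twopi_gt0/=.
by rewrite subr0 mulrC.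
Qed.

Lemma torus_int_norm_le (f : R -> R) (B : R) : CI f -> (forall x, 0 <= x <= 2 * pi -> `|f x| <= B) ->
  `|torus_int f| <= 2 * pi * B.
Proof.
move=> cf h; rewrite ler_norml -(torus_int_cst B) -[- torus_int _]mulN1r -torus_intZ; last exact: ci_cst.
apply/andP; split; apply: torus_int_le; rewrite ?mulN1r//; try exact: ci_cst.
- by move=> x xp; have := h x xp; rewrite ler_norml => /andP[].
- by move=> x xp; have := h x xp; rewrite ler_norml => /andP[].
Qed.

Lemma torus_int_FTC (F f : R -> R) : (forall x : R, is_derive x 1 F (f x)) -> continuous f ->
  torus_int f = F (2 * pi) - F 0.
Proof.
move=> hF cf; rewrite /torus_int /Rintegral (@continuous_FTC2 _ f F)//.
- exact: twopi_gt0.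
- exact: ci_cont.
- have cF := is_derive_continuous hF; split.
  + by move=> x _; have := hF x => h; exact: ex_derive.
  + exact: cvg_at_right_filter (cF 0).
  + exact: cvg_at_left_filter (cF (2 * pi)).
- by move=> x _; rewrite derive1E; have := hF x => h; exact: derive_val.
Qed.

Lemma cos_sin_periodic (n : int) (x : R) :
  cos (n%:~R * (2 * pi) + x) = cos x /\ sin (n%:~R * (2 * pi) + x) = sin x.
Proof.
have := Cinfty_subproof (expin n : Cinfty R).
have key (k : nat) (y : R) : cos (y + (2 * pi) *+ k) = cos y /\ sin (y + (2 * pi) *+ k) = sin y.
  elim: k y => [|k IH] y; first by rewrite mulr0n addr0.
  rewrite mulrSr addrA mulr_natl cosD2pi sinD2pi -mulr_natl; exact: IH.
move=> _; case: n => k.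
  by rewrite -pmulrn [k%:R * _]mulr_natl [_ + x]addrC; exact: key.
rewrite NegzE mulrNz mulNr -pmulrn [k.+1%:R * _]mulr_natl [_ + x]addrC.
have := key k.+1 (x - (2 * pi) *+ k.+1); rewrite subrK => -[-> ->] //.
Qed.

Lemma torus_int_cosL (n : int) (b : R) : n != 0 -> torus_int (fun y => cos (n%:~R * y + b)) = 0.
Proof.
move=> n0; have nR : n%:~R != 0 :> R by rewrite intr_eq0.
pose F := fun y : R => n%:~R^-1 * sin (n%:~R * y + b).
have hF (x : R) : is_derive x 1 F (cos (n%:~R * x + b)).
  apply: is_derive_eq (is_deriveZ n%:~R^-1 (is_derive_sinL n%:~R b x)) _.
  by rewrite /GRing.scale /= mulrCA mulVf ?mulr1.
rewrite (torus_int_FTC hF); last exact: is_derive_continuous (is_derive_cosL _ _).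
by rewrite /F (cos_sin_periodic n b).2 mulr0 add0r subrr.
Qed.

Lemma cos_mul_cos (x y : R) : cos x * cos y = 2^-1 * cos (x - y) + 2^-1 * cos (x + y).
Proof. by rewrite cosB cosD; field. Qed.

Lemma torus_int_cos_cos (j k : nat) (a b : R) : (0 < j)%N -> (0 < k)%N -> j != k ->
  torus_int (fun y => cos (j%:R * y + a) * cos (k%:R * y + b)) = 0.
Proof.
move=> j0 k0 jk.
rewrite (_ : (fun y => _) = fun y => 2^-1 * cos ((j%:Z - k%:Z)%:~R * y + (a - b)) + 2^-1 * cos ((j%:Z + k%:Z)%:~R * y + (a + b))); last first.
  apply/funext => y; rewrite cos_mul_cos rmorphB rmorphD /= -!pmulrn.
  by congr (_ * cos _ + _ * cos _); ring.
rewrite torus_intD; [|exact: ci_cosL|exact: ci_cosL].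
rewrite !torus_int_cosL ?mulr0 ?addr0//; first by apply/eqP; lia.
by rewrite subr_eq0 eqz_nat.
Qed.

Lemma torus_int_cos2 (k : nat) (a : R) : (0 < k)%N ->
  torus_int (fun y => cos (k%:R * y + a) * cos (k%:R * y + a)) = pi.
Proof.
move=> k0.
rewrite (_ : (fun y => _) = fun y => 2^-1 * 1 + 2^-1 * cos ((k%:Z + k%:Z)%:~R * y + (a + a))); last first.
  apply/funext => y; rewrite cos_mul_cos rmorphD /= -!pmulrn subrr cos0.
  by congr (_ * _ + _ * cos _); ring.
rewrite torus_intD; [|exact: ci_cst|exact: ci_cosL].
rewrite torus_int_cosL ?mulr0 ?addr0; last by apply/eqP; lia.
by rewrite torus_int_cst mulr1 mulKf.
Qed.

(** Subtracting the projections one after the other leaves a nonnegative square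
   integral, because distinct frequencies are orthogonal whatever their phases. *)
Lemma bessel (g : R -> R) (al : nat -> R) (N : nat) : CI g ->
  \sum_(k < N) torus_int (fun y => g y * cos (k.+1%:R * y + al k)) ^+ 2 <= pi * torus_int (fun y => g y * g y).
Proof.
pose c k := torus_int (fun y => g y * cos (k.+1%:R * y + al k)).
move=> cg; have pi0 : 0 < pi :> R by exact: pi_gt0.
pose ph k y := cos (k.+1%:R * y + al k).
have cph k : CI (ph k) by exact: ci_cosL.
suff [h [ch hc h2]] : exists h : R -> R, [/\ CI h,
    forall k, (N <= k)%N -> torus_int (fun y => h y * ph k y) = c k &
    torus_int (fun y => h y * h y) = torus_int (fun y => g y * g y) - pi^-1 * \sum_(k < N) c k ^+ 2].
  have : 0 <= torus_int (fun y => h y * h y) by apply: torus_int_ge0 => y; rewrite -expr2 sqr_ge0.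
  rewrite h2 subr_ge0 -(ler_pM2l pi0) mulrA divff ?gt_eqF// mul1r//.
elim: N => [|N [h [ch hc h2]]].
  by exists g; split => //; rewrite big_ord0 mulr0 subr0.
have hN := hc N (leqnn N).
exists (fun y => 1 * h y + (- (c N / pi)) * ph N y); split.
- by apply: ciD; exact: ciZ.
- move=> k Nk.
  rewrite (_ : (fun y => _) = fun y => 1 * (h y * ph k y) + (- (c N / pi)) * (ph N y * ph k y)); last first.
    by apply/funext => y; ring.
  rewrite torus_intD; [|exact: ciM|exact: ciM].
  rewrite hc ?(ltnW Nk)// torus_int_cos_cos ?mulr0 ?addr0 ?mul1r// eqSS neq_ltn Nk//.
- rewrite (_ : (fun y => _) = fun y => 1 * (1 * (h y * h y) + (- (2 * (c N / pi))) * (h y * ph N y)) + (c N / pi) ^+ 2 * (ph N y * ph N y)); last first.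
    by apply/funext => y; ring.
  rewrite torus_intD; [|by apply: ciD; apply: ciZ; exact: ciM|exact: ciM].
  rewrite torus_intD; [|exact: ciM|exact: ciM].
  rewrite hN torus_int_cos2// h2 big_ord_recr /=.
  set S := \sum_(i < N) c i ^+ 2.
  have pn : pi != 0 :> R by rewrite gt_eqF.
  move: (torus_int _) S (c N) (pi) pn => I S d q pn.
  by field.
Qed.

(** The squares are summable by [bessel]; phases depending on k are needed for
   integrals centred at a point. *)
Lemma riemann_lebesgue (g : R -> R) (al : nat -> R) : CI g ->
  (fun k => torus_int (fun y => g y * cos (k.+1%:R * y + al k))) @ \oo --> (0 : R).
Proof.
move=> cg; set c := fun k => _.
have h : cvgn (series (fun k => c k ^+ 2)).
  apply: nondecreasing_is_cvgn.
    by apply/nondecreasing_seqP => n; rewrite !seriesEnat /= big_nat_recr//= lerDl sqr_ge0.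
  exists (pi * torus_int (fun y => g y * g y)) => _ [n _ <-].
  by rewrite seriesEord; exact: bessel.
have := cvg_series_cvg_0 h => h0.
have h1 : (fun k => Num.sqrt (c k ^+ 2)) @ \oo --> (0 : R).
  have h00 : Num.sqrt (0 : R) = 0 by exact: sqrtr0.
  rewrite -[X in _ --> X]h00.
  apply: (@cvg_comp _ _ _ (fun k => c k ^+ 2) (@Num.sqrt R) _ _ _ h0).
  exact: sqrt_continuous.
apply/norm_cvg0P; rewrite (_ : (fun k => _) = (fun k => Num.sqrt (c k ^+ 2))) //.
by apply/funext => k; rewrite sqrtr_sqr.
Qed.

End TorusIntegral.

(** * The Dirichlet integral *)

Section Dirichlet.
Context {R : realType}.
Local Notation CI f := ({within `[0, 2 * pi], continuous f}).

Lemma torus_int_eq (f g : R -> R) : (forall x, 0 <= x <= 2 * pi -> f x = g x) ->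
  torus_int f = torus_int g.
Proof.
move=> h; apply: eq_Rintegral => x; rewrite inE /= in_itv /= => xI; exact: h.
Qed.

Lemma dirichlet_kernel (z : R) N :
  (1 + 2 * \sum_(k < N) cos (k.+1%:R * z)) * sin (z / 2) =
  sin (N%:R * z) * cos (z / 2) + cos (N%:R * z) * sin (z / 2).
Proof.
elim: N => [|N IH].
  by rewrite big_ord0 mulr0 addr0 mul0r sin0 cos0 mul0r add0r.
have e1 : N.+1%:R * z = N%:R * z + z / 2 + z / 2 by rewrite -natr1; field.
rewrite big_ord_recr /= mulrDr addrA mulrDl IH -sinD e1.
rewrite [in RHS](sinD (N%:R * z + z / 2)) (cosD (N%:R * z + z / 2)).
move: (sin (_ + _)) (cos (_ + _)) (cos2Dsin2 (z / 2)) => a b.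
move: (cos _) (sin _) => c s' h.
transitivity (a * (c ^+ 2 + s' ^+ 2) + 2 * (b * c - a * s') * s'); first by rewrite h mulr1.
by ring.
Qed.

(** The quotient by the half-angle sine, filled in by the derivative, turns the
   Dirichlet integral into two oscillating integrals. *)
Lemma half_angle_quotient (f : R -> R) (x d : R) : continuous f -> 0 < x < 2 * pi ->
  is_derive x 1 f d -> exists rho : R -> R, CI rho /\
  forall y, 0 <= y <= 2 * pi -> f y - f x = 2 * rho y * sin ((y - x) / 2).
Proof.
move=> cf /andP[x0 x1] hf.
pose g y : R := 2 * sin (2^-1 * y + - (x / 2)).
have cg : continuous g.
  by move=> y; apply: cvgM; [exact: cvg_cst|exact: (is_derive_continuous (is_derive_sinL _ _))].
have hg : is_derive x 1 g 1.
  have h := is_deriveZ (2 : R) (is_derive_sinL 2^-1 (- (x / 2)) x).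
  apply: (is_derive_eq h); rewrite /GRing.scale /=.
  by rewrite [2^-1 * x]mulrC subrr cos0 mul1r mulfV.
have gE y : g y = 2 * sin ((y - x) / 2) by rewrite /g; congr (_ * sin _); ring.
have gx : g x = 0 by rewrite gE subrr mul0r sin0 mulr0.
have /is_derive1_caratheodory[phi [hphi cphi phix]] := hf.
have /is_derive1_caratheodory[psi [hpsi cpsi psix]] := hg.
have gn0 y : 0 <= y <= 2 * pi -> y != x -> g y != 0.
  move=> /andP[y0 y1] yx; rewrite gE mulf_neq0//.
  have [lt|gt|/eqP] := ltgtP y x; last by rewrite (negPf yx).
    rewrite -oppr_eq0 -sinN gt_eqF// sin_gt0_pi//; apply/andP; split; lra.
  rewrite gt_eqF// sin_gt0_pi//; apply/andP; split; lra.
pose rho y := if y == x then d else (f y - f x) / g y.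
exists rho; split; last first.
  move=> y yI; rewrite /rho; have [->|yx] := eqVneq y x.
    by rewrite !subrr mul0r sin0 mulr0.
  have h0 := gn0 y yI yx; rewrite gE in h0 *.
  have s0 : sin ((y - x) / 2) != 0 by move: h0; rewrite mulf_eq0 negb_or => /andP[].
  by field.
apply: continuous_in_subspaceT => y; rewrite inE /= in_itv /= => yI.
have [->|yx] := eqVneq y x.
  have -> : rho = (fun y => phi y / psi y).
    apply/funext => z; rewrite /rho; case: eqVneq => [->|zx]; first by rewrite phix psix divr1.
    have zx0 : z - x != 0 by rewrite subr_eq0.
    by rewrite hphi -[g z]subr0 -gx hpsi invfM mulrACA mulfV// mulr1.
  by apply: cvgM => //; apply: cvgV => //; rewrite psix oner_eq0.
have h : ((f z - f x) / g z) @[z --> y] --> (f y - f x) / g y.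
  apply: cvgM; first by apply: cvgB; [exact: cf|exact: cvg_cst].
  by apply: cvgV; [exact: gn0|exact: cg].
rewrite /continuous_at /rho (negPf yx).
have hn : (z - x) @[z --> y] --> y - x by apply: cvgB; [exact: cvg_id|exact: cvg_cst].
apply: cvg_trans h; apply: near_eq_cvg; near=> z.
have : z - x != 0 by near: z; apply: (cvgr_neq0 _ hn); rewrite subr_eq0.
by rewrite subr_eq0 => /negPf ->.
Unshelve. all: by end_near. Qed.

Lemma sin_cos_shift (x : R) : sin x = cos (x - pi / 2).
Proof. by rewrite cosBpihalf. Qed.

(** The kernel has integral 2 pi, and what remains after subtracting f x is
   oscillating because of [half_angle_quotient] and [dirichlet_kernel]. *)
Lemma dirichlet_cvg (f : R -> R) (x d : R) : continuous f -> 0 < x < 2 * pi ->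
  is_derive x 1 f d ->
  torus_int f + 2 * \sum_(k < N) torus_int (fun y => f y * cos (k.+1%:R * (y - x)))
   @[N --> \oo] --> 2 * pi * f x.
Proof.
move=> cf xI hf; have [rho [crho hrho]] := half_angle_quotient cf xI hf.
pose r1 y := rho y * cos (2^-1 * y + - (x / 2)).
pose r2 y := rho y * sin (2^-1 * y + - (x / 2)).
have c1 : CI r1 by apply: ciM => //; exact: ci_cosL.
have c2 : CI r2 by apply: ciM => //; exact: ci_sinL.
have h1 := riemann_lebesgue (fun k => - (k.+1%:R * x) - pi / 2) c1.
have h2 := riemann_lebesgue (fun k => - (k.+1%:R * x)) c2.
rewrite -cvg_shiftS /=.
have key N : torus_int f + 2 * \sum_(k < N) torus_int (fun y => f y * cos (k.+1%:R * (y - x))) =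
   2 * pi * f x + torus_int (fun y => 2 * (rho y * sin ((y - x) / 2)) * (1 + 2 * \sum_(k < N) cos (k.+1%:R * (y - x)))).
  have cD (k : nat) : CI (fun y => cos (k.+1%:R * (y - x))).
    rewrite (_ : (fun y => _) = (fun y => cos (k.+1%:R * y + (- (k.+1%:R * x))))); first exact: ci_cosL.
    by apply/funext => y; congr cos; ring.
  have cS n : CI (fun y => \sum_(k < n) cos (k.+1%:R * (y - x))).
    elim: n => [|n IH].
      rewrite (_ : (fun y => _) = (fun=> 0)); first exact: ci_cst.
      by apply/funext => y; rewrite big_ord0.
    rewrite (_ : (fun y => _) = (fun y => \sum_(k < n) cos (k.+1%:R * (y - x)) + cos (n.+1%:R * (y - x)))); first exact: ciD.
    by apply/funext => y; rewrite big_ord_recr.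
  have lin (g : R -> R) n : CI g -> torus_int g + 2 * \sum_(k < n) torus_int (fun y => g y * cos (k.+1%:R * (y - x))) =
      torus_int (fun y => g y * (1 + 2 * \sum_(k < n) cos (k.+1%:R * (y - x)))).
    move=> cg; elim: n => [|n IH].
      by rewrite big_ord0 mulr0 addr0; apply: torus_int_eq => y _; rewrite big_ord0 mulr0 addr0 mulr1.
    rewrite big_ord_recr /= mulrDr addrA IH -[X in X + _]mul1r -torus_intD//; last 2 first.
    - by apply: ciM => //; apply: ciD; [exact: ci_cst|exact: ciZ].
    - exact: ciM.
    by apply: torus_int_eq => y _; rewrite big_ord_recr /=; ring.
  have cfi := ci_cont cf.
  have l1 : torus_int (fun y => f x * (1 + 2 * \sum_(k < N) cos (k.+1%:R * (y - x)))) = 2 * pi * f x.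
    rewrite -(lin (fun=> f x)); last exact: ci_cst.
    rewrite torus_int_cst big1 ?mulr0 ?addr0// => k _.
    rewrite torus_intZ; last exact: cD.
    rewrite (_ : (fun y => _) = (fun y => cos ((Posz k.+1)%:~R * y + (- (k.+1%:R * x))))).
      by rewrite torus_int_cosL// mulr0.
    by apply/funext => y; congr cos; rewrite -pmulrn; ring.
  rewrite lin// -l1 -[X in X + _]mul1r -[X in _ + X]mul1r.
  rewrite -torus_intD; last 2 first.
  - by apply: ciM; [exact: ci_cst|apply: ciD; [exact: ci_cst|exact: ciZ]].
  - apply: ciM; last by apply: ciD; [exact: ci_cst|exact: ciZ].
    apply: ciZ; rewrite (_ : (fun y => _) = r2) //.
    by apply/funext => y; rewrite /r2; congr (_ * sin _); ring.
  by apply: torus_int_eq => y yI; rewrite !mul1r -mulrDl mulrA -hrho// [f x + _]addrC subrK.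
rewrite (_ : (fun N => _) = (fun N => 2 * pi * f x +
    (2 * torus_int (fun y => r1 y * cos (N.+1%:R * y + (- (N.+1%:R * x) - pi / 2))) +
     2 * torus_int (fun y => r2 y * cos (N.+1%:R * y + (- (N.+1%:R * x))))))).
  have -> : 2 * pi * f x = 2 * pi * f x + (2 * (0 : R) + 2 * 0) by rewrite mulr0 !addr0.
  apply: cvgD; first by rewrite mulr0 !addr0; exact: cvg_cst.
  by apply: cvgD; apply: cvgM => //; exact: cvg_cst.
apply/funext => N; rewrite key; congr (_ + _); rewrite -torus_intD; last 2 first.
- by apply: ciM => //; exact: ci_cosL.
- by apply: ciM => //; exact: ci_cosL.
apply: torus_int_eq => y _.
rewrite (_ : forall q t : R, 2 * (rho y * q) * t = 2 * rho y * (t * q)); last by move=> q t; ring.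
rewrite dirichlet_kernel /r1 /r2.
have -> : 2^-1 * y - x / 2 = (y - x) / 2 by ring.
have -> : N.+1%:R * y + (- (N.+1%:R * x) - pi / 2) = N.+1%:R * (y - x) - pi / 2 by ring.
have -> : N.+1%:R * y - N.+1%:R * x = N.+1%:R * (y - x) by ring.
by rewrite -sin_cos_shift; ring.
Qed.

End Dirichlet.

(** * Fourier coefficients and inversion *)

Section FourierCoefficients.
Context {R : realType}.
Local Notation C := R[i].
Local Notation Re := complex.Re.
Local Notation Im := complex.Im.
Local Notation CI f := ({within `[0, 2 * pi], continuous f}).

Definition ccont (f : R -> C) : Prop :=
  continuous (fun x => Re (f x)) /\ continuous (fun x => Im (f x)).

Lemma ccontD f g : ccont f -> ccont g -> ccont (fun x => f x + g x).
Proof.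
move=> [f1 f2] [g1 g2]; split => x.
  by under eq_fun do rewrite ReD; apply: cvgD; [exact: f1|exact: g1].
by under eq_fun do rewrite ImD; apply: cvgD; [exact: f2|exact: g2].
Qed.

Lemma ccontM f g : ccont f -> ccont g -> ccont (fun x => f x * g x).
Proof.
move=> [f1 f2] [g1 g2]; split => x.
  under eq_fun do rewrite ReM; apply: cvgB; apply: cvgM; [exact: f1|exact: g1|exact: f2|exact: g2].
under eq_fun do rewrite ImM; apply: cvgD; apply: cvgM; [exact: f1|exact: g2|exact: f2|exact: g1].
Qed.

Lemma ccont_cst c : ccont (fun _ => c).
Proof. by split => x; exact: cvg_cst. Qed.

Lemma ccontZ c f : ccont f -> ccont (fun x => c * f x).
Proof. by move=> cf; apply: ccontM => //; exact: ccont_cst. Qed.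

Lemma ccontJ f : ccont f -> ccont (fun x => conjc (f x)).
Proof.
move=> [f1 f2]; split => x.
  by rewrite (_ : (fun x => Re _) = (fun x => Re (f x))); [exact: f1|apply/funext => y; case: (f y)].
rewrite (_ : (fun x => Im _) = (fun x => - Im (f x))); last by apply/funext => y; case: (f y).
by apply: cvgN; exact: f2.
Qed.

Lemma ccont_cderive (f df : R -> C) : (forall x, is_cderive x f (df x)) -> ccont f.
Proof. by move=> h; apply: continuous_cderive => t; exists (df t). Qed.

Lemma ccont_cis a : ccont (fun x => cis (a * x)).
Proof. exact: ccont_cderive (fun x => is_cderive_cis x a). Qed.

Lemma ccont_sum (I : Type) (s : seq I) (f : I -> R -> C) : (forall i, ccont (f i)) ->
  ccont (fun x => \sum_(i <- s) f i x).
Proof.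
move=> h; elim: s => [|i s IH].
  by rewrite (_ : (fun x => _) = (fun=> 0)); [exact: ccont_cst|apply/funext => x; rewrite big_nil].
rewrite (_ : (fun x => _) = (fun x => f i x + \sum_(i <- s) f i x)); first exact: ccontD.
by apply/funext => x; rewrite big_cons.
Qed.

Lemma ccont_uniform (f : R -> C) :
  (forall eps : R, 0 < eps -> exists2 g, ccont g & forall x, normc (f x - g x) < eps) -> ccont f.
Proof.
move=> h.
have key (pr : C -> R) : (forall z w, pr (z - w) = pr z - pr w) -> (forall z, `|pr z| <= normc z) ->
  (forall g, ccont g -> continuous (fun x => pr (g x))) -> continuous (fun x => pr (f x)).
  move=> prB prn prc x; apply/cvgrPdist_lt => eps e0.
  have e3 : 0 < eps / 3 by rewrite divr_gt0.
  have [g cg hg] := h _ e3.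
  have /cvgrPdist_lt /(_ _ e3) := prc g cg x.
  apply: filterS => y hy.
  have -> : pr (f x) - pr (f y) = pr (f x - g x) + (pr (g x) - pr (g y)) - pr (f y - g y).
    by rewrite !prB; ring.
  have := ler_normB (pr (f x - g x) + (pr (g x) - pr (g y))) (pr (f y - g y)).
  have := ler_normD (pr (f x - g x)) (pr (g x) - pr (g y)).
  have := le_lt_trans (prn _) (hg x); have := le_lt_trans (prn _) (hg y).
  by move: hy; lra.
split.
- apply: key; [by move=> z w; rewrite ReD ReN|exact: normc_Re|by move=> g []].
- apply: key; [by move=> z w; rewrite ImD ImN|exact: normc_Im|by move=> g []].
Qed.

(** The end points have measure zero. *)
Lemma torus_int_eq_oo (f g : R -> R) : CI f -> CI g ->
  (forall x, 0 < x < 2 * pi -> f x = g x) -> torus_int f = torus_int g.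
Proof.
move=> cf cg h; rewrite /torus_int /Rintegral.
rewrite (@integral_itv_bndoo R 0 (2 * pi) (EFin \o f) true false); last first.
  by apply: measurable_funS (measurable_int _ (ci_integrable cf)) => //; exact: subset_itv_oo_cc.
rewrite (@integral_itv_bndoo R 0 (2 * pi) (EFin \o g) true false); last first.
  by apply: measurable_funS (measurable_int _ (ci_integrable cg)) => //; exact: subset_itv_oo_cc.
congr fine; apply: eq_integral => x; rewrite inE /= in_itv /= => xI.
by rewrite h.
Qed.

Lemma ctorus_int_eq_oo (f g : R -> C) : ccont f -> ccont g ->
  (forall x, 0 < x < 2 * pi -> f x = g x) -> ctorus_int f = ctorus_int g.
Proof.
move=> [f1 f2] [g1 g2] h; congr (_ +i* _); apply: torus_int_eq_oo; try exact: ci_cont.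
- by move=> x xI; rewrite h.
- by move=> x xI; rewrite h.
Qed.

Lemma ctorus_intD (f g : R -> C) : ccont f -> ccont g ->
  ctorus_int (fun x => f x + g x) = ctorus_int f + ctorus_int g.
Proof.
move=> [f1 f2] [g1 g2]; apply: complex_eq; rewrite ?ReD ?ImD /=.
  rewrite -[X in X + _]mul1r -[X in _ + X]mul1r -torus_intD; [|exact: ci_cont|exact: ci_cont].
  by apply: torus_int_eq => x _; rewrite ReD !mul1r.
rewrite -[X in X + _]mul1r -[X in _ + X]mul1r -torus_intD; [|exact: ci_cont|exact: ci_cont].
by apply: torus_int_eq => x _; rewrite ImD !mul1r.
Qed.

Lemma ctorus_intZ (c : C) (f : R -> C) : ccont f ->
  ctorus_int (fun x => c * f x) = c * ctorus_int f.
Proof.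
move=> [f1 f2]; apply: complex_eq; rewrite ?ReM ?ImM /=.
  rewrite -mulNr -torus_intD; [|exact: ci_cont|exact: ci_cont].
  by apply: torus_int_eq => x _; rewrite ReM mulNr.
rewrite -torus_intD; [|exact: ci_cont|exact: ci_cont].
by apply: torus_int_eq => x _; rewrite ImM.
Qed.

Lemma normc_ctorus_int (f : R -> C) B : ccont f -> (forall x, 0 <= x <= 2 * pi -> normc (f x) <= B) ->
  normc (ctorus_int f) <= 2 * pi * (2 * B).
Proof.
move=> [f1 f2] h; apply: le_trans (normc_le_ReIm _) _ => /=.
have h1 : `|torus_int (fun x => Re (f x))| <= 2 * pi * B.
  by apply: torus_int_norm_le => [|x xI]; [exact: ci_cont|apply: le_trans (normc_Re _) (h x xI)].
have h2 : `|torus_int (fun x => Im (f x))| <= 2 * pi * B.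
  by apply: torus_int_norm_le => [|x xI]; [exact: ci_cont|apply: le_trans (normc_Im _) (h x xI)].
by apply: le_trans (lerD h1 h2) _; rewrite le_eqVlt; apply/orP; left; apply/eqP; ring.
Qed.

Definition fc (f : R -> C) (n : int) : C :=
  ((2 * pi)^-1)%:C * ctorus_int (fun x => f x * expin_fun n x).

Lemma expin_cis n (x : R) : expin_fun n x = cis (- (n%:~R * x)).
Proof. by rewrite /cis cosN sinN. Qed.

Lemma ccont_expin n : ccont (expin_fun n : R -> C).
Proof.
rewrite (_ : expin_fun n = fun x => cis ((- n%:~R) * x)); first exact: ccont_cis.
by apply/funext => x; rewrite expin_cis mulNr.
Qed.

Lemma fc_expin_cont f n : ccont f -> ccont (fun x => f x * expin_fun n x).
Proof. by move=> cf; apply: ccontM => //; exact: ccont_expin. Qed.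

Lemma fcD f g n : ccont f -> ccont g -> fc (fun x => f x + g x) n = fc f n + fc g n.
Proof.
move=> cf cg; rewrite /fc -mulrDr -ctorus_intD; [|exact: fc_expin_cont|exact: fc_expin_cont].
by congr (_ * ctorus_int _); apply/funext => x; rewrite mulrDl.
Qed.

Lemma fcZ c f n : ccont f -> fc (fun x => c * f x) n = c * fc f n.
Proof.
move=> cf; rewrite /fc mulrCA -(ctorus_intZ c); last exact: fc_expin_cont.
by congr (_ * ctorus_int _); apply/funext => x; rewrite mulrA.
Qed.

Lemma fc_sum (I : Type) (s : seq I) (f : I -> R -> C) n : (forall i, ccont (f i)) ->
  fc (fun x => \sum_(i <- s) f i x) n = \sum_(i <- s) fc (f i) n.
Proof.
move=> h; elim: s => [|i s IH].
  rewrite big_nil (_ : (fun x => _) = (fun x => 0 * 0)).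
    by rewrite fcZ ?mul0r//; exact: ccont_cst.
  by apply/funext => x; rewrite big_nil mul0r.
rewrite big_cons -IH -fcD//; last exact: ccont_sum.
by rewrite (_ : (fun x => \sum_(j <- i :: s) f j x) = (fun x => f i x + \sum_(j <- s) f j x)) //; apply/funext => x; rewrite big_cons.
Qed.

Lemma eq_fc f g n : ccont f -> ccont g -> (forall x, 0 < x < 2 * pi -> f x = g x) ->
  fc f n = fc g n.
Proof.
move=> cf cg h; congr (_ * _); apply: ctorus_int_eq_oo; try exact: fc_expin_cont.
by move=> x xI; rewrite h.
Qed.

Lemma normc_fc f n B : ccont f -> (forall x, 0 <= x <= 2 * pi -> normc (f x) <= B) -> normc (fc f n) <= 2 * B.
Proof.
move=> cf h; rewrite normcM normcR ger0_norm ?invr_ge0 ?(ltW twopi_gt0)//.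
rewrite -ler_pdivlMl ?invr_gt0 ?twopi_gt0// invrK; apply: normc_ctorus_int.
  exact: fc_expin_cont.
by move=> x xI; rewrite expin_cis normcM normc_cis mulr1; exact: h.
Qed.

Lemma ctorus_int_cis (m : int) : ctorus_int (fun x : R => cis (m%:~R * x)) = if m == 0 then (2 * pi)%:C else 0.
Proof.
have [->|m0] := eqVneq m 0.
  apply: complex_eq => /=.
    rewrite (_ : (fun x => _) = (fun=> 1)); first by rewrite torus_int_cst mulr1.
    by apply/funext => x; rewrite mul0r cos0.
  rewrite (_ : (fun x => _) = (fun=> 0)); first by rewrite torus_int_cst mulr0.
  by apply/funext => x; rewrite mul0r sin0.
apply: complex_eq => /=.
  rewrite (_ : (fun x => _) = (fun x => cos (m%:~R * x + 0))); first exact: torus_int_cosL.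
  by apply/funext => x; rewrite addr0.
rewrite (_ : (fun x => _) = (fun x => cos (m%:~R * x + (- (pi / 2))))); first exact: torus_int_cosL.
by apply/funext => x; rewrite sin_cos_shift.
Qed.

Lemma fc_cis (m n : int) : fc (fun x => cis (m%:~R * x)) n = (m == n)%:R.
Proof.
rewrite /fc (_ : (fun x => _) = (fun x => cis ((m - n)%:~R * x))); last first.
  by apply/funext => x; rewrite expin_cis -cisD rmorphB /= mulrBl.
rewrite ctorus_int_cis subr_eq0; case: eqP => _; last by rewrite mulr0.
by rewrite -rmorphM /= mulVf ?gt_eqF ?twopi_gt0.
Qed.

Section TrigSeries.
Variables (T : choiceType) (pr : T -> int) (c : T -> C).
Hypothesis cs : csummable c.

Lemma trig_approx (eps : R) : 0 < eps -> exists2 s : seq T, uniq s &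
  forall h : T -> C, (forall i, normc (h i) <= 1) ->
    normc (csum (fun i => c i * h i) - \sum_(i <- s) c i * h i) < eps.
Proof.
move=> e0; have [s us hs] := csum_approx cs e0; exists s => // h hh; apply: hs => i.
by rewrite normcM ler_piMr// normc_ge0.
Qed.

Lemma ccont_trig : ccont (fun x => csum (fun i => c i * cis ((pr i)%:~R * x))).
Proof.
apply: ccont_uniform => eps e0; have [s us hs] := trig_approx e0.
exists (fun x => \sum_(i <- s) c i * cis ((pr i)%:~R * x)).
  by apply: ccont_sum => i; apply: ccontZ; exact: ccont_cis.
by move=> x; apply: (hs (fun i => cis ((pr i)%:~R * x))) => i; rewrite normc_cis.
Qed.

(** The absolutely convergent series is a uniform limit of trigonometric
   polynomials. The frequencies pr i may repeat, as they do for products of series. *)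
Lemma fc_trig n : fc (fun x => csum (fun i => c i * cis ((pr i)%:~R * x))) n =
  csum (fun i => c i * (pr i == n)%:R).
Proof.
apply/eqP; rewrite -subr_eq0 -normc_eq0; apply/eqP/le_anti/andP; split; last exact: normc_ge0.
apply/ler_addgt0Pl => eps e0; rewrite addr0.
have e3 : 0 < eps / 3 by rewrite divr_gt0.
have [s us hs] := trig_approx e3.
set f := fun x => _; pose g x := \sum_(i <- s) c i * cis ((pr i)%:~R * x).
have cg : ccont g by apply: ccont_sum => i; apply: ccontZ; exact: ccont_cis.
have fg : fc g n = \sum_(i <- s) c i * (pr i == n)%:R.
  rewrite /g fc_sum; last by move=> i; apply: ccontZ; exact: ccont_cis.
  by apply: eq_bigr => i _; rewrite fcZ ?fc_cis//; exact: ccont_cis.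
have h1 : normc (fc f n - fc g n) <= 2 * (eps / 3).
  have -> : fc f n - fc g n = fc (fun x => f x + -1 * g x) n.
    by rewrite fcD ?fcZ ?mulN1r//; [exact: ccont_trig|exact: ccontZ].
  apply: normc_fc => [|x _]; first by apply: ccontD; [exact: ccont_trig|exact: ccontZ].
  rewrite mulN1r; apply/ltW/(hs (fun i => cis ((pr i)%:~R * x))) => i; by rewrite normc_cis.
have h2 : normc (csum (fun i => c i * (pr i == n)%:R) - fc g n) < eps / 3.
  rewrite fg; apply: hs => i; case: (_ == _); first by rewrite [normc _]normc1.
  by rewrite [normc _]normc0.
set a := csum _ in h2 *.
have -> : fc f n - a = (fc f n - fc g n) - (a - fc g n) by ring.
apply: le_trans (le_normcD _ _) _; rewrite normcN.
by move: h1 h2; lra.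
Qed.

End TrigSeries.

(** Relates the symmetric partial sums of classical Fourier series to the
   unordered sum. *)
Lemma csum_sym (a : int -> C) (eps : R) : csummable a -> 0 < eps ->
  exists N0, forall N, (N0 <= N)%N ->
  normc (a 0 + \sum_(k < N) (a k.+1%:Z + a (- k.+1%:Z)) - csum a) < eps.
Proof.
move=> sa e0; have e2 : 0 < eps / 2 by rewrite divr_gt0.
have [s us hs] := csum_approx sa e2.
exists (\max_(i <- s) `|i|%N) => N hN.
have [s' us' hs'] : exists2 s', uniq s' & (forall n : int, (n \in s') = (`|n| <= N)%N) /\
   \sum_(i <- s') a i = a 0 + \sum_(k < N) (a k.+1%:Z + a (- k.+1%:Z)).
  elim: (N) => [|K [t ut [ht st]]].
    exists [:: 0] => //; split; last by rewrite big_seq1 big_ord0 addr0.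
    by move=> n; rewrite inE leqn0 absz_eq0.
  exists (K.+1%:Z :: (- K.+1%:Z) :: t).
    by rewrite /= ut !inE !ht negb_or !andbT; apply/andP; split; [apply/andP; split|]; lia.
  split; first by move=> n; rewrite !inE ht; lia.
  by rewrite !big_cons st big_ord_recr /=; ring.
case: hs' => hs' <-.
pose g i := if i \in s' then a i else 0.
have := hs g; have := hs a (fun=> lexx _).
have -> : \sum_(i <- s) g i = \sum_(i <- s) a i.
  rewrite big_seq [RHS]big_seq; apply: eq_bigr => i si; rewrite /g hs'.
  have iN : (`|i| <= N)%N by apply: leq_trans hN; exact: (@leq_bigmax_seq _ s xpredT (fun i : int => `|i|%N) i si isT).
  by rewrite iN.
rewrite /g csum_fin// => h1 h2.
have {}h2 : normc (\sum_(i <- s') a i - \sum_(i <- s) a i) < eps / 2.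
  by apply: h2 => i; case: ifP => // _; rewrite [leLHS]normc0 normc_ge0.
set x := \sum_(i <- s') _ in h2 *; set y := \sum_(i <- s) _ in h1 h2; set z := csum a in h1 *.
have -> : x - z = (x - y) - (z - y) by ring.
by apply: le_lt_trans (le_normcD _ _) _; rewrite normcN; move: h1 h2; lra.
Qed.

Lemma Re_sum (I : Type) (s : seq I) (P : pred I) (F : I -> C) :
  Re (\sum_(i <- s | P i) F i) = \sum_(i <- s | P i) Re (F i).
Proof. by elim/big_ind2: _ => // z a w b <- <-; rewrite ReD. Qed.

Lemma Im_sum (I : Type) (s : seq I) (P : pred I) (F : I -> C) :
  Im (\sum_(i <- s | P i) F i) = \sum_(i <- s | P i) Im (F i).
Proof. by elim/big_ind2: _ => // z a w b <- <-; rewrite ImD. Qed.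

Lemma fc_pair (f : R -> C) (x : R) (n : int) : ccont f ->
  fc f n * cis (n%:~R * x) + fc f (- n) * cis ((- n)%:~R * x) =
  ((2 * pi)^-1 * 2)%:C * ctorus_int (fun y => f y * (cos (n%:~R * (y - x)))%:C).
Proof.
move=> cf; rewrite /fc rmorphM /= -!mulrA -mulrDr; congr (_ * _).
rewrite ![ctorus_int _ * _]mulrC -!ctorus_intZ; last 3 first.
- exact: fc_expin_cont.
- exact: fc_expin_cont.
- apply: ccontM => //; split=> y; last exact: cvg_cst.
  rewrite (_ : (fun x0 => _) = (fun x0 : R => cos (n%:~R * x0 + - (n%:~R * x)))).
    exact: (is_derive_continuous (is_derive_cosL _ _)).
  by apply/funext => z /=; rewrite mulrBr.
rewrite -ctorus_intD; [|by apply: ccontZ; exact: fc_expin_cont|by apply: ccontZ; exact: fc_expin_cont].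
congr ctorus_int; apply/funext => y.
rewrite !expin_cis mulrCA [X in _ + X]mulrCA -mulrDr [RHS]mulrCA; congr (_ * _).
rewrite -!cisD rmorphN /= !mulNr opprK.
have -> : n%:~R * x - n%:~R * y = - (n%:~R * (y - x)) by ring.
have -> : - (n%:~R * x) + n%:~R * y = n%:~R * (y - x) by ring.
by apply: complex_eq; rewrite ?ReD ?ImD ?ReM ?ImM /= ?cosN ?sinN; ring.
Qed.

(** The symmetric partial sums are Dirichlet integrals. *)
Lemma fourier_inversion (f : R -> C) (x : R) (d : C) : ccont f -> csummable (fc f) ->
  0 < x < 2 * pi -> is_cderive x f d ->
  f x = csum (fun n => fc f n * cis (n%:~R * x)).
Proof.
move=> cf fs xI [d1 d2].
set S := csum _.
have ss : csummable (fun n => fc f n * cis (n%:~R * x)).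
  by apply: csummable_le fs => n; rewrite normcM normc_cis mulr1.
apply/eqP; rewrite -subr_eq0 -normc_eq0; apply/eqP/le_anti/andP; split; last exact: normc_ge0.
apply/ler_addgt0Pl => eps e0; rewrite addr0.
have e3 : 0 < eps / 3 by rewrite divr_gt0.
have [N0 hN0] := csum_sym ss e3.
pose P (g : R -> R) N := (2 * pi)^-1 * (torus_int g + 2 * \sum_(k < N) torus_int (fun y => g y * cos (k.+1%:R * (y - x)))).
have hP (g : R -> R) dg : continuous g -> is_derive x 1 g dg -> exists N1, forall N, (N1 <= N)%N -> `|P g N - g x| < eps / 3.
  move=> cg hg; have h := dirichlet_cvg cg xI hg.
  have h' : P g N @[N --> \oo] --> g x.
    have -> : g x = (2 * pi)^-1 * (2 * pi * g x) by rewrite mulKf// gt_eqF// twopi_gt0.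
    by apply: cvgM => //; exact: cvg_cst.
  move/cvgrPdist_lt: h' => /(_ _ e3) [N1 _ hN1]; exists N1 => N hN.
  by rewrite distrC; exact: hN1.
have [N1 hN1] := hP _ _ cf.1 d1; have [N2 hN2] := hP _ _ cf.2 d2.
pose N := maxn N0 (maxn N1 N2).
have {}hN0 := hN0 N (leq_maxl _ _).
have {}hN1 := hN1 N (leq_trans (leq_maxl N1 N2) (leq_maxr _ _)).
have {}hN2 := hN2 N (leq_trans (leq_maxr N1 N2) (leq_maxr _ _)).
have E : fc f 0 * cis (0%:~R * x) + \sum_(k < N) (fc f k.+1%:Z * cis (k.+1%:Z%:~R * x) + fc f (- k.+1%:Z) * cis ((- k.+1%:Z)%:~R * x))
   = P (fun y => Re (f y)) N +i* P (fun y => Im (f y)) N.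
  under eq_bigr do rewrite fc_pair//.
  have e00 : fc f 0 * cis (0%:~R * x) = ((2 * pi)^-1)%:C * ctorus_int f.
    rewrite mul0r cis0 mulr1 /fc; congr (_ * ctorus_int _); apply/funext => y.
    by rewrite expin_cis mul0r oppr0 cis0 mulr1.
  have cR (z : C) (r : R) : (Re (z * r%:C) = Re z * r) * (Im (z * r%:C) = Im z * r).
    by rewrite ReM ImM /= !mulr0 subr0 add0r.
  have cR' (z : C) (r : R) : (Re (r%:C * z) = r * Re z) * (Im (r%:C * z) = r * Im z).
    by rewrite ReM ImM /= !mul0r subr0 addr0.
  rewrite e00; apply: complex_eq.
    rewrite -[RHS]/(P (fun y => Re (f y)) N) /P ReD cR' Re_sum (mulrDr (2 * pi)^-1 (torus_int _)) !mulr_sumr.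
    congr (_ + _); apply: eq_bigr => k _.
    rewrite cR' -mulrA; congr (_ * (_ * _)); apply: torus_int_eq => y _.
    by rewrite cR.
  rewrite -[RHS]/(P (fun y => Im (f y)) N) /P ImD cR' Im_sum (mulrDr (2 * pi)^-1 (torus_int _)) !mulr_sumr.
  congr (_ + _); apply: eq_bigr => k _.
  rewrite cR' -mulrA; congr (_ * (_ * _)); apply: torus_int_eq => y _.
  by rewrite cR.
rewrite E -/S in hN0.
set Q := _ +i* _ in hN0.
have -> : f x - S = (f x - Q) + (Q - S) by ring.
have h : normc (f x - Q) <= `|P (fun y => Re (f y)) N - Re (f x)| + `|P (fun y => Im (f y)) N - Im (f x)|.
  by apply: le_trans (normc_le_ReIm _) _; rewrite ReD ReN ImD ImN /= distrC [X in _ + X]distrC.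
apply: le_trans (le_normcD _ _) _.
by move: h hN0 hN1 hN2; lra.
Qed.

End FourierCoefficients.

(** * Fourier coefficients of smooth functions *)

Section SmoothCoefficients.
Context {R : realType}.
Local Notation J n := (japanese n : R).
Local Notation C := R[i].
Local Notation Re := complex.Re.
Local Notation Im := complex.Im.

Lemma is_cderive_smooth (phi : Cinfty R) k x :
  is_cderive x (cderive1n k phi) (cderive1n k.+1 phi x).
Proof.
have /asboolP[_ [s1 s2]] := Cinfty_subproof phi.
split => /=.
  by rewrite derive1E; apply: DeriveDef; first exact: s1.
by rewrite derive1E; apply: DeriveDef; first exact: s2.
Qed.

Lemma ccont_smooth (phi : Cinfty R) k : ccont (cderive1n k phi).
Proof. exact: ccont_cderive (is_cderive_smooth phi k). Qed.

Lemma cderive1n0 (f : R -> C) : cderive1n 0 f = f.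
Proof. by apply/funext => x; rewrite /cderive1n /derive1n /=; case: (f x). Qed.

Lemma ccont_Cinfty (phi : Cinfty R) : ccont (phi : R -> C).
Proof. by rewrite -(cderive1n0 phi); exact: ccont_smooth. Qed.

Lemma is_cderive_Cinfty (phi : Cinfty R) x : is_cderive x (phi : R -> C) (cderive1n 1 phi x).
Proof. by have := is_cderive_smooth phi 0 x; rewrite cderive1n0. Qed.

Lemma derive1n_periodic (f : R -> R) (c : R) k : (forall x, f (x + c) = f x) ->
  forall x, derive1n k f (x + c) = derive1n k f x.
Proof.
move=> h; elim: k => [//|k IH] x; rewrite !derive1nS /derive1.
rewrite (_ : (fun h0 : R => h0^-1 *: (derive1n k f (h0 + (x + c)) - derive1n k f (x + c))) =
  (fun h0 : R => h0^-1 *: (derive1n k f (h0 + x) - derive1n k f x))) //.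
by apply/funext => u; rewrite IH addrA IH.
Qed.

Lemma cderive1n_periodic (phi : Cinfty R) k x :
  cderive1n k phi (x + 2 * pi) = cderive1n k phi x.
Proof.
have /asboolP[per _] := Cinfty_subproof phi.
by apply: complex_eq => /=; apply: derive1n_periodic => y; rewrite per.
Qed.

Lemma ctorus_int_FTC (F f : R -> C) : (forall x, is_cderive x F (f x)) -> ccont f ->
  ctorus_int f = F (2 * pi) - F 0.
Proof.
move=> hF [c1 c2]; apply: complex_eq.
  rewrite ReD ReN -[LHS]/(torus_int (fun x => Re (f x))).
  exact: (torus_int_FTC (fun x => (hF x).1) c1).
rewrite ImD ImN -[LHS]/(torus_int (fun x => Im (f x))).
exact: (torus_int_FTC (fun x => (hF x).2) c2).
Qed.

Lemma is_cderive_expin n x : is_cderive x (expin_fun n : R -> C) ((0 +i* (- n%:~R)) * expin_fun n x).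
Proof.
have := is_cderive_cis x (- (n%:~R : R)); rewrite expin_cis mulNr.
by rewrite (_ : (fun t : R => cis (- n%:~R * t)) = expin_fun n) //; apply/funext => y; rewrite expin_cis mulNr.
Qed.

(** Integration by parts; the boundary terms cancel by periodicity. *)
Lemma fc_cderive (phi : Cinfty R) k n :
  fc (cderive1n k.+1 phi) n = (0 +i* n%:~R) * fc (cderive1n k phi) n.
Proof.
have h x := is_cderiveM (is_cderive_smooth phi k x) (is_cderive_expin n x).
have c0 := ccont_smooth phi k; have c1 := ccont_smooth phi k.+1.
have ce := @ccont_expin R n.
set a : C := 0 +i* (- n%:~R).
have -> : 0 +i* n%:~R = - a by apply: complex_eq; rewrite ?ReN ?ImN /= ?oppr0 ?opprK.
have cc : ccont (fun x => cderive1n k.+1 phi x * expin_fun n x + cderive1n k phi x * (a * expin_fun n x)).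
  by apply: ccontD; apply: ccontM => //; exact: ccontZ.
have := ctorus_int_FTC h cc.
have e : cderive1n k phi (2 * pi) * expin_fun n (2 * pi) = cderive1n k phi 0 * expin_fun n 0.
  rewrite -[X in cderive1n k phi X * _]add0r cderive1n_periodic; congr (_ * _).
  have /asboolP[per _] := Cinfty_subproof (expin n : Cinfty R).
  by rewrite -[X in expin_fun n X]add0r; exact: per.
rewrite e subrr (_ : (fun x => _) = (fun x => cderive1n k.+1 phi x * expin_fun n x + a * (cderive1n k phi x * expin_fun n x))); last first.
  by apply/funext => x; rewrite [X in _ + X]mulrCA.
rewrite ctorus_intD; [|exact: fc_expin_cont|by apply: ccontZ; exact: fc_expin_cont].
rewrite ctorus_intZ; last exact: fc_expin_cont.
by move=> /eqP; rewrite addr_eq0 => /eqP e1; rewrite /fc e1; ring.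
Qed.

Lemma fc_cderive2 (phi : Cinfty R) n :
  fc (cderive1n 2 phi) n = - (n%:~R ^+ 2)%:C * fc phi n.
Proof.
rewrite !fc_cderive cderive1n0 mulrA; congr (_ * _).
by apply: complex_eq; rewrite ?ReM ?ImM ?ReN ?ImN /=; ring.
Qed.

(** Since <n>^2 = 1 + n^2 is the symbol of 1 - d^2/dx^2. *)
Lemma fc_decay (phi : Cinfty R) (B : R) n :
  (forall (k : nat) x, (k <= 2)%N -> 0 <= x <= 2 * pi -> normc (cderive1n k phi x) <= B) ->
  normc (fc phi n) <= 4 * B * J n `^ (- 2).
Proof.
move=> h.
have e : (J n ^+ 2)%:C * fc phi n = fc (fun x => phi x + -1 * cderive1n 2 phi x) n.
  rewrite fcD; [|exact: ccont_Cinfty|by apply: ccontZ; exact: ccont_smooth].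
  rewrite fcZ; last exact: ccont_smooth.
  by rewrite fc_cderive2 japaneseE rmorphD /=; ring.
have h2 : normc (fc (fun x => phi x + -1 * cderive1n 2 phi x) n) <= 2 * (B + B).
  apply: normc_fc.
    by apply: ccontD; [exact: ccont_Cinfty|apply: ccontZ; exact: ccont_smooth].
  move=> x xI; apply: le_trans (le_normcD _ _) _.
  have := h 0%N x isT xI; rewrite cderive1n0 => h0; rewrite mulN1r normcN lerD//.
  exact: h.
move: h2; rewrite -e normcM normcR ger0_norm ?exprn_ge0 ?japanese_ge0// => h2.
rewrite powRN -[X in J n `^ X]/(2%:R) powR_mulrn ?japanese_ge0//.
rewrite ler_pdivlMr ?exprn_gt0 ?japanese_gt0// mulrC; apply: le_trans h2 _.
by rewrite le_eqVlt; apply/orP; left; apply/eqP; ring.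
Qed.

Lemma ccont_bounded (f : R -> C) (a b : R) : a <= b -> ccont f ->
  exists2 B : R, 0 <= B & forall x, a <= x <= b -> normc (f x) <= B.
Proof.
move=> ab [c1 c2].
have key (g : R -> R) : continuous g -> exists2 B : R, 0 <= B & forall x, a <= x <= b -> `|g x| <= B.
  move=> cg; have cn : {within `[a, b], continuous (fun x => `|g x|)}.
    by apply: continuous_subspaceT => x; apply: cvg_norm; exact: cg.
  have [c _ hc] := EVT_max ab cn; exists `|g c| => // x xI; apply: hc; rewrite in_itv/=; exact: xI.
have [B1 B10 h1] := key _ c1; have [B2 B20 h2] := key _ c2.
exists (B1 + B2) => [|x xI]; first exact: addr_ge0.
by apply: le_trans (normc_le_ReIm _) _; rewrite lerD ?h1 ?h2.
Qed.

Lemma Cinfty_decay (phi : Cinfty R) : exists2 B : R, 0 <= B &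
  forall n, normc (fc phi n) <= B * J n `^ (- 2).
Proof.
have pi2 : 0 <= 2 * pi :> R by rewrite ltW ?twopi_gt0.
have [B0 B00 h0] := ccont_bounded pi2 (ccont_smooth phi 0).
have [B1 B10 h1] := ccont_bounded pi2 (ccont_smooth phi 1).
have [B2 B20 h2] := ccont_bounded pi2 (ccont_smooth phi 2).
exists (4 * (B0 + B1 + B2)) => [|n]; first by rewrite mulr_ge0// !addr_ge0.
apply: fc_decay => -[|[|[|//]]] x _ xI.
- by apply: le_trans (h0 x xI) _; rewrite -addrA lerDl addr_ge0.
- by apply: le_trans (h1 x xI) _; rewrite addrAC lerDr addr_ge0.
- by apply: le_trans (h2 x xI) _; rewrite lerDr addr_ge0.
Qed.

Lemma csummable_japanese2 (c : int -> C) (B : R) : (forall n, normc (c n) <= B * J n `^ (- 2)) ->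
  csummable c.
Proof.
move=> h; have B0 : 0 <= B.
  rewrite -(pmulr_lge0 _ (powR_japanese_gt0 0 (-2) : 0 < J 0 `^ (-2))); apply: le_trans (h 0); exact: normc_ge0.
have l2 : 1 < 2 :> R by rewrite ltr1n.
apply: csummable_le h _.
apply: (@le_lt_trans _ _ (B * jsum 2)%:E); last exact: ltry.
apply: nsum_scale => //; first by move=> n; rewrite powR_ge0.
by rewrite (nsum_japanese l2).
Qed.

Lemma Cinfty_inversion (phi : Cinfty R) x : 0 < x < 2 * pi ->
  phi x = csum (fun n => fc phi n * cis (n%:~R * x)) :> C.
Proof.
move=> xI; apply: (fourier_inversion (ccont_Cinfty phi) _ xI (is_cderive_Cinfty phi x)).
by have [B _ hB] := Cinfty_decay phi; exact: csummable_japanese2 hB.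
Qed.

End SmoothCoefficients.

(** * The exponential windows *)

Section Windows.
Context {R : realType}.
Local Notation J n := (japanese n : R).
Local Notation C := R[i].
Local Notation Re := complex.Re.
Local Notation Im := complex.Im.
Local Notation CI f := ({within `[0, 2 * pi], continuous f}).

Lemma Rint_FTC (a b : R) (F f : R -> R) : a < b -> (forall x : R, is_derive x 1 F (f x)) ->
  continuous f -> \int[lebesgue_measure]_(x in `[a, b]) f x = F b - F a.
Proof.
move=> ab hF cf; rewrite /Rintegral (@continuous_FTC2 _ f F)//.
- exact: continuous_subspaceT.
- have cF := is_derive_continuous hF; split.
  + by move=> x _; have := hF x => h; exact: ex_derive.
  + exact: cvg_at_right_filter (cF a).
  + exact: cvg_at_left_filter (cF b).
- by move=> x _; rewrite derive1E; have := hF x => h; exact: derive_val.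
Qed.

Lemma torus_int_piecewise (f g1 g2 G1 G2 : R -> R) : CI f ->
  (forall x : R, is_derive x 1 G1 (g1 x)) -> (forall x : R, is_derive x 1 G2 (g2 x)) ->
  continuous g1 -> continuous g2 ->
  (forall x, 0 <= x <= pi -> f x = g1 x) -> (forall x, pi <= x <= 2 * pi -> f x = g2 x) ->
  torus_int f = G1 pi - G1 0 + (G2 (2 * pi) - G2 pi).
Proof.
move=> cf h1 h2 c1 c2 e1 e2; have p0 := @pi_gt0 R.
have p2 : pi < 2 * pi :> R by rewrite mulrDl mul1r ltrDl.
have fi := ci_integrable cf.
have := @Rintegral_itvB R f (BLeft 0) (BRight (2 * pi)) pi fi.
rewrite !bnd_simp => /(_ (ltW p0) (ltW p2)) h.
have -> : torus_int f = \int[lebesgue_measure]_(t in [set` Interval (BLeft 0) (BRight pi)]) f t +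
   \int[lebesgue_measure]_(x in [set` Interval (BRight pi) (BRight (2 * pi))]) f x.
  by rewrite -h addrC subrK.
rewrite Rintegral_itv_obnd_cbnd; last first.
  apply: integrableS fi => //= x /=; rewrite !in_itv /= => /andP[a ->]; rewrite andbT.
  by rewrite (le_trans (ltW p0) (ltW a)).
rewrite -(Rint_FTC p0 h1 c1) -(Rint_FTC p2 h2 c2); congr (_ + _); apply: eq_Rintegral => x.
  by rewrite inE /= in_itv /=; exact: e1.
by rewrite inE /= in_itv /=; exact: e2.
Qed.

(** Continuous across the period and equal to an exponential on both sides of its
   kink at pi; the centre makes both end points regular. *)
Definition window (m : R) (x : R) : C := (expR (- (m * `|x - pi|)))%:C.

Lemma window_left m x : x <= pi -> window m x = (expR (- (m * pi)))%:C * (expR (m * x))%:C.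
Proof.
by move=> xp; rewrite /window ler0_norm ?subr_le0// -rmorphM -expRD; congr ((expR _)%:C); ring.
Qed.

Lemma window_right m x : pi <= x -> window m x = (expR (m * pi))%:C * (expR (- m * x))%:C.
Proof.
by move=> xp; rewrite /window ger0_norm ?subr_ge0// -rmorphM -expRD; congr ((expR _)%:C); ring.
Qed.

Lemma ccont_window m : ccont (window m).
Proof.
split => x; last exact: cvg_cst.
apply: (@continuous_comp _ _ _ (fun x => - (m * `|x - pi|)) (@expR R)); last exact: continuous_expR.
apply: cvgN; apply: cvgM; first exact: cvg_cst.
by apply: cvg_norm; apply: cvgB; [exact: cvg_id|exact: cvg_cst].
Qed.

Lemma is_cderive_near (f g : R -> C) x d : (\near x, f x = g x) -> is_cderive x f d ->
  is_cderive x g d.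
Proof.
move=> h [d1 d2]; split.
  by apply: near_eq_is_derive d1; apply: filterS h => y ->.
by apply: near_eq_is_derive d2; apply: filterS h => y ->.
Qed.

Lemma is_cderive_window m x : x != pi -> exists d, is_cderive x (window m) d.
Proof.
move=> xp; have [xl|xr] := ltP x pi.
  exists ((expR (- (m * pi)))%:C * (m * expR (m * x))%:C).
  apply: (is_cderive_near _ (is_cderiveZ _ (is_cderive_expR x m))).
  near=> y; rewrite window_left//; apply: ltW; near: y; exact: lt_nbhsl.
have {}xr : pi < x by rewrite lt_neqAle eq_sym xp.
exists ((expR (m * pi))%:C * (- m * expR (- m * x))%:C).
apply: (is_cderive_near _ (is_cderiveZ _ (is_cderive_expR x (- m)))).
near=> y; rewrite window_right//; apply: ltW; near: y; exact: lt_nbhsr.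
Unshelve. all: by end_near. Qed.

Lemma is_cderive_exp_cis (a b x : R) : a != 0 ->
  is_cderive x (fun x => (a +i* b)^-1 * ((expR (a * x))%:C * cis (b * x)))
    ((expR (a * x))%:C * cis (b * x)).
Proof.
move=> a0; have h := is_cderiveZ (a +i* b)^-1 (is_cderiveM (is_cderive_expR x a) (is_cderive_cis x b)).
have ab : a +i* b != 0 by apply/eqP => -[e _]; rewrite e eqxx in a0.
rewrite (_ : _ * _ = (a +i* b)^-1 * ((a * expR (a * x))%:C * cis (b * x) + (expR (a * x))%:C * ((0 +i* b) * cis (b * x)))) //.
have -> : (a * expR (a * x))%:C = a%:C * (expR (a * x))%:C by rewrite rmorphM.
have e : a +i* b = a%:C + (0 +i* b) by apply: complex_eq; rewrite ?ReD ?ImD /= ?addr0 ?add0r.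
set E := (expR _)%:C; set c := cis _.
rewrite (_ : a%:C * E * c + E * ((0 +i* b) * c) = (a +i* b) * (E * c)); last by rewrite e; ring.
by rewrite mulKf.
Qed.

(** The coefficients are explicit, since the restrictions to both halves are
   exponentials: 2 m (exp(- i pi l) - exp(- m pi)) / (m^2 + l^2) before
   normalization. *)
Lemma normc_fc_window (m : R) (l : int) : 0 < m -> normc (fc (window m) l) <= m / (m ^+ 2 + l%:~R ^+ 2).
Proof.
move=> m0; have p0 := @pi_gt0 R.
pose b : R := - l%:~R.
pose k1 : C := (expR (- (m * pi)))%:C; pose k2 : C := (expR (m * pi))%:C.
pose G1 x := k1 * ((m +i* b)^-1 * ((expR (m * x))%:C * cis (b * x))).
pose g1 x := k1 * ((expR (m * x))%:C * cis (b * x)).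
pose G2 x := k2 * ((- m +i* b)^-1 * ((expR (- m * x))%:C * cis (b * x))).
pose g2 x := k2 * ((expR (- m * x))%:C * cis (b * x)).
have mN0 : m != 0 by rewrite gt_eqF.
have h1 x : is_cderive x G1 (g1 x) by apply: is_cderiveZ; exact: is_cderive_exp_cis.
have h2 x : is_cderive x G2 (g2 x) by apply: is_cderiveZ; apply: is_cderive_exp_cis; rewrite oppr_eq0.
have cex a : ccont (fun x : R => (expR (a * x))%:C) by exact: ccont_cderive (fun x => is_cderive_expR x a).
have c1 : ccont g1 by apply: ccontZ; apply: ccontM; [exact: cex|exact: ccont_cis].
have c2 : ccont g2 by apply: ccontZ; apply: ccontM; [exact: cex|exact: ccont_cis].
pose f x := window m x * expin_fun l x.
have cf : ccont f by apply: fc_expin_cont; exact: ccont_window.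
have e1 x : 0 <= x <= pi -> f x = g1 x.
  by move=> /andP[_ xp]; rewrite /f window_left// expin_cis -mulrA -mulNr.
have e2 x : pi <= x <= 2 * pi -> f x = g2 x.
  by move=> /andP[xp _]; rewrite /f window_right// expin_cis -mulrA -mulNr.
have E : ctorus_int f = G1 pi - G1 0 + (G2 (2 * pi) - G2 pi).
  apply: complex_eq; rewrite !(ReD, ReN, ImD, ImN).
    rewrite -[LHS]/(torus_int (fun x => Re (f x))).
    apply: (torus_int_piecewise (ci_cont cf.1) (fun x => (h1 x).1) (fun x => (h2 x).1) c1.1 c2.1).
      by move=> x xI; rewrite e1.
    by move=> x xI; rewrite e2.
  rewrite -[LHS]/(torus_int (fun x => Im (f x))).
  apply: (torus_int_piecewise (ci_cont cf.2) (fun x => (h1 x).2) (fun x => (h2 x).2) c1.2 c2.2).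
    by move=> x xI; rewrite e1.
  by move=> x xI; rewrite e2.
have cl2 : cis (b * (2 * pi)) = 1.
  have [hc hs] := cos_sin_periodic l (0 : R).
  by rewrite /b mulNr -cisJ /cis -[l%:~R * _]addr0 hc hs cos0 sin0 /conjc oppr0.
have ED : (m +i* b)^-1 - (- m +i* b)^-1 = (2 * m / (m ^+ 2 + l%:~R ^+ 2))%:C.
  have n1 : m +i* b != 0 by apply/eqP => -[e _]; rewrite e eqxx in mN0.
  have n2 : - m +i* b != 0 by apply/eqP => -[/eqP]; rewrite oppr_eq0 (negPf mN0).
  have d0 : m ^+ 2 + l%:~R ^+ 2 != 0 by rewrite gt_eqF// ltr_pwDl ?exprn_gt0 ?sqr_ge0.
  apply: (mulfI (mulf_neq0 n1 n2)).
  have i1 : (m +i* b) * (m +i* b)^-1 = 1 by rewrite mulfV.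
  have i2 : (- m +i* b) * (- m +i* b)^-1 = 1 by rewrite mulfV.
  rewrite (_ : forall u v x y : C, u * v * (x - y) = (u * x) * v - u * (v * y)); last by move=> *; ring.
  rewrite i1 i2 mul1r mulr1.
  apply: complex_eq; rewrite ?ReM ?ImM ?ReD ?ImD ?ReN ?ImN /= /b; field; exact: d0.
have E' : ctorus_int f = (cis (b * pi) - k1) * (2 * m / (m ^+ 2 + l%:~R ^+ 2))%:C.
  have k12 : k1 * (expR (m * pi))%:C = 1 by rewrite /k1 -rmorphM -expRD addNr expR0.
  have k21 : k2 * (expR (- m * pi))%:C = 1 by rewrite /k2 -rmorphM -expRD mulNr subrr expR0.
  have k22 : k2 * (expR (- m * (2 * pi)))%:C = k1.
    by rewrite /k2 /k1 -rmorphM -expRD; congr ((expR _)%:C); ring.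
  have z0 : (expR (m * 0))%:C * cis (b * 0) = 1 by rewrite !mulr0 expR0 cis0 mulr1.
  rewrite E /G1 /G2 cl2 z0 -ED.
  set u := (m +i* b)^-1; set v := (- m +i* b)^-1; set c := cis _.
  rewrite (_ : k1 * (u * (_ * c)) = (k1 * (expR (m * pi))%:C) * (u * c)); last by ring.
  rewrite (_ : k2 * (v * ((expR (- m * (2 * pi)))%:C * 1)) = (k2 * (expR (- m * (2 * pi)))%:C) * v); last by ring.
  rewrite (_ : k2 * (v * (_ * c)) = (k2 * (expR (- m * pi))%:C) * (v * c)); last by ring.
  by rewrite k12 k21 k22; ring.
rewrite /fc E' !normcM !normcR.
have d0 : 0 < m ^+ 2 + l%:~R ^+ 2 by rewrite ltr_pwDl ?exprn_gt0 ?sqr_ge0.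
rewrite !ger0_norm ?invr_ge0 ?mulr_ge0 ?invr_ge0 ?(ltW p0) ?(ltW m0) ?(ltW d0)//.
have n2 : normc (cis (b * pi) - k1) <= 2.
  apply: le_trans (le_normcD _ _) _; rewrite normc_cis normcN normcR ger0_norm ?expR_ge0//.
  have : expR (- (m * pi)) <= 1 by rewrite -expR0 ler_expR oppr_le0 mulr_ge0 ?ltW.
  by lra.
apply: (@le_trans _ _ ((2 * pi)^-1 * (2 * (2 * m / (m ^+ 2 + l%:~R ^+ 2))))).
  rewrite ler_wpM2l ?invr_ge0 ?mulr_ge0 ?(ltW p0)// ler_wpM2r// divr_ge0 ?(ltW d0)// mulr_ge0// ltW//.
set d := m ^+ 2 + _ in d0 *.
have gen (x y : R) : x != 0 -> y != 0 -> (2 * x)^-1 * (2 * (2 * m / y)) = (2 / x) * (m / y).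
  by move=> x0 y0; field; apply/andP; split.
rewrite (gen pi d); [|by rewrite gt_eqF|by rewrite gt_eqF].
by rewrite ler_piMl ?divr_ge0 ?(ltW m0) ?(ltW d0)// ler_pdivrMr// mul1r pi_ge2.
Qed.

(** Interpolating between the two terms of m^2 + l^2 trades a small power
   of m for decay slightly better than <l>^-1. *)
Lemma window_decay (m e : R) (l : int) : 1 <= m -> 0 <= e <= 1 ->
  m / (m ^+ 2 + l%:~R ^+ 2) <= 2 * m `^ e * J l `^ (- (1 + e)).
Proof.
move=> m1 /andP[e0 e1]; have m0 : 0 < m := lt_le_trans ltr01 m1.
have j0 := @japanese_gt0 R l.
have d0 : 0 < m ^+ 2 + l%:~R ^+ 2 by rewrite ltr_pwDl ?exprn_gt0 ?sqr_ge0.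
rewrite ler_pdivrMr//.
have h : m `^ (1 - e) * J l `^ (1 + e) <= 2 * (m ^+ 2 + l%:~R ^+ 2).
  pose x := Num.max m (J l).
  have x0 : 0 < x by rewrite lt_max m0.
  apply: (@le_trans _ _ (x `^ (1 - e) * x `^ (1 + e))).
    apply: ler_pM; rewrite ?powR_ge0// ge0_ler_powR ?nnegrE ?(ltW m0) ?(ltW x0) ?(ltW j0) ?subr_ge0 ?addr_ge0//.
      by rewrite le_max lexx.
    by rewrite le_max lexx orbT.
  rewrite -powRD; last by rewrite (gt_eqF x0) implybT.
  rewrite (_ : 1 - e + (1 + e) = 2%:R); last by ring.
  rewrite powR_mulrn ?(ltW x0)// /x; have := japaneseE l (R := R).
  have : 1 <= m ^+ 2 by rewrite expr_ge1 ?(ltW m0).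
  have := sqr_ge0 (l%:~R : R).
  by rewrite /Num.max; case: ifP => _ ? ? E; rewrite ?E; lra.
have mE : m = m `^ e * (m `^ (1 - e) * J l `^ (1 + e)) * J l `^ (- (1 + e)).
  rewrite mulrA -powRD; last by rewrite (gt_eqF m0) implybT.
  rewrite -[RHS]mulrA -powRD; last by rewrite (gt_eqF j0) implybT.
  by rewrite subrr powRr0 mulr1 addrC subrK powRr1// ltW.
apply: (@le_trans _ _ (m `^ e * (2 * (m ^+ 2 + l%:~R ^+ 2)) * J l `^ (- (1 + e)))).
  by rewrite {1}mE ler_wpM2r ?powR_ge0// ler_wpM2l ?powR_ge0.
set w := J l `^ _; move: (m ^+ 2 + _) => d; rewrite le_eqVlt; apply/orP; left; apply/eqP.
by move: (m `^ e) => u; ring.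
Qed.

Variables (p : R) (p1 : 1 <= p).
Let p0 : 0 < p. Proof. exact: lt_le_trans ltr01 p1. Qed.

(** The exponent e = 1 / (20 p) leaves <l>^(-1 - 1/40) after multiplication by the
   weight and raising to the power p. *)
Lemma tnorm_window (m k : R) (c : int -> C) : 1 <= m -> 0 <= k ->
  (forall l, normc (c l) <= k * (m / (m ^+ 2 + l%:~R ^+ 2))) ->
  csummable c /\
  (tnorm p (fun l => normc (c l)) <= ((2 * k) `^ p * m `^ (1 / 20) * jsum (1 + 1 / 40))%:E)%E.
Proof.
move=> m1 k0 hc; have m0 : 0 < m := lt_le_trans ltr01 m1.
pose q := p^-1; have q0 : 0 < q by rewrite invr_gt0.
have q1 : q <= 1 by rewrite invf_le1.
pose e := q / 20.
have eI : 0 <= e <= 1 by rewrite /e; apply/andP; split; lra.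
have hc' l : normc (c l) <= 2 * k * m `^ e * J l `^ (- (1 + e)).
  apply: le_trans (hc l) _.
  rewrite (_ : 2 * k * _ * _ = k * (2 * m `^ e * J l `^ (- (1 + e)))); last by ring.
  by rewrite ler_wpM2l// window_decay.
have mk : 0 <= 2 * k * m `^ e by rewrite !mulr_ge0 ?powR_ge0.
split.
  apply: csummable_le hc' _.
  have l1 : 1 < 1 + e by rewrite ltrDl /e divr_gt0.
  apply: (@le_lt_trans _ _ (2 * k * m `^ e * jsum (1 + e))%:E); last exact: ltry.
  apply: nsum_scale => // [l|]; first exact: powR_ge0.
  by rewrite (nsum_japanese l1).
rewrite /tnorm.
apply: (@le_trans _ _ (nsum (fun l : int => ((2 * k) `^ p * m `^ (1 / 20) * J l `^ (- (1 + 1 / 40)))%:E))).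
  apply: le_nsum => l; rewrite lee_fin.
  have pq : q * p = 1 by rewrite /q mulVf// gt_eqF.
  have -> : (2 * k) `^ p * m `^ (1 / 20) * J l `^ (- (1 + 1 / 40)) =
      (J l `^ (bexp p) * (2 * k * m `^ e * J l `^ (- (1 + e)))) `^ p.
    rewrite mulrCA -powRD; last by rewrite (gt_eqF (japanese_gt0 l)) implybT.
    rewrite [in RHS]powRM ?powR_ge0// [in RHS](powRM (x := 2 * k)) ?powR_ge0 ?mulr_ge0// -!powRrM.
    congr (_ * _ `^ _ * _ `^ _).
      by rewrite /e mulrAC pq.
    rewrite /bexp /e -/q (_ : _ * p = (- 1 + 1 / 40 - 1 / 20) * (q * p)); last by ring.
    by rewrite pq; field.
  rewrite ge0_ler_powR ?nnegrE ?(ltW p0) ?mulr_ge0 ?powR_ge0 ?normc_ge0//.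
  by rewrite ler_wpM2l ?powR_ge0.
have l1 : 1 < 1 + 1 / 40 :> R by lra.
apply: nsum_scale => //; first by rewrite mulr_ge0 ?powR_ge0.
  by move=> l; rewrite powR_ge0.
by rewrite (nsum_japanese l1).
Qed.

Lemma window_series (m k x0 : R) : 0 < m -> 0 < k -> csummable (fc (window m)) ->
  forall t, 0 < t + x0 < 2 * pi -> t + x0 != pi ->
  csum (fun l => k%:C * fc (window m) l * cis (l%:~R * x0) * cis (l%:~R * t)) =
  (k * expR (- (m * `|t + x0 - pi|)))%:C.
Proof.
move=> m0 k0 ws t tI tp; have [d hd] := is_cderive_window m tp.
have := fourier_inversion (ccont_window m) ws tI hd.
rewrite /window rmorphM /= => ->; rewrite -csumZ; last first.
  by apply: csummable_le ws => n; rewrite normcM normc_cis mulr1.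
apply: eq_csum => l; rewrite mulrDr cisD; ring.
Qed.

(** Absolutely convergent series that agree with exp(- M t) and exp(2 M t) on
   the short interval [0, 1/M] only, at the price of a small power of M. *)
Lemma exp_windows : exists2 Cw : R, 0 < Cw & forall M : R, 1 <= M ->
  exists gamma eta : int -> C,
  [/\ csummable gamma /\ csummable eta,
      (tnorm p (fun l => normc (gamma l)) <= (Cw * M `^ (1 / 20))%:E)%E,
      (tnorm p (fun l => normc (eta l)) <= (Cw * M `^ (1 / 20))%:E)%E,
      forall t, 0 <= t <= M^-1 -> csum (fun l => gamma l * cis (l%:~R * t)) = (expR (- (M * t)))%:C &
      forall t, 0 <= t <= M^-1 -> csum (fun l => eta l * cis (l%:~R * t)) = (expR (2 * (M * t)))%:C].
Proof.
pose k1 := expR (2^-1) : R; pose k2 := expR 3 : R.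
have k10 : 0 < k1 := expR_gt0 _; have k20 : 0 < k2 := expR_gt0 _.
have j0 := @jsum_ge0 R (1 + 1 / 40).
pose A := (2 * k1) `^ p * jsum (1 + 1 / 40); pose B := (2 * k2) `^ p * jsum (1 + 1 / 40).
have A0 : 0 <= A by rewrite mulr_ge0 ?powR_ge0.
have B0 : 0 <= B by rewrite mulr_ge0 ?powR_ge0.
have AB : 0 < A + 2 * B + 1 by move: A0 B0; clearbody A B; lra.
exists (A + 2 * B + 1) => //.
move=> M M1; have M0 : 0 < M := lt_le_trans ltr01 M1.
have Mi0 : 0 < M^-1 by rewrite invr_gt0.
have Mi1 : M^-1 <= 1 by rewrite invf_le1.
have pi2 := @pi_ge2 R.
have M2 : 1 <= 2 * M by lra.
have ws m : 1 <= m -> csummable (fc (window m)).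
  move=> m1; have hc l : normc (fc (window m) l) <= 1 * (m / (m ^+ 2 + l%:~R ^+ 2)).
    by rewrite mul1r; apply: normc_fc_window; exact: lt_le_trans ltr01 m1.
  by have [] := tnorm_window m1 ler01 hc.
(* These shifts move [0, 1/M] strictly inside one of the halves of the period,
   away from the kink of the window. *)
pose x1 := pi + M^-1 / 2 : R; pose x2 := pi - 3 / 2 * M^-1 : R.
pose gamma l := k1%:C * fc (window M) l * cis (l%:~R * x1).
pose eta l := k2%:C * fc (window (2 * M)) l * cis (l%:~R * x2).
have [gs gt] : csummable gamma /\ (tnorm p (fun l => normc (gamma l)) <= ((2 * k1) `^ p * M `^ (1 / 20) * jsum (1 + 1 / 40))%:E)%E.
  apply: tnorm_window => // [|l]; first exact: ltW.
  rewrite normcM normc_cis mulr1 normcM normcR gtr0_norm//; apply: ler_wpM2l; [exact: ltW|exact: normc_fc_window].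
have [es et] : csummable eta /\ (tnorm p (fun l => normc (eta l)) <= ((2 * k2) `^ p * (2 * M) `^ (1 / 20) * jsum (1 + 1 / 40))%:E)%E.
  apply: tnorm_window => // [|l]; first exact: ltW.
  rewrite normcM normc_cis mulr1 normcM normcR gtr0_norm//; apply: ler_wpM2l; [exact: ltW|apply: normc_fc_window; lra].
have MP : 0 <= M `^ (1 / 20) := powR_ge0 _ _.
exists gamma, eta; split => //.
- apply: le_trans gt _; rewrite lee_fin mulrAC -/A; apply: ler_wpM2r => //.
  by move: A0 B0; clearbody A B; lra.
- apply: le_trans et _; rewrite lee_fin mulrAC -/B.
  rewrite (powRM (x := 2)) ?(ltW M0)// mulrA; apply: ler_wpM2r => //.
  have h2 : 2 `^ (1 / 20) <= 2 :> R.
    by rewrite -[leRHS]powRr1// ler_powR ?ler1n//; lra.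
  apply: le_trans (ler_wpM2l B0 h2) _.
  by move: A0 B0; clearbody A B; lra.
- move=> t /andP[t0 tM]; have e : t + x1 - pi = t + M^-1 / 2 by rewrite /x1; ring.
  rewrite (window_series M0 k10 (ws M M1)).
  + rewrite e ger0_norm; last by lra.
    by rewrite /k1 -expRD; congr ((expR _)%:C); field; rewrite gt_eqF.
  + by apply/andP; rewrite /x1; split; lra.
  + by rewrite -subr_eq0 e; apply/eqP; lra.
- move=> t /andP[t0 tM]; have e : t + x2 - pi = t - 3 / 2 * M^-1 by rewrite /x2; ring.
  have M20 : 0 < 2 * M by lra.
  rewrite (window_series M20 k20 (ws (2 * M) M2)).
  + rewrite e ltr0_norm; last by lra.
    by rewrite /k2 -expRD; congr ((expR _)%:C); field; rewrite gt_eqF.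
  + by apply/andP; rewrite /x2; split; lra.
  + by rewrite -subr_eq0 e; apply/eqP; lra.
Qed.

End Windows.

(** * Lipschitz dependence of the profiles on their data *)

Section Stability.
Context {R : realType}.
Local Notation J n := (japanese n : R).
Local Notation C := R[i].
Variables (p s : R) (p1 : 1 <= p) (s0 : 0 <= s).
Let p0 : 0 < p. Proof. exact: lt_le_trans ltr01 p1. Qed.

(** The weights with kap > 0 control two extra derivatives, with
   submultiplicativity constants independent of kap. *)
Definition wt (kap : R) (n : int) : R := J n `^ s * (1 + kap * J n ^+ 2).

Lemma wt_gt0 kap n : 0 <= kap -> 0 < wt kap n.
Proof.
by move=> k0; rewrite mulr_gt0 ?powR_japanese_gt0// ltr_wpDr// mulr_ge0// exprn_ge0// japanese_ge0.
Qed.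

Lemma wt0 n : wt 0 n = J n `^ s.
Proof. by rewrite /wt mul0r addr0 mulr1. Qed.

Lemma wt_ge kap n : 0 <= kap -> kap * J n ^+ 2 <= wt kap n.
Proof.
move=> k0; have j0 : 0 <= kap * J n ^+ 2 by rewrite mulr_ge0// exprn_ge0// japanese_ge0.
rewrite -[leLHS]mul1r; apply: ler_pM => //; first exact: powR_japanese_ge1.
by rewrite lerDr.
Qed.

Lemma wt_mul kap j k l : 0 <= kap ->
  wt kap (j - k + l) <= 4 `^ s * 3 * (wt kap j * wt kap k * wt kap l).
Proof.
move=> k0; set a := j - k + l.
have ja := @japanese_ge1 R a; have j1 := @japanese_ge1 R j; have j2 := @japanese_ge1 R k; have j3 := @japanese_ge1 R l.
have h1 : J a `^ s <= 4 `^ s * (J j `^ s * J k `^ s * J l `^ s).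
  have g0 (x : R) : 1 <= x -> 0 <= x by lra.
  have n1 := g0 _ j1; have n2 := g0 _ j2; have n3 := g0 _ j3.
  rewrite -(powRM s n1 n2) -(powRM s (mulr_ge0 n1 n2) n3) -powRM ?mulr_ge0//.
  apply: ge0_ler_powR; rewrite ?nnegrE ?mulr_ge0 ?(g0 _ ja)//.
  have a1 := @japaneseM R (j - k) l; have a2 := @japaneseM R j (- k).
  rewrite japaneseN in a2; apply: le_trans a1 _.
  rewrite (_ : 4 * (J j * J k * J l) = 2 * (2 * (J j * J k) * J l)); last by ring.
  by rewrite ler_wpM2l// ler_wpM2r// g0.
have h2 : 1 + kap * J a ^+ 2 <= 3 * ((1 + kap * J j ^+ 2) * (1 + kap * J k ^+ 2) * (1 + kap * J l ^+ 2)).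
  have a1 := @japaneseD R (j - k) l; have a2 := @japaneseD R j (- k).
  rewrite japaneseN in a2.
  have a3 : J a <= J j + J k + J l by apply: le_trans a1 _; rewrite lerD2r.
  have a4 : J a ^+ 2 <= 3 * (J j ^+ 2 + J k ^+ 2 + J l ^+ 2).
    apply: (@le_trans _ _ ((J j + J k + J l) ^+ 2)).
      by apply: lerXn2r; rewrite ?nnegrE//; [exact: japanese_ge0|rewrite !addr_ge0 ?japanese_ge0].
    move: (J j) (J k) (J l) => x y z; rewrite -subr_ge0.
    rewrite (_ : _ - _ = (x - y) ^+ 2 + (x - z) ^+ 2 + (y - z) ^+ 2); last by ring.
    by rewrite !addr_ge0 ?sqr_ge0.
  have a5 := ler_wpM2l k0 a4.
  have q (n : int) : 0 <= kap * J n ^+ 2 by rewrite mulr_ge0// exprn_ge0// japanese_ge0.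
  have q1 := q j; have q2 := q k; have q3 := q l.
  have q12 := mulr_ge0 q1 q2; have q13 := mulr_ge0 q1 q3; have q23 := mulr_ge0 q2 q3.
  have q123 := mulr_ge0 q12 q3.
  move: a5 q1 q2 q3 q12 q13 q23 q123.
  set x := J j ^+ 2; set y := J k ^+ 2; set z := J l ^+ 2; set w := J a ^+ 2.
  have -> : kap * (3 * (x + y + z)) = 3 * (kap * x) + 3 * (kap * y) + 3 * (kap * z) by ring.
  move: (kap * x) (kap * y) (kap * z) (kap * w) => X Y Z V.
  have -> : (1 + X) * (1 + Y) * (1 + Z) = 1 + X + Y + Z + X * Y + X * Z + Y * Z + X * Y * Z by ring.
  move: (X * Y * Z) (X * Y) (X * Z) (Y * Z) => t u v r; clear; lra.
rewrite /wt.
rewrite (_ : 4 `^ s * 3 * _ = (4 `^ s * (J j `^ s * J k `^ s * J l `^ s)) * (3 * ((1 + kap * J j ^+ 2) * (1 + kap * J k ^+ 2) * (1 + kap * J l ^+ 2)))); last by ring.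
apply: ler_pM => //; first exact: powR_ge0.
by rewrite addr_ge0// mulr_ge0// exprn_ge0// japanese_ge0.
Qed.

Lemma anorm_le (W1 W2 : int -> R) (a b : int -> C) (K B : R) : 0 <= K ->
  (forall n, 0 <= W2 n) ->
  (forall n, 0 <= W1 n * normc (a n) <= K * (W2 n * normc (b n))) ->
  (anorm p W2 b <= B%:E)%E -> (anorm p W1 a <= (K `^ p * B)%:E)%E.
Proof.
move=> K0 W0 h hb; rewrite /anorm.
apply: (@le_trans _ _ (nsum (fun n => (K `^ p * (W2 n * normc (b n)) `^ p)%:E))).
  apply: le_nsum => n; have /andP[h0 hn] := h n.
  have wn0 : 0 <= W2 n * normc (b n) by rewrite mulr_ge0 ?normc_ge0.
  rewrite lee_fin -powRM// ge0_ler_powR ?nnegrE ?(ltW p0)// mulr_ge0//.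
by apply: nsum_scale => // [|n]; rewrite powR_ge0.
Qed.

(** A small kap makes the extra derivatives cost at most 1, so that the lifespan
   does not depend on the size of the smooth norms. *)
Lemma wt_small (a : int -> C) (rho0 D : R) : 0 <= D ->
  (anorm p (wt 0) a <= rho0%:E)%E ->
  (anorm p (fun n => (wt 0 n * J n ^+ 2)%R) a <= D%:E)%E ->
  exists2 kap : R, 0 < kap & (anorm p (wt kap) a <= (2 `^ p * (rho0 + 1))%:E)%E.
Proof.
move=> D0 ha hD; exists (D + 1)^-1; first by rewrite invr_gt0; lra.
set kap := (D + 1)^-1; have k0 : 0 < kap by rewrite invr_gt0; lra.
have k1 : kap <= 1 by rewrite invf_le1; lra.
have kD : kap `^ p * D <= 1.
  apply: (@le_trans _ _ (kap * D)).
    rewrite ler_wpM2r// -[leRHS]powRr1 ?(ltW k0)//; apply: ger_powR => //; by rewrite k0 k1.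
  by rewrite /kap mulrC ler_pdivrMr; lra.
have w0 n : 0 <= wt 0 n by rewrite ltW// wt_gt0.
apply: (@le_trans _ _ ((2 `^ p)%:E * (anorm p (wt 0) a + nsum (fun n => (kap `^ p * (wt 0 n * J n ^+ 2 * normc (a n)) `^ p)%:E)))%E).
  rewrite /anorm -nsumD; last 2 first.
  - by move=> n; rewrite lee_fin powR_ge0.
  - by move=> n; rewrite lee_fin mulr_ge0 ?powR_ge0.
  rewrite -nsumZ ?powR_ge0//; last by move=> n; rewrite adde_ge0 ?lee_fin ?mulr_ge0 ?powR_ge0.
  apply: le_nsum => n; rewrite -EFinD -EFinM lee_fin.
  have j0 : 0 <= wt 0 n * J n ^+ 2 * normc (a n) by rewrite mulr_ge0 ?normc_ge0// mulr_ge0 ?w0// exprn_ge0// japanese_ge0.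
  have -> : wt kap n * normc (a n) = wt 0 n * normc (a n) + kap * (wt 0 n * J n ^+ 2 * normc (a n)).
    by rewrite wt0 /wt; ring.
  rewrite -powRM ?(ltW k0)//; apply: powRD_le => //; first by rewrite mulr_ge0 ?normc_ge0.
  by rewrite mulr_ge0 ?(ltW k0).
rewrite EFinM; apply: lee_wpmul2l; first by rewrite lee_fin powR_ge0.
rewrite EFinD; apply: leeD => //.
apply: (@le_trans _ _ (kap `^ p * D)%:E); last by rewrite lee_fin.
by apply: nsum_scale => // [|n]; rewrite powR_ge0.
Qed.

Lemma powR_contract (x c : R) : 0 <= x -> 0 <= c <= 1 -> (x * c) `^ p <= c * x `^ p.
Proof.
move=> x0 /andP[c0 c1]; rewrite powRM// mulrC ler_wpM2r ?powR_ge0//.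
have [->|cn0] := eqVneq c 0; first by rewrite powR0// gt_eqF.
have cp : 0 < c by rewrite lt_neqAle eq_sym cn0.
rewrite -[leRHS]powRr1//; apply: ger_powR => //; by rewrite cp c1.
Qed.

(** The windows cost M^(1/20) in G, twice in the square of Y, while T
   gains M^(-2/5), so a large M makes the cubic term a contraction. *)
Lemma contraction_parameters (Ct Cw A rho : R) : 0 < Ct -> 0 < Cw -> 0 < A -> 0 <= rho ->
  exists2 M : R, 1 <= M &
  let G := Cw * M `^ (1 / 20) in let T := Ct * A `^ p * M `^ (- (2 / 5)) in
  let Y := 2 * 2 `^ p * (G * rho) in
  2 `^ p * (G * rho + T * (Y * (Y * Y))) <= Y /\
  2 `^ p * 2 `^ p * 2 `^ p * (3 * (T * (Y * Y))) <= 2^-1.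
Proof.
move=> Ct0 Cw0 A0 r0; pose P : R := 2 `^ p.
have P1 : 1 <= P by rewrite -(@powRr0 R 2) ler_powR ?ler1n// ltW.
have P0 : 0 < P := lt_le_trans ltr01 P1.
pose K0 := P * P * P * (3 * (Ct * A `^ p * (2 * P * (Cw * rho)) ^+ 2)).
have K00 : 0 <= K0.
  rewrite /K0; apply: mulr_ge0; first by rewrite !mulr_ge0 ?(ltW P0).
  by apply: mulr_ge0 => //; apply: mulr_ge0; [rewrite mulr_ge0 ?powR_ge0 ?(ltW Ct0)|exact: sqr_ge0].
pose x := 1 + 2 * K0; have x1 : 1 <= x by rewrite /x; lra.
have x0 : 0 < x := lt_le_trans ltr01 x1.
(* T * Y ^ 2 scales like M ^ (- 3 / 10), and (x ^ 4) ^ (- 3 / 10) <= x ^ -1. *)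
exists (x ^+ 4) => [|G T Y]; first by rewrite expr_ge1 ?(ltW x0).
set M := x ^+ 4 in G T Y *; have M0 : 0 < M by rewrite exprn_gt0.
have e : M `^ (- (2 / 5)) * (M `^ (1 / 20) * M `^ (1 / 20)) <= x^-1.
  rewrite -!powRD; try by rewrite (gt_eqF M0) implybT.
  rewrite /M -powR_mulrn ?(ltW x0)// -powRrM -(@powR_inv1 R x) ?(ltW x0)//.
  by apply: ler_powR => //; lra.
have TY : P * P * P * (3 * (T * (Y * Y))) <= 2^-1.
  rewrite (_ : P * P * P * _ = K0 * (M `^ (- (2 / 5)) * (M `^ (1 / 20) * M `^ (1 / 20)))); last first.
    rewrite /K0 /T /Y /G -/P; move: (M `^ _) (M `^ _) (A `^ p) => a b c; ring.
  apply: le_trans (ler_wpM2l K00 e) _.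
  by rewrite ler_pdivrMr// /x; lra.
have Y0 : 0 <= Y by rewrite /Y /G !mulr_ge0 ?powR_ge0 ?(ltW Cw0).
have T0 : 0 <= T by rewrite /T !mulr_ge0 ?powR_ge0 ?(ltW Ct0).
split; last exact: TY.
have PT : P * (T * (Y * Y)) <= 2^-1.
  apply: le_trans TY; have ty : 0 <= T * (Y * Y) := mulr_ge0 T0 (mulr_ge0 Y0 Y0).
  rewrite (_ : P * P * P * _ = P * (T * (Y * Y)) * (P * P * 3)); last by ring.
  apply: ler_peMr; first by rewrite mulr_ge0// ltW.
  by rewrite !mulr_ege1// ler1n.
rewrite -/P (_ : P * _ = P * (G * rho) + P * (T * (Y * Y)) * Y); last by ring.
have := ler_wpM2r Y0 PT; have : Y = 2 * (P * (G * rho)) by rewrite /Y -/P; ring.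
move: (P * (G * rho)) (P * (T * (Y * Y)) * Y) => a b; lra.
Qed.

(** Both solutions are limits of the Picard iterates started from their data: with
   a weight wt kap the iterates decay fast enough to be compared with the smooth
   solution, and with the weight wt 0 they depend on the data in a Lipschitz way
   with constants that only see the norm of the statement. *)
Lemma profile_stability (rho0 : R) : 0 <= rho0 ->
  exists2 T : R, 0 < T & exists2 K : R, 0 < K &
  forall kw (u v : R -> int -> C) (D delta : R), normc kw = 1 ->
  profile_solution T kw u -> profile_solution T kw v ->
  (anorm p (wt 0%R) (u 0%R) <= rho0%:E)%E -> (anorm p (wt 0%R) (v 0%R) <= rho0%:E)%E ->
  0 <= D -> (anorm p (fun n => (wt 0 n * J n ^+ 2)%R) (u 0%R) <= D%:E)%E ->
  (anorm p (fun n => (wt 0 n * J n ^+ 2)%R) (v 0%R) <= D%:E)%E ->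
  0 <= delta -> (anorm p (wt 0%R) (fun n => (u 0 n - v 0 n)%R) <= delta%:E)%E ->
  forall t, 0 <= t <= T ->
  (anorm p (wt 0%R) (fun n => (u t n - v t n)%R) <= (K * delta)%:E)%E.
Proof.
move=> r00.
have [Cw Cw0 hw] := exp_windows p1.
have [Ct Ct0 htri] := duhamel_trilinear p1 Cw0.
pose rho : R := 2 `^ p * (rho0 + 1).
have P1 : 1 <= 2 `^ p :> R by rewrite -[leLHS](@powRr0 R 2) ler_powR ?ler1n// ltW.
have P0 : 0 < 2 `^ p :> R := lt_le_trans ltr01 P1.
have r0 : 0 <= rho by rewrite mulr_ge0 ?powR_ge0//; lra.
have rr : rho0 <= rho by rewrite -[leLHS]mul1r; apply: ler_pM => //; lra.
pose A : R := 4 `^ s * 3; have A0 : 0 < A by rewrite mulr_gt0 ?powR_gt0.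
have [M M1 hM] := contraction_parameters Ct0 Cw0 A0 r0.
pose G := Cw * M `^ (1 / 20); pose T := Ct * A `^ p * M `^ (- (2 / 5)).
pose Y := 2 * 2 `^ p * (G * rho).
have [hc1 hc2] : 2 `^ p * (G * rho + T * (Y * (Y * Y))) <= Y /\
  2 `^ p * 2 `^ p * 2 `^ p * (3 * (T * (Y * Y))) <= 2^-1 by exact: hM.
clear hM.
have M0 : 0 < M := lt_le_trans ltr01 M1.
have G0 : 0 < G by rewrite mulr_gt0 ?powR_gt0.
have T0 : 0 <= T by rewrite !mulr_ge0 ?powR_ge0 ?(ltW Ct0).
have Y0 : 0 <= Y.
  apply: mulr_ge0; first by rewrite mulr_ge0 ?powR_ge0.
  exact: mulr_ge0 (ltW G0) r0.
clearbody Y.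
have [gamma [eta [[gs es] hg he hhg hhe]]] := hw M M1.
have wp kap n : 0 <= kap -> 0 < wt kap n by exact: wt_gt0.
have [K1 K10 hK1] := anorm_l1 p1 (fun n => wp 0 n (lexx 0)).
have hT kap : 0 <= kap -> forall c1 c2 c3 (B1 B2 B3 : R), 0 <= B1 -> 0 <= B2 -> 0 <= B3 ->
    (xnc p (wt kap) c1 <= B1%:E)%E -> (xnc p (wt kap) c2 <= B2%:E)%E -> (xnc p (wt kap) c3 <= B3%:E)%E ->
    (xnc p (wt kap) (duhamel M gamma (dcoef eta c1 c2 c3)) <= (T * (B1 * (B2 * B3)))%:E)%E.
  move=> k0 c1 c2 c3 B1 B2 B3; apply: htri => //; first by move=> n; exact: wp.
  by move=> j k l; exact: wt_mul.
pose E1 : R := expR 1 `^ p.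
exists M^-1; first by rewrite invr_gt0.
exists (2 `^ p * (E1 * (K1 * (2 * (2 `^ p * G))))).
  have E10 : 0 < E1 by rewrite powR_gt0 ?expR_gt0.
  have l2 : 0 < 2 :> R by [].
  exact: mulr_gt0 P0 (mulr_gt0 E10 (mulr_gt0 K10 (mulr_gt0 l2 (mulr_gt0 P0 G0)))).
move=> kw u v D delta hkw su sv ru rv D0 Du Dv d0 hd t tI.
(* The weight wt kap gives the decay <n>^-2 of the iterates, hence their convergence
   to the smooth solution at time t. *)
have rows (a : R -> int -> C) : profile_solution M^-1 kw a -> (anorm p (wt 0%R) (a 0%R) <= rho0%:E)%E ->
    (anorm p (fun n => (wt 0 n * J n ^+ 2)%R) (a 0%R) <= D%:E)%E ->
    exists2 B : R, 0 < B & (forall m n, (nsum (fun l => (normc (picard M gamma eta kw (a 0%R) m n l))%:E) <= (B * J n `^ (- 2))%:E)%E) /\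
    (exists E : int -> R, forall m n, normc ((expR (M * t))%:C * ev (picard M gamma eta kw (a 0%R) m) t n - a t n) <= E n * 2 ^- m).
  move=> sa ra Da; have [kap k0 hk] := wt_small D0 ra Da.
  have wk n : 0 < wt kap n by apply: wp; exact: ltW.
  have pb := picard_bound p1 wk (ltW G0) hg hkw (hT kap (ltW k0)) Y0 hk hc1.
  have [K2 K20 hK2] := row_bound p1 wk.
  have [[Bs hBs] _ _ _] := sa.
  have Bs0 : 0 <= Bs.
    have := hBs 0 0; rewrite lexx invr_ge0 (ltW M0) => /(_ isT) h.
    rewrite -(pmulr_lge0 _ (powR_japanese_gt0 0 (-2) : 0 < J 0 `^ (-2))).
    by apply: le_trans h; exact: normc_ge0.
  pose B := K2 * Y `^ p^-1 / kap + Bs + 1.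
  have B10 : 0 <= K2 * Y `^ p^-1 / kap by rewrite !mulr_ge0 ?powR_ge0 ?invr_ge0 ?(ltW k0) ?(ltW K20).
  have B0 : 0 < B by rewrite /B; lra.
  have rw m n : (nsum (fun l => (normc (picard M gamma eta kw (a 0%R) m n l))%:E) <= (B * J n `^ (- 2))%:E)%E.
    apply: le_trans (hK2 _ _ n Y0 (pb m)) _; rewrite lee_fin.
    apply: (@le_trans _ _ (K2 * Y `^ p^-1 / kap * J n `^ (- 2))); last first.
      by rewrite ler_wpM2r ?powR_ge0// /B; lra.
    rewrite powRN -[X in J n `^ X]/(2%:R) powR_mulrn ?japanese_ge0// -[leRHS]mulrA -invfM.
    rewrite ler_wpM2l ?mulr_ge0 ?powR_ge0 ?(ltW K20)//.
    rewrite lef_pV2 ?posrE//; first exact/wt_ge/ltW.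
    by rewrite mulr_gt0 ?exprn_gt0 ?japanese_gt0.
  exists B => //; split => //.
  have hBs' t' n : 0 <= t' <= M^-1 -> normc (a t' n) <= B * J n `^ (- 2).
    by move=> t'I; apply: le_trans (hBs t' n t'I) _; rewrite ler_wpM2r ?powR_ge0// /B; lra.
  have [L hL] := picard_cvg M1 hkw gs es hhg hhe B0 sa (fun n => erefl) hBs' rw.
  exists (fun n => expR 1 * B * J n `^ (- 2) * expR (L * t)) => m n.
  apply: le_trans (hL m t n tI) _; rewrite le_eqVlt; apply/orP; left; apply/eqP; ring.
have [Bu Bu0 [rowu [Eu hEu]]] := rows u su ru Du.
have [Bv Bv0 [rowv [Ev hEv]]] := rows v sv rv Dv.
set pu := picard M gamma eta kw (u 0) in rowu hEu.
set pv := picard M gamma eta kw (v 0) in rowv hEv.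
(* The iterates from the two data stay close in the norm without extra weight. *)
have lip m : (anorm p (wt 0%R) (fun n => (ev (pu m) t n - ev (pv m) t n)%R) <= (K1 * (2 * (2 `^ p * (G * delta))))%:E)%E.
  have := picard_lip p1 (fun n => wp 0 n (lexx 0)) A0 M1 (ltW G0) T0 (fun j k l => wt_mul j k l (lexx 0)) hg he hkw
    (hT 0 (lexx 0)) Y0 (le_trans ru _) (le_trans rv _) hc1 hc2 d0 hd m.
  rewrite !lee_fin => /(_ rr rr) h; apply: (hK1 _ _ _ h) => n.
  have cs (c : int -> int -> C) B : (forall n, (nsum (fun l => (normc (c n l))%:E) <= (B * J n `^ (- 2))%:E)%E) ->
      csummable (fun l => c n l * cis (l%:~R * t)).
    move=> hc; apply: (@le_lt_trans _ _ (B * J n `^ (- 2))%:E); last exact: ltry.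
    by apply: le_trans (hc n); apply: le_nsum => l; rewrite lee_fin normcM normc_cis mulr1.
  have -> : ev (pu m) t n - ev (pv m) t n = ev (fun n l => pu m n l - pv m n l) t n.
    rewrite /ev -csumB; [|exact: cs (rowu m)|exact: cs (rowv m)].
    by apply: eq_csum => l; rewrite mulrBl.
  exact: normc_ev.
pose X m n := (expR (M * t))%:C * (ev (pu m) t n - ev (pv m) t n).
have hX m : (anorm p (wt 0%R) (X m) <= (E1 * (K1 * (2 * (2 `^ p * (G * delta)))))%:E)%E.
  apply: anorm_le (lip m) => [|n|n]; first exact: expR_ge0.
    exact/ltW/wp.
  have w0 : 0 <= wt 0 n by exact/ltW/wp.
  apply/andP; split; first by rewrite mulr_ge0 ?normc_ge0.
  rewrite /X normcM normcR ger0_norm ?expR_ge0// mulrCA; apply: ler_wpM2r.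
    by rewrite mulr_ge0 ?normc_ge0.
  rewrite ler_expR; case/andP: tI => _; by rewrite -[M^-1]mul1r ler_pdivlMr// mulrC.
apply: nsum_le_seq => sq usq.
pose Err n := (wt 0 n * (Eu n + Ev n)) `^ p.
have Err0 n : 0 <= Err n by exact: powR_ge0.
have bnd m : \sum_(n <- sq) (wt 0 n * normc (u t n - v t n)) `^ p <=
    2 `^ p * (E1 * (K1 * (2 * (2 `^ p * (G * delta)))) + 2 ^- m * \sum_(n <- sq) Err n).
  have EE n : 0 <= Eu n + Ev n.
    have := le_trans (normc_ge0 _) (hEu 0%N n); have := le_trans (normc_ge0 _) (hEv 0%N n).
    by rewrite expr0 invr1 !mulr1; lra.
  have h1 n : normc (u t n - v t n) <= normc (X m n) + (Eu n + Ev n) * 2 ^- m.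
    have -> : u t n - v t n = X m n - ((expR (M * t))%:C * ev (pu m) t n - u t n) + ((expR (M * t))%:C * ev (pv m) t n - v t n).
      by rewrite /X; ring.
    apply: le_trans (le_normcD _ _) _; apply: (le_trans (lerD (le_normcD _ _) (lexx _))).
    by rewrite normcN mulrDl; have := hEu m n; have := hEv m n; lra.
  have h2 n : (wt 0 n * normc (u t n - v t n)) `^ p <=
      2 `^ p * ((wt 0 n * normc (X m n)) `^ p + 2 ^- m * Err n).
    have w0 : 0 <= wt 0 n by exact/ltW/wp.
    have we : 0 <= wt 0 n * (Eu n + Ev n) by rewrite mulr_ge0.
    have c0 : 0 <= 2 ^- m :> R by rewrite invr_ge0 exprn_ge0.
    apply: (@le_trans _ _ ((wt 0 n * normc (X m n) + wt 0 n * (Eu n + Ev n) * 2 ^- m) `^ p)).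
      apply: ge0_ler_powR; rewrite ?nnegrE ?(ltW p0)//; first by rewrite mulr_ge0 ?normc_ge0.
        exact: addr_ge0 (mulr_ge0 w0 (normc_ge0 _)) (mulr_ge0 we c0).
      by rewrite -mulrA -mulrDr ler_wpM2l.
    apply: le_trans (powRD_le p1 (mulr_ge0 w0 (normc_ge0 _)) (mulr_ge0 we c0)) _.
    rewrite ler_wpM2l ?powR_ge0// lerD2l; apply: powR_contract => //.
    by rewrite c0 invf_le1 ?exprn_gt0// exprn_ege1// ler1n.
  apply: (@le_trans _ _ (\sum_(n <- sq) 2 `^ p * ((wt 0 n * normc (X m n)) `^ p + 2 ^- m * Err n))).
    by apply: ler_sum => n _; exact: h2.
  rewrite -mulr_sumr big_split /= -mulr_sumr ler_wpM2l ?powR_ge0// lerD2r -lee_fin.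
  apply: le_trans (hX m); rewrite -sumEFin; apply: nsum_seq_le => // n.
  by rewrite lee_fin powR_ge0.
rewrite sumEFin lee_fin.
set S := \sum_(n <- sq) _ in bnd *; set Er := \sum_(n <- sq) _ in bnd.
have Er0 : 0 <= Er by apply: sumr_ge0.
apply/ler_addgt0Pl => eps eps0.
have [m hm] : exists m : nat, 2 `^ p * Er < eps * 2 ^+ m.
  exists (Num.truncn (2 `^ p * Er / eps)).+1.
  rewrite -ltr_pdivrMl// mulrC; apply: lt_le_trans (truncnS_gt _) _.
  by rewrite -natrX ler_nat; apply: ltnW; exact: ltn_expl.
apply: le_trans (bnd m) _; rewrite mulrDr addrC.
apply: lerD; last by rewrite le_eqVlt; apply/orP; left; apply/eqP; ring.
by rewrite mulrCA mulrC ler_pdivrMr ?exprn_gt0// ltW.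
Qed.

End Stability.

(** * The norms of the statement on Fourier coefficients *)

Section FourierLebesgueNorms.
Context {R : realType}.
Local Notation J n := (japanese n : R).
Local Notation C := R[i].

Lemma fourier_coefB (f g : torus_distribution R) n :
  fourier_coef (f - g) n = fourier_coef f n - fourier_coef g n.
Proof. by rewrite /fourier_coef -mulrBr. Qed.

Lemma fourier_coefZ (c : C) (f : torus_distribution R) n :
  fourier_coef (c *: f) n = c * fourier_coef f n.
Proof. by rewrite /fourier_coef mulrCA. Qed.

Lemma fourier_coef_fc (u : Cinfty R) n : fourier_coef (to_distribution u) n = fc u n.
Proof. by []. Qed.

Variables (p : R) (p0 : 0 < p).

Lemma Hsp_normE s (f : torus_distribution R) :
  Hsp_norm s p f = (anorm p (fun n => J n `^ s)%R (fourier_coef f) `^ p^-1)%E.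
Proof.
congr (_ `^ _)%E; apply: eq_nsum => n; congr EFin.
by rewrite powRM ?powR_ge0 ?normc_ge0// -powRrM [s * p]mulrC.
Qed.

Lemma Hsp_norm_ge0 s (f : torus_distribution R) : (0 <= Hsp_norm s p f)%E.
Proof. exact: poweR_ge0. Qed.

Lemma Hsp_norm_le s (f : torus_distribution R) (x : R) : 0 <= x ->
  (Hsp_norm s p f <= x%:E)%E <-> (anorm p (fun n => J n `^ s)%R (fourier_coef f) <= (x `^ p)%:E)%E.
Proof.
move=> x0; rewrite Hsp_normE; set a := anorm _ _ _.
have a0 : (0 <= a)%E by exact: anorm_ge0.
have mono (r : R) : 0 <= r -> forall y z : \bar R, (0 <= y)%E -> (y <= z)%E -> (y `^ r <= z `^ r)%E.
  move=> r0 y z y0 yz; apply: gt0_ler_poweR => //; rewrite in_itv /= leey andbT//.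
  exact: le_trans y0 yz.
split => h.
  have := mono p (ltW p0) _ _ (poweR_ge0 _ _) h.
  by rewrite -poweRrM mulVf ?gt_eqF// poweRe1.
have pi0 : 0 <= p^-1 by rewrite invr_ge0 ltW.
have := mono p^-1 pi0 _ _ a0 h.
by rewrite poweR_EFin -powRrM mulfV ?gt_eqF// powRr1.
Qed.

Lemma Hsp_norm_lty s (f : torus_distribution R) :
  (Hsp_norm s p f < +oo)%E <-> (anorm p (fun n => J n `^ s)%R (fourier_coef f) < +oo)%E.
Proof.
rewrite Hsp_normE; split; last exact: poweR_lty.
by apply: lty_poweRy; rewrite invr_eq0 gt_eqF.
Qed.

Lemma Hsp_norm_cvg0 s (F : set_system R) (FF : Filter F) (f : R -> torus_distribution R) :
  Hsp_norm s p (f t) @[t --> F] --> 0%E <->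
  forall eps : R, 0 < eps ->
    \forall t \near F, (anorm p (fun n => J n `^ s)%R (fourier_coef (f t)) <= (eps `^ p)%:E)%E.
Proof.
split.
  move=> /fine_cvgP [ffin /cvgrPdist_le h] eps eps0.
  near=> t; apply/Hsp_norm_le; first exact: ltW.
  have fint : Hsp_norm s p (f t) \is a fin_num by near: t.
  have : `|0 - fine (Hsp_norm s p (f t))| <= eps by near: t; exact: h.
  rewrite sub0r normrN ger0_norm; last by apply: fine_ge0; exact: Hsp_norm_ge0.
  by rewrite -lee_fin fineK.
move=> h; apply/fine_cvgP; split.
  near=> t; rewrite ge0_fin_numE ?Hsp_norm_ge0//.
  apply: (@le_lt_trans _ _ (1%R)%:E); last exact: ltry.
  by apply/Hsp_norm_le => //; near: t; exact: h.
apply/cvgrPdist_le => eps eps0; near=> t.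
have ht : (Hsp_norm s p (f t) <= eps%:E)%E.
  by apply/Hsp_norm_le; [exact: ltW|near: t; exact: h].
rewrite sub0r normrN ger0_norm; last by apply: fine_ge0; exact: Hsp_norm_ge0.
rewrite -lee_fin fineK// ge0_fin_numE ?Hsp_norm_ge0//.
by apply: le_lt_trans ht _; exact: ltry.
Unshelve. all: by end_near. Qed.

Lemma anorm_term (W : int -> R) (a : int -> C) (x : R) n : 0 <= x -> (forall n, 0 <= W n) ->
  (anorm p W a <= (x `^ p)%:E)%E -> W n * normc (a n) <= x.
Proof.
move=> x0 W0 h.
have wn : 0 <= W n * normc (a n) by rewrite mulr_ge0 ?normc_ge0.
have h' : (W n * normc (a n)) `^ p <= x `^ p.
  rewrite -lee_fin; apply: le_trans h.
  by apply: (@nsum_term _ _ (fun n => ((W n * normc (a n)) `^ p)%:E)) => k; rewrite lee_fin powR_ge0.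
rewrite leNgt; apply/negP => lt.
have := gt0_ltr_powR p0 (x := x) (y := W n * normc (a n)).
by rewrite !nnegrE => /(_ x0 wn lt); rewrite ltNge h'.
Qed.

Lemma anormJ (W : int -> R) (a b : int -> C) : (forall n, normc (a n) = normc (b n)) ->
  anorm p W a = anorm p W b.
Proof. by move=> h; apply: eq_nsum => n; rewrite h. Qed.

End FourierLebesgueNorms.

(** * Rapid decay *)

Section SmoothDecay.
Context {R : realType}.
Local Notation J n := (japanese n : R).
Local Notation C := R[i].

Lemma fc_cderive_iter (phi : Cinfty R) k n :
  normc (fc (cderive1n k phi) n) = `|n%:~R| ^+ k * normc (fc phi n).
Proof.
elim: k => [|k IH]; first by rewrite cderive1n0 expr0 mul1r.
rewrite fc_cderive normcM IH exprS mulrA; congr (_ * _ * _).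
by rewrite normcE /= expr0n add0r sqrtr_sqr.
Qed.

Lemma japanese_le2 (n : int) : n != 0 -> J n <= 2 * `|n%:~R|.
Proof.
move=> n0; have h : 1 <= `|n%:~R| ^+ 2 :> R.
  by apply: exprn_ege1; rewrite -intr_norm ler1z; lia.
rewrite -ler_sqr ?nnegrE ?japanese_ge0 ?mulr_ge0// japaneseE exprMn real_normK ?num_real//.
by move: h; rewrite real_normK ?num_real//; lra.
Qed.

Lemma Cinfty_decay_all (phi : Cinfty R) (k : nat) : exists2 B : R, 0 <= B &
  forall n, J n ^+ k * normc (fc phi n) <= B.
Proof.
have pi2 : 0 <= 2 * pi :> R by rewrite ltW ?twopi_gt0.
have [B0 B00 h0] := ccont_bounded pi2 (ccont_Cinfty phi).
have [B1 B10 h1] := ccont_bounded pi2 (ccont_smooth phi k).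
exists (2 ^+ k * (2 * B1) + 2 * B0) => [|n].
  by rewrite addr_ge0// ?mulr_ge0// exprn_ge0.
have n0 := normc_fc n (ccont_Cinfty phi) h0.
have n1 := normc_fc n (ccont_smooth phi k) h1.
have [->|nn] := eqVneq n 0.
  rewrite /japanese expr0n addr0 sqrtr1 expr1n mul1r -[leLHS]add0r.
  have := normc_fc 0 (ccont_Cinfty phi) h0; apply: lerD.
  by rewrite mulr_ge0 ?exprn_ge0// mulr_ge0.
apply: (@le_trans _ _ (2 ^+ k * (`|n%:~R| ^+ k * normc (fc phi n)))).
  rewrite mulrA -exprMn ler_wpM2r ?normc_ge0//.
  by apply: lerXn2r; rewrite ?nnegrE ?japanese_ge0 ?mulr_ge0// japanese_le2.
rewrite -fc_cderive_iter -[leLHS]addr0; apply: lerD; last by rewrite mulr_ge0.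
by rewrite ler_wpM2l ?exprn_ge0.
Qed.

Lemma Cinfty_decay_powR (phi : Cinfty R) (th : R) : exists2 B : R, 0 <= B &
  forall n, J n `^ th * normc (fc phi n) <= B * J n `^ (- 2).
Proof.
pose k := (Num.truncn (th + 2)).+1.
have hk : th + 2 <= k%:R by exact/ltW/truncnS_gt.
have [B B0 hB] := Cinfty_decay_all phi k; exists B => // n.
have j2 := powR_japanese_gt0 n 2 (R := R).
have -> : J n `^ (- 2) = (J n `^ 2)^-1 by rewrite powRN.
rewrite ler_pdivlMr// mulrAC; apply: le_trans (hB n).
rewrite ler_wpM2r ?normc_ge0// -powRD; last by rewrite (gt_eqF (japanese_gt0 n)) implybT.
by rewrite -powR_mulrn ?japanese_ge0// ler_powR ?japanese_ge1.
Qed.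

Lemma anorm_bound (p : R) (W : int -> R) (a : int -> C) (B : R) : 1 <= p -> 0 <= B ->
  (forall n, 0 <= W n) -> (forall n, W n * normc (a n) <= B * J n `^ (- 2)) ->
  (anorm p W a <= (B `^ p * jsum 2)%:E)%E.
Proof.
move=> p1 B0 W0 h; have p0 : 0 < p := lt_le_trans ltr01 p1.
have l2 : 1 < 2 :> R by rewrite ltr1n.
apply: (@le_trans _ _ (nsum (fun n => (B `^ p * J n `^ (- 2))%:E))).
  apply: le_nsum => n; rewrite lee_fin.
  have b0 : 0 <= B * J n `^ (- 2) by rewrite mulr_ge0 ?powR_ge0.
  apply: (@le_trans _ _ ((B * J n `^ (- 2)) `^ p)).
    by apply: ge0_ler_powR; rewrite ?nnegrE ?(ltW p0) ?h// mulr_ge0 ?normc_ge0.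
  rewrite powRM ?powR_ge0// ler_wpM2l ?powR_ge0// -powRrM ler_powR ?japanese_ge1//.
  by rewrite mulNr lerN2 ler_peMr.
apply: nsum_scale; [exact: powR_ge0|by move=> n; rewrite powR_ge0|by rewrite (nsum_japanese l2)].
Qed.

Lemma Cinfty_anorm (p : R) (phi : Cinfty R) (th : R) : 1 <= p ->
  exists2 D : R, 0 <= D & (anorm p (fun n => J n `^ th)%R (fc phi) <= D%:E)%E.
Proof.
move=> p1; have [B B0 hB] := Cinfty_decay_powR phi th.
exists (B `^ p * jsum 2); first by rewrite mulr_ge0 ?powR_ge0 ?jsum_ge0.
by apply: anorm_bound => // n; exact: powR_ge0.
Qed.

End SmoothDecay.

(** * The equation for the Fourier coefficients *)

Section CubicCoefficients.
Context {R : realType}.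
Local Notation J n := (japanese n : R).
Local Notation C := R[i].
Local Notation Re := complex.Re.
Local Notation Im := complex.Im.

Lemma sqr_normcE (z : C) : (normc z ^+ 2)%:C = z * conjc z.
Proof. by rewrite sqr_normc; apply: complex_eq; rewrite ?ReM ?ImM; case: z => a b /=; ring. Qed.

Variables (c : int -> C) (B : R) (hB : forall n, normc (c n) <= B * J n `^ (- 2)).

Let B0 : 0 <= B.
Proof.
rewrite -(pmulr_lge0 _ (powR_japanese_gt0 0 (-2) : 0 < J 0 `^ (-2))).
by apply: le_trans (hB 0); exact: normc_ge0.
Qed.

Let cs : csummable c.
Proof. exact: csummable_japanese2 hB. Qed.

Let cJ : csummable (fun k => conjc (c k)).
Proof. by apply: csummable_le cs => k; rewrite normcJ. Qed.

Let c2 : csummable (fun jk : int * int => c jk.1 * conjc (c jk.2)).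
Proof. exact: csummable_mul cs cJ. Qed.

Let c3 : csummable (fun t : (int * int) * int => c t.1.1 * conjc (c t.1.2) * c t.2).
Proof. exact: csummable_mul c2 cs. Qed.

Let ts (T : choiceType) (f : T -> C) (g : T -> R) : csummable f -> csummable (fun i => f i * cis (g i)).
Proof. by move=> fs; apply: csummable_le fs => i; rewrite normcM normc_cis mulr1. Qed.

Variables (u : R -> C) (cu : ccont u).
Hypothesis hu : forall x, 0 < x < 2 * pi -> u x = csum (fun n => c n * cis (n%:~R * x)).

Let usq x : 0 < x < 2 * pi -> u x * conjc (u x) =
  csum (fun jk : int * int => c jk.1 * conjc (c jk.2) * cis ((jk.1 - jk.2)%:~R * x)).
Proof.
move=> xI; rewrite hu// -csumJ.
rewrite (csum_mul (ts _ cs)); last first.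
  by apply: csummable_le cs => i; rewrite normcJ normcM normc_cis mulr1.
apply: eq_csum => -[j k]; rewrite -[X in X = _]/(c j * cis (j%:~R * x) * conjc (c k * cis (k%:~R * x))).
rewrite -[X in _ = X]/(c j * conjc (c k) * cis ((j - k)%:~R * x)).
rewrite [conjc (_ * _)]rmorphM rmorphB mulrBl cisD -cisJ; exact: mulrACA.
Qed.

Lemma ccont_usq : ccont (fun x => (normc (u x) ^+ 2)%:C).
Proof.
rewrite (_ : (fun x => _) = (fun x => u x * conjc (u x))).
  by apply: ccontM => //; exact: ccontJ.
by apply/funext => x; rewrite sqr_normcE.
Qed.

(** Products of absolutely convergent series are series over pairs and triples of
   frequencies, of which [fc_trig] selects those with the right total. *)
Lemma fc_cubic n : fc (fun x => (normc (u x) ^+ 2)%:C * u x) n =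
  csum (fun jk : int * int => c jk.1 * conjc (c jk.2) * c (n - jk.1 + jk.2)).
Proof.
pose pr (t : (int * int) * int) : int := t.1.1 - t.1.2 + t.2.
rewrite (@eq_fc _ _ (fun x => csum (fun t => c t.1.1 * conjc (c t.1.2) * c t.2 * cis ((pr t)%:~R * x)))).
- rewrite (fc_trig pr c3) -(@csum_pair _ _ _ (fun (jk : int * int) (l : int) => c jk.1 * conjc (c jk.2) * c l * (pr (jk, l) == n)%:R)); last first.
    apply: csummable_le c3 => t; rewrite normcM; case: eqP => _.
      by rewrite [normc 1]normc1 mulr1.
    by rewrite [normc 0]normc0 mulr0; exact: normc_ge0.
  apply: eq_csum => -[j k] /=.
  rewrite -(@csum_delta _ _ (n - j + k) (fun l => c j * conjc (c k) * c l)).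
  apply: eq_csum => l; rewrite /pr /= (_ : (j - k + l == n) = (l == n - j + k)); last first.
    by apply/eqP/eqP => h; lia.
  by case: eqP => _; rewrite ?mulr1 ?mulr0.
- by apply: ccontM => //; exact: ccont_usq.
- exact: ccont_trig.
move=> x xI; rewrite sqr_normcE usq// hu//.
rewrite (csum_mul (ts _ c2) (ts _ cs)); apply: eq_csum => t.
by rewrite /pr [in RHS]rmorphD [in RHS]mulrDl [in RHS]cisD; exact: mulrACA.
Qed.

(** The mean of the square is its coefficient at frequency 0. *)
Lemma fc_mass : (torus_mean (fun y => normc (u y) ^+ 2))%:C =
  csum (fun k => c k * conjc (c k)).
Proof.
pose pr (t : int * int) : int := t.1 - t.2.
have -> : (torus_mean (fun y => normc (u y) ^+ 2))%:C = fc (fun x => (normc (u x) ^+ 2)%:C) 0.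
  rewrite /torus_mean /fc rmorphM /=; congr (_ * _); apply: complex_eq => /=.
    by apply: torus_int_eq => x _; rewrite !mul0r cos0 mulr1 subr0.
  rewrite -[LHS](mulr0 (2 * pi)) -(torus_int_cst 0); apply: torus_int_eq => x _.
  by rewrite !mul0r sin0 oppr0 mulr0 addr0.
rewrite (@eq_fc _ _ (fun x => csum (fun t => c t.1 * conjc (c t.2) * cis ((pr t)%:~R * x)))).
- rewrite (fc_trig pr c2) -(@csum_pair _ _ _ (fun (j k : int) => c j * conjc (c k) * (pr (j, k) == 0)%:R)); last first.
    apply: csummable_le c2 => t; rewrite normcM; case: eqP => _.
      by rewrite [normc 1]normc1 mulr1.
    by rewrite [normc 0]normc0 mulr0; exact: normc_ge0.
  apply: eq_csum => j.
  rewrite -(@csum_delta _ _ j (fun k => c j * conjc (c k))).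
  apply: eq_csum => k; rewrite /pr /= (_ : (j - k == 0) = (k == j)); last first.
    by rewrite subr_eq0 eq_sym.
  by case: eqP => _; rewrite ?mulr1 ?mulr0.
- exact: ccont_usq.
- exact: ccont_trig.
by move=> x xI; rewrite sqr_normcE usq.
Qed.

(** The pairs j = n and j = k each contribute the mass times the coefficient
   at n, which is what the renormalization of the equation subtracts. *)
Lemma renormalized_cubic n :
  csum (fun jk : int * int => (@resc R n jk.1 jk.2)%:C * (c jk.1 * conjc (c jk.2) * c (n - jk.1 + jk.2))) =
  csum (fun jk : int * int => c jk.1 * conjc (c jk.2) * c (n - jk.1 + jk.2))
    - 2 * csum (fun k => c k * conjc (c k)) * c n.
Proof.
pose g (jk : int * int) := c jk.1 * conjc (c jk.2) * c (n - jk.1 + jk.2).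
have gs : csummable g.
  apply: (@csummable_le _ _ _ (fun jk => normc (c jk.1) * normc (c jk.2) * normc (c (n - jk.1 + jk.2)))).
    by move=> jk; rewrite /g !normcM normcJ.
  have [K K0 hK] := @japanese_conv3 R.
  have b3 : 0 <= B * B * B by rewrite !mulr_ge0.
  have w0 (jk : int * int) : 0 <= J jk.1 `^ (- 2) * J jk.2 `^ (- 2) * J (n - jk.1 + jk.2) `^ (- 2).
    by rewrite !mulr_ge0 ?powR_ge0.
  apply: le_lt_trans (le_lt_trans (nsum_scale b3 w0 (hK n)) (ltry _)).
  apply: le_nsum => jk; rewrite lee_fin.
  rewrite (_ : B * B * B * _ = (B * J jk.1 `^ (-2)) * (B * J jk.2 `^ (-2)) * (B * J (n - jk.1 + jk.2) `^ (-2))); last by ring.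
  by do 2?[apply: ler_pM => //]; rewrite ?mulr_ge0 ?normc_ge0//; exact: hB.
pose m := csum (fun k => c k * conjc (c k)).
have dom (b : int * int -> bool) : csummable (fun jk => (b jk)%:R * g jk).
  apply: csummable_le gs => jk; rewrite normcM; case: (b jk).
    by rewrite [normc 1]normc1 mul1r.
  by rewrite [normc 0]normc0 mul0r normc_ge0.
have e1 : csum (fun jk : int * int => (n == jk.1)%:R * g jk) = m * c n.
  rewrite -(@csum_pair _ _ _ (fun j k => (n == j)%:R * g (j, k))); last exact: (dom (fun jk => n == jk.1)).
  have mE : m * c n = csum (fun k => g (n, k)).
    rewrite mulrC /m -csumZ.
      by apply: eq_csum => k; rewrite /g /= subrr add0r; ring.
    apply: (@csummable_le _ _ _ (fun k => B * normc (c k))).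
      move=> k; rewrite normcM normcJ ler_wpM2r ?normc_ge0//.
      apply: le_trans (hB k) _; rewrite ler_piMr// powR_japaneseN_le1//.
    have [E hE] := csummable_bound cs.
    by apply: le_lt_trans (nsum_scale B0 (fun k => normc_ge0 (c k)) hE) (ltry _).
  rewrite mE -(@csum_delta _ _ n (fun j => csum (fun k => g (j, k)))).
  apply: eq_csum => j; rewrite [n == j]eq_sym; case: eqP => [->|_].
    by apply: eq_csum => k; rewrite mul1r.
  by rewrite -[RHS](@csum0 _ int); apply: eq_csum => k; rewrite mul0r.
have e2 : csum (fun jk : int * int => (jk.1 == jk.2)%:R * g jk) = m * c n.
  rewrite -(@csum_pair _ _ _ (fun j k => (j == k)%:R * g (j, k))); last exact: (dom (fun jk => jk.1 == jk.2)).
  rewrite mulrC /m -csumZ; last first.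
    apply: (@csummable_le _ _ _ (fun k => B * normc (c k))).
      move=> k; rewrite normcM normcJ ler_wpM2r ?normc_ge0//.
      apply: le_trans (hB k) _; rewrite ler_piMr// powR_japaneseN_le1//.
    have [E hE] := csummable_bound cs.
    by apply: le_lt_trans (nsum_scale B0 (fun k => normc_ge0 (c k)) hE) (ltry _).
  apply: eq_csum => j.
  rewrite (@eq_csum _ _ _ (fun k => if k == j then g (j, k) else 0)).
    by rewrite csum_delta /g /= subrK; ring.
  by move=> k; rewrite [j == k]eq_sym; case: eqP => _; rewrite ?mul1r ?mul0r.
rewrite (@eq_csum _ _ _ (fun jk => g jk - (n == jk.1)%:R * g jk - (jk.1 == jk.2)%:R * g jk)); last first.
  move=> jk; rewrite -/(g jk) /resc !rmorphB /= !rmorph_nat.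
  by ring.
rewrite csumB; [|by apply: csummableD => //; apply: csummableN; exact: (dom (fun jk => n == jk.1))|exact: (dom (fun jk => jk.1 == jk.2))].
rewrite csumB ?e1 ?e2; [|exact: gs|exact: (dom (fun jk => n == jk.1))].
by rewrite -/m -/g; ring.
Qed.

End CubicCoefficients.

(** * Smooth solutions have profiles *)

Section SolutionProfiles.
Context {R : realType}.
Local Notation J n := (japanese n : R).
Local Notation C := R[i].
Local Notation Re := complex.Re.
Local Notation Im := complex.Im.

Lemma near_within_ex (t : R) (Q : R -> Prop) :
  (\forall t' \near within `[0, +oo[ (nbhs t), Q t') ->
  exists2 d : R, 0 < d & forall t', 0 <= t' -> `|t' - t| < d -> Q t'.
Proof.
rewrite near_withinE => /nbhs_ballP [d d0 hd]; exists d => // t' t0 td.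
apply: hd; first by rewrite /ball /= distrC.
by rewrite /= in_itv /= t0.
Qed.

Lemma near_dnbhs_ex (t : R) (Q : R -> Prop) :
  (\forall t' \near within `[0, +oo[ t^', Q t') ->
  exists2 d : R, 0 < d & forall t', 0 <= t' -> t' != t -> `|t' - t| < d -> Q t'.
Proof.
rewrite near_withinE /dnbhs near_withinE => /nbhs_ballP [d d0 hd]; exists d => // t' t0 tn td.
apply: hd; first by rewrite /ball /= distrC.
  exact: tn.
by rewrite /= in_itv /= t0.
Qed.

Lemma within_cvg (T : R) (f : R -> R) :
  (forall t, 0 <= t <= T -> forall eps : R, 0 < eps -> exists2 d : R, 0 < d &
    forall t', 0 <= t' -> `|t' - t| < d -> `|f t - f t'| <= eps) ->
  {within `[0, T], continuous f}.
Proof.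
move=> h; apply/subspace_continuousP => t; rewrite /= in_itv /= => tI.
apply/cvgrPdist_le => e e0; have [d d0 hd] := h t tI e e0.
rewrite near_withinE; apply/nbhs_ballP; exists d => // t' td; rewrite /= in_itv /= => /andP[t'0 _].
by apply: hd => //; rewrite distrC.
Qed.

(** The weighted supremum of the coefficients is a continuous function of time,
   so it is bounded on compact intervals. *)
Lemma bounded_family (U : R -> int -> C) (T : R) : 0 <= T ->
  (forall t, 0 <= t -> forall eps : R, 0 < eps -> exists2 d : R, 0 < d &
    forall t', 0 <= t' -> `|t' - t| < d ->
    forall n, J n `^ 2 * normc (U t' n - U t n) <= eps) ->
  (forall t, exists B : R, forall n, normc (U t n) <= B * J n `^ (- 2)) ->
  exists2 B : R, 0 < B & forall t n, 0 <= t <= T -> normc (U t n) <= B * J n `^ (- 2).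
Proof.
move=> T0 hC hB.
have jp n : 0 < J n `^ 2 :> R by exact: powR_japanese_gt0.
have jE n (x B : R) : (x <= B * J n `^ (- 2)) = (J n `^ 2 * x <= B).
  by rewrite powRN ler_pdivlMr// mulrC.
pose A t := [set J n `^ 2 * normc (U t n) | n in [set: int]].
have A0 t : A t !=set0 by exists (J 0 `^ 2 * normc (U t 0)), 0.
have Aub t : has_ubound (A t).
  by have [B hB'] := hB t; exists B => _ [n _ <-]; rewrite -jE.
pose h t := sup (A t).
have hle t n : J n `^ 2 * normc (U t n) <= h t by apply: ub_le_sup => //; exists n.
have one a b e : (forall n, J n `^ 2 * normc (U b n - U a n) <= e) -> h b <= h a + e.
  move=> hab; apply: ge_sup => // _ [n _ <-].
  apply: le_trans (lerD (hle a n) (hab n)); rewrite -mulrDr ler_wpM2l ?(ltW (jp n))//.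
  by have := le_normcD (U a n) (U b n - U a n); rewrite [U a n + _]addrC subrK.
have ch : {within `[0, T], continuous h}.
  apply: within_cvg => t /andP[t0 _] e e0; have [d d0 hd] := hC t t0 e e0; exists d => // t' t'0 td.
  have h1 := one t t' e (hd t' t'0 td).
  have h2 : h t <= h t' + e by apply: one => n; rewrite -normcN opprB; exact: hd.
  by rewrite ler_norml; apply/andP; split; lra.
have [tm _ htm] := EVT_max T0 ch.
have hm0 : 0 <= h tm.
  by apply: le_trans (hle tm 0); exact: mulr_ge0 (ltW (jp 0)) (normc_ge0 _).
exists (h tm + 1) => [|t n tI]; first by lra.
rewrite jE; apply: le_trans (hle t n) _.
have := htm t; rewrite in_itv /= => /(_ tI); lra.
Qed.

Lemma is_derive_eps (f : R -> R) (t d : R) :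
  (forall eps : R, 0 < eps -> exists2 e : R, 0 < e &
    forall t', t' != t -> `|t' - t| < e -> `|(t' - t)^-1 * (f t' - f t) - d| <= eps) ->
  is_derive t 1 f d.
Proof.
move=> h; have hc : h0^-1 *: ((f \o shift t) (h0 *: (1 : R)) - f t) @[h0 --> 0^'] --> d.
  apply/cvgrPdist_le => eps e0; have [e ep he] := h eps e0.
  rewrite near_withinE; apply/nbhs_ballP; exists e => // k kd k0.
  have kt : k + t - t = k by rewrite addrK.
  have := he (k + t); rewrite kt -subr_eq0 kt => /(_ k0).
  rewrite distrC /GRing.scale /= mulr1; apply.
  by move: kd; rewrite /ball /= sub0r normrN.
by apply: DeriveDef; [apply/cvg_ex; exists d|exact: cvg_lim hc].
Qed.

Lemma is_cderive_eps (f : R -> C) (t : R) (d : C) :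
  (forall eps : R, 0 < eps -> exists2 e : R, 0 < e &
    forall t', t' != t -> `|t' - t| < e -> normc (((t' - t)^-1)%:C * (f t' - f t) - d) <= eps) ->
  is_cderive t f d.
Proof.
move=> h; split; apply: is_derive_eps => eps e0; have [e ep he] := h eps e0; exists e => // t' tn td.
  apply: le_trans (he t' tn td); apply: le_trans (normc_Re _).
  by rewrite ReD ReN ReM /= mul0r subr0 ReD ReN.
apply: le_trans (he t' tn td); apply: le_trans (normc_Im _).
by rewrite ImD ImN ImM /= mul0r addr0 ImD ImN.
Qed.

Lemma phaseE (n j k : int) : phase n j k = n ^+ 2 - j ^+ 2 + k ^+ 2 - (n - j + k) ^+ 2.
Proof. rewrite /phase; ring. Qed.

(** Passing to the profile removes the linear term and puts the oscillation of
   the resonance function into the nonlinearity. *)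
Lemma profile_of_coefficients (omega : R) (U D : R -> int -> C) (T : R) :
  (forall t, 0 <= t -> forall eps : R, 0 < eps -> exists2 d : R, 0 < d &
    forall t', 0 <= t' -> `|t' - t| < d -> forall n, normc (U t' n - U t n) <= eps) ->
  (forall t, 0 <= t -> forall eps : R, 0 < eps -> exists2 d : R, 0 < d &
    forall t', 0 <= t' -> t' != t -> `|t' - t| < d ->
    forall n, normc (((t' - t)^-1)%:C * (U t' n - U t n) - D t n) <= eps) ->
  (exists B : R, forall t n, 0 <= t <= T -> normc (U t n) <= B * J n `^ (- 2)) ->
  (forall t, 0 <= t -> forall n,
    'i * D t n - (n%:~R ^+ 2)%:C * U t n + omega%:C *
    csum (fun jk : int * int => (@resc R n jk.1 jk.2)%:C * (U t jk.1 * conjc (U t jk.2) * U t (n - jk.1 + jk.2))) = 0) ->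
  profile_solution T ('i * omega%:C) (fun t n => cis ((n ^+ 2)%:~R * t) * U t n).
Proof.
move=> hC hD [B hB] heq.
have cR (n : int) : {within `[0, T], continuous (fun t => Re (U t n))}.
  apply: within_cvg => t /andP[t0 _] e e0; have [d d0 hd] := hC t t0 e e0; exists d => // t' t'0 td.
  by rewrite distrC -ReN -ReD; exact: le_trans (normc_Re _) (hd t' t'0 td n).
have cI (n : int) : {within `[0, T], continuous (fun t => Im (U t n))}.
  apply: within_cvg => t /andP[t0 _] e e0; have [d d0 hd] := hC t t0 e e0; exists d => // t' t'0 td.
  by rewrite distrC -ImN -ImD; exact: le_trans (normc_Im _) (hd t' t'0 td n).
have [cc cs] : (forall n : int, {within `[0, T], continuous (fun t => Re (cis ((n ^+ 2)%:~R * t) : C))}) /\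
    (forall n : int, {within `[0, T], continuous (fun t => Im (cis ((n ^+ 2)%:~R * t) : C))}).
  by split => n; apply: continuous_subspaceT; have [h1 h2] := @ccont_cis R (n ^+ 2)%:~R.
split.
- by exists B => t n tI; rewrite normcM normc_cis mul1r; exact: hB.
- move=> n; rewrite (_ : (fun t => _) = (fun t => Re (cis ((n ^+ 2)%:~R * t)) * Re (U t n) - Im (cis ((n ^+ 2)%:~R * t)) * Im (U t n))).
    by move=> t; apply: cvgB; apply: cvgM; [exact: cc|exact: cR|exact: cs|exact: cI].
  by apply/funext => t; rewrite ReM.
- move=> n; rewrite (_ : (fun t => _) = (fun t => Re (cis ((n ^+ 2)%:~R * t)) * Im (U t n) + Im (cis ((n ^+ 2)%:~R * t)) * Re (U t n))).
    by move=> t; apply: cvgD; apply: cvgM; [exact: cc|exact: cI|exact: cs|exact: cR].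
  by apply/funext => t; rewrite ImM.
- move=> n t /andP[t0 tT].
  have dU : is_cderive t (fun t => U t n) (D t n).
    apply: is_cderive_eps => eps e0; have [d d0 hd] := hD t (ltW t0) eps e0.
    exists (Num.min d t) => [|t' tn]; first by rewrite lt_min d0.
    rewrite lt_min => /andP[td tt].
    have t'0 : 0 <= t' by move: tt; rewrite ltr_norml; lra.
    exact: hd t' t'0 tn td n.
  have h := is_cderiveM (is_cderive_cis t (n ^+ 2)%:~R) dU.
  have e := heq t (ltW t0) n.
  have -> : 'i * omega%:C * nl (fun n => cis ((n ^+ 2)%:~R * t) * U t n) t n =
    (0 +i* (n ^+ 2)%:~R) * cis ((n ^+ 2)%:~R * t) * U t n + cis ((n ^+ 2)%:~R * t) * D t n; last exact: h.
  have tI : 0 <= t <= T by rewrite !ltW.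
  move: (U t) (D t n) (hB t ^~ tI) e => c d hBc e.
  pose Z := csum (fun jk : int * int => (@resc R n jk.1 jk.2)%:C * (c jk.1 * conjc (c jk.2) * c (n - jk.1 + jk.2))).
  have -> : nl (fun n => cis ((n ^+ 2)%:~R * t) * c n) t n = cis ((n ^+ 2)%:~R * t) * Z.
    rewrite /nl /Z -csumZ; last first.
      have [h1 _] := nl_term_csummable 0 n hBc hBc hBc.
      apply: csummable_le h1 => jk.
      by rewrite mulr0 cis0 mulr1.
    apply: eq_csum => jk; move: jk.1 jk.2 => j k.
    have cj (z y : C) : conjc (z * y) = conjc z * conjc y by exact: rmorphM.
    rewrite cj cisJ phaseE.
    have -> : (n ^+ 2 - j ^+ 2 + k ^+ 2 - (n - j + k) ^+ 2)%:~R * t =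
       (n ^+ 2)%:~R * t + (- ((j ^+ 2)%:~R * t)) + (k ^+ 2)%:~R * t + (- (((n - j + k) ^+ 2)%:~R * t)).
      by rewrite !(rmorphD, rmorphN) /=; ring.
    rewrite !cisD.
    have inv (x : R) : cis x * cis (- x) = 1 :> C by rewrite -cisD subrr cis0.
    move: (inv ((j ^+ 2)%:~R * t)) (inv ((k ^+ 2)%:~R * t)) (inv (((n - j + k) ^+ 2)%:~R * t)).
    move: (cis ((j ^+ 2)%:~R * t)) (cis (- ((j ^+ 2)%:~R * t))) => a a'.
    move: (cis ((k ^+ 2)%:~R * t)) (cis (- ((k ^+ 2)%:~R * t))) => b b'.
    move: (cis (((n - j + k) ^+ 2)%:~R * t)) (cis (- (((n - j + k) ^+ 2)%:~R * t))) => l l'.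
    move: (cis _) (resc _ _ _)%:C (c j) (conjc (c k)) (c (n - j + k)) => N r x y z ha hb hl.
    transitivity (N * r * (x * y * z) * (a * a') * (b * b') * (l * l')); first by ring.
    by rewrite ha hb hl; ring.
  have ii : 'i * 'i = -1 :> C by apply: complex_eq; rewrite ?ReM ?ImM ?ReN ?ImN /=; ring.
  have -> : 0 +i* (n ^+ 2)%:~R = 'i * (n%:~R ^+ 2)%:C :> C.
    by rewrite rmorphXn; apply: complex_eq; rewrite ?ReM ?ImM /=; ring.
  have e' : omega%:C * Z = (n%:~R ^+ 2)%:C * c n - 'i * d.
    by move: e => /eqP; rewrite addrC addr_eq0 opprB => /eqP ->.
  move: (cis _) => N.
  rewrite (_ : 'i * omega%:C * (N * Z) = 'i * N * (omega%:C * Z)); last by ring.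
  rewrite e' mulrBr (_ : _ * ('i * d) = ('i * 'i) * (N * d)); last by ring.
  by rewrite ii; ring.
Qed.

Variables (omega : R) (S : Cinfty R -> R -> Cinfty R).
Hypothesis hS : is_solution_map omega S.

Lemma Cinfty_Hsp (sigma : R) (u : Cinfty R) : Hsp sigma 2 (to_distribution u).
Proof.
apply/Hsp_norm_lty => //; have l2 : 1 <= 2 :> R by rewrite ler1n.
by have [D D0 hD] := Cinfty_anorm u sigma l2; apply: le_lt_trans hD (ltry _).
Qed.

(** The C^1 dependence on time in a Sobolev norm of high order controls each
   coefficient, uniformly after multiplication by powers of <n>. *)
Lemma solution_facts (u0 : Cinfty R) (sg : R) : exists D : R -> int -> C,
  (forall t, 0 <= t -> forall eps : R, 0 < eps -> exists2 d : R, 0 < d &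
    forall t', 0 <= t' -> `|t' - t| < d ->
    forall n, J n `^ sg * normc (fc (S u0 t') n - fc (S u0 t) n) <= eps) /\
  (forall t, 0 <= t -> forall eps : R, 0 < eps -> exists2 d : R, 0 < d &
    forall t', 0 <= t' -> t' != t -> `|t' - t| < d ->
    forall n, J n `^ 2 * normc (((t' - t)^-1)%:C * (fc (S u0 t') n - fc (S u0 t) n) - D t n) <= eps).
Proof.
have [_ [sg0 hsg]] := hS.
pose sigma := Num.max sg0 (Num.max sg 4).
have s0 : sg0 <= sigma by rewrite le_max lexx.
have s1 : sg <= sigma by rewrite !le_max lexx orbT.
have s2 : 4 <= sigma by rewrite !le_max lexx !orbT.
have [Ss [dSs [hE hH _]]] := hsg sigma s0.
have [[_ hc] _ hd] := hH _ (Cinfty_Hsp sigma u0).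
have l2 : 0 < 2 :> R by [].
have wle (a b : R) n (z : C) (e : R) : a <= b -> J n `^ b * normc z <= e -> J n `^ a * normc z <= e.
  move=> ab; apply: le_trans; rewrite ler_wpM2r ?normc_ge0// ler_powR// japanese_ge1//.
exists (fun t n => fourier_coef (dSs (to_distribution u0) t) n); split.
  move=> t t0 eps e0; have tI : `[0, +oo[%classic t by rewrite /= in_itv /= t0.
  have /(Hsp_norm_cvg0 l2) /(_ eps e0) := hc t tI.
  move=> /near_within_ex [d d0 h]; exists d => // t' t'0 t'd n.
  apply: (wle _ _ _ _ _ s1); have := h t' t'0 t'd; rewrite !hE// => h'.
  have := anorm_term l2 n (ltW e0) (fun n => powR_ge0 _ _) h'.
  by rewrite fourier_coefB !fourier_coef_fc.
move=> t t0 eps e0; have tI : `[0, +oo[%classic t by rewrite /= in_itv /= t0.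
have /(Hsp_norm_cvg0 l2) /(_ eps e0) := hd t tI.
move=> /near_dnbhs_ex [d d0 h]; exists d => // t' t'0 t'n t'd n.
have s3 : 2 <= sigma - 2 by lra.
apply: (wle _ _ _ _ _ s3); have := h t' t'0 t'n t'd; rewrite !hE// => h'.
have := anorm_term l2 n (ltW e0) (fun n => powR_ge0 _ _) h'.
by rewrite !(fourier_coefB, fourier_coefZ) !fourier_coef_fc.
Qed.

Lemma within_dnbhs_cvg0 (t : R) (f : R -> R) (eps : R) : 0 < eps ->
  f t' @[t' --> within `[0, +oo[ t^'] --> (0 : R) ->
  exists2 d : R, 0 < d & forall t', 0 <= t' -> t' != t -> `|t' - t| < d -> `|f t'| <= eps.
Proof.
move=> e0 /cvgrPdist_le /(_ _ e0) /near_dnbhs_ex [d d0 h]; exists d => // t' t0 tn td.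
by have := h t' t0 tn td; rewrite sub0r normrN.
Qed.

(** The Fourier series of the difference quotients converge uniformly in x to
   that of the derivative, so the pointwise time derivative is a Fourier series with
   coefficients D t. Taking coefficients in the equation gives the claim; the
   interior of the period suffices. *)
Lemma coefficient_equation (u0 : Cinfty R) (D : R -> int -> C) :
  (forall t, 0 <= t -> forall eps : R, 0 < eps -> exists2 d : R, 0 < d &
    forall t', 0 <= t' -> t' != t -> `|t' - t| < d ->
    forall n, J n `^ 2 * normc (((t' - t)^-1)%:C * (fc (S u0 t') n - fc (S u0 t) n) - D t n) <= eps) ->
  forall t, 0 <= t -> forall n, let c := fc (S u0 t) in
  'i * D t n - (n%:~R ^+ 2)%:C * c n + omega%:C *
    csum (fun jk : int * int => (@resc R n jk.1 jk.2)%:C * (c jk.1 * conjc (c jk.2) * c (n - jk.1 + jk.2))) = 0.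
Proof.
move=> hD t t0 n c; have [/(_ u0) [_ hN] _] := hS.
have l2 : 1 < 2 :> R by rewrite ltr1n.
have [Bc Bc0 hBc] := Cinfty_decay (S u0 t).
have cs := csummable_japanese2 hBc.
have jE m : J m `^ (- 2) = (J m `^ 2)^-1 by rewrite powRN.
have jp m : 0 < J m `^ 2 by exact: powR_japanese_gt0.
have hD' eps : 0 < eps -> exists2 d : R, 0 < d & forall t', 0 <= t' -> t' != t -> `|t' - t| < d ->
    forall n, normc (((t' - t)^-1)%:C * (fc (S u0 t') n - fc (S u0 t) n) - D t n) <= eps * J n `^ (- 2).
  move=> e0; have [d d0 h] := hD t t0 eps e0; exists d => // t' t'0 t'n t'd m.
  by rewrite jE ler_pdivlMr// mulrC; exact: h.
have qs t' : exists B : R, forall n, normc (((t' - t)^-1)%:C * (fc (S u0 t') n - fc (S u0 t) n)) <= B * J n `^ (- 2).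
  have [B B0 hB] := Cinfty_decay (S u0 t').
  exists (normc ((t' - t)^-1)%:C * (B + Bc)) => m; rewrite normcM -mulrA ler_wpM2l ?normc_ge0// mulrDl.
  by apply: le_trans (le_normcD _ _) _; rewrite normcN lerD.
have Ds : csummable (D t).
  have [d d0 h] := hD' 1 ltr01.
  have t'n : t + d / 2 != t by rewrite -subr_eq0 addrC addKr; apply/eqP; lra.
  have t'0 : 0 <= t + d / 2 by lra.
  have t'd : `|t + d / 2 - t| < d by rewrite addrC addKr gtr0_norm; lra.
  have [B hB] := qs (t + d / 2).
  apply: (@csummable_japanese2 _ _ (B + 1)) => m.
  rewrite (_ : D t m = ((t + d / 2 - t)^-1)%:C * (fc (S u0 (t + d / 2)) m - fc (S u0 t) m) - (((t + d / 2 - t)^-1)%:C * (fc (S u0 (t + d / 2)) m - fc (S u0 t) m) - D t m)); last by ring.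
  apply: le_trans (le_normcD _ _) _; rewrite normcN mulrDl lerD//; exact: h.
pose g x := csum (fun n => D t n * cis (n%:~R * x)).
pose N x : C := (normc (S u0 t x) ^+ 2)%:C * (S u0 t x : C).
pose m : C := csum (fun k => c k * conjc (c k)).
have mE : (torus_mean (fun y => normc (S u0 t y) ^+ 2))%:C = m.
  exact: (fc_mass hBc (ccont_Cinfty _) (fun x xI => Cinfty_inversion (S u0 t) xI)).
have cN : ccont N by apply: ccontM; [exact: (ccont_usq (ccont_Cinfty (S u0 t)))|exact: ccont_Cinfty].
have cg : ccont g by exact: ccont_trig.
have eq x : 0 < x < 2 * pi ->
    'i * g x + (cderive1n 2 (S u0 t) x + omega%:C * (N x + (- (2 * m)) * (S u0 t x : C))) = 0.
  move=> xI; have [ut [hut e]] := hN t x t0.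
  have -> : g x = ut.
    apply/eqP; rewrite -subr_eq0 -normc_eq0; apply/eqP/le_anti/andP; split; last exact: normc_ge0.
    apply/ler_addgt0Pl => eps e0; rewrite addr0.
    have J0 := @jsum_ge0 R 2.
    pose e1 := eps / (2 * (jsum 2 + 1)).
    have e10 : 0 < e1 by rewrite divr_gt0// mulr_gt0//; lra.
    have e20 : 0 < eps / 2 by rewrite divr_gt0.
    have [d1 d10 h1] := hD' _ e10.
    have [d2 d20 h2] := within_dnbhs_cvg0 e20 hut.
    pose d := Num.min d1 d2; have d0 : 0 < d by rewrite lt_min d10.
    have [dd1 dd2] : d <= d1 /\ d <= d2 by rewrite /d !ge_min !lexx orbT.
    pose t' := t + d / 2.
    have t't : t' - t = d / 2 by rewrite /t' addrC addKr.
    have t'n : t' != t by rewrite -subr_eq0 t't; apply/eqP; lra.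
    have t'0 : 0 <= t' by rewrite /t'; lra.
    have t'd : `|t' - t| < d by rewrite t't gtr0_norm; lra.
    have k1 := h1 t' t'0 t'n (lt_le_trans t'd dd1).
    have k2 := h2 t' t'0 t'n (lt_le_trans t'd dd2).
    pose q m := ((t' - t)^-1)%:C * (fc (S u0 t') m - fc (S u0 t) m).
    have qE : ((t' - t)^-1)%:C * ((S u0 t' x : C) - S u0 t x) = csum (fun m => q m * cis (m%:~R * x)).
      have [B B0 hB] := Cinfty_decay (S u0 t').
      have cs' := csummable_japanese2 hB.
      have tw (f : int -> C) : csummable f -> csummable (fun m => f m * cis (m%:~R * x)).
        by move=> fs; apply: csummable_le fs => i; rewrite normcM normc_cis mulr1.
      rewrite (Cinfty_inversion (S u0 t') xI) (Cinfty_inversion (S u0 t) xI) -csumB; [|exact: tw|exact: tw].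
      rewrite -csumZ; last first.
        by apply: csummableD; [exact: tw|apply: csummableN; exact: tw].
      by apply: eq_csum => i; rewrite /q; ring.
    have qs' : csummable q by have [B hB] := qs t'; exact: csummable_japanese2 hB.
    have k3 : normc (g x - csum (fun m => q m * cis (m%:~R * x))) <= eps / 2.
      rewrite /g -csumB; last 2 first.
      - by apply: csummable_le Ds => i; rewrite normcM normc_cis mulr1.
      - by apply: csummable_le qs' => i; rewrite normcM normc_cis mulr1.
      apply: (@normc_csum_le _ _ _ (fun i => e1 * J i `^ (- 2))).
        move=> i; rewrite -mulrBl normcM normc_cis mulr1 -normcN opprB; exact: k1.
      apply: (@le_trans _ _ (e1 * jsum 2)%:E).
        apply: nsum_scale; [exact: ltW|by move=> i; rewrite powR_ge0|by rewrite (nsum_japanese l2)].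
      rewrite lee_fin /e1 invfM mulrA -mulrA ler_piMr ?(ltW e20)// mulrC ler_pdivrMr; lra.
    rewrite -qE in k3.
    rewrite ger0_norm ?normc_ge0// in k2.
    rewrite (_ : g x - ut = (g x - ((t' - t)^-1)%:C * ((S u0 t' x : C) - S u0 t x)) + (((t' - t)^-1)%:C * ((S u0 t' x : C) - S u0 t x) - ut)); last by ring.
    by apply: le_trans (le_normcD _ _) _; move: k2 k3; lra.
  rewrite -[RHS]e -addrA; congr (_ + (_ + _)).
  by rewrite /N -mE !rmorphM !rmorphB !rmorphM /= rmorph_nat; ring.
have cL : ccont (fun x => 'i * g x + (cderive1n 2 (S u0 t) x + omega%:C * (N x + (- (2 * m)) * (S u0 t x : C)))).
  apply: ccontD; first exact: ccontZ.
  apply: ccontD; first exact: ccont_smooth.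
  by apply: ccontZ; apply: ccontD => //; apply: ccontZ; exact: ccont_Cinfty.
have := eq_fc n cL (ccont_cst 0) eq.
have -> : fc (fun _ : R => 0 : C) n = 0.
  rewrite (_ : (fun _ => _) = (fun x => 0 * (S u0 t x : C))); last by apply/funext => x; rewrite mul0r.
  by rewrite fcZ ?mul0r//; exact: ccont_Cinfty.
have cu := ccont_Cinfty (S u0 t).
rewrite fcD; [|exact: ccontZ|]; last first.
  by apply: ccontD; [exact: ccont_smooth|apply: ccontZ; apply: ccontD => //; exact: ccontZ].
rewrite fcD; [|exact: ccont_smooth|by apply: ccontZ; apply: ccontD => //; exact: ccontZ].
rewrite !fcZ//; last by apply: ccontD => //; exact: ccontZ.
rewrite fcD//; last exact: ccontZ.
rewrite fcZ// fc_cderive2 (fc_trig id Ds).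
rewrite (fc_cubic hBc cu (fun x xI => Cinfty_inversion (S u0 t) xI)).
have -> : csum (fun i : int => D t i * (i == n)%:R) = D t n.
  rewrite -(@csum_delta _ _ n (fun i => D t i)); apply: eq_csum => i.
  by case: eqP => _; rewrite ?mulr1 ?mulr0.
rewrite (renormalized_cubic hBc) -/m -/c => <-.
by ring.
Qed.

Lemma solution_bounded (u0 : Cinfty R) (T : R) : 0 <= T -> exists2 B : R, 0 < B &
  forall t n, 0 <= t <= T -> normc (fc (S u0 t) n) <= B * J n `^ (- 2).
Proof.
move=> T0; have [D [hC _]] := solution_facts u0 2.
apply: (@bounded_family (fun t => fc (S u0 t)) T T0 hC) => t.
by have [B _ hB] := Cinfty_decay (S u0 t); exists B.
Qed.

Definition solution_profile (u0 : Cinfty R) (t : R) (n : int) : C :=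
  cis ((n ^+ 2)%:~R * t) * fc (S u0 t) n.

Lemma profileB u0 v0 t n : normc (solution_profile u0 t n - solution_profile v0 t n) =
  normc (fc (S u0 t) n - fc (S v0 t) n).
Proof. by rewrite /solution_profile -mulrBr normcM normc_cis mul1r. Qed.

Lemma profile0 u0 n : solution_profile u0 0 n = fc u0 n.
Proof.
have [/(_ u0) [h _] _] := hS; rewrite /solution_profile mulr0 cis0 mul1r.
by rewrite /fc (_ : (Cinfty_fun (S u0 0) : R -> C) = Cinfty_fun u0) //; apply/funext.
Qed.

Lemma profile_of_solution u0 (T : R) : 0 <= T ->
  profile_solution T ('i * omega%:C) (solution_profile u0).
Proof.
move=> T0; have [D [hC hD]] := solution_facts u0 0.
apply: (@profile_of_coefficients omega (fun t => fc (S u0 t)) D T) => //.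
- move=> t t0 eps e0; have [d d0 hd] := hC t t0 eps e0; exists d => // t' t'0 td n.
  by have := hd t' t'0 td n; rewrite powRr0 mul1r.
- move=> t t0 eps e0; have [d d0 hd] := hD t t0 eps e0; exists d => // t' t'0 tn td n.
  apply: le_trans (hd t' t'0 tn td n).
  by rewrite ler_peMl ?normc_ge0// powR_japanese_ge1.
- have [B _ hB] := solution_bounded u0 T0; by exists B.
- by move=> t t0 n; exact: (coefficient_equation hD t0 n).
Qed.

End SolutionProfiles.

(** * Distributions and truncations *)

Section Extension.
Context {R : realType}.
Local Notation J n := (japanese n : R).
Local Notation C := R[i].

Lemma fc_linear (a : C) (f g : Cinfty R) n :
  fc (a *: f + g : Cinfty R) n = a * fc f n + fc g n.
Proof.
have cf := ccont_Cinfty f; have cg := ccont_Cinfty g.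
rewrite -fcZ// -fcD//; exact: ccontZ.
Qed.

(** Pairing the coefficients with those of the test function converges by
   [fc_decay], with only two derivatives of the test function involved. *)
Lemma distribution_of_coefs (c : int -> C) (B : R) : (forall n, normc (c n) <= B) ->
  exists D : torus_distribution R, forall n, fourier_coef D n = c n.
Proof.
move=> hB; have B0 : 0 <= B by apply: le_trans (hB 0); exact: normc_ge0.
have l2 : 1 < 2 :> R by rewrite ltr1n.
pose F (phi : Cinfty R) : C := (2 * pi)%:C * csum (fun n => c n * fc phi (- n)).
have sF (phi : Cinfty R) : csummable (fun n => c n * fc phi (- n)).
  have [A A0 hA] := Cinfty_decay phi.
  apply: (@csummable_japanese2 _ _ (B * A)) => n.
  by rewrite normcM -mulrA ler_pM ?normc_ge0// -japaneseN.
have Fdist : (F : Cinfty R -> R[i]^o) \in is_distribution.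
  apply/asboolP; split.
    move=> a f g; rewrite /F.
    rewrite (@eq_csum _ _ _ (fun n => a * (c n * fc f (- n)) + c n * fc g (- n))); last first.
      by move=> n; rewrite fc_linear mulrDr mulrCA.
    rewrite csumD; [|exact: csummableZ|exact: sF].
    by rewrite csumZ; [rewrite mulrDr mulrCA|exact: sF].
  exists (2 * pi * (B * 4 * jsum 2)), 2%N; split.
    by rewrite mulr_ge0 ?(ltW twopi_gt0)// mulr_ge0 ?jsum_ge0// mulr_ge0.
  move=> phi A hA; rewrite /F normcM normcR ger0_norm ?(ltW twopi_gt0)//.
  rewrite -!mulrA; do 2!(rewrite ler_wpM2l ?pi_ge0//).
  have A0 : 0 <= A by apply: le_trans (hA 0%N 0 isT); exact: normc_ge0.
  have BA0 : 0 <= B * (4 * A) by rewrite mulr_ge0// mulr_ge0.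
  apply: (@normc_csum_le _ _ _ (fun n => B * (4 * A) * J n `^ (- 2))).
    move=> n; rewrite normcM -[leRHS]mulrA ler_pM ?normc_ge0// -japaneseN.
    by apply: fc_decay => k x k2 _; exact: hA.
  apply: (@le_trans _ _ (B * (4 * A) * jsum 2)%:E); last first.
    by rewrite lee_fin le_eqVlt; apply/orP; left; apply/eqP; ring.
  by apply: nsum_scale => // [n|]; [rewrite powR_ge0|rewrite (nsum_japanese l2)].
exists (MkTorusDistribution Fdist) => m.
rewrite /fourier_coef /= /F mulrA -rmorphM mulVf ?gt_eqF ?twopi_gt0// mul1r.
rewrite -(@csum_delta _ _ m c); apply: eq_csum => n.
rewrite (_ : (Cinfty_fun (expin m) : R -> C) = fun x => cis ((- m)%:~R * x)).
  by rewrite fc_cis eqr_opp eq_sym; case: eqP => _; rewrite ?mulr1 ?mulr0.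
by apply/funext => x; rewrite /= expin_cis rmorphN mulNr.
Qed.

Definition box (N : nat) : seq int := [seq i%:Z - N%:Z | i <- iota 0 (2 * N).+1].

Lemma box_uniq N : uniq (box N).
Proof. by rewrite map_inj_uniq ?iota_uniq// => i j; lia. Qed.

Lemma mem_box N (n : int) : (n \in box N) = (`|n| <= N)%N.
Proof.
apply/mapP/idP => h; first by case: h => i; rewrite mem_iota => hi ->; lia.
exists (absz (n + N%:Z)); last by lia.
by rewrite mem_iota; lia.
Qed.

Lemma truncation (c : int -> C) (N : nat) : exists u : Cinfty R, forall n,
  fc u n = if (`|n| <= N)%N then c n else 0.
Proof.
suff h (s : seq int) : uniq s -> exists u : Cinfty R, forall n, fc u n = if n \in s then c n else 0.
  have [u hu] := h _ (box_uniq N); exists u => n; by rewrite hu mem_box.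
elim: s => [|m s IH] /=.
  move=> _; exists 0 => n.
  have := fc_linear 0 (0 : Cinfty R) 0 n; rewrite scale0r addr0 mul0r add0r => _.
  have := fc_linear (-1) (0 : Cinfty R) 0 n.
  by rewrite scaler0 addr0 mulN1r addNr.
move=> /andP[ms us]; have [u hu] := IH us.
exists (c m *: expin (- m) + u) => n; rewrite fc_linear hu.
rewrite (_ : (Cinfty_fun (expin (- m)) : R -> C) = fun x => cis (m%:~R * x)); last first.
  by apply/funext => x; rewrite /= expin_cis rmorphN mulNr opprK.
rewrite fc_cis inE [n == m]eq_sym; case: eqP => [<-|_] /=; last by rewrite mulr0 add0r.
by rewrite (negPf ms) mulr1 addr0.
Qed.

Variables (p : R) (p1 : 1 <= p).
Let p0 : 0 < p. Proof. exact: lt_le_trans ltr01 p1. Qed.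

Lemma anorm_tail (W : int -> R) (c : int -> C) (eps : R) : (anorm p W c < +oo)%E -> 0 < eps ->
  exists N0, forall N, (N0 <= N)%N ->
    (anorm p W (fun n => (c n - if (`|n| <= N)%N then c n else 0)%R) <= eps%:E)%E.
Proof.
move=> hc e0.
have [s us hs] := nsum_tail (fun n => powR_ge0 (W n * normc (c n)) p : (0 <= ((W n * normc (c n)) `^ p)%:E)%E) hc e0.
exists (\max_(i <- s) `|i|%N) => N hN; apply: ltW; apply: le_lt_trans hs.
apply: le_nsum => n; case: ifP => nN.
  rewrite subrr [normc _]normc0 mulr0 powR0 ?gt_eqF//.
  by case: ifP => // _; rewrite lee_fin powR_ge0.
case: ifP => [ns|_]; last by rewrite subr0.
have := leq_trans (@leq_bigmax_seq _ s xpredT (fun i : int => `|i|%N) n ns isT) hN.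
by rewrite nN.
Qed.

Lemma anormD (W : int -> R) (a b c : int -> C) (x y : R) : (forall n, 0 <= W n) ->
  (forall n, c n = a n + b n) -> (anorm p W a <= x%:E)%E -> (anorm p W b <= y%:E)%E ->
  (anorm p W c <= (2 `^ p * (x + y))%:E)%E.
Proof.
move=> W0 hc ha hb; rewrite EFinM EFinD.
apply: (@le_trans _ _ ((2 `^ p)%:E * (anorm p W a + anorm p W b))%E).
  rewrite /anorm -nsumD; [|by move=> n; rewrite lee_fin powR_ge0|by move=> n; rewrite lee_fin powR_ge0].
  rewrite -nsumZ ?powR_ge0//; last by move=> n; rewrite adde_ge0 ?lee_fin ?powR_ge0.
  apply: le_nsum => n; rewrite -EFinD -EFinM lee_fin.
  have wa : 0 <= W n * normc (a n) by rewrite mulr_ge0 ?normc_ge0.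
  have wb : 0 <= W n * normc (b n) by rewrite mulr_ge0 ?normc_ge0.
  apply: le_trans (powRD_le p1 wa wb); apply: ge0_ler_powR; rewrite ?nnegrE ?(ltW p0)//.
  - by rewrite mulr_ge0 ?normc_ge0.
  - by rewrite addr_ge0.
  by rewrite -mulrDr ler_wpM2l// hc le_normcD.
by apply: lee_wpmul2l; [rewrite lee_fin powR_ge0|apply: leeD].
Qed.

Lemma anorm_subC (W : int -> R) (a b : int -> C) :
  anorm p W (fun n => (a n - b n)%R) = anorm p W (fun n => (b n - a n)%R).
Proof. by apply: anormJ => n; rewrite -normcN opprB. Qed.

(** Fatou's lemma, tested on finite sums; the factor 2^p replaces the triangle
   inequality for the p-th powers. *)
Lemma anorm_limit (W : int -> R) (a : nat -> int -> C) (b c : int -> C) (x : R) :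
  (forall n, 0 < W n) ->
  (forall n, forall eps : R, 0 < eps -> exists N0, forall N, (N0 <= N)%N -> normc (c n - a N n) <= eps) ->
  (forall eps : R, 0 < eps -> exists N0, forall N, (N0 <= N)%N ->
    (anorm p W (fun n => (a N n - b n)%R) <= (x + eps)%:E)%E) ->
  (anorm p W (fun n => (c n - b n)%R) <= (2 `^ p * x)%:E)%E.
Proof.
move=> W0 ha hx; apply: nsum_le_seq => s us; rewrite sumEFin lee_fin.
apply/ler_addgt0Pl => eps e0.
pose P : R := 2 `^ p; have P0 : 0 < P by rewrite powR_gt0.
pose e1 := eps / (2 * P); have e10 : 0 < e1 by rewrite divr_gt0// mulr_gt0.
have [N1 hN1] := hx _ e10.
pose L : R := (size s).+1%:R; have L0 : 0 < L by rewrite ltr0n.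
pose e2 := e1 / L; have e20 : 0 < e2 by rewrite divr_gt0.
have [N2 hN2] : exists N2, forall N, (N2 <= N)%N -> forall n, n \in s -> (W n * normc (c n - a N n)) `^ p <= e2.
  elim: (s) => [|m s' [N3 h3]]; first by exists 0%N.
  have e3 : 0 < e2 `^ p^-1 / W m by rewrite divr_gt0 ?powR_gt0.
  have [N4 h4] := ha m _ e3.
  exists (maxn N3 N4) => N; rewrite geq_max => /andP[n3 n4] n; rewrite inE => /orP[/eqP ->|ns]; last exact: h3.
  have := h4 N n4; rewrite ler_pdivlMr// mulrC => h.
  apply: (@le_trans _ _ ((e2 `^ p^-1) `^ p)); last by rewrite -powRrM mulVf ?gt_eqF// powRr1// ltW.
  apply: ge0_ler_powR; rewrite ?nnegrE ?(ltW p0) ?powR_ge0//.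
  by rewrite mulr_ge0 ?normc_ge0 ?(ltW (W0 _)).
pose N := maxn N1 N2.
have {}hN1 := hN1 N (leq_maxl _ _); have {}hN2 := hN2 N (leq_maxr _ _).
have hs : \sum_(n <- s) (W n * normc (a N n - b n)) `^ p <= x + e1.
  rewrite -lee_fin; apply: le_trans hN1; rewrite -sumEFin; apply: nsum_seq_le => // n.
  by rewrite lee_fin powR_ge0.
have hs2 : \sum_(n <- s) (W n * normc (c n - a N n)) `^ p <= e1.
  apply: (@le_trans _ _ (\sum_(n <- s) e2)).
    by rewrite big_seq [leRHS]big_seq; apply: ler_sum => n ns; exact: hN2.
  rewrite big_const_seq count_predT iter_addr_0 -mulr_natr /e2 -mulrA ler_piMr ?(ltW e10)//.
  by rewrite mulrC ler_pdivrMr// mul1r ler_nat.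
apply: (@le_trans _ _ (P * (\sum_(n <- s) (W n * normc (c n - a N n)) `^ p + \sum_(n <- s) (W n * normc (a N n - b n)) `^ p))).
  rewrite -big_split /= mulr_sumr; apply: ler_sum => n _.
  have wa : 0 <= W n * normc (c n - a N n) := mulr_ge0 (ltW (W0 n)) (normc_ge0 _).
  have wb : 0 <= W n * normc (a N n - b n) := mulr_ge0 (ltW (W0 n)) (normc_ge0 _).
  apply: le_trans (powRD_le p1 wa wb); apply: ge0_ler_powR; rewrite ?nnegrE ?(ltW p0)//.
  - exact: mulr_ge0 (ltW (W0 n)) (normc_ge0 _).
  - by rewrite addr_ge0.
  rewrite -mulrDr ler_wpM2l ?(ltW (W0 n))//.
  by rewrite (_ : c n - b n = (c n - a N n) + (a N n - b n)) ?le_normcD//; ring.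
apply: le_trans (ler_wpM2l (ltW P0) (lerD hs2 hs)) _.
have -> : P * (e1 + (x + e1)) = P * x + eps by rewrite /e1; field; rewrite gt_eqF.
by rewrite addrC.
Qed.

Lemma coef_limit (a : nat -> C) :
  (forall eps : R, 0 < eps -> exists N0, forall N N', (N0 <= N)%N -> (N0 <= N')%N -> normc (a N - a N') <= eps) ->
  exists c : C, forall eps : R, 0 < eps -> exists N0, forall N, (N0 <= N)%N -> normc (c - a N) <= eps.
Proof.
move=> h.
have key (f : nat -> R) : (forall eps : R, 0 < eps -> exists N0, forall N N', (N0 <= N)%N -> (N0 <= N')%N -> `|f N - f N'| <= eps) ->
    exists l : R, forall eps : R, 0 < eps -> exists N0, forall N, (N0 <= N)%N -> `|l - f N| <= eps.
  move=> hf; have cf : cvgn f.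
    apply/cauchy_cvgP/cauchy_exP => eps e0; have e2 : 0 < eps / 2 by rewrite divr_gt0.
    have [N0 hN] := hf _ e2; exists (f N0); exists N0 => // N /= NN.
    rewrite /ball /=; apply: le_lt_trans (hN _ _ (leqnn _) NN) _; lra.
  exists (limn f) => eps e0; have /cvgrPdist_le /(_ _ e0) [N0 _ hN] := cf; by exists N0.
have [|l1 h1] := key (fun N => complex.Re (a N)).
  move=> eps e0; have [N0 hN] := h eps e0; exists N0 => N N' n1 n2.
  by rewrite -ReN -ReD; exact: le_trans (normc_Re _) (hN N N' n1 n2).
have [|l2 h2] := key (fun N => complex.Im (a N)).
  move=> eps e0; have [N0 hN] := h eps e0; exists N0 => N N' n1 n2.
  by rewrite -ImN -ImD; exact: le_trans (normc_Im _) (hN N N' n1 n2).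
exists (l1 +i* l2) => eps e0; have e2 : 0 < eps / 2 by rewrite divr_gt0.
have [N1 hN1] := h1 _ e2; have [N2 hN2] := h2 _ e2.
exists (maxn N1 N2) => N; rewrite geq_max => /andP[n1 n2].
apply: le_trans (normc_le_ReIm _) _; rewrite ReD ReN ImD ImN /=.
by have := hN1 N n1; have := hN2 N n2; lra.
Qed.

End Extension.

(** * The extended solution map *)

Section ExtendedFlow.
Context {R : realType}.
Local Notation J n := (japanese n : R).
Local Notation C := R[i].
Variables (omega : R) (homega : omega = 1 \/ omega = -1) (S : Cinfty R -> R -> Cinfty R).
Hypothesis hS : is_solution_map omega S.
Variables (p s : R) (p1 : 1 <= p) (s0 : 0 <= s).
Let p0 : 0 < p. Proof. exact: lt_le_trans ltr01 p1. Qed.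
Let W (n : int) : R := J n `^ s.
Let W0 n : 0 < W n. Proof. exact: powR_japanese_gt0. Qed.
Let W0' n : 0 <= W n. Proof. exact: ltW. Qed.

(** The profiles have the same moduli as the solutions. *)
Lemma smooth_stability (rho0 : R) : 0 <= rho0 ->
  exists2 T : R, 0 < T & exists2 K : R, 0 < K & forall (u0 v0 : Cinfty R) (delta : R),
  (anorm p W (fc u0) <= rho0%:E)%E -> (anorm p W (fc v0) <= rho0%:E)%E -> 0 <= delta ->
  (anorm p W (fun n => (fc u0 n - fc v0 n)%R) <= delta%:E)%E ->
  forall t, 0 <= t <= T ->
  (anorm p W (fun n => (fc (S u0 t) n - fc (S v0 t) n)%R) <= (K * delta)%:E)%E.
Proof.
move=> r0; have [T T0 [K K0 h]] := profile_stability p1 s0 r0.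
exists T => //; exists K => // u0 v0 delta hu hv d0 hd t tI.
have wE : wt s 0 = W by apply/funext => n; rewrite wt0.
have w2E (v : Cinfty R) : anorm p (fun n => (wt s 0 n * J n ^+ 2)%R) (solution_profile S v 0) =
    anorm p (fun n => J n `^ (s + 2))%R (fc v).
  apply: eq_nsum => n; rewrite (profile0 hS) wE /W.
  rewrite powRD; last by rewrite (gt_eqF (japanese_gt0 n)) implybT.
  by rewrite -[X in J n `^ _ * J n `^ X * _]/(2%:R) powR_mulrn ?japanese_ge0.
have zE (v : Cinfty R) : anorm p (wt s 0) (solution_profile S v 0) = anorm p W (fc v).
  by rewrite wE; apply: anormJ => n; rewrite (profile0 hS).
have [Du Du0 hDu] := Cinfty_anorm u0 (s + 2) p1.
have [Dv Dv0 hDv] := Cinfty_anorm v0 (s + 2) p1.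
have kw1 : normc ('i * omega%:C : C) = 1.
  rewrite normcM normcR; have -> : `|omega| = 1 by case: homega => ->; rewrite ?normrN normr1.
  by rewrite mulr1 normcE /= expr0n add0r expr1n sqrtr1.
have T0' := ltW T0.
have := h ('i * omega%:C) (solution_profile S u0) (solution_profile S v0) (Du + Dv) delta kw1
  (profile_of_solution hS u0 T0') (profile_of_solution hS v0 T0').
rewrite !zE !w2E => /(_ hu hv (addr_ge0 Du0 Dv0)) h1.
have h2 := h1 (le_trans hDu _) (le_trans hDv _) d0.
rewrite !lee_fin lerDl lerDr in h2; have {}h2 := h2 Dv0 Du0.
have e1 : anorm p (wt s 0) (fun n => solution_profile S u0 0 n - solution_profile S v0 0 n) =
   anorm p W (fun n => fc u0 n - fc v0 n).
  by rewrite wE; apply: anormJ => n; rewrite !(profile0 hS).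
have e2 : anorm p (wt s 0) (fun n => solution_profile S u0 t n - solution_profile S v0 t n) =
   anorm p W (fun n => fc (S u0 t) n - fc (S v0 t) n).
  by rewrite wE; apply: anormJ => n; rewrite profileB.
rewrite e1 in h2; rewrite -e2; exact: h2 hd t tI.
Qed.

Lemma truncation_close (c : int -> C) (rho tau : R) : (anorm p W c <= rho%:E)%E -> 0 < tau ->
  exists N0, forall N, (N0 <= N)%N -> exists u : Cinfty R,
  [/\ forall n, fc u n = if (`|n| <= N)%N then c n else 0,
      (anorm p W (fc u) <= rho%:E)%E & (anorm p W (fun n => (c n - fc u n)%R) <= tau%:E)%E].
Proof.
move=> hc t0; have [N0 hN0] := anorm_tail p1 (le_lt_trans hc (ltry _)) t0.
exists N0 => N NN; have [u hu] := truncation c N; exists u; split => //.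
  apply: le_trans hc; apply: le_nsum => n; rewrite lee_fin hu.
  apply: ge0_ler_powR; rewrite ?nnegrE ?(ltW p0)//; try exact: mulr_ge0 (W0' n) (normc_ge0 _).
  apply: ler_wpM2l => //; case: ifP => // _; rewrite [normc _]normc0; exact: normc_ge0.
apply: le_trans (hN0 N NN); rewrite le_eqVlt; apply/orP; left; apply/eqP.
by apply: anormJ => n; rewrite hu.
Qed.

Variables (rho0 T K : R) (K0 : 0 < K).
Hypothesis stab : forall (u0 v0 : Cinfty R) (delta : R),
  (anorm p W (fc u0) <= rho0%:E)%E -> (anorm p W (fc v0) <= rho0%:E)%E -> 0 <= delta ->
  (anorm p W (fun n => (fc u0 n - fc v0 n)%R) <= delta%:E)%E ->
  forall t, 0 <= t <= T ->
  (anorm p W (fun n => (fc (S u0 t) n - fc (S v0 t) n)%R) <= (K * delta)%:E)%E.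
Let P : R := 2 `^ p.
Let P1 : 1 <= P. Proof. by rewrite /P -[leLHS](@powRr0 R 2) ler_powR ?ler1n// ltW. Qed.
Let P0 : 0 < P. Proof. exact: lt_le_trans ltr01 P1. Qed.
Let K2 := P * (K * P).
Let K20 : 0 < K2. Proof. exact: mulr_gt0 P0 (mulr_gt0 K0 P0). Qed.

(** The coefficients d are those of the extended flow at time t from data with
   coefficients c: they depend Lipschitz-continuously on smooth comparison data.
   Applied to truncations of c, this determines d. *)
Definition flow_coefs (c : int -> C) (t : R) (d : int -> C) : Prop :=
  forall (v0 : Cinfty R) (delta : R), (anorm p W (fc v0) <= rho0%:E)%E -> 0 <= delta ->
  (anorm p W (fun n => (c n - fc v0 n)%R) <= delta%:E)%E ->
  (anorm p W (fun n => (d n - fc (S v0 t) n)%R) <= (K2 * delta)%:E)%E.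

Lemma flow_coefs_smooth (u0 : Cinfty R) t : (anorm p W (fc u0) <= rho0%:E)%E -> 0 <= t <= T ->
  flow_coefs (fc u0) t (fc (S u0 t)).
Proof.
move=> hu tI v0 delta hv d0 hd; apply: le_trans (stab hu hv d0 hd tI) _.
rewrite lee_fin ler_wpM2r// /K2 mulrCA ler_peMr ?(ltW K0)//.
exact: mulr_ege1.
Qed.

(** The solutions from the truncations of c form a Cauchy sequence by the
   stability of smooth solutions. *)
Lemma flow_coefs_ex (c : int -> C) t : (anorm p W c <= rho0%:E)%E -> 0 <= t <= T ->
  exists d, flow_coefs c t d.
Proof.
move=> hc tI.
have [u hu] := choice (truncation c).
have ru N : (anorm p W (fc (u N)) <= rho0%:E)%E.
  apply: le_trans hc; apply: le_nsum => n; rewrite lee_fin hu.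
  apply: ge0_ler_powR; rewrite ?nnegrE ?(ltW p0)//; try exact: mulr_ge0 (W0' n) (normc_ge0 _).
  apply: ler_wpM2l => //; case: ifP => // _; rewrite [normc _]normc0; exact: normc_ge0.
have tail tau : 0 < tau -> exists N0, forall N, (N0 <= N)%N -> (anorm p W (fun n => (c n - fc (u N) n)%R) <= tau%:E)%E.
  move=> t0; have [N0 hN0] := anorm_tail p1 (le_lt_trans hc (ltry _)) t0.
  exists N0 => N NN; apply: le_trans (hN0 N NN); rewrite le_eqVlt; apply/orP; left; apply/eqP.
  by apply: anormJ => n; rewrite hu.
have near_v (v0 : Cinfty R) (x y : R) N : 0 <= x -> 0 <= y -> (anorm p W (fc v0) <= rho0%:E)%E ->
    (anorm p W (fun n => (c n - fc (u N) n)%R) <= x%:E)%E ->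
    (anorm p W (fun n => (c n - fc v0 n)%R) <= y%:E)%E ->
    (anorm p W (fun n => (fc (S (u N) t) n - fc (S v0 t) n)%R) <= (K * (P * (x + y)))%:E)%E.
  move=> x0 y0 hv hx hy.
  apply: (stab (ru N) hv (mulr_ge0 (ltW P0) (addr_ge0 x0 y0)) _ tI).
  rewrite anorm_subC in hx.
  by apply: (anormD p1 W0' _ hx hy) => n; ring.
have cauchy n : exists l : C, forall eps : R, 0 < eps -> exists N0, forall N, (N0 <= N)%N -> normc (l - fc (S (u N) t) n) <= eps.
  apply: coef_limit => eps e0.
  pose tau := eps `^ p / (2 * (K * P)).
  have tau0 : 0 < tau by rewrite divr_gt0 ?powR_gt0// mulr_gt0// mulr_gt0.
  have [N0 hN0] := tail _ tau0; exists N0 => N N' n1 n2.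
  have := near_v (u N') tau tau N (ltW tau0) (ltW tau0) (ru N') (hN0 _ n1) (hN0 _ n2).
  have -> : K * (P * (tau + tau)) = eps `^ p by rewrite /tau; field; rewrite !gt_eqF.
  move=> h; have := anorm_term p0 n (ltW e0) W0' h; apply: le_trans.
  by rewrite ler_peMl ?normc_ge0// powR_japanese_ge1.
have [d hd] := choice cauchy.
exists d => v0 delta hv d0 hdel.
have -> : K2 * delta = 2 `^ p * (K * (P * delta)) by rewrite /K2 /P; ring.
apply: (@anorm_limit _ p p1 W (fun N => fc (S (u N) t))) => // eps e0.
pose tau := eps / (K * P); have tau0 : 0 < tau by rewrite divr_gt0// mulr_gt0.
have [N0 hN0] := tail _ tau0; exists N0 => N NN.
apply: le_trans (near_v v0 tau delta N (ltW tau0) d0 hv (hN0 N NN) hdel) _.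
by rewrite lee_fin le_eqVlt; apply/orP; left; apply/eqP; rewrite /tau; field; rewrite !gt_eqF.
Qed.

Lemma flow_coefs_lty (c d : int -> C) t : (anorm p W c <= rho0%:E)%E -> flow_coefs c t d ->
  (anorm p W d < +oo)%E.
Proof.
move=> hc hd; have [N0 hN0] := truncation_close hc ltr01.
have [u [_ ru cu]] := hN0 N0 (leqnn _).
have h1 := hd u 1 ru ler01 cu.
have [D D0 hD] := Cinfty_anorm (S u t) s p1.
have := @anormD _ _ p1 W (fun n => d n - fc (S u t) n) (fc (S u t)) d _ _ W0' (fun n => esym (subrK _ _)) h1 hD.
by move=> h; apply: le_lt_trans h (ltry _).
Qed.

(** Comparison with the smooth solutions from truncations at the same frequency,
   whose data are at most as far apart as c and c'. *)
Lemma flow_coefs_lip (c c' d d' : int -> C) (delta : R) t : 0 <= t <= T ->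
  (anorm p W c <= rho0%:E)%E -> (anorm p W c' <= rho0%:E)%E ->
  flow_coefs c t d -> flow_coefs c' t d' -> 0 < delta ->
  (anorm p W (fun n => (c n - c' n)%R) <= delta%:E)%E ->
  (anorm p W (fun n => (d n - d' n)%R) <= (P * (K2 + P * (K + K2)) * delta)%:E)%E.
Proof.
move=> tI hc hc' hd hd' d0 hdel.
have [N1 h1] := truncation_close hc d0; have [N2 h2] := truncation_close hc' d0.
have [u [uE ru cu]] := h1 _ (leq_maxl N1 N2); have [v [vE rv cv]] := h2 _ (leq_maxr N1 N2).
have huv : (anorm p W (fun n => (fc u n - fc v n)%R) <= delta%:E)%E.
  apply: le_trans hdel; apply: le_nsum => n; rewrite lee_fin uE vE.
  apply: ge0_ler_powR; rewrite ?nnegrE ?(ltW p0)//; try exact: mulr_ge0 (W0' n) (normc_ge0 _).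
  apply: ler_wpM2l => //; case: ifP => // _; rewrite subrr [normc _]normc0; exact: normc_ge0.
have a1 := hd u delta ru (ltW d0) cu.
have a2 := stab ru rv (ltW d0) huv tI.
have a3 := hd' v delta rv (ltW d0) cv; rewrite anorm_subC in a3.
have a4 := @anormD _ _ p1 W _ _ (fun n => fc (S u t) n - d' n) _ _ W0' (fun n => esym (subrKA _ _ _)) a2 a3.
have := @anormD _ _ p1 W _ _ (fun n => d n - d' n) _ _ W0' (fun n => esym (subrKA _ _ _)) a1 a4.
by move=> h; apply: le_trans h _; rewrite lee_fin le_eqVlt; apply/orP; left; apply/eqP; rewrite /P; ring.
Qed.

(** A uniform limit of the smooth solutions from truncations, which are
   continuous in time. *)
Lemma flow_coefs_continuous (c : int -> C) (d : R -> int -> C) :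
  (anorm p W c <= rho0%:E)%E -> (forall t, 0 <= t <= T -> flow_coefs c t (d t)) ->
  forall t, 0 <= t <= T -> forall eps : R, 0 < eps -> exists2 e : R, 0 < e &
    forall t', 0 <= t' <= T -> `|t' - t| < e ->
    (anorm p W (fun n => (d t' n - d t n)%R) <= (eps `^ p)%:E)%E.
Proof.
move=> hc hd t tI eps e0.
have j0 := @jsum_ge0 R 2.
pose E := eps `^ p; have E0 : 0 < E by rewrite powR_gt0.
pose tau := E / (4 * (P * P * K2)).
have PPK : 0 < 4 * (P * P * K2) by rewrite mulr_gt0// mulr_gt0// mulr_gt0.
have tau0 : 0 < tau by rewrite divr_gt0.
have [N0 hN0] := truncation_close hc tau0; have [u [_ ru cu]] := hN0 _ (leqnn _).
have PPj : 0 < 2 * (P * P * (jsum 2 + 1)) by rewrite mulr_gt0// mulr_gt0 ?mulr_gt0//; lra.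
pose B := (E / (2 * (P * P * (jsum 2 + 1)))) `^ p^-1.
have B0 : 0 < B by rewrite powR_gt0// divr_gt0.
have [_ [hC _]] := solution_facts hS u (s + 2).
have [e e0' he] := hC t (proj1 (andP tI)) B B0.
exists e => // t' t'I t'd.
have a1 := hd t' t'I u tau ru (ltW tau0) cu.
have a3 := hd t tI u tau ru (ltW tau0) cu; rewrite anorm_subC in a3.
have a2 : (anorm p W (fun n => (fc (S u t') n - fc (S u t) n)%R) <= (B `^ p * jsum 2)%:E)%E.
  apply: anorm_bound => //; first exact: ltW.
  move=> n; rewrite powRN ler_pdivlMr ?powR_japanese_gt0// mulrAC.
  have := he t' (proj1 (andP t'I)) t'd n.
  by rewrite powRD//; rewrite (gt_eqF (japanese_gt0 n)) implybT.
have a4 := @anormD _ _ p1 W _ _ (fun n => fc (S u t') n - d t n) _ _ W0' (fun n => esym (subrKA _ _ _)) a2 a3.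
have a5 := @anormD _ _ p1 W _ _ (fun n => d t' n - d t n) _ _ W0' (fun n => esym (subrKA _ _ _)) a1 a4.
apply: le_trans a5 _; rewrite lee_fin -/P -/E.
have BE : B `^ p = E / (2 * (P * P * (jsum 2 + 1))).
  by rewrite /B -powRrM mulVf ?gt_eqF// powRr1// ltW// divr_gt0.
have k1 : P * (K2 * tau) <= E / 4.
  have -> : P * (K2 * tau) = E / 4 * P^-1 by rewrite /tau; field; rewrite !gt_eqF.
  by rewrite ler_piMr ?divr_ge0 ?(ltW E0)// invf_le1.
have k2 : P * P * (K2 * tau) = E / 4 by rewrite /tau; field; rewrite !gt_eqF.
have k3 : P * P * (B `^ p * jsum 2) <= E / 2.
  have -> : P * P * (B `^ p * jsum 2) = E / 2 * (jsum 2 / (jsum 2 + 1)).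
    have j1 : jsum 2 + 1 != 0 :> R by rewrite gt_eqF//; lra.
    by rewrite BE; field; rewrite j1 gt_eqF.
  by rewrite ler_piMr ?divr_ge0 ?(ltW E0)// ler_pdivrMr; lra.
have -> : P * (K2 * tau + P * (B `^ p * jsum 2 + K2 * tau)) =
  P * (K2 * tau) + P * P * (B `^ p * jsum 2) + P * P * (K2 * tau) by ring.
by move: k1 k2 k3; lra.
Qed.

End ExtendedFlow.

Theorem theorem1p1 (R : realType) (omega : R) (homega : omega = 1 \/ omega = -1)
    (S : Cinfty R -> R -> Cinfty R) (hS : is_solution_map omega S)
    (p s r : R) (hp : 1 <= p) (hs : 0 <= s) :
  exists2 tau : R, 0 < tau &
    exists Sext : torus_distribution R -> R -> torus_distribution R,
      [/\ forall f, Hsp_ball s p r f -> C0_Hsp `[0, tau] s p (Sext f),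
          unif_continuous_C0_Hsp (Hsp_ball s p r) s p `[0, tau] s p Sext &
          forall u0 : Cinfty R, Hsp_ball s p r (to_distribution u0) ->
            forall t : R, 0 <= t <= tau ->
              Sext (to_distribution u0) t = to_distribution (S u0 t)].
Proof.
have p0 : 0 < p := lt_le_trans ltr01 hp.
pose W (n : int) : R := japanese n `^ s.
pose rho := `|r| `^ p.
have ballE f : Hsp_ball s p r f -> (anorm p W (fourier_coef f) <= rho%:E)%E.
  move=> hf; have r0 : 0 <= r by rewrite -lee_fin; apply: le_trans hf; exact: Hsp_norm_ge0.
  by rewrite /rho ger0_norm//; apply/(Hsp_norm_le p0 s f r0).
have [T T0 [K K0 stab]] := smooth_stability homega hS hp hs (powR_ge0 `|r| p).
pose P : R := 2 `^ p; pose K2 := P * (K * P).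
pose K3 := P * (K2 + P * (K + K2)).
have P0 : 0 < P by rewrite powR_gt0.
have K20 : 0 < K2 := mulr_gt0 P0 (mulr_gt0 K0 P0).
have K30 : 0 < K3 := mulr_gt0 P0 (addr_gt0 K20 (mulr_gt0 P0 (addr_gt0 K0 K20))).
exists T => //.
(* The second clause makes the extension agree with S on distributions that come
   from smooth functions; it is consistent because S only depends on the
   distribution of its datum. *)
pose ext f t (D : torus_distribution R) : Prop := 0 <= t <= T -> Hsp_ball s p r f ->
  flow_coefs S p s rho K (fourier_coef f) t (fourier_coef D) /\
  forall u0 : Cinfty R, f = to_distribution u0 -> D = to_distribution (S u0 t).
have same (u v : Cinfty R) t : 0 <= t -> to_distribution u = to_distribution v ->
    to_distribution (S u t) = to_distribution (S v t).
  move=> t0 uv; have [_ [sg0 /(_ sg0 (lexx _)) [Ss [dSs [hE _ _]]]]] := hS.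
  by rewrite -!hE// uv.
have ext_ex f t : exists D, ext f t D.
  have [[tI hf]|h] := pselect (0 <= t <= T /\ Hsp_ball s p r f); last first.
    by exists 0 => tI hf; case: h.
  have bf := ballE f hf.
  have [[u fu]|nu] := pselect (exists u : Cinfty R, f = to_distribution u).
    exists (to_distribution (S u t)) => _ _; split.
      by rewrite fu in bf *; exact: (flow_coefs_smooth hp K0 stab).
    by move=> v fv; apply: same; [case/andP: tI|rewrite -fu].
  have [d hd] := flow_coefs_ex hp hs K0 stab bf tI.
  have dl := flow_coefs_lty hp bf hd.
  have [B hB] : exists B : R, forall n, normc (d n) <= B.
    have d0 : (0 <= anorm p W d)%E by exact: anorm_ge0.
    exists (fine (anorm p W d) `^ p^-1) => n.
    have h : (anorm p W d <= ((fine (anorm p W d) `^ p^-1) `^ p)%:E)%E.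
      by rewrite -powRrM mulVf ?gt_eqF// powRr1 ?fine_ge0// fineK// ge0_fin_numE.
    have := anorm_term p0 n (powR_ge0 _ _) (fun n => powR_ge0 _ _) h.
    by apply: le_trans; rewrite ler_peMl ?normc_ge0// powR_japanese_ge1.
  have [D hD] := distribution_of_coefs hB.
  exists D => _ _; split; last by move=> u fu; case: nu; exists u.
  by rewrite (_ : fourier_coef D = d) //; apply/funext.
have [Sext hSext] := choice (fun f => ex_intro (fun g => forall t, ext f t (g t)) _ (projT2 (choice (ext_ex f)))).
have coefs f t : Hsp_ball s p r f -> 0 <= t <= T ->
    flow_coefs S p s rho K (fourier_coef f) t (fourier_coef (Sext f t)).
  by move=> hf tI; case: (hSext f t tI hf).
exists Sext; split.
- move=> f hf; split => t.
    rewrite /= in_itv /= => tI; apply/(Hsp_norm_lty p0 s).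
    by have := flow_coefs_lty hp (ballE f hf) (coefs f t hf tI).
  rewrite /= in_itv /= => tI; apply/(Hsp_norm_cvg0 p0 s) => eps e0.
  have [e e0' he] := flow_coefs_continuous hS hp K0 (ballE f hf) (fun t => coefs f t hf) tI e0.
  rewrite near_withinE; apply/nbhs_ballP; exists e => // t' td; rewrite /= in_itv /= => t'I.
  have := he t' t'I; rewrite distrC => /(_ td).
  by congr (_ <= _)%E; apply: anormJ => n; rewrite fourier_coefB.
- move=> eps e0; have e2 : 0 < eps / 2 by rewrite divr_gt0.
  (* K3 * delta ^ p is the p-th power of eps / 2. *)
  pose delta := ((eps / 2) `^ p / K3) `^ p^-1.
  have q0 : 0 < (eps / 2) `^ p / K3 by rewrite divr_gt0 ?powR_gt0.
  have dp : delta `^ p = (eps / 2) `^ p / K3.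
    by rewrite /delta -powRrM mulVf ?gt_eqF// powRr1// ltW.
  exists delta; first by rewrite powR_gt0.
  move=> f g hf hg /ltW hfg.
  have hd : (anorm p W (fun n => (fourier_coef f n - fourier_coef g n)%R) <= (delta `^ p)%:E)%E.
    have /(Hsp_norm_le p0 s _ (powR_ge0 _ _)) := hfg; apply: le_trans.
    by rewrite le_eqVlt; apply/orP; left; apply/eqP; apply: anormJ => n; rewrite fourier_coefB.
  apply: (@le_lt_trans _ _ (eps / 2)%:E); last by rewrite lte_fin; lra.
  apply: ub_ereal_sup => _ [t + <-]; rewrite /= in_itv /= => tI.
  apply/(Hsp_norm_le p0 s _ (ltW e2)).
  have dpos : 0 < delta `^ p by rewrite dp.
  have := flow_coefs_lip hp stab tI (ballE f hf) (ballE g hg) (coefs f t hf tI) (coefs g t hg tI) dpos hd.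
  rewrite -/P -/K2 -/K3 dp (_ : K3 * _ = (eps / 2) `^ p); last by rewrite mulrC divfK// gt_eqF.
  by apply: le_trans; rewrite le_eqVlt; apply/orP; left; apply/eqP; apply: anormJ => n; rewrite fourier_coefB.
- by move=> u0 hu t tI; have [_ h] := hSext _ t tI hu; exact: h.
Qed.
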